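(* Let $1<p<\infty$ and $|Q|\in L^{p/2}_{\mathrm{loc}}(\Omega)$, and suppose the structural conditions hold with $\gamma=\delta=p$ and $\psi\in[p,p+1-\sigma^{-1})$. Assume also that the coefficient functions satisfy (i) $b,e\in L^{\mathcal B}_{\mathrm{loc}}(\Omega)$ with $\mathcal B>\max\{p'\sigma',\frac{d_0}{p-1}\}$; (ii) $h,g\in L^{\mathcal H}_{\mathrm{loc}}(\Omega)$ with $\mathcal H>\frac{d_0}p$, $\mathcal H>\sigma'$; (iii) $d,f\in L^{\mathcal D}_{\mathrm{loc}}(\Omega)$ with $\mathcal D>\frac{d_0}p$, $\mathcal D>\sigma'$; (iv) $c\in L^{\mathcal C}_{\mathrm{loc}}(\Omega)$ with $\mathcal C>\frac{d_0p\sigma}{(p+1-\psi)(p\sigma+d_0)-d_0}>0$ and $\mathcal C>\frac{p\sigma}{\sigma(p+1-\psi)-1}$. Let $r_1:\Omega\to(0,\infty)$ be a function satisfying $r_1\le\min\{R_0,R_1,R_2,1\}$ with the property that given any compact $K\subset\Omega$ there is a positive constant $s_0$ such that $s_0\le r_1(y)\le1$ for every $y\in K$. Then if $(u,\nabla u)\in W^{1,p}_Q(\Omega)$ is a weak solution of $\mathrm{div}(A(x,u,\nabla u))=B(x,u,\nabla u)$ in $\Omega$, $u$ is essentially locally Hölder continuous with respect to $\rho$ in $\Omega$; that is, for every compact set $K\subset\Omega$ there are positive constants $C,\mu$ such that $$\operatorname*{ess\,sup}_{z,x\in K}\frac{|u(z)-u(x)|}{\rho(z,x)^\mu}\le C.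$$
   Context: **Setting.** $\Omega\subset\mathbb{R}^n$ is a bounded domain, $1<p<\infty$, and $Q(x)$ is a measurable, symmetric, nonnegative definite $n\times n$ matrix function on $\Omega$ with $|Q|\in L^{p/2}_{\mathrm{loc}}(\Omega)$. Primes denote dual exponents. $|E|$ is Lebesgue measure, $\fint_E f=\frac1{|E|}\int_E f\,dx$. $Lip_0(U)$ is the set of Lipschitz functions with compact support in $U$. **Quasimetric.** $\rho:\Omega\times\Omega\to[0,\infty)$ is symmetric, $\rho(x,y)=0$ iff $x=y$, and $\rho(x,y)\le\kappa[\rho(x,z)+\rho(y,z)]$ for all $x,y,z$, with a constant $\kappa\ge1$. $B(x,r)=\{y\in\Omega:\rho(x,y)<r\}$. All balls $B(x,r)$ are open in the Euclidean topology, and for every $x\in\Omega$, $|x-y|\to0$ if $\rho(x,y)\to0$. $R_0:\Omega\to(0,\infty)$ is a function such that the Euclidean closure of $B(x,r)$ is contained in $\Omega$ for $0<r<R_0(x)$ (such a function exists). **Doubling.** $(\Omega,\rho,dx)$ is a local homogeneous space: there are constants $C_0,d_0>0$ and $R_1:\Omega\to(0,\infty)$ such that $|B(x,r)|\le C_0(r/t)^{d_0}|B(y,t)|$ whenever $x,y\in\Omega$, $0<t\le r<R_1(x)$ and $B(y,t)\cap B(x,r)\neq\emptyset$. **Sobolev spaces.** For open $U\subset\Omega$, $W^{1,p}_Q(U)$ is the completion of the locally Lipschitz functions on $U$ with finite norm $\|u\|_{W^{1,p}_Q(U)}=(\int_U|u|^p+\int_U|\sqrt Q\nabla u|^p)^{1/p}$,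 identified with the set of pairs $(u,\nabla u)$ ($\nabla u$ denotes the second component, not necessarily determined by $u$) for which there are such functions $u_k$ with $u_k\to u$ in $L^p(U)$ and $\int_U|\sqrt Q(\nabla u_k-\nabla u)|^p\to0$. $(W^{1,p}_Q)_0(U)$ is defined in the same way using Lipschitz functions with compact support in $U$. **Analytic assumptions.** There is $R_2:\Omega\to(0,\infty)$ such that for every ball $B(y,r)$ with $0<r<R_2(y)$ the following hold. (a) Sobolev: with constants $C_1>0$, $\sigma>1$, $\big(\fint_{B(y,r)}|w|^{p\sigma}\big)^{1/(p\sigma)}\le C_1\big[r\big(\fint_{B(y,r)}|\sqrt Q\nabla w|^p\big)^{1/p}+\big(\fint_{B(y,r)}|w|^p\big)^{1/p}\big]$ for all $(w,\nabla w)\in(W^{1,p}_Q)_0(B(y,r))$. (b) Poincaré: with constants $C_2>0$, $\mathfrak{b}\ge1$, $\fint_{B(y,r)}|w-w_{B(y,r)}|\le C_2r\big(\fint_{B(y,\mathfrak{b}r)}|\sqrt Q\nabla w|^p\big)^{1/p}$ for all $(w,\nabla w)\in W^{1,p}_Q(\Omega)$, where $w_{B(y,r)}=\fint_{B(y,r)}w$. (c) Cutoffs: with positive constants $s^*,C_{s^*},\tau,N$, where $p\sigma'<s^*\le\infty$ and $\tau<1$, there are Lipschitz functions $\{\eta_j\}_{j\ge1}$ with $\mathrm{supp}\,\eta_1\subset B(y,r)$, and for all $j$: $0\le\eta_j\le1$, $\eta_j=1$ on $B(y,\tau r)$, $\mathrm{supp}\,\eta_{j+1}\subset\{x\in B(y,r):\eta_j(x)=1\}$,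 and $\big(\fint_{B(y,r)}|\sqrt Q\nabla\eta_j|^{s^*}\big)^{1/s^*}\le C_{s^*}N^j/r$. (d) For some $t\in[1,\infty]$ (independent of the ball) there is $C_3=C_3(B(y,r))>0$ with $\big(\int_{B(y,r)}|\sqrt Q\nabla\eta|^{pt}\big)^{1/(pt)}<\infty$ for all $\eta\in\{\eta_j\}$ and $\big(\int_{B(y,r)}|f|^{pt'}\big)^{1/(pt')}\le C_3\|f\|_{W^{1,p}_Q(\Omega)}$ for all $f\in Lip_{\mathrm{loc}}(\Omega)$ (essential suprema if an exponent is infinite). **Structural conditions** (exponents $\gamma,\psi,\delta>1$). There are a constant $a>1$, nonnegative measurable functions $b,c,d,e,f,g,h$ on $\Omega$ and a vector $\tilde A(x,z,\xi)\in\mathbb{R}^n$ such that for a.e. $x\in\Omega$ and all $(z,\xi)\in\mathbb{R}\times\mathbb{R}^n$: $A(x,z,\xi)=\sqrt{Q(x)}\tilde A(x,z,\xi)$; $\xi\cdot A(x,z,\xi)\ge a^{-1}|\sqrt{Q(x)}\xi|^p-h(x)|z|^\gamma-g(x)$; $|\tilde A(x,z,\xi)|\le a|\sqrt{Q(x)}\xi|^{p-1}+b(x)|z|^{\gamma-1}+e(x)$; $|B(x,z,\xi)|\le c(x)|\sqrt{Q(x)}\xi|^{\psi-1}+d(x)|z|^{\delta-1}+f(x)$. Standing minimal integrability: $c\in L_{\mathrm{loc}}^{\sigma p/(\sigma p-1-\sigma(\psi-1))}(\Omega)$, $e\in L^{p'}_{\mathrm{loc}}(\Omega)$, $f\in L^{(\sigma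 p)'}_{\mathrm{loc}}(\Omega)$, $b\in L_{\mathrm{loc}}^{\sigma p/(\sigma(p-1)-\gamma+1)}(\Omega)$, $d\in L_{\mathrm{loc}}^{p\sigma/(p\sigma-\delta)}(\Omega)$. **Weak solution.** $(u,\nabla u)\in W^{1,p}_Q(\Omega)$ is a weak solution of $\mathrm{div}(A(x,u,\nabla u))=B(x,u,\nabla u)$ in $\Omega$ if $\int_\Omega[\nabla\varphi\cdot A(x,u,\nabla u)+\varphi B(x,u,\nabla u)]\,dx=0$ for every nonnegative $\varphi\in Lip_0(\Omega)$. *)

(* Defs.v *)
From HB Require Import structures.
From mathcomp Require Import all_boot all_order all_algebra.
From mathcomp Require Import all_classical all_reals all_analysis.
From mathcomp Require Import ess_sup_inf.

Set Implicit Arguments.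
Unset Strict Implicit.
Unset Printing Implicit Defensive.

Import Order.TTheory GRing.Theory Num.Theory.
Import numFieldNormedType.Exports.

Local Open Scope classical_set_scope.
Local Open Scope ring_scope.

(* R^n is 'rV[R]_n.  The library has no Lebesgue measure on it, so it is built
   here by Caratheodory's construction from the outer measure given by
   countable coverings by half-open boxes; measurable therefore means Lebesgue
   measurable.  [None] stands for the empty box. *)
Section lebesgue_outer.
Context {R : realType} {n : nat}.
Implicit Types (B : option ('rV[R]_n * 'rV[R]_n)) (X : set 'rV[R]_n).

Definition box B : set 'rV[R]_n :=
  if B is Some (a, b) then [set x | forall i, a 0 i < x 0 i <= b 0 i] else set0.

Definition box_vol B : \bar R :=
  if B is Some (a, b) then (\prod_i Num.max (b 0 i - a 0 i) 0)%:E else 0%E.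

Definition lebesgue_outer X : \bar R :=
  ereal_inf [set (\sum_(k <oo) box_vol (B k))%E
            | B in [set B | X `<=` \bigcup_k box (B k)]].

Lemma box_vol_ge0 B : (0 <= box_vol B)%E.
Proof.
by case: B => [[a b]|//]; rewrite lee_fin prodr_ge0// => i _; rewrite le_max lexx orbT.
Qed.

Lemma lebesgue_outer_ge0 X : (0 <= lebesgue_outer X)%E.
Proof.
apply: le_ereal_inf_tmp => _ [B _ <-].
by apply: nneseries_ge0 => k _ _; exact: box_vol_ge0.
Qed.

Lemma lebesgue_outer0 : lebesgue_outer set0 = 0%E.
Proof.
apply/eqP; rewrite eq_le lebesgue_outer_ge0 andbT.
apply: ereal_inf_lbound; exists (fun=> None) => //.
exact: eseries0.
Qed.

Lemma le_lebesgue_outer : {homo lebesgue_outer : X Y / X `<=` Y >-> (X <= Y)%E}.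
Proof.
move=> X Y XY; apply/ereal_inf_le_tmp => _ [B YB <-].
by exists B => //=; exact: subset_trans YB.
Qed.

Lemma lebesgue_outer_sigma_subadditive : sigma_subadditive lebesgue_outer.
Proof.
move=> A; have [[i ioo]|] := pselect (exists i, lebesgue_outer (A i) = +oo%E).
  rewrite (eseries_pinfty _ _ ioo) ?leey// => k _.
  by rewrite -ltNye (lt_le_trans _ (lebesgue_outer_ge0 _)).
rewrite -forallNE => Aoo.
apply/lee_addgt0Pr => e e0.
rewrite (le_trans _ (epsilon_trick _ _ (ltW e0)))//; last first.
  by move=> k; exact: lebesgue_outer_ge0.
pose P k (B : nat -> option ('rV[R]_n * 'rV[R]_n)) :=
  A k `<=` \bigcup_j box (B j) /\
  (\sum_(j <oo) box_vol (B j) <= lebesgue_outer (A k) + (e / (2 ^ k.+1)%:R)%:E)%E.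
have [G PG] : {G : nat -> nat -> option ('rV[R]_n * 'rV[R]_n) & forall k, P k (G k)}.
  apply: (@choice _ _ P) => k.
  have en1 : 0 < e / (2 ^ k.+1)%:R by rewrite divr_gt0// ltr0n expn_gt0.
  have Afin : ereal_inf [set (\sum_(j <oo) box_vol (B j))%E
            | B in [set B | A k `<=` \bigcup_j box (B j)]] \is a fin_num.
    rewrite ge0_fin_numE; last exact: lebesgue_outer_ge0.
    by rewrite ltey; apply/eqP; exact: Aoo.
  have [_ [B AB <-] /ltW h] := lb_ereal_inf_adherent en1 Afin.
  by exists B; split.
pose w := fun ij : nat * nat => box_vol (G ij.1 ij.2).
have w_ge0 x : (0 <= w x)%E by exact: box_vol_ge0.
apply: (@le_trans _ _ (\esum_(i in setT) w i)).
  apply: ereal_inf_lbound => /=.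
  have /card_esym/ppcard_eqP[f] := card_nat2.
  exists (uncurry G \o f).
    move=> t [i _] /(PG i).1[j _ Bt]; exists (f^-1%FUN (i, j)) => //=.
    by rewrite invK ?inE.
  rewrite nneseries_esumT; last by move=> *; exact: box_vol_ge0.
  rewrite (reindex_esum setT setT f)//=.
  by apply: eq_esum => k _; rewrite /w/=; case: (f k).
rewrite (_ : esum _ _ = \sum_(i <oo) \sum_(j <oo) box_vol (G i j))%E; last first.
  rewrite -setXTT (_ : [set: nat] `*` _ = [set: nat] `*`` (fun=> [set: nat])); last first.
    by apply/seteqP; split.
  rewrite -(@esum_esum _ _ _ setT (fun=> setT) (fun i j => box_vol (G i j)))//;
    last by move=> *; exact: box_vol_ge0.
  rewrite nneseries_esumT; last first.
    by move=> i; apply: nneseries_ge0 => *; exact: box_vol_ge0.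
  apply: eq_esum => i _.
  by rewrite nneseries_esumT// => *; exact: box_vol_ge0.
apply: lee_nneseries => [i _ _|i _]; last exact: (PG i).2.
by apply: nneseries_ge0 => *; exact: box_vol_ge0.
Qed.

End lebesgue_outer.

HB.instance Definition _ (R : realType) (n : nat) :=
  isOuterMeasure.Build R 'rV[R]_n (@lebesgue_outer R n)
    lebesgue_outer0 lebesgue_outer_ge0
    le_lebesgue_outer lebesgue_outer_sigma_subadditive.

HB.instance Definition _ (R : realType) (n : nat) :=
  Measurable.copy 'rV[R]_n (caratheodory_type (@lebesgue_outer R n)).

Definition leb {R : realType} {n : nat} : set 'rV[R]_n -> \bar R :=
  @lebesgue_outer R n.

HB.instance Definition _ (R : realType) (n : nat) :=
  isMeasure.Build _ 'rV[R]_n R (@leb R n)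
    (@caratheodory_measure0 _ _ (@lebesgue_outer R n))
    (@caratheodory_measure_ge0 _ _ (@lebesgue_outer R n))
    (@caratheodory_measure_sigma_additive _ _ (@lebesgue_outer R n)).

Section euclidean.
Context {R : realType} {n : nat}.
Implicit Types (xi zeta : 'rV[R]_n) (M : 'M[R]_n) (E U K : set 'rV[R]_n).

Definition dotr xi zeta : R := \sum_i xi 0 i * zeta 0 i.

(* The library's norm on 'rV[R]_n is the max norm. *)
Definition enorm xi : R := Num.sqrt (dotr xi xi).

(* Vectors are rows and the matrices below are symmetric: the vector M xi of
   the paper is [xi *m M]. *)
Definition opnorm M : R := sup [set enorm (xi *m M) | xi in [set xi | enorm xi <= 1]].

Definition psdmx M : Prop := M^T = M /\ forall xi, 0 <= dotr xi (xi *m M).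

(* The unique nonnegative definite square root when [psdmx M]. *)
Definition sqrtmx M : 'M[R]_n := xget 0 [set S | psdmx S /\ S *m S = M].

(* The gradient of a locally Lipschitz function, which by Rademacher's theorem
   exists almost everywhere; the values elsewhere are irrelevant. *)
Definition grad (f : 'rV[R]_n -> R) (x : 'rV[R]_n) : 'rV[R]_n :=
  \row_i 'D_(delta_mx 0 i) f x.

Definition supp (f : 'rV[R]_n -> R) : set 'rV[R]_n := closure [set x | f x != 0].

(* Only the values of f on the open set U matter. *)
Definition Lip_loc U (f : 'rV[R]_n -> R) : Prop :=
  forall x, U x -> exists2 V, nbhs x V & [lipschitz f y | y in V `&` U].

(* Elements of Lip_0(U) are extended by 0 outside U. *)
Definition Lip_0 U (f : 'rV[R]_n -> R) : Prop :=
  [/\ lipschitz f, compact (supp f) & supp f `<=` U].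

Local Open Scope ereal_scope.

Definition Lnorm_on E (q : \bar R) (f : 'rV[R]_n -> R) : \bar R :=
  Lnorm leb q (fun x => (f x * \1_E x)%:E).

Definition Lloc U (q : \bar R) (f : 'rV[R]_n -> R) : Prop :=
  measurable_fun U f /\
  forall K, compact K -> K `<=` U -> Lnorm_on K q f < +oo.

Definition nonneg_measurable U (f : 'rV[R]_n -> R) : Prop :=
  measurable_fun U f /\ forall x, U x -> (0 <= f x)%R.

Definition fint E (f : 'rV[R]_n -> \bar R) : \bar R :=
  ((fine (leb E))^-1)%:E * \int[leb]_(x in E) f x.

Definition avg E (f : 'rV[R]_n -> R) : R := fine (fint E (EFin \o f)).

Definition avg_norm E (q : \bar R) (f : 'rV[R]_n -> R) : \bar R :=
  if q is r%:E then (fint E (fun x => (`|f x| `^ r)%:E)) `^ r^-1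
  else Lnorm_on E q f.

End euclidean.

Definition dual_exp {R : realType} (p : R) : R := p / (p - 1).

Section sobolev.
Context {R : realType} {n : nat}.
Variables (p : R) (Q : 'rV[R]_n -> 'M[R]_n).
Implicit Types (U : set 'rV[R]_n) (u : 'rV[R]_n -> R) (g : 'rV[R]_n -> 'rV[R]_n).

Definition Qnorm (x xi : 'rV[R]_n) : R := enorm (xi *m sqrtmx (Q x)).

Local Open Scope ereal_scope.

Definition Wnorm U u g : \bar R :=
  (\int[leb]_(x in U) (`|u x| `^ p)%:E +
   \int[leb]_(x in U) (Qnorm x (g x) `^ p)%:E) `^ p^-1.

(* The pairs (u, g) in the completion of the functions of class S that have
   finite norm on U. *)
Definition sobolev_completion (S : set ('rV[R]_n -> R)) U u g : Prop :=
  [/\ measurable_fun U u, (forall i, measurable_fun U (fun x => g x 0%R i)) &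
   exists v : nat -> 'rV[R]_n -> R,
   [/\ forall k, S (v k) /\ Wnorm U (v k) (grad (v k)) < +oo,
       \int[leb]_(x in U) (`|v k x - u x| `^ p)%:E @[k --> \oo] --> 0 &
       \int[leb]_(x in U) (Qnorm x (grad (v k) x - g x) `^ p)%:E
         @[k --> \oo] --> 0]].

Definition W1pQ U := sobolev_completion (Lip_loc U) U.

Definition W1pQ_0 U := sobolev_completion (Lip_0 U) U.

End sobolev.

Section quasimetric.
Context {R : realType} {n : nat}.
Variables (Om : set 'rV[R]_n) (rho : 'rV[R]_n -> 'rV[R]_n -> R).

Definition qball (x : 'rV[R]_n) (r : R) : set 'rV[R]_n :=
  [set y | Om y /\ rho x y < r].

Definition quasimetric : Prop :=
  [/\ forall x y, Om x -> Om y -> 0 <= rho x y,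
      forall x y, Om x -> Om y -> rho x y = rho y x,
      forall x y, Om x -> Om y -> (rho x y = 0 <-> x = y) &
      exists2 kappa, 1 <= kappa & forall x y z, Om x -> Om y -> Om z ->
        rho x y <= kappa * (rho x z + rho y z)].

Definition balls_open : Prop := forall x r, Om x -> 0 < r -> open (qball x r).

Definition rho_controls_euclidean : Prop := forall x, Om x ->
  forall e, 0 < e -> exists2 dlt, 0 < dlt &
    forall y, Om y -> rho x y < dlt -> enorm (x - y) < e.

Definition closed_balls_inside (R0 : 'rV[R]_n -> R) : Prop :=
  forall x r, Om x -> 0 < r -> r < R0 x -> closure (qball x r) `<=` Om.

Definition local_homogeneous (d0 : R) (R1 : 'rV[R]_n -> R) : Prop :=
  exists2 C0, 0 < C0 & forall x y r t, Om x -> Om y ->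
    0 < t -> t <= r -> r < R1 x -> qball y t `&` qball x r !=set0 ->
    (leb (qball x r) <= (C0 * (r / t) `^ d0)%:E * leb (qball y t))%E.

Section analytic.
Variables (p : R) (Q : 'rV[R]_n -> 'M[R]_n) (R2 : 'rV[R]_n -> R).
Local Open Scope ereal_scope.

Definition sobolev_inequality (sigma : R) : Prop :=
  exists2 C1, (0 < C1)%R & forall y r, Om y -> (0 < r)%R -> (r < R2 y)%R ->
  forall w gw, W1pQ_0 p Q (qball y r) w gw ->
    avg_norm (qball y r) (p * sigma)%:E w <=
    C1%:E * (r%:E * avg_norm (qball y r) p%:E (fun x => Qnorm Q x (gw x)) +
             avg_norm (qball y r) p%:E w).

Definition poincare_inequality : Prop :=
  exists C2 bb, [/\ (0 < C2)%R, (1 <= bb)%R &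
  forall y r, Om y -> (0 < r)%R -> (r < R2 y)%R ->
  forall w gw, W1pQ p Q Om w gw ->
    fint (qball y r) (fun x => `|w x - avg (qball y r) w|%:E) <=
    (C2 * r)%:E *
      avg_norm (qball y (bb * r)) p%:E (fun x => Qnorm Q x (gw x))].

Definition is_cutoff_sequence (s : \bar R) (Cs tau N : R) (y : 'rV[R]_n) (r : R)
    (eta : nat -> 'rV[R]_n -> R) : Prop :=
  supp (eta 1%N) `<=` qball y r /\
  forall j, (1 <= j)%N ->
  [/\ lipschitz (eta j),
      (forall x, (0 <= eta j x <= 1)%R),
      (forall x, qball y (tau * r) x -> eta j x = 1%R),
      supp (eta j.+1) `<=` [set x | qball y r x /\ eta j x = 1%R] &
      avg_norm (qball y r) s (fun x => Qnorm Q x (grad (eta j) x)) <=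
        (Cs * N ^+ j / r)%:E].

Definition cutoff_conditions (sigma : R) : Prop :=
  exists (s : \bar R) (Cs tau N : R) (t : \bar R),
  [/\ (p * dual_exp sigma)%:E < s,
      [/\ (0 < Cs)%R, (0 < tau)%R, (tau < 1)%R & (0 < N)%R], 1 <= t &
  forall y r, Om y -> (0 < r)%R -> (r < R2 y)%R ->
  exists eta : nat -> 'rV[R]_n -> R,
  [/\ is_cutoff_sequence s Cs tau N y r eta,
      forall j, (1 <= j)%N ->
        Lnorm_on (qball y r) (p%:E * t) (fun x => Qnorm Q x (grad (eta j) x))
          < +oo &
      exists2 C3, (0 < C3)%R & forall f, Lip_loc Om f ->
        Lnorm_on (qball y r) (p%:E * hoelder_conjugate t) f <=
          C3%:E * Wnorm p Q Om f (grad f)]].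

End analytic.

(* The essential supremum over K x K is taken with respect to Lebesgue measure
   on R^(2n), a pair (z, x) being the concatenation of z and x.  The diagonal,
   on which the quotient is 0 by convention, is a null set for n > 0. *)
Definition ess_locally_holder (u : 'rV[R]_n -> R) : Prop :=
  forall K : set 'rV[R]_n, compact K -> K `<=` Om ->
  exists C mu, [/\ 0 < C, 0 < mu &
    (ess_sup (@leb R (n + n)) (fun w =>
      let z := lsubmx w in let x := rsubmx w in
      (`|u z - u x| / rho z x `^ mu * (\1_K z * \1_K x))%:E) <= C%:E)%E].

End quasimetric.

Section equation.
Context {R : realType} {n : nat}.
Variables (Om : set 'rV[R]_n) (p : R) (Q : 'rV[R]_n -> 'M[R]_n).
Variables (A : 'rV[R]_n -> R -> 'rV[R]_n -> 'rV[R]_n).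
Variables (B : 'rV[R]_n -> R -> 'rV[R]_n -> R).

Definition structural_conditions (gamma psi delta : R)
    (b c d e f g h : 'rV[R]_n -> R) : Prop :=
  [/\ 1 < gamma, 1 < psi, 1 < delta,
      [/\ nonneg_measurable Om b, nonneg_measurable Om c & nonneg_measurable Om d]
      /\ [/\ nonneg_measurable Om e, nonneg_measurable Om f,
             nonneg_measurable Om g & nonneg_measurable Om h] &
  exists a (At : 'rV[R]_n -> R -> 'rV[R]_n -> 'rV[R]_n), 1 < a /\
  \forall x \ae leb, Om x -> forall z xi,
  [/\ A x z xi = At x z xi *m sqrtmx (Q x),
      a^-1 * Qnorm Q x xi `^ p - h x * `|z| `^ gamma - g x
        <= dotr xi (A x z xi),
      enorm (At x z xi) <=
        a * Qnorm Q x xi `^ (p - 1) + b x * `|z| `^ (gamma - 1) + e x &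
      `|B x z xi| <=
        c x * Qnorm Q x xi `^ (psi - 1) + d x * `|z| `^ (delta - 1) + f x]].

Definition minimal_integrability (sigma gamma psi delta : R)
    (b c d e f : 'rV[R]_n -> R) : Prop :=
  [/\ Lloc Om (sigma * p / (sigma * p - 1 - sigma * (psi - 1)))%:E c,
      Lloc Om (dual_exp p)%:E e,
      Lloc Om (dual_exp (sigma * p))%:E f,
      Lloc Om (sigma * p / (sigma * (p - 1) - gamma + 1))%:E b &
      Lloc Om (p * sigma / (p * sigma - delta))%:E d].

(* The integral being 0 includes its existence as a Lebesgue integral, whence
   the integrability clause ([integral] is a total function). *)
Definition weak_solution (u : 'rV[R]_n -> R) (du : 'rV[R]_n -> 'rV[R]_n) : Prop :=
  W1pQ p Q Om u du /\
  forall phi, Lip_0 Om phi -> (forall x, 0 <= phi x) ->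
  let F x := (dotr (grad phi x) (A x (u x) (du x)) +
              phi x * B x (u x) (du x))%:E in
  leb.-integrable Om F /\ (\int[leb]_(x in Om) F x = 0)%E.

End equation.

(* Main.v *)
Require Import Defs.
From HB Require Import structures.
From mathcomp Require Import all_boot all_order all_algebra.
From mathcomp Require Import all_classical all_reals all_analysis.
From mathcomp Require Import measurable_realfun ess_sup_inf ring lra.
From mathcomp Require spectral complex.
Set Implicit Arguments.
Unset Strict Implicit.
Unset Printing Implicit Defensive.
Import Order.TTheory GRing.Theory Num.Theory.
Import numFieldNormedType.Exports.
Local Open Scope classical_set_scope.
Local Open Scope ring_scope.

(* The proof follows De Giorgi.  Testing the equation with cutoffs times convex functions of u
   gives a Caccioppoli inequality in which all lower-order coefficients enter through a single
   function Z(x), which by Young's inequality lies in L^s with s > sigma'; once u is known to be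
   bounded, also s > d0 / p.  Sobolev's inequality with the accumulating sequence of cutoffs
   then yields a De Giorgi lemma: if the L^(p sigma) average of (u - k)_+ / l over a ball is
   small enough, then u <= k + l on the concentric ball reduced by the factor tau.  Applied with
   k = l large to u and -u, it shows that u is locally bounded.  For m <= u <= M on a ball, one
   of u and -u lies below its mean level on half of a smaller ball; the logarithm of 1 / (M + lam
   - u) has bounded energy at the scale of the ball, and by Poincare's inequality u is close to M
   only on a small set.  The De Giorgi lemma then improves the upper bound: the oscillation
   decays by a fixed factor, unless it is already smaller than a power r^al of the radius,
   al = 1 - d0 / (p s).  Iterating over balls of geometrically decreasing radii gives the Hoelder
   estimate.  If some nonempty open set is null, then the measure vanishes, and the claim is
   trivial. *)

(** * Lebesgue measure on R^n *)

(** The second component of a pair [(u, du)] is not determined by [u], so [du] need not vanish on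
    level sets of [u], and the positive part of [u - k] has no chain rule. Every nonlinearity is
    therefore of class C1: [ramp] replaces the positive part, and the barriers of the logarithmic
    estimate are continued linearly before they become singular. Chain and product rules are taken
    from Lipschitz approximants, where Rademacher's theorem supplies partial derivatives almost
    everywhere, and carried to the limit by dominated convergence. The two thresholds for the
    exponent s of Z act as follows: s > sigma' makes the Sobolev gain exceed the Hoelder loss, so
    that the De Giorgi recursion is superlinear; s > d0 / p leaves a positive power of r after
    division by the volume of a ball, which is at least of order r^d0. Boundedness of u has to come
    in between, because Young's inequality turns the term with c into c^P (1 + |u|)^(P (psi - p)), P
    = p / (p + 1 - psi), whose second factor costs integrability as long as only |u|^(p sigma) is
    known to be integrable. The case of a null open set is split off so that quasimetric balls have
    positive measure. *)

Section leb_basic.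
Context {R : realType} {n : nat}.
Implicit Types (A N U X : set 'rV[R]_n) (x v : 'rV[R]_n).

Lemma lebE X : leb X = lebesgue_outer X. Proof. by []. Qed.

(** Cutting a half-open box along the hyperplane [x_i = c] gives two half-open boxes that differ
    from it only in the i-th side, and the lengths of the two sides add up to at most the original
    one. Done for every box of a cover, this is Caratheodory's criterion. *)
Lemma halfspace_measurable (i : 'I_n) (c : R) :
  measurable [set x : 'rV[R]_n | x 0 i <= c].
Proof.
apply: le_caratheodory_measurable => X.
apply: le_ereal_inf_tmp => _ [B XB <-].
pose lo (B : option ('rV[R]_n * 'rV[R]_n)) := if B is Some (a, b) then
  Some (a, \row_j (if j == i then Num.min (b 0 j) c else b 0 j)) else None.
pose hi (B : option ('rV[R]_n * 'rV[R]_n)) := if B is Some (a, b) then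
  Some (\row_j (if j == i then Num.max (a 0 j) c else a 0 j), b) else None.
apply: (@le_trans _ _ (\sum_(k <oo) box_vol (lo (B k)) +
                       \sum_(k <oo) box_vol (hi (B k)))%E).
  apply: leeD; apply: ereal_inf_lbound.
    exists (lo \o B) => //= x [Xx xc]; have [k _ Bx] := XB _ Xx.
    exists k => //=; case: (B k) Bx => [[a b]|//] /= H j.
    rewrite mxE; case: eqP => [->|//]; have /andP[-> /= h] := H i.
    by rewrite le_min h.
  exists (hi \o B) => //= x [Xx /negP xc]; have [k _ Bx] := XB _ Xx.
  exists k => //=; case: (B k) Bx => [[a b]|//] /= H j.
  rewrite mxE; case: eqP => [->|//]; have /andP[h ->] := H i.
  by rewrite gt_max h/= andbT ltNge.
rewrite -nneseriesD; try by move=> *; exact: box_vol_ge0.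
apply: lee_nneseries => k _; first by rewrite adde_ge0// box_vol_ge0.
case: (B k) => [[a b]|] /=; last by rewrite adde0.
rewrite -EFinD lee_fin (bigD1 i)//= [X in _ + X](bigD1 i)//= [leRHS](bigD1 i)//=.
rewrite [X in _ * X + _](_ : _ = \prod_(j < n | j != i) Num.max (b 0 j - a 0 j) 0); last first.
  by apply: eq_bigr => j /negbTE ji; rewrite mxE ji.
rewrite [X in _ + _ * X](_ : _ = \prod_(j < n | j != i) Num.max (b 0 j - a 0 j) 0); last first.
  by apply: eq_bigr => j /negbTE ji; rewrite mxE ji.
rewrite -mulrDl ler_wpM2r//.
  by apply: prodr_ge0 => j _; rewrite le_max lexx orbT.
rewrite !mxE eqxx.
have [bc|cb] := leP (b 0 i) c; have [ac|ca] := leP (a 0 i) c; rewrite !maxEle;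
  repeat case: ifP => ?; lra.
Qed.

Lemma coord_measurable (i : 'I_n) : measurable_fun [set: 'rV[R]_n] (fun x => x 0 i).
Proof.
apply: (@measurability _ _ _ _ _ _ (@measurable_realfun.RGenOInfty.G R)).
  exact: measurable_realfun.RGenOInfty.measurableE.
move=> _ [_ [c ->] <-]; rewrite setTI.
rewrite (_ : _ @^-1` _ = ~` [set x : 'rV[R]_n | x 0 i <= c]).
  by apply: measurableC; exact: halfspace_measurable.
by apply/seteqP; split => x /=; rewrite in_itv/= andbT ltNge => /negP.
Qed.

Lemma ball_rVP x r y : ball x r y <-> 0 < r /\ forall i, `|x 0 i - y 0 i| < r.
Proof.
split=> [[r0 H]|[r0 H]]; split => // i; last by rewrite ord1.
by have := H 0 i.
Qed.

Lemma ball_rV_measurable x r : measurable (ball x r).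
Proof.
have [r0|r0] := ltP 0 r; last first.
  rewrite (_ : ball x r = set0) //; apply/seteqP; split => // y /ball_rVP[].
  by rewrite ltNge r0.
rewrite (_ : ball x r = \bigcap_(i in [set: 'I_n])
    [set y : 'rV[R]_n | `|x 0 i - y 0 i| < r]).
  apply: fin_bigcap_measurable => // i _.
  have mf : measurable_fun [set: 'rV[R]_n] (fun y : 'rV[R]_n => x 0 i - y 0 i).
    by apply: measurable_funB; [exact: measurable_cst|exact: coord_measurable].
  have := mf measurableT _ (measurable_itv `]- r, r[).
  rewrite setTI; congr measurable; apply/seteqP; split => y /=.
    by rewrite in_itv/= ltr_norml.
  by rewrite in_itv/= ltr_norml.
apply/seteqP; split => y.
  by move=> /ball_rVP[_ H] i _; exact: H.
by move=> H; apply/ball_rVP; split => // i; exact: H.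
Qed.

Lemma rat_ball x e : 0 < e -> exists (q : 'rV[rat]_n) (r : rat),
  ball (map_mx ratr q : 'rV[R]_n) (ratr r) x /\
  ball (map_mx ratr q : 'rV[R]_n) (ratr r) `<=` ball x e.
Proof.
move=> e0; have e20 : 0 < e / 2 by rewrite divr_gt0.
have [r] := rat_in_itvoo e20; rewrite in_itv/= => /andP[r0 re].
have H i : exists q : rat, `|ratr q - x 0 i| < ratr r.
  have : x 0 i - ratr r < x 0 i by rewrite gtrBl.
  move=> /rat_in_itvoo[q]; rewrite in_itv/= => /andP[q1 q2].
  by exists q; rewrite ltr_norml; lra.
have [q Hq] := choice H.
exists (\row_i q i), r; split.
  by apply/ball_rVP; split => // i; rewrite !mxE.
move=> y /ball_rVP[_ Hy]; apply/ball_rVP; split => // i.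
have := Hy i; have := Hq i; rewrite !mxE !ltr_norml => /andP[? ?] /andP[? ?].
by lra.
Qed.

(** A Lindelof argument with rational centres and radii. Codes of balls that are not good are
    replaced by the ball of radius 0, which is empty; hence the condition on [set0]. *)
Lemma rat_cover U (good : set (set 'rV[R]_n)) : good set0 ->
  (forall x, U x -> exists2 e, 0 < e & forall V, V `<=` ball x e -> good V) ->
  exists (q : nat -> 'rV[R]_n) (r : nat -> R),
    (forall k, good (ball (q k) (r k))) /\ U `<=` \bigcup_k ball (q k) (r k).
Proof.
move=> g0 H.
pose P (qr : 'rV[rat]_n * rat) :=
  good (ball (map_mx ratr qr.1 : 'rV[R]_n) (ratr qr.2)).
pose c k : 'rV[R]_n * R := if (unpickle k : option ('rV[rat]_n * rat)) is Some qr then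
  if `[< P qr >] then (map_mx ratr qr.1, ratr qr.2) else (0, 0) else (0, 0).
have b0 : good (ball (0 : 'rV[R]_n) 0).
  rewrite (_ : ball _ _ = set0)//; apply/seteqP; split => // y /ball_rVP[].
  by rewrite ltxx.
exists (fst \o c), (snd \o c); split.
  move=> k /=; rewrite /c; case: unpickle => [qr|//].
  by case: ifPn => // /asboolP.
move=> x /H[e e0 He]; have [q [r [xq qe]]] := rat_ball x e0.
exists (pickle (q, r)) => //=; rewrite /c pickleK.
by case: ifPn => // /asboolP; case; exact: He.
Qed.

Lemma open_rV_measurable U : open U -> measurable U.
Proof.
move=> oU.
have [|x Ux|q [r [H1 H2]]] := @rat_cover U (fun V => V `<=` U).
- by [].
- move: (oU) => /(_ x Ux) /nbhs_ballP[e e0 He].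
  by exists e => // V; move/subset_trans; apply.
rewrite (_ : U = \bigcup_k ball (q k) (r k)).
  by apply: bigcup_measurable => k _; exact: ball_rV_measurable.
by apply/seteqP; split=> // x [k _] /H1.
Qed.

Lemma closed_rV_measurable X : closed X -> measurable X.
Proof.
move=> cX; rewrite -[X]setCK; apply: measurableC.
by apply: open_rV_measurable; exact: closed_openC.
Qed.

Lemma leb_bounded X : bounded_set X -> (leb X < +oo)%E.
Proof.
move=> [M [_ bX]].
pose k := Num.max (M + 1) 1.
have {}bX x : X x -> forall i, `|x 0 i| <= k.
  move=> Xx i; have h : `|x| <= M + 1 by apply: bX => //; rewrite ltrDl.
  apply: (@le_trans _ _ (M + 1)); last by rewrite le_max lexx.
  apply: le_trans h; rewrite [leRHS]/Num.norm/= mx_normrE.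
  exact: (@le_bigmax _ _ _ _ (fun ij => `|x ij.1 ij.2|) (0, i)).
(* The lower corner is moved down by 1, since boxes do not contain their lower faces. *)
pose B : option ('rV[R]_n * 'rV[R]_n) := Some (const_mx (- k - 1), const_mx k).
apply: (@le_lt_trans _ _ (box_vol B)); last by rewrite /= ltry.
apply: ereal_inf_lbound; exists (fun j : nat => if j == 0%N then B else None) => /=.
  move=> x /bX H; exists 0%N => //= i; rewrite !mxE.
  by have := H i; rewrite ler_norml; lra.
rewrite (@nneseries_split _ _ 0 1)//; last by move=> k0 _; exact: box_vol_ge0.
rewrite big_nat1 eseries0 ?adde0//.
by move=> [|i].
Qed.

Lemma null_measurable N : leb N = 0%E -> measurable N.
Proof.
move=> N0; apply: le_caratheodory_measurable => X.
have XN : lebesgue_outer (X `&` N) = 0%E.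
  apply/eqP; rewrite eq_le lebesgue_outer_ge0 andbT.
  by rewrite -N0; apply: le_lebesgue_outer; exact: subIsetr.
change (lebesgue_outer (X `&` N) + lebesgue_outer (X `&` ~` N) <= lebesgue_outer X)%E.
by rewrite XN add0e; apply: le_lebesgue_outer; exact: subIsetl.
Qed.

Lemma leb_shift X v : leb [set x | X (x + v)] = leb X.
Proof.
have H (Y : set 'rV[R]_n) (w : 'rV[R]_n) :
    (lebesgue_outer [set x | Y (x + w)%R] <= lebesgue_outer Y)%E.
  apply: le_ereal_inf_tmp => _ [B YB <-].
  pose sh (C : option ('rV[R]_n * 'rV[R]_n)) :=
    if C is Some (a, b) then Some (a - w, b - w) else None.
  apply: ereal_inf_lbound; exists (sh \o B) => /=.
    move=> x /YB[k _ Bk]; exists k => //=; case: (B k) Bk => [[a b]|//] /= h i.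
    by have := h i; rewrite !mxE; lra.
  apply: eq_eseriesr => k _; case: (B k) => [[a b]|]//=.
  by congr (_%:E); apply: eq_bigr => i _; rewrite !mxE; congr (Num.max _ _); ring.
apply/eqP; rewrite eq_le !lebE H /=.
have := H [set x | X (x + v)] (- v); congr (lebesgue_outer _ <= _)%E.
by apply/seteqP; split => x /=; rewrite subrK.
Qed.

Lemma shift_measurable X v : measurable X -> measurable [set x | X (x + v)].
Proof.
move=> mX; apply: le_caratheodory_measurable => Y.
have e (Z : set 'rV[R]_n) : lebesgue_outer [set x | Z (x - v)] = lebesgue_outer Z.
  exact: leb_shift.
rewrite -[leRHS]e (mX [set x | Y (x - v)]) leeD//.
  rewrite -[leRHS](leb_shift _ v) lebE; apply: le_lebesgue_outer => x /= [].
  by rewrite addrK.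
rewrite -[leRHS](leb_shift _ v) lebE; apply: le_lebesgue_outer => x /= [].
by rewrite addrK.
Qed.

(** Translates of one null ball cover the space by countably many null balls. Where this case is
    excluded, nonempty open sets have positive measure. *)
Lemma open_null U : open U -> U !=set0 -> leb U = 0%E ->
  forall X, leb X = 0%E.
Proof.
move=> oU [x0 Ux0] U0 X.
apply/eqP; rewrite eq_le lebesgue_outer_ge0 andbT.
have [|x _|q [r [H1 H2]]] := @rat_cover setT (fun V => lebesgue_outer V = 0%E).
- exact: lebesgue_outer0.
- move: (oU) => /(_ x0 Ux0) /nbhs_ballP[e e0 He].
  exists e => // V Vb; apply/eqP; rewrite eq_le lebesgue_outer_ge0 andbT.
  rewrite -U0 -(leb_shift _ (x0 - x)) lebE; apply: le_lebesgue_outer.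
  move=> y /Vb /ball_rVP[_ h]; apply: He; apply/ball_rVP; split => // i.
  by have := h i; rewrite !mxE; congr (`|_| < _); ring.
apply: (@le_trans _ _ (lebesgue_outer (\bigcup_k ball (q k) (r k)))).
  by apply: le_lebesgue_outer => x _; exact: H2.
apply: (le_trans (lebesgue_outer_sigma_subadditive _)).
by rewrite eseries0// => k _ _; exact: H1.
Qed.

Definition cube (k : nat) : set 'rV[R]_n := [set x | forall i, `|x 0 i| <= k%:R].

Lemma cube_measurable k : measurable (cube k).
Proof.
rewrite (_ : cube k = \bigcap_(i in [set: 'I_n]) [set x : 'rV[R]_n | `|x 0 i| <= k%:R]).
  apply: fin_bigcap_measurable => // i _.
  have := @coord_measurable i measurableT _ (measurable_itv `[- k%:R, k%:R]).
  rewrite setTI; congr measurable; apply/seteqP; split => y /=.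
    by rewrite in_itv/= ler_norml.
  by rewrite in_itv/= ler_norml.
by apply/seteqP; split => [y H i _|y H i]; exact: H.
Qed.

Lemma cube_bounded k : bounded_set (cube k).
Proof.
exists k%:R; split => // M kM x xk /=; rewrite [leLHS]/Num.norm/= mx_normrE.
apply: bigmax_le => [|[i j] _ /=]; first by rewrite (le_trans _ (ltW kM)).
by rewrite ord1 (le_trans (xk j)) ?ltW.
Qed.

Lemma bigcup_cube : \bigcup_k cube k = setT.
Proof.
apply/seteqP; split => // x _; exists (Num.truncn `|x|).+1 => //= i.
apply: (@le_trans _ _ `|x|).
  rewrite [leRHS]/Num.norm/= mx_normrE.
  exact: (@le_bigmax _ _ _ _ (fun ij => `|x ij.1 ij.2|) (0, i)).
by rewrite ltW// truncnS_gt.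
Qed.

Lemma leb_sigma_finite : sigma_finite [set: 'rV[R]_n] leb.
Proof.
exists cube; first by rewrite bigcup_cube.
by move=> k; split; [exact: cube_measurable|exact/leb_bounded/cube_bounded].
Qed.

End leb_basic.

HB.instance Definition _ (R : realType) (n : nat) :=
  Measure_isSigmaFinite.Build _ _ _ (@leb R n) leb_sigma_finite.

Lemma box_vol_prod (R : realType) (n : nat) (a b a' b' : 'rV[R]_n) :
  box_vol (Some (row_mx a a', row_mx b b')) =
  (box_vol (Some (a, b)) * box_vol (Some (a', b')))%E.
Proof.
rewrite /= -EFinM big_split_ord/=; congr ((_ * _)%:E); apply: eq_bigr => i _.
  by rewrite !row_mxEl.
by rewrite !row_mxEr.
Qed.

(** The cylinder over [N] is exhausted by the sets [S k] over bounded cubes. There each box of a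
    cover of [N] is multiplied by one fixed box of volume [v] containing the cube, so that a cover
    of total volume less than [e / v] gives one of volume at most [e]. *)
Lemma null_prodl (R : realType) (n : nat) (N : set 'rV[R]_n) : leb N = 0%E ->
  leb [set w : 'rV[R]_(n + n) | N (lsubmx w)] = 0%E.
Proof.
move=> N0; apply/eqP; rewrite eq_le lebesgue_outer_ge0 andbT.
pose S k := [set w : 'rV[R]_(n + n) | N (lsubmx w) /\ cube k (rsubmx w)].
apply: (@le_trans _ _ (lebesgue_outer (\bigcup_k S k))).
  apply: le_lebesgue_outer => w /= Nw.
  have : [set: 'rV[R]_n] (rsubmx w) by [].
  by rewrite -bigcup_cube => -[k _ H]; exists k.
apply: (le_trans (lebesgue_outer_sigma_subadditive _)).
rewrite eseries0// => k _ _; apply/eqP; rewrite eq_le lebesgue_outer_ge0 andbT.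
apply/lee_addgt0Pr => e e0; rewrite add0e.
pose a' : 'rV[R]_n := const_mx (- k%:R - 1); pose b' : 'rV[R]_n := const_mx k%:R.
pose v := \prod_(i < n) Num.max (b' 0 i - a' 0 i) 0.
have v0 : 0 < v.
  apply: prodr_gt0 => i _; rewrite !mxE lt_max; apply/orP; left.
  by have := ler0n R k; lra.
have ev0 : 0 < e / v by rewrite divr_gt0.
have Nfin : lebesgue_outer N \is a fin_num by rewrite -lebE N0.
have [_ [B NB <-]] := lb_ereal_inf_adherent ev0 Nfin.
rewrite -[ereal_inf _]/(leb N) N0 add0e => Bv.
pose pr (C : option ('rV[R]_n * 'rV[R]_n)) :=
  if C is Some (a, b) then Some (row_mx a a', row_mx b b') else None.
have prE C : box_vol (pr C) = (v%:E * box_vol C)%E.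
  case: C => [[a b]|]; last by rewrite mule0.
  by rewrite box_vol_prod muleC.
apply: (@le_trans _ _ (\sum_(j <oo) box_vol (pr (B j)))%E).
  apply: ereal_inf_lbound; exists (pr \o B) => //= w [/NB[j _ Bj] kw].
  exists j => //=; case: (B j) Bj => [[a b]|//] /= ab i.
  case: (split_ordP i) => l ->; last first.
    by have := kw l; rewrite !row_mxEr !mxE ler_norml; lra.
  by have := ab l; rewrite !row_mxEl !mxE.
rewrite (eq_eseriesr (fun j _ => prE (B j))) nneseriesZl; last first.
  by move=> *; exact: box_vol_ge0.
rewrite (_ : e%:E = (v%:E * (e / v)%:E)%E); last by rewrite -EFinM mulrCA divff ?mulr1 ?gt_eqF.
by rewrite lee_pmul2l// ltW.
Qed.

(** Exchanging the two blocks of coordinates maps boxes to boxes of the same volume. *)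
Lemma null_prodr (R : realType) (n : nat) (N : set 'rV[R]_n) : leb N = 0%E ->
  leb [set w : 'rV[R]_(n + n) | N (rsubmx w)] = 0%E.
Proof.
move=> /null_prodl N0; apply/eqP; rewrite eq_le lebesgue_outer_ge0 andbT -N0.
apply: le_ereal_inf_tmp => _ [B NB <-].
pose sw (C : option ('rV[R]_(n + n) * 'rV[R]_(n + n))) := if C is Some (a, b) then
  Some (row_mx (rsubmx a) (lsubmx a), row_mx (rsubmx b) (lsubmx b)) else None.
apply: ereal_inf_lbound; exists (sw \o B) => /=.
  move=> w Nw; have [|j _ Bj] := NB (row_mx (rsubmx w) (lsubmx w)).
    by rewrite /= row_mxKl.
  exists j => //=; case: (B j) Bj => [[a b]|//] /= ab i.
  case: (split_ordP i) => l ->.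
    by rewrite !row_mxEl; have := ab (rshift n l); rewrite row_mxEr !mxE.
  by rewrite !row_mxEr; have := ab (lshift n l); rewrite row_mxEl !mxE.
apply: eq_eseriesr => j _; case: (B j) => [[a b]|]//=.
rewrite !big_split_ord/= mulrC; congr ((_ * _)%:E); apply: eq_bigr => i _.
  by rewrite !row_mxEr !mxE.
by rewrite !row_mxEl !mxE.
Qed.

(** * Rademacher's theorem *)

(* A Lipschitz function plus a multiple of the identity is nondecreasing, and its Stieltjes
   measure has a bounded density; differentiating the integral of this density gives the
   one-dimensional theorem. *)
Definition lip_up (R : realType) (f : R -> R) (L : R)
  (fL : forall x y, `|f x - f y| <= L * `|x - y|) : R -> R := fun x => f x + L * x.

Section lip_up.
Context (R : realType) (f : R -> R) (L : R).
Hypothesis fL : forall x y, `|f x - f y| <= L * `|x - y|.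

Lemma lip_up_nd : {homo lip_up fL : x y / x <= y}.
Proof.
move=> x y xy; rewrite /lip_up; have := fL x y.
by rewrite (distrC x) (ger0_norm (_ : 0 <= y - x)) ?subr_ge0// ler_norml; lra.
Qed.

Lemma lip_up_rc : right_continuous (lip_up fL).
Proof.
move=> x; apply: cvg_at_right_filter; apply: cvgD; last first.
  by apply: cvgM; [exact: cvg_cst|exact: cvg_id].
apply/cvgrPdist_lt => e e0.
have [L0|L0] := leP L 0.
  near=> y; apply: le_lt_trans (fL x y) _.
  by apply: le_lt_trans e0; rewrite mulr_le0_ge0.
have eL : 0 < e / L by exact: divr_gt0.
apply/nbhs_ballP; exists (e / L) => // y h.
by apply: le_lt_trans (fL x y) _; rewrite mulrC -ltr_pdivlMr.
Unshelve. all: by end_near. Qed.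

HB.instance Definition _ := @isCumulative.Build R _ R (lip_up fL) lip_up_nd lip_up_rc.
End lip_up.

Lemma lebesgue_stieltjes_itvoc (R : realType) (g : cumulative R R) (a b : R) : a <= b ->
  lebesgue_stieltjes_measure g `]a, b]%classic = (g b - g a)%:E.
Proof.
move=> ab.
rewrite /lebesgue_stieltjes_measure/= /measure_extension/= measurable_mu_extE/=; last by exists (a, b).
by rewrite wlength_itv_bnd.
Qed.

Section lipschitz_ae.
Context (R : realType) (f : R -> R) (L : R).
Hypothesis L0 : 0 < L.
Hypothesis fL : forall x y, `|f x - f y| <= L * `|x - y|.
Let fLN x y : `|- f x - - f y| <= L * `|x - y|.
Proof. by rewrite -opprD normrN. Qed.

Let LS : {measure set (measurableTypeR R) -> \bar R} := lebesgue_stieltjes_measure (lip_up fL).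
Let LSN : {measure set (measurableTypeR R) -> \bar R} := lebesgue_stieltjes_measure (lip_up fLN).

Let LSE a b : a <= b -> LS `]a, b]%classic = (lip_up fL b - lip_up fL a)%:E.
Proof. exact: lebesgue_stieltjes_itvoc. Qed.
Let LSNE a b : a <= b -> LSN `]a, b]%classic = (lip_up fLN b - lip_up fLN a)%:E.
Proof. exact: lebesgue_stieltjes_itvoc. Qed.

(** The increments of [lip_up fL] and [lip_up fLN] add up to [2 * L * (b - a)], since [f] and [- f]
    cancel. The sum of both Stieltjes measures, divided by [2 * L], is thus Lebesgue measure by
    uniqueness, and [LS] is at most [2 * L] times Lebesgue measure. *)
Lemma LS_dominated : LS `<< (@lebesgue_measure R).
Proof.
have L2 : 0 < 2 * L by exact: mulr_gt0.
have L20 : 0 <= (2 * L)^-1 by rewrite invr_ge0 ltW.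
pose m : {measure set (measurableTypeR R) -> \bar R} :=
  mscale (NngNum L20) (measure_add LS LSN).
have mXE X : m X = ((2 * L)^-1%:E * (LS X + LSN X))%E by rewrite -measure_addE.
apply/null_content_dominatesP => A mA A0.
have mE : m A = 0%E.
  transitivity (@lebesgue_measure R A); last exact: A0.
  apply/esym; apply: (@lebesgue_stieltjes_measure_unique R idfun m) => //.
  move=> X [[a b] _ <-] /=.
  have [ab|ba] := leP a b; last by rewrite set_itv_ge ?measure0// -leNgt bnd_simp ltW.
  rewrite lebesgue_stieltjes_itvoc// mXE LSE// LSNE//.
  rewrite -EFinD -EFinM /lip_up; congr EFin.
  by rewrite /=; field; rewrite gt_eqF.
have : (LS A <= (2 * L)%:E * m A)%E.
  rewrite mXE muleA -EFinM divff ?gt_eqF// mul1e.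
  by rewrite leeDl.
by rewrite mE mule0 => H; apply/eqP; rewrite eq_le H measure_ge0.
Qed.

Lemma lipschitz_ae_derivable_itv (k : R) :
  {ae lebesgue_measure, forall x, - k < x < k -> derivable f x 1}.
Proof.
have [k0|k0] := leP k 0.
  by apply: aeW => x /andP[]; lra.
pose D := `]- k, k]%classic.
have mD : measurable (D : set (measurableTypeR R)) by exact: measurable_itv.
have Dfin : (LS D < +oo)%E by rewrite LSE ?ltry//; lra.
(* Restriction to a bounded interval makes the measure finite, so that it is a charge and has an
   integrable density. *)
pose nu : {finite_measure set (measurableTypeR R) -> \bar R} := mfrestr mD Dfin.
pose nuc : {charge set (measurableTypeR R) -> \bar R} := charge_of_finite_measure nu.
have nudom : nuc `<< (@lebesgue_measure R).
  apply/null_content_dominatesP => A mA A0; rewrite /nuc/= /charge_of_finite_measure/=.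
  have /null_content_dominatesP /(_ A mA A0) LA := LS_dominated.
  apply/eqP; rewrite eq_le measure_ge0 andbT -LA.
  by apply: le_measure; rewrite ?inE//; exact: measurableI.
pose h x := fine (Radon_Nikodym nuc lebesgue_measure x).
have hE : EFin \o h = Radon_Nikodym nuc lebesgue_measure.
  by apply/funext => x /=; rewrite fineK// Radon_Nikodym_fin_num.
have ih : lebesgue_measure.-integrable setT (EFin \o h).
  by rewrite hE; exact: Radon_Nikodym_integrable.
have locf : locally_integrable setT h by apply: open_integrable_locally => //; exact: openT.
have ihy y : lebesgue_measure.-integrable `]-oo, y] (EFin \o h).
  by apply: integrableS ih => //; exact: measurable_itv.
have := @FTC1Ny R h ihy locf.
apply: filterS; first exact: (ae_filter_ringOfSetsType lebesgue_measure).
move=> x [dF _] /andP[kx xk].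
have FE y : - k < y < k -> \int[lebesgue_measure]_(t in `]-oo, y]) h t =
    lip_up fL y - lip_up fL (- k).
  move=> /andP[ky yk].
  rewrite /Rintegral; under eq_integral do rewrite -[(h _)%:E]/((EFin \o h) _) hE.
  rewrite -Radon_Nikodym_integral//.
  rewrite /nuc/= /charge_of_finite_measure/= /mfrestr/= /mrestr.
  rewrite (_ : _ `&` _ = `]- k, y]%classic); first by rewrite LSE// ltW.
  apply/seteqP; split => t /=; rewrite !in_itv/=; first by move=> [h1 /andP[h2 h3]]; apply/andP.
  by move=> /andP[h1 h2]; split => //; rewrite /D/= in_itv/= h1 (le_trans h2)// ltW.
have dG : derivable (lip_up fL \- cst (lip_up fL (- k))) x 1.
  apply: near_eq_derivable dF; near=> y; apply: FE.
  suff : y \in `]- k, k[ by rewrite in_itv.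
  by near: y; apply: near_in_itvoo; rewrite in_itv/= kx xk.
have dG1 : derivable (lip_up fL \- cst (lip_up fL (- k)) \+ cst (lip_up fL (- k)) \- (L \*: id)) x 1.
  apply: derivableB; first by apply: derivableD; [exact: dG|exact: derivable_cst].
  by apply: derivableZ; exact: derivable_id.
rewrite (_ : f = lip_up fL \- cst (lip_up fL (- k)) \+ cst (lip_up fL (- k)) \- (L \*: id))//.
by apply/funext => y /=; rewrite /lip_up subrK addrK.
Unshelve. all: by end_near. Qed.

Lemma lipschitz_ae_derivable : {ae lebesgue_measure, forall x, derivable f x 1}.
Proof.
have H : {ae lebesgue_measure, forall x, forall k : nat, - k%:R < x < k%:R -> derivable f x 1}.
  by apply: ae_foralln => k; exact: lipschitz_ae_derivable_itv.
move: H; apply: filterS; first exact: (ae_filter_ringOfSetsType lebesgue_measure).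
move=> x /(_ (Num.truncn `|x|).+1); apply; rewrite -ltr_norml.
exact: truncnS_gt.
Qed.
End lipschitz_ae.

(** * Directional derivatives of Lipschitz functions of several variables *)

Section rademacher.
Context (R : realType) (n : nat).
Implicit Types (f : 'rV[R]_n -> R) (x y v : 'rV[R]_n).
Local Notation borel := (g_sigma_algebraType (@open 'rV[R]_n)).

Lemma borel_continuous f : continuous f -> measurable_fun [set: borel] f.
Proof.
move=> cf; apply: (@measurability _ _ _ _ _ _ (@measurable_realfun.RGenOInfty.G R)).
  exact: measurable_realfun.RGenOInfty.measurableE.
move=> _ [_ [c ->] <-]; rewrite setTI; apply: sub_sigma_algebra.
by apply: open_comp => [x _|]; [exact: cf|exact: interval_open].
Qed.

Lemma borel_leb (X : set borel) : measurable X -> measurable (X : set 'rV[R]_n).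
Proof.
move=> mX; have : measurable_fun [set: 'rV[R]_n] (id : 'rV[R]_n -> borel).
  apply: (@measurability _ _ 'rV[R]_n borel setT id (@open 'rV[R]_n)) => //.
  by move=> _ [U oU <-]; rewrite setTI preimage_id; exact: open_rV_measurable.
by move=> /(_ measurableT X mX); rewrite setTI preimage_id.
Qed.

(** The target carries the Borel sets: a ball of the maximum norm is cut out by finitely many
    inequalities between coordinates, and open sets are countable unions of balls. Lebesgue
    measurable sets are not pulled back in this way, which is why the exceptional set below is built
    as a Borel set. *)
Lemma line_measurable v :
  measurable_fun [set: measurableTypeR R * 'rV[R]_n] (fun z => (z.2 - z.1 *: v) : borel).
Proof.
apply: (@measurability _ _ (measurableTypeR R * 'rV[R]_n)%type borel setT _ (@open 'rV[R]_n)) => //.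
move=> _ [U oU <-]; rewrite setTI.
have [|x Ux|q [r [H1 H2]]] := @rat_cover R n U (fun V => V `<=` U).
- by [].
- move: (oU) => /(_ x Ux) /nbhs_ballP[e e0 He].
  by exists e => // V; move/subset_trans; apply.
rewrite (_ : _ @^-1` U = \bigcup_k [set z : measurableTypeR R * 'rV[R]_n |
    ball (q k) (r k) (z.2 - z.1 *: v)]); last first.
  apply/seteqP; split => z /=; first by move=> /H2.
  by move=> [k _]; exact: H1.
apply: bigcup_measurable => k _.
have [r0|r0] := ltP 0 (r k); last first.
  rewrite (_ : [set _ | _] = set0)//; apply/seteqP; split => // y /ball_rVP[].
  by rewrite ltNge r0.
rewrite (_ : [set _ | _] = \bigcap_(i in [set: 'I_n])
  [set z : measurableTypeR R * 'rV[R]_n | `|q k 0 i - (z.2 0 i - z.1 * v 0 i)| < r k]).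
  apply: fin_bigcap_measurable => // i _.
  have mf : measurable_fun [set: measurableTypeR R * 'rV[R]_n]
      (fun z => q k 0 i - (z.2 0 i - z.1 * v 0 i)).
    apply: measurable_funB; first exact: measurable_cst.
    apply: measurable_funB.
      by apply: (measurableT_comp (@coord_measurable R n i)); exact: measurable_snd.
    by apply: measurable_funM; [exact: measurable_fst|exact: measurable_cst].
  have := mf measurableT _ (measurable_itv `]- r k, r k[).
  rewrite setTI; congr measurable; apply/seteqP; split => y /=.
    by rewrite in_itv/= ltr_norml.
  by rewrite in_itv/= ltr_norml.
apply/seteqP; split => z.
  by move=> /ball_rVP[_ H] i _; have := H i; rewrite !mxE.
by move=> H; apply/ball_rVP; split => // i; have := H i Logic.I; rewrite /= !mxE.
Qed.

End rademacher.
Section lip_quotient.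
Context (R : realType) (V : normedModType R) (f : V -> R) (L : R).
Hypothesis L0 : 0 <= L.
Hypothesis fL : forall x y, `|f x - f y| <= L * `|x - y|.

Lemma lip_continuous : continuous f.
Proof.
move=> x; apply/cvgrPdist_lt => e e0.
have L1 : 0 < L + 1 by rewrite ltr_wpDl.
have eL : 0 < e / (L + 1) by exact: divr_gt0.
apply/nbhs_ballP; exists (e / (L + 1)) => // y.
rewrite -ball_normE/= ltr_pdivlMr// => h.
apply: le_lt_trans (fL x y) _; apply: le_lt_trans h.
by rewrite [leRHS]mulrC ler_wpM2r// lerDl.
Qed.

Lemma quotient_continuous (v : V) (h : R) :
  continuous (fun x => h^-1 * (f (h *: v + x) - f x)).
Proof.
move=> x; apply: (@cvgM _ _ _ _ (cst h^-1) (fun x => f (h *: v + x) - f x)); first exact: cvg_cst.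
apply: cvgB; last exact: lip_continuous.
apply: (@cvg_comp _ _ _ (fun y => h *: v + y) f _ (nbhs (h *: v + x))); last exact: lip_continuous.
by apply: cvgD; [exact: cvg_cst|exact: cvg_id].
Qed.

Lemma quotient_continuous_step (v x : V) (h : R) : h != 0 ->
  {for h, continuous (fun h : R => h^-1 * (f (h *: v + x) - f x))}.
Proof.
move=> h0; apply: cvgM; first exact: cvgV.
apply: cvgB; last exact: cvg_cst.
apply: (@cvg_comp _ _ _ (fun h => h *: v + x) f _ (nbhs (h *: v + x))); last exact: lip_continuous.
by apply: cvgD; [apply: cvgZr_tmp; exact: cvg_id|exact: cvg_cst].
Qed.

End lip_quotient.

Section rademacher2.
Context (R : realType) (n : nat) (f : 'rV[R]_n -> R) (L : R) (v : 'rV[R]_n).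
Hypothesis L0 : 0 <= L.
Hypothesis fL : forall x y, `|f x - f y| <= L * `|x - y|.
Local Notation borel := (g_sigma_algebraType (@open 'rV[R]_n)).

Let q (h : R) (x : 'rV[R]_n) : R := h^-1 * (f (h *: v + x) - f x).

Let q_measurable h : measurable_fun [set: borel] (q h).
Proof.
by apply: borel_continuous; exact: (quotient_continuous L0 fL).
Qed.

(** Failure of the Cauchy criterion for the difference quotients. Steps are restricted to rational
    numbers so that [N] is a countable combination of Borel sets. *)
Let bad (m k : nat) (s t : rat) : set borel :=
  [set x | [/\ 0 < `|ratr s : R| < k.+1%:R^-1, 0 < `|ratr t : R| < k.+1%:R^-1 &
    m.+1%:R^-1 < `|q (ratr s) x - q (ratr t) x| ] ].
Let N : set borel := \bigcup_m \bigcap_k \bigcup_s \bigcup_t bad m k s t.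

Let N_measurable : measurable N.
Proof.
apply: bigcup_measurable => m _; apply: bigcapT_measurable => k.
apply: bigcupT_measurable_rat => s; apply: bigcupT_measurable_rat => t.
have [H|H] := pselect (0 < `|ratr s : R| < k.+1%:R^-1 /\ 0 < `|ratr t : R| < k.+1%:R^-1); last first.
  by rewrite (_ : bad _ _ _ _ = set0)//; apply/seteqP; split => // x [? ? _]; apply: H.
have mf : measurable_fun [set: borel] (fun x => `|q (ratr s) x - q (ratr t) x|).
  apply: (measurableT_comp (@normr_measurable R setT)).
  by apply: measurable_funB; exact: q_measurable.
have := mf measurableT _ (measurable_itv `]m.+1%:R^-1, +oo[).
rewrite setTI; congr measurable; apply/seteqP; split => x /=; rewrite in_itv/= andbT.
  by move: H => [? ?] ?; split.
by case.
Qed.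

Let q_cont_h x h : h != 0 -> {for h, continuous (q^~ x)}.
Proof.
exact: (quotient_continuous_step L0 fL).
Qed.

Let derivableE x : derivable f x v <-> cvg (q h x @[h --> 0^']).
Proof. by []. Qed.

(** For nonzero steps the difference quotient depends continuously on the step, so that a bound for
    its oscillation along rational steps extends to all steps. *)
Let notN_derivable x : ~ N x -> derivable f x v.
Proof.
move=> Nx; apply/derivableE; apply/cauchy_cvgP.
apply/cauchy_exP => e e0.
have [m me] : exists m, m.+1%:R^-1 < e.
  exists (Num.truncn e^-1); rewrite invf_plt ?posrE//; exact: truncnS_gt.
have [k Hk] : exists k, forall s t : rat, 0 < `|ratr s : R| < k.+1%:R^-1 ->
    0 < `|ratr t : R| < k.+1%:R^-1 -> `|q (ratr s) x - q (ratr t) x| <= m.+1%:R^-1.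
  apply: contrapT => H; apply: Nx; exists m => // k _.
  apply: contrapT => H2; apply: H; exists k => s t hs ht.
  by rewrite leNgt; apply/negP => H3; apply: H2; exists s => //; exists t.
have rat_near h d : 0 < `|h| < k.+1%:R^-1 -> 0 < d ->
    exists2 s : rat, 0 < `|ratr s : R| < k.+1%:R^-1 & `|q h x - q (ratr s) x| < d.
  move=> /andP[h0 hk] d0.
  have hn0 : h != 0 by rewrite -normr_gt0.
  have : \forall t \near h, [/\ t != 0, `|t| < k.+1%:R^-1 & `|q h x - q t x| < d].
    near=> t; split.
    - near: t; exact: (@open_neq R 0 h).
    - near: t; have := @norm_continuous R R^o h.
      by move=> /cvgr_lt; apply.
    - by near: t; apply: cvgr_dist_lt => //; exact: q_cont_h.
  move=> /nbhs_ballP[r /= r0 Hr].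
  have /rat_in_itvoo[s] : h < h + r by rewrite ltrDl.
  rewrite in_itv/= => /andP[s1 s2]; exists s.
    have [|H1 H2 _] := Hr (ratr s); last by rewrite normr_gt0 H1.
    by rewrite -ball_normE/= ltr_norml; apply/andP; split; lra.
  have [|] // := Hr (ratr s).
  by rewrite -ball_normE/= ltr_norml; apply/andP; split; lra.
pose h0 : R := k.+1%:R^-1 / 2.
have k0 : 0 < k.+1%:R^-1 :> R by rewrite invr_gt0.
have h00 : 0 < h0 by rewrite divr_gt0.
have h0k : 0 < `|h0| < k.+1%:R^-1.
  by rewrite gtr0_norm// h00/= ltr_pdivrMr// ltr_pMr// ltr1n.
exists (q h0 x).
exists k.+1%:R^-1 => //= h; rewrite /ball_/= sub0r normrN => hk hn0.
have hk0 : 0 < `|h| < k.+1%:R^-1 by rewrite normr_gt0 hn0.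
pose d : R := (e - m.+1%:R^-1) / 2.
have d0 : 0 < d by rewrite divr_gt0// subr_gt0.
have [s Hs qs] := rat_near h0 d h0k d0.
have [t Ht qt] := rat_near h d hk0 d0.
rewrite -ball_normE/= -/(q h x).
apply: (le_lt_trans (ler_distD (q (ratr s) x) _ _)).
have -> : e = d + (m.+1%:R^-1 + d) by rewrite /d; set c := m.+1%:R^-1; field.
apply: ltr_leD => //; apply: (le_trans (ler_distD (q (ratr t) x) _ _)).
by apply: lerD; [exact: Hk|rewrite distrC ltW].
Unshelve. all: by end_near. Qed.

Let derivable_notN x : derivable f x v -> ~ N x.
Proof.
move=> /derivableE /cvg_ex[l /cvgrPdist_lt H] [m _ Nx].
have /H[e /= e0 He] : 0 < m.+1%:R^-1 / 2 :> R by rewrite divr_gt0// invr_gt0.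
have [k ke] : exists k, k.+1%:R^-1 < e.
  exists (Num.truncn e^-1); rewrite invf_plt ?posrE//; exact: truncnS_gt.
have [s _ [t _ [/andP[s0 sk] /andP[t0 tk]]]] := Nx k Logic.I.
have /He /(_ (_ : ratr s != 0)) h1 : ball (0 : R) e (ratr s).
  by rewrite -ball_normE/= sub0r normrN (lt_trans sk).
have /He /(_ (_ : ratr t != 0)) h2 : ball (0 : R) e (ratr t).
  by rewrite -ball_normE/= sub0r normrN (lt_trans tk).
rewrite ltNge => /negP; apply.
rewrite normr_gt0 in s0; rewrite normr_gt0 in t0.
apply: (le_trans (ler_distD l _ _)); rewrite [m.+1%:R^-1]splitr.
by apply: lerD; [rewrite distrC ltW// h1|rewrite ltW// h2].
Qed.

(* The exceptional set meets every line parallel to v in a null set.  Fubini's theorem is applied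
   to the product of an interval with R^n: by translation invariance the measure of the set is
   the average over t of the measures of its translates by t v. *)
Lemma rademacher_dir : leb [set x | ~ derivable f x v] = 0%E.
Proof.
have mN : measurable (N : set 'rV[R]_n) by apply: borel_leb; exact: N_measurable.
suff N0 : leb N = 0%E.
  apply/eqP; rewrite eq_le measure_ge0 andbT -N0; apply: le_lebesgue_outer.
  by move=> x /= dx; apply: contrapT => /notN_derivable.
pose A := [set z : measurableTypeR R * 'rV[R]_n | `[0, 1]%classic z.1 /\ N (z.2 - z.1 *: - v)].
have mA : measurable A.
  apply: measurableI.
    have := @measurable_fst _ _ (measurableTypeR R) 'rV[R]_n measurableT _ (@measurable_itv R `[0, 1]).
    by rewrite setTI.
  by have := @line_measurable R n (- v) measurableT N N_measurable; rewrite setTI.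
have := indic_fubini_tonelli lebesgue_measure (@leb R n) mA.
rewrite indic_fubini_tonelli_FE//.
rewrite [RHS]integral0_eq => [|y _]; last first.
  have L1 : 0 < L * `|v| + 1 by rewrite ltr_wpDl// mulr_ge0.
  have gL s t : `|f (y + s *: v) - f (y + t *: v)| <= (L * `|v| + 1) * `|s - t|.
    apply: le_trans (fL _ _) _; rewrite opprD addrACA subrr add0r -scalerBl normrZ.
    by rewrite mulrCA mulrC ler_wpM2r// lerDl.
  have [B [mB B0 gB]] := lipschitz_ae_derivable L1 gL.
  rewrite indic_fubini_tonelli_GE//=.
  apply: (@subset_measure0 _ _ _ lebesgue_measure _ B) => //.
    exact: measurable_ysection.
  rewrite ysectionE => t /= [_ Nt]; apply: gB => /= dt; move: Nt; apply: derivable_notN.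
  move: dt; rewrite /derivable/= scalerN opprK.
  rewrite (_ : (fun h => _) = (fun h => h^-1 *: (f (h *: v + (y + t *: v)) - f (y + t *: v))))//.
  apply/funext => h; rewrite /= [h *: 1]mulr1; congr (_ *: (f _ - _)).
  by rewrite scalerDl addrCA addrA.
rewrite (_ : _ \o _ = fun t => (\1_(`[0, 1]%classic) t)%:E * leb N)%E; last first.
  apply/funext => t /=; rewrite indicE.
  have [t01|t01] := boolP (t \in _).
    rewrite mul1e -[RHS](leb_shift _ (- (t *: - v))); congr (leb _).
    rewrite xsectionE; apply/seteqP; split => y /=; first by case.
    by split => //; rewrite inE in t01.
  rewrite mul0e (_ : xsection _ _ = set0) ?measure0//.
  rewrite xsectionE; apply/seteqP; split => y //= [h _].
  by move/negP: t01; rewrite inE; apply.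
rewrite ge0_integralZr//; last first.
  by apply/measurable_EFinP; exact: measurable_indic.
rewrite integral_indic//= setIT lebesgue_measure_itv/= lte_fin ltr01.
by rewrite oppr0 adde0 mul1e.
Qed.

End rademacher2.

(** * Gradients of locally Lipschitz functions *)

Lemma near_continuous_at (R : realType) (V : normedModType R) (f g : V -> R) (x : V) :
  {near x, g =1 f} -> {for x, continuous g} -> {for x, continuous f}.
Proof.
move=> fg cg; have gx : g x = f x := nbhs_singleton fg.
suff : f @ x --> g x by rewrite gx.
by apply: cvg_trans cg; apply: near_eq_cvg; move: fg; apply: filterS => y ->.
Qed.

Section lip.
Context {R : realType} {n : nat}.
Implicit Types (f g : 'rV[R]_n -> R) (A U V : set 'rV[R]_n) (x y v : 'rV[R]_n).

Definition lip_with (M : R) A f := forall x y, A x -> A y -> `|f x - f y| <= M * `|x - y|.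

Lemma lipschitz_inP A f : [lipschitz f x | x in A] <-> exists2 M, 0 <= M & lip_with M A f.
Proof.
split=> [[M [_ H]]|[M M0 H]].
  exists (Num.max (M + 1) 0); first by rewrite le_max lexx orbT.
  move=> x y Ax Ay; have : M < Num.max (M + 1) 0 by rewrite lt_max ltrDl ltr01.
  by move=> /H /(_ (x, y)); apply.
exists M; split => [|N MN [x y] [/= Ax Ay]]; first exact: num_real.
by apply: le_trans (H x y Ax Ay) _; rewrite ler_wpM2r// ltW.
Qed.

Lemma lip_withS (M N : R) A U f : M <= N -> U `<=` A -> lip_with M A f -> lip_with N U f.
Proof.
move=> MN UA H x y Ux Uy; apply: le_trans (H _ _ (UA _ Ux) (UA _ Uy)) _.
by rewrite ler_wpM2r.
Qed.

Lemma lip_loc_ball U f x : open U -> Lip_loc U f -> U x ->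
  exists e M, [/\ 0 < e, 0 <= M, ball x e `<=` U & lip_with M (ball x e) f].
Proof.
move=> oU Lf Ux; have [V xV /lipschitz_inP[M M0 H]] := Lf x Ux.
have : nbhs x (V `&` U) by apply: filterI => //; exact: oU.
move=> /nbhs_ballP[e /= e0 He]; exists e, M; split => // [y /He[]//|].
exact: lip_withS H.
Qed.

(** McShane's formula: the infimum over [y] in [A] of [f y + M * |x - y|]. It makes the theorem on
    global Lipschitz functions applicable to functions that are Lipschitz only on a ball. *)
Lemma lip_extension (M : R) A f : 0 <= M -> A !=set0 -> lip_with M A f ->
  exists2 g, lip_with M setT g & forall x, A x -> g x = f x.
Proof.
move=> M0 [a Aa] fA.
pose S x := [set f y + M * `|x - y| | y in A].
have lbS x : lbound (S x) (f a - M * `|x - a|).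
  move=> _ [y Ay <-]; have := fA a y Aa Ay; rewrite ler_norml => /andP[_ h].
  have : M * `|a - y| <= M * `|x - a| + M * `|x - y|.
    by rewrite -mulrDr ler_wpM2l// (distrC x a) ler_distD.
  by move: h; lra.
have infS x : has_inf (S x).
  by split; [exists (f a + M * `|x - a|), a|exists (f a - M * `|x - a|)].
exists (fun x => inf (S x)).
  have H x y : inf (S x) - M * `|x - y| <= inf (S y).
    apply: lb_le_inf; first by case: (infS y).
    move=> _ [z Az <-]; rewrite lerBlDr.
    apply: (@le_trans _ _ (f z + M * `|x - z|)).
      by apply: ge_inf; [case: (infS x)|exists z].
    by rewrite -addrA lerD2l -mulrDr ler_wpM2l// [leRHS]addrC ler_distD.
  move=> x y _ _; rewrite ler_norml; have := H x y; have := H y x.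
  by rewrite (distrC y x); set c := M * _; lra.
move=> x Ax; apply/eqP; rewrite eq_le; apply/andP; split.
  apply: ge_inf; first by case: (infS x).
  by exists x => //; rewrite subrr normr0 mulr0 addr0.
apply: lb_le_inf; first by case: (infS x).
move=> _ [y Ay <-]; have := fA x y Ax Ay; rewrite ler_norml => /andP[_].
by lra.
Qed.

Definition pd f x := forall i, derivable f x (delta_mx 0 i).

Lemma pd_near f g x : {near x, f =1 g} -> pd f x -> pd g x.
Proof. by move=> fg H i; exact: near_eq_derivable (H i). Qed.

Lemma lip_pd (M : R) f : 0 <= M -> lip_with M setT f -> leb [set x | ~ pd f x] = 0%E.
Proof.
move=> M0 fM; have H i := @rademacher_dir R n f M (delta_mx 0 i) M0 (fun x y => fM x y Logic.I Logic.I).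
apply/eqP; rewrite eq_le lebesgue_outer_ge0 andbT.
apply: (@le_trans _ _ (lebesgue_outer (\bigcup_k (if insub k is Some i then
    [set x | ~ derivable f x (delta_mx 0 (i : 'I_n))] else set0)))).
  apply: le_lebesgue_outer => x /= /existsNP[i Hi]; exists (val i) => //.
  by rewrite valK.
apply: (le_trans (lebesgue_outer_sigma_subadditive _)).
rewrite eseries0// => k _ _; case: insubP => [i _ _|_]; last exact: lebesgue_outer0.
exact: H.
Qed.

(** Countably many balls on which [f] is Lipschitz cover [U]. On each of them [f] agrees near every
    point with a global Lipschitz extension, so both have the same partial derivatives. *)
Lemma lip_loc_pd U f : open U -> Lip_loc U f -> leb [set x | U x /\ ~ pd f x] = 0%E.
Proof.
move=> oU Lf; apply/eqP; rewrite eq_le lebesgue_outer_ge0 andbT.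
have [|x Ux|q [r [H1 H2]]] := @rat_cover R n U
  (fun V => lebesgue_outer (V `&` [set x | ~ pd f x]) = 0%E).
- by rewrite set0I lebesgue_outer0.
- have [e [M [e0 M0 eU fM]]] := lip_loc_ball oU Lf Ux.
  exists e => // V Ve; apply/eqP; rewrite eq_le lebesgue_outer_ge0 andbT.
  have [|g gM gf] := lip_extension M0 _ fM; first by exists x; exact: ballxx.
  rewrite -(lip_pd M0 gM) lebE; apply: le_lebesgue_outer => y [/Ve ye /= ny] gy.
  apply: ny; apply: pd_near gy.
  have : nbhs y (ball x e) by apply: open_nbhs_nbhs; split => //; exact: ball_open.
  by apply: filterS => z /gf.
apply: (@le_trans _ _ (lebesgue_outer (\bigcup_k (ball (q k) (r k) `&` [set x | ~ pd f x])))).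
  by apply: le_lebesgue_outer => x [/H2[k _ xk] nx]; exists k.
apply: (le_trans (lebesgue_outer_sigma_subadditive _)).
by rewrite eseries0// => k _ _; exact: H1.
Qed.

Lemma leb_null_sub A V : A `<=` V -> leb V = 0%E -> leb A = 0%E.
Proof.
move=> AV V0; apply/eqP; rewrite eq_le lebesgue_outer_ge0 andbT -V0.
exact: le_lebesgue_outer.
Qed.

Lemma aeP (P : 'rV[R]_n -> Prop) : (\forall x \ae leb, P x) <-> leb [set x | ~ P x] = 0%E.
Proof.
split=> [[N [mN N0 PN]]|H]; first exact: leb_null_sub N0.
by exists [set x | ~ P x]; split => //; exact: null_measurable.
Qed.

(** Completeness of Lebesgue measure: the behaviour on [N] changes a preimage only by a subset of a
    null set. *)
Lemma measurable_null_patch {d} {T : measurableType d} U N (f : 'rV[R]_n -> T) :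
  measurable U -> leb N = 0%E -> measurable_fun (U `\` N) f -> measurable_fun U f.
Proof.
move=> mU N0 mf _ B mB.
have -> : U `&` f @^-1` B = ((U `\` N) `&` f @^-1` B) `|` ((U `&` f @^-1` B) `&` N).
  apply/seteqP; split => x /=.
    by move=> [Ux Bx]; have [Nx|Nx] := pselect (N x); [right|left].
  by move=> [[[? _] ?]|[]].
apply: measurableU.
  by apply: mf => //; apply: measurableD => //; exact: null_measurable.
by apply: null_measurable; apply: leb_null_sub N0; exact: subIsetr.
Qed.

Lemma continuous_in_measurable U f : open U -> (forall x, U x -> {for x, continuous f}) ->
  measurable_fun U f.
Proof.
move=> oU cf; apply: (@measurability _ _ _ _ _ _ (@measurable_realfun.RGenOInfty.G R)).
  exact: measurable_realfun.RGenOInfty.measurableE.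
move=> _ [_ [c ->] <-]; apply: open_rV_measurable.
rewrite openE => x [Ux fx]; apply: filterI; first exact: oU.
by apply: cf => //; apply: open_nbhs_nbhs; split => //; exact: interval_open.
Qed.

Lemma lip_with_continuous_at (M e : R) f x : 0 < e -> 0 <= M -> lip_with M (ball x e) f ->
  {for x, continuous f}.
Proof.
move=> e0 M0 fM.
have [|g gM gf] := lip_extension M0 _ fM; first by exists x; exact: ballxx.
apply: (@near_continuous_at R _ f g); last first.
  exact: (@lip_continuous R _ g M M0 (fun x y => gM x y Logic.I Logic.I) x).
have : nbhs x (ball x e) by exact: nbhsx_ballx.
by apply: filterS => z /gf.
Qed.

Lemma lip_loc_continuous U f x : open U -> Lip_loc U f -> U x -> {for x, continuous f}.
Proof.
move=> oU Lf Ux; have [e [M [e0 M0 _ fM]]] := lip_loc_ball oU Lf Ux.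
exact: lip_with_continuous_at fM.
Qed.

Lemma lip_loc_measurable U f : open U -> Lip_loc U f -> measurable_fun U f.
Proof.
move=> oU Lf; apply: continuous_in_measurable => // x Ux.
exact: lip_loc_continuous Lf Ux.
Qed.

(** Outside a null set the partial derivative is the limit of difference quotients with steps
    [1 / (k + 1)]. Extending [f] by 0 makes these quotients measurable on the whole space; near a
    point of [U] the extension has no effect once the step is small. *)
Lemma grad_measurable U f i : open U -> Lip_loc U f ->
  measurable_fun U (fun x => grad f x 0 i).
Proof.
move=> oU Lf; have N0 := lip_loc_pd oU Lf.
set N := [set x | _] in N0.
have mU := open_rV_measurable oU.
apply: (measurable_null_patch mU N0).
pose g := f \_ U.
have mg : measurable_fun [set: 'rV[R]_n] g.
  by apply/(measurable_restrictT _ mU); exact: lip_loc_measurable.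
pose e : 'rV[R]_n := delta_mx 0 i.
pose q (k : nat) x : R := k.+1%:R * (g (x + k.+1%:R^-1 *: e) - g x).
apply: (@measurable_fun_cvg _ _ _ _ q).
  move=> k; apply: measurable_funTS.
  apply: measurable_funM; first exact: measurable_cst.
  apply: measurable_funB; last exact: mg.
  move=> _ Y mY; rewrite setTI.
  have mgY : measurable (g @^-1` Y) by rewrite -[X in measurable X]setTI; exact: mg.
  exact: (shift_measurable (k.+1%:R^-1 *: e) mgY).
move=> x [Ux nN].
have px : pd f x by apply: contrapT => npx; apply: nN.
have := px i; rewrite /grad mxE /derivable -/e => /cvgP; rewrite -/('D_e f x) => H.
apply/cvgrPdist_lt => eps eps0.
have [r /= r0 Hr] := (cvgrPdist_lt _ _).1 H eps eps0.
have [s /= s0 Hs] := (nbhs_ballP _ _).1 (oU x Ux).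
have e1 : `|e| <= 1.
  rewrite [leLHS]/Num.norm/= mx_normrE; apply: bigmax_le => // -[a b] _ /=.
  by rewrite mxE; case: andP => _; rewrite ?normr1 ?normr0.
near=> k.
have k0 : 0 < k.+1%:R^-1 :> R by rewrite invr_gt0.
have kr : `|0 - k.+1%:R^-1 : R| < r.
  by near: k; exact: ((cvgrPdist_lt _ _).1 (@cvg_harmonic R) r r0).
have ks : `|0 - k.+1%:R^-1 : R| < s.
  by near: k; exact: ((cvgrPdist_lt _ _).1 (@cvg_harmonic R) s s0).
have := Hr k.+1%:R^-1 kr (lt0r_neq0 k0).
rewrite /q /g !patchE (mem_set Ux) mem_set; last first.
  apply: Hs; rewrite -ball_normE/= opprD addrA subrr sub0r normrN normrZ.
  by rewrite sub0r normrN in ks; apply: le_lt_trans ks; rewrite ler_piMr.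
by rewrite invrK /= [k.+1%:R^-1 *: e + x]addrC.
Unshelve. all: by end_near. Qed.

Let quotientE f x v : (fun h : R => h^-1 *: ((f \o shift x) (h *: v) - f x)) =
  (fun h : R => h^-1 *: (((fun t : R => f (x + t *: v)) \o shift (0 : R)) (h *: (1 : R))
     - f (x + (0 : R) *: v))).
Proof.
by apply/funext => h /=; rewrite [h *: 1]mulr1 scale0r !addr0 [h *: v + x]addrC.
Qed.

Lemma lineE f x v : derivable f x v = derivable (fun t : R => f (x + t *: v)) 0 1.
Proof. by rewrite /derivable quotientE. Qed.

Lemma line_deriveE f x v : 'D_v f x = 'D_1 (fun t : R => f (x + t *: v)) 0.
Proof. by rewrite /derive quotientE. Qed.

(** Along each coordinate line this is the chain rule in one variable. *)
Lemma grad_comp (F : R -> R) (dF : R) f x : pd f x -> is_derive (f x) (1 : R) F dF ->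
  pd (F \o f) x /\ grad (F \o f) x = dF *: grad f x.
Proof.
move=> px HF.
have H i : is_derive (0 : R) (1 : R) (F \o (fun t : R => f (x + t *: delta_mx 0 i)))
    (dF * 'D_(delta_mx 0 i) f x).
  apply: is_derive1_comp; first by rewrite scale0r addr0.
  by have := px i; rewrite line_deriveE lineE => /derivableP.
split.
  by move=> i; rewrite lineE; have [] := H i.
apply/rowP => i; rewrite !mxE line_deriveE.
by have [_ ->] := H i.
Qed.

Lemma grad_mul f g x : pd f x -> pd g x ->
  pd (f * g) x /\ grad (f * g) x = f x *: grad g x + g x *: grad f x.
Proof.
move=> pf pg; split; first by move=> i; exact: derivableM.
by apply/rowP => i; rewrite !mxE deriveM.
Qed.

Lemma grad_supp f x : ~ supp f x -> grad f x = 0.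
Proof.
move=> nx; apply/rowP => i; rewrite !mxE.
have : \forall y \near x, f y = 0.
  have : open_nbhs x (~` supp f) by split => //; exact/closed_openC/closed_closure.
  move=> /open_nbhs_nbhs; apply: filterS => y ny.
  by apply: contrapT => /eqP fy; apply: ny; exact: subset_closure.
move=> H; have : {near x, (cst 0 : 'rV[R]_n -> R) =1 f} by move: H; apply: filterS => y ->.
by move=> /near_eq_derive <-; rewrite derive_cst.
Qed.

End lip.

(** * The seminorms of the matrix Q *)

Section dotr_theory.
Context {R : realType} {n : nat}.
Implicit Types (x y z : 'rV[R]_n) (S : 'M[R]_n).

Lemma dotrC x y : dotr x y = dotr y x.
Proof. by apply: eq_bigr => i _; rewrite mulrC. Qed.

Lemma dotrDl x y z : dotr (x + y) z = dotr x z + dotr y z.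
Proof. by rewrite /dotr -big_split/=; apply: eq_bigr => i _; rewrite mxE mulrDl. Qed.

Lemma dotrZl (a : R) x z : dotr (a *: x) z = a * dotr x z.
Proof. by rewrite /dotr mulr_sumr; apply: eq_bigr => i _; rewrite mxE mulrA. Qed.

Lemma dotrDr x y z : dotr z (x + y) = dotr z x + dotr z y.
Proof. by rewrite !(dotrC z) dotrDl. Qed.

Lemma dotrZr (a : R) x z : dotr z (a *: x) = a * dotr z x.
Proof. by rewrite !(dotrC z) dotrZl. Qed.

Lemma dotr_ge0 x : 0 <= dotr x x.
Proof. by apply: sumr_ge0 => i _; rewrite -expr2 sqr_ge0. Qed.

Lemma dotr_sym S x y : S^T = S -> dotr x (y *m S) = dotr (x *m S) y.
Proof.
move=> ST; have E (a b : 'rV[R]_n) : dotr a b = (a *m b^T) 0 0.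
  by rewrite /dotr mxE; apply: eq_bigr => i _; rewrite mxE.
by rewrite !E trmx_mul ST mulmxA.
Qed.

Lemma enorm_ge0 x : 0 <= enorm x. Proof. exact: sqrtr_ge0. Qed.

Lemma enorm_sqr x : enorm x ^+ 2 = dotr x x.
Proof. by rewrite sqr_sqrtr// dotr_ge0. Qed.

Lemma cauchy_schwarz x y : `|dotr x y| <= enorm x * enorm y.
Proof.
rewrite -(@ler_pXn2r _ 2)// ?nnegrE ?mulr_ge0 ?enorm_ge0//.
rewrite real_normK ?num_real// exprMn !enorm_sqr.
have [y0|y0] := eqVneq (dotr y y) 0.
  suff -> : dotr x y = 0 by rewrite y0 mulr0 expr2 mulr0.
  apply: big1 => i _; move/eqP: y0; rewrite psumr_eq0 => [/allP/(_ i)|j _]; last first.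
    by rewrite -expr2 sqr_ge0.
  by rewrite mem_index_enum -expr2 sqrf_eq0 => /(_ isT)/eqP ->; rewrite mulr0.
have yp : 0 < dotr y y by rewrite lt_def y0 dotr_ge0.
have := dotr_ge0 (dotr y y *: x + (- dotr x y) *: y).
rewrite !(dotrDl, dotrDr, dotrZl, dotrZr) (dotrC y x) => H.
have : 0 <= dotr y y * (dotr x x * dotr y y - dotr x y ^+ 2).
  by apply: le_trans H _; rewrite le_eqVlt; apply/orP; left; apply/eqP; ring.
by rewrite pmulr_rge0// subr_ge0.
Qed.

Lemma enormD x y : enorm (x + y) <= enorm x + enorm y.
Proof.
rewrite -(@ler_pXn2r _ 2)// ?nnegrE ?addr_ge0 ?enorm_ge0//.
rewrite sqrrD !enorm_sqr !(dotrDl, dotrDr) (dotrC y x).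
have := le_trans (ler_norm _) (cauchy_schwarz x y).
by move: (enorm x * enorm y) => c; lra.
Qed.

Lemma enormZ (a : R) x : enorm (a *: x) = `|a| * enorm x.
Proof. by rewrite /enorm dotrZl dotrZr mulrA -expr2 sqrtrM ?sqr_ge0// sqrtr_sqr. Qed.

End dotr_theory.

(** Polynomials commute with conjugation, so that the identity needs to be checked on the
    eigenvalues only. *)
Lemma horner_mx_fourth_root (F : fieldType) n (S M : 'M[F]_n.+1) (d : 'rV[F]_n.+1) (q : {poly F}) :
  S \in unitmx -> M = invmx S *m diag_mx d *m S -> (forall i, q.[d 0 i] ^+ 4 = d 0 i) ->
  (horner_mx M q *m horner_mx M q) *m (horner_mx M q *m horner_mx M q) = M.
Proof.
move=> SU -> Hq; rewrite horner_mx_uconjC// horner_mx_diag; set D := diag_mx _.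
have e (A B : 'M[F]_n.+1) : (invmx S *m A *m S) *m (invmx S *m B *m S) = invmx S *m (A *m B) *m S.
  by rewrite !mulmxA mulmxK.
rewrite !e; congr (_ *m _ *m _).
rewrite /D !mulmx_diag; congr diag_mx; apply/rowP => i; rewrite !mxE -[RHS]Hq.
by rewrite !exprS expr0 mulr1 !mulrA.
Qed.

(** * Square roots of nonnegative definite matrices *)

Section psd_root.
Import spectral complex.
Local Open Scope complex_scope.
Variable (R : realType).

(** Newton's scheme: a new node is met by adding a multiple of the product over the old ones, which
    vanishes there. The prescribed values come from a function, so repeated nodes cause no
    conflict. *)
Lemma poly_interpolation (s : seq R) (f : R -> R) : exists q : {poly R}, forall x, x \in s -> q.[x] = f x.
Proof.
elim: s => [|x s [q Hq]]; first by exists 0.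
have [xs|xs] := boolP (x \in s).
  by exists q => y; rewrite inE => /predU1P[->|]; exact: Hq.
pose w := \prod_(y <- s) ('X - y%:P).
have wx : w.[x] != 0.
  by rewrite /w horner_prod prodf_seq_neq0; apply/allP => y ys /=;
    rewrite hornerXsubC subr_eq0; apply: contraNneq xs => ->.
have ws y : y \in s -> w.[y] = 0.
  by move=> ys; apply/rootP; rewrite root_prod_XsubC.
exists (q + ((f x - q.[x]) / w.[x])%:P * w) => y.
rewrite !hornerE inE => /predU1P[->|ys]; first by rewrite divfK// addrCA subrr addr0.
by rewrite (ws _ ys) mulr0 addr0 Hq.
Qed.

(* Taking a polynomial in M keeps the root symmetric and real; the square of a symmetric fourth
   root is then a nonnegative definite square root. *)
Lemma psd_fourth_root n (M : 'M[R]_n.+1) : psdmx M ->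
  exists T : 'M[R]_n.+1, T^T = T /\ T *m T *m (T *m T) = M.
Proof.
move=> [MT M0].
pose C : numClosedFieldType := R[i].
pose cR : {rmorphism R -> C} := real_complex R.
pose M' : 'M[C]_n.+1 := map_mx cR M.
have M'sym : M' \is symmetricmx.
  by apply/is_hermitianmxP; rewrite expr0 scale1r [RHS]map_mx_id// /M' map_trmx MT.
have M'real : M' \is a mxOver Num.real.
  by apply/mxOverP => i j; rewrite mxE; apply/complex_realP; exists (M i j).
have M'herm := realsym_hermsym M'sym M'real.
have Mspec := elimT (orthomx_spectralP (C := C)) (hermitian_normalmx M'herm).
have dreal := hermitian_spectral_diag_real M'herm.
set d := spectral_diag M' in Mspec dreal.
set S := spectralmx M' in Mspec.
have SU : S \is unitarymx := spectral_unitarymx M'.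
have Sunit : S \in unitmx := unitarymx_unit SU.
pose l (i : 'I_n.+1) : R := complex.Re (d 0 i).
have dl i : d 0 i = cR (l i).
  by rewrite /l; apply/esym/RRe_real; exact: (mxOverP dreal).
(* An eigenvalue is the value of the quadratic form at a complex unit eigenvector, and for a real
   symmetric matrix this is the sum of its values at the real and the imaginary part of that
   vector. *)
have l0 i : 0 <= l i.
  have : S *m M' *m invmx S = diag_mx d.
    by rewrite Mspec !mulmxA mulmxV// mul1mx mulmxK.
  rewrite invmx_unitary// => /matrixP /(_ i i); rewrite [RHS]mxE eqxx mulr1n.
  pose a : 'rV[R]_n.+1 := \row_j complex.Re (S i j).
  pose b : 'rV[R]_n.+1 := \row_j complex.Im (S i j).
  move=> /(congr1 (@complex.Re R)).
  have -> : complex.Re ((S *m M' *m (S ^t*)%sesqui) i i) = dotr a (a *m M) + dotr b (b *m M).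
    have ReD : {morph (@complex.Re R) : x y / x + y} by move=> [? ?] [? ?].
    rewrite mxE (big_morph (@complex.Re R) ReD (erefl _)).
    rewrite /dotr -big_split/=; under [RHS]eq_bigr do rewrite !mxE !mulr_sumr -big_split/=.
    rewrite exchange_big/=; apply: eq_bigr => k _.
    rewrite !mxE mulr_suml (big_morph (@complex.Re R) ReD (erefl _)); apply: eq_bigr => j _.
    rewrite !mxE; case: (S i j) => a1 b1; case: (S i k) => a2 b2 /=.
    have -> : M k j = M j k by rewrite -{1}MT mxE.
    by ring.
  by rewrite dl /= => <-; rewrite addr_ge0.
have [q Hq] := poly_interpolation [seq l i | i : 'I_n.+1] (fun x => Num.sqrt (Num.sqrt x)).
have {}Hq i : q.[l i] = Num.sqrt (Num.sqrt (l i)) by apply: Hq; apply/mapP; exists i => //; rewrite mem_enum.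
exists (horner_mx M q); split.
  elim/poly_ind: q {Hq} => [|p c IH]; first by rewrite rmorph0 trmx0.
  have hC : horner_mx M p *m M = M *m horner_mx M p.
    rewrite -{2 3}(horner_mx_X M).
    by rewrite -[LHS](rmorphM (horner_mx M)) -[RHS](rmorphM (horner_mx M)) mulrC.
  rewrite rmorphD rmorphM/= horner_mx_X horner_mx_C linearD/= tr_scalar_mx.
  by congr (_ + _); rewrite -[LHS]/((horner_mx M p *m M)^T) trmx_mul IH MT -hC.
apply: (@map_mx_inj _ _ cR); rewrite -/M' !map_mxM !map_horner_mx -/M'.
apply: (horner_mx_fourth_root Sunit Mspec) => i.
rewrite dl horner_map Hq -rmorphXn; congr (cR _).
by rewrite (exprM _ 2 2) !sqr_sqrtr ?sqrtr_ge0.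
Qed.

Lemma psd_root_exists n (M : 'M[R]_n) : psdmx M -> exists S, psdmx S /\ S *m S = M.
Proof.
case: n M => [|n] M.
  by exists M; split => //; apply/matrixP => -[].
move=> /psd_fourth_root[T [TT TM]]; exists (T *m T); split => //.
split; first by rewrite trmx_mul TT.
move=> xi; have -> : dotr xi (xi *m (T *m T)) = dotr (xi *m T) (xi *m T).
  by rewrite mulmxA dotr_sym.
exact: dotr_ge0.
Qed.

End psd_root.

Section qnorm.
Context {R : realType} {n : nat} (Q : 'rV[R]_n -> 'M[R]_n).
Implicit Types (x xi eta : 'rV[R]_n).

Lemma sqrtmx_sym (M : 'M[R]_n) : (@sqrtmx R n M)^T = sqrtmx M.
Proof.
rewrite /sqrtmx; case: xgetP => [S _ [[]]//|_]; exact: trmx0.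
Qed.

Lemma sqrtmx_sqr (M : 'M[R]_n) : psdmx M -> sqrtmx M *m sqrtmx M = M.
Proof.
move=> /psd_root_exists[S HS]; rewrite /sqrtmx; case: xgetP => [S' _ []//|H].
by have := H S HS.
Qed.

Lemma Qnorm_ge0 x xi : 0 <= Qnorm Q x xi. Proof. exact: enorm_ge0. Qed.

Lemma QnormD x xi eta : Qnorm Q x (xi + eta) <= Qnorm Q x xi + Qnorm Q x eta.
Proof. by rewrite /Qnorm mulmxDl enormD. Qed.

Lemma QnormZ x (a : R) xi : Qnorm Q x (a *: xi) = `|a| * Qnorm Q x xi.
Proof. by rewrite /Qnorm -scalemxAl enormZ. Qed.

Lemma Qnorm0 x : Qnorm Q x 0 = 0.
Proof. by rewrite -(scale0r (0 : 'rV[R]_n)) QnormZ normr0 mul0r. Qed.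

Lemma QnormN x xi : Qnorm Q x (- xi) = Qnorm Q x xi.
Proof. by rewrite -scaleN1r QnormZ normrN1 mul1r. Qed.

Lemma dotr_sqrtmx x xi eta :
  `|dotr xi (eta *m sqrtmx (Q x))| <= Qnorm Q x xi * enorm eta.
Proof. by rewrite dotr_sym ?sqrtmx_sym// cauchy_schwarz. Qed.

(** Under the root stands a polynomial in the entries of [Q x]; this gives measurability of [Qnorm]
    without following the choice made in [sqrtmx]. The existence of a square root enters here. *)
Lemma QnormE x xi : psdmx (Q x) ->
  Qnorm Q x xi = Num.sqrt (\sum_i xi 0 i * (\sum_j xi 0 j * Q x j i)).
Proof.
move=> Qx; rewrite /Qnorm /enorm; congr Num.sqrt.
rewrite -dotr_sym ?sqrtmx_sym// -mulmxA sqrtmx_sqr//.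
by apply: eq_bigr => i _; rewrite mxE.
Qed.

Lemma Qnorm_measurable U (g : 'rV[R]_n -> 'rV[R]_n) : measurable U ->
  (forall x, U x -> psdmx (Q x)) ->
  (forall i j, measurable_fun U (fun x => Q x i j)) ->
  (forall i, measurable_fun U (fun x => g x 0 i)) ->
  measurable_fun U (fun x => Qnorm Q x (g x)).
Proof.
move=> mU Qpsd mQ mg.
apply: (@eq_measurable_fun _ _ _ _ U
  (fun x => Num.sqrt (\sum_i g x 0 i * (\sum_j g x 0 j * Q x j i)))).
  by move=> x; rewrite inE => /Qpsd Qx; rewrite QnormE.
apply: measurableT_comp.
  by apply: continuous_measurable_fun; exact: sqrt_continuous.
apply: measurable_sum => i; apply: measurable_funM; first exact: mg.
apply: measurable_sum => j; apply: measurable_funM; [exact: mg|exact: mQ].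
Qed.

End qnorm.

Lemma powR_div (R : realType) (x a s : R) : 0 <= x -> 0 < a -> (x / a) `^ s = x `^ s / a `^ s.
Proof.
move=> x0 a0; have as0 : 0 < a `^ s by exact: powR_gt0.
have xa : 0 <= x / a by apply: divr_ge0 => //; exact: ltW.
have := powRM s xa (ltW a0); rewrite divfK ?gt_eqF// => ->.
by rewrite mulfK// gt_eqF.
Qed.

(** * Integrals of nonnegative functions *)

Section integral_bounds.
Context {d : measure_display} {T : measurableType d} {R : realType}.
Variable mu : {measure set T -> \bar R}.
Implicit Types (D : set T) (f g : T -> R).

Definition nnm D f := measurable_fun D f /\ forall x, D x -> 0 <= f x.

Definition Int D f : \bar R := (\int[mu]_(x in D) (f x)%:E)%E.

Arguments Int D%_classical_set_scope f%_ring_scope.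

Lemma Int_ge0 D f : nnm D f -> (0 <= Int D f)%E.
Proof. by move=> [_ f0]; apply: integral_ge0 => x Dx; rewrite lee_fin f0. Qed.

Lemma Int_le D f g : measurable D -> nnm D f -> nnm D g ->
  {ae mu, forall x, D x -> f x <= g x} -> (Int D f <= Int D g)%E.
Proof.
move=> mD [mf f0] [mg g0] fg; apply: ae_ge0_le_integral => //.
- exact/measurable_EFinP.
- exact/measurable_EFinP.
Qed.

Lemma IntD D f g : measurable D -> nnm D f -> nnm D g ->
  Int D (fun x => f x + g x) = (Int D f + Int D g)%E.
Proof.
move=> mD [mf f0] [mg g0]; rewrite /Int -ge0_integralD//.
- exact/measurable_EFinP.
- exact/measurable_EFinP.
Qed.

Lemma IntZ D f (k : R) : measurable D -> nnm D f -> 0 <= k ->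
  Int D (fun x => k * f x) = (k%:E * Int D f)%E.
Proof.
move=> mD [mf f0] k0; rewrite /Int -ge0_integralZl_EFin//.
exact/measurable_EFinP.
Qed.

Lemma Int_cst D (k : R) : measurable D -> 0 <= k -> Int D (fun=> k) = (k%:E * mu D)%E.
Proof. by move=> mD k0; rewrite /Int integral_cst. Qed.

Lemma Int_sub D E f : measurable D -> measurable E -> nnm D f -> E `<=` D ->
  (Int E f <= Int D f)%E.
Proof.
move=> mD mE [mf f0] ED; apply: ge0_subset_integral => //.
exact/measurable_EFinP.
Qed.

Lemma nnm_sub D E f : measurable D -> E `<=` D -> nnm D f -> nnm E f.
Proof.
move=> mD ED [mf f0]; split; first exact: measurable_funS mf.
by move=> x /ED; exact: f0.
Qed.

Lemma nnmD D f g : nnm D f -> nnm D g -> nnm D (fun x => f x + g x).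
Proof.
move=> [mf f0] [mg g0]; split; first exact: measurable_funD.
by move=> x Dx; rewrite addr_ge0 ?f0 ?g0.
Qed.

Lemma nnmM D f g : nnm D f -> nnm D g -> nnm D (fun x => f x * g x).
Proof.
move=> [mf f0] [mg g0]; split; first exact: measurable_funM.
by move=> x Dx; rewrite mulr_ge0 ?f0 ?g0.
Qed.

Lemma nnm_cst D (k : R) : 0 <= k -> nnm D (fun=> k).
Proof. by move=> k0; split => //; exact: measurable_cst. Qed.

Lemma measurable_pow D f (a : R) : measurable_fun D f -> measurable_fun D (fun x => f x `^ a).
Proof. by move=> mf; exact: (measurableT_comp (measurable_powR a)). Qed.

Lemma measurable_abs D f : measurable_fun D f -> measurable_fun D (fun x => `|f x|).
Proof. by move=> mf; exact: (measurableT_comp (@normr_measurable R setT)). Qed.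

Lemma nnm_pow D f (a : R) : measurable_fun D f -> nnm D (fun x => f x `^ a).
Proof. by move=> mf; split => [|x _]; [exact: measurable_pow|exact: powR_ge0]. Qed.

Lemma nnm_abs D f : measurable_fun D f -> nnm D (fun x => `|f x|).
Proof. by move=> mf; split => [|x _]; [exact: measurable_abs|exact: normr_ge0]. Qed.

Lemma Int_integrable D f : nnm D f -> (Int D f < +oo)%E -> mu.-integrable D (EFin \o f).
Proof.
move=> [mf f0] fi; apply/integrableP; split; first exact/measurable_EFinP.
rewrite (_ : \int[mu]_(x in D) _ = Int D f)%E//; apply: eq_integral => x; rewrite inE => Dx.
by rewrite /= ger0_norm ?f0.
Qed.

(** Along a subsequence with integrals at most [2^-(k+1)] the sum of the series is integrable, hence
    finite almost everywhere. It bounds every term, and the terms of a convergent series tend to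
    0. *)
Lemma fast_subsequence D (a : nat -> T -> R) : measurable D ->
  (forall k, nnm D (a k)) -> Int D (a k) @[k --> \oo] --> 0%E ->
  exists (phi : nat -> nat) (S : T -> R), [/\ nnm D S, (Int D S < +oo)%E &
    {ae mu, forall x, D x -> (forall k, a (phi k) x <= S x) /\ (a (phi k) x @[k --> \oo] --> 0)}].
Proof.
move=> mD na a0.
have H k : exists m, (Int D (a m) <= (1 / (2 ^ k.+1)%:R : R)%:E)%E.
  have e0 : 0 < 1 / (2 ^ k.+1)%:R :> R by rewrite divr_gt0// ltr0n expn_gt0.
  have /fine_cvgP[/= [N1 _ h1] /cvgrPdist_lt /(_ _ e0)[N2 _ h2]] := a0.
  exists (maxn N1 N2); rewrite -(fineK (h1 _ (leq_maxl N1 N2))) lee_fin.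
  by have := h2 _ (leq_maxr N1 N2); rewrite /= sub0r normrN => /ltW; apply: le_trans; exact: ler_norm.
have [phi Hphi] := choice H.
pose eS x : \bar R := (\sum_(k <oo) (a (phi k) x)%:E)%E.
have a_ge0 x k : D x -> (0 <= (a (phi k) x)%:E)%E.
  by move=> Dx; rewrite lee_fin; apply: (na _).2.
have mE k : measurable_fun D (fun x => (a (phi k) x)%:E).
  by apply/measurable_EFinP; exact: (na _).1.
have meS : measurable_fun D eS by apply: ge0_emeasurable_sum => // k x Dx _; exact: a_ge0.
have IS : (\int[mu]_(x in D) eS x <= 1)%E.
  rewrite /eS integral_nneseries//; last by move=> k x Dx; exact: a_ge0.
  apply: (@le_trans _ _ (\sum_(k <oo) (0 + (1 / (2 ^ k.+1)%:R : R)%:E))%E).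
    apply: lee_nneseries; first by move=> *; exact: Int_ge0 (na _).
    by move=> k _; rewrite add0e; exact: Hphi.
  apply: (le_trans (epsilon_trick xpredT (fun=> lexx 0%E) ler01)).
  by rewrite eseries0 ?add0e.
have eS0 x : D x -> (0 <= eS x)%E by move=> Dx; apply: nneseries_ge0 => *; exact: a_ge0.
have iS : mu.-integrable D eS.
  apply/integrableP; split => //; apply: (@le_lt_trans _ _ 1%E); last by rewrite ltry.
  by apply: le_trans IS; apply: ge0_le_integral => //; [exact: measurableT_comp|move=> x Dx; rewrite gee0_abs ?eS0].
exists phi, (fine \o eS); split.
- split; first exact: measurableT_comp.
  by move=> x Dx /=; rewrite fine_ge0 ?eS0.
- apply: (@le_lt_trans _ _ 1%E); last by rewrite ltry.
  apply: le_trans IS; apply: ge0_le_integral => //.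
  + by move=> x Dx; rewrite lee_fin /= fine_ge0 ?eS0.
  + by apply/measurable_EFinP; exact: measurableT_comp.
  + move=> x Dx /=; have := eS0 x Dx; case: (eS x) => //= r _; exact: leey.
have := integrable_ae mD iS; apply: filterS => x fS Dx; have {}fS := fS Dx.
have part n : \sum_(0 <= k < n) a (phi k) x <= fine (eS x).
  rewrite -lee_fin fineK// -sumEFin; apply: nneseries_lim_ge => k _ _; exact: a_ge0.
split.
  move=> k /=; apply: le_trans (part k.+1); rewrite big_nat_recr//= lerDr.
  by apply: sumr_ge0 => i _; have := a_ge0 x i Dx; rewrite lee_fin.
apply: cvg_series_cvg_0; apply: nondecreasing_is_cvgn.
  apply/nondecreasing_seqP => n; rewrite /series/= big_nat_recr//= lerDl.
  by have := a_ge0 x n Dx; rewrite lee_fin.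
by exists (fine (eS x)) => _ [n _ <-]; exact: part.
Qed.

(** With a real number as bound, estimates combine by real arithmetic and contain the finiteness of
    the integral. *)
Definition Ile D f (c : R) : Prop := (Int D f <= c%:E)%E.

Lemma Ile_le D f g (c e : R) : measurable D -> nnm D f -> nnm D g ->
  {ae mu, forall x, D x -> f x <= g x} -> c <= e -> Ile D g c -> Ile D f e.
Proof.
move=> mD nf ng fg ce gc; apply: le_trans (Int_le mD nf ng fg) _.
by apply: le_trans gc _; rewrite lee_fin.
Qed.

Lemma IleD D f g (c e : R) : measurable D -> nnm D f -> nnm D g ->
  Ile D f c -> Ile D g e -> Ile D (fun x => f x + g x) (c + e).
Proof. by move=> mD nf ng fc ge; rewrite /Ile IntD// EFinD leeD. Qed.

Lemma IleZ D f (k c : R) : measurable D -> nnm D f -> 0 <= k -> Ile D f c ->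
  Ile D (fun x => k * f x) (k * c).
Proof. by move=> mD nf k0 fc; rewrite /Ile IntZ// EFinM lee_wpmul2l ?lee_fin. Qed.

Lemma Ile_fin D f : nnm D f -> (Int D f < +oo)%E <-> exists c, Ile D f c.
Proof.
move=> nf; split=> [fi|[c fc]]; last by apply: le_lt_trans fc _; rewrite ltry.
exists (fine (Int D f)); rewrite /Ile fineK// ge0_fin_numE//; exact: Int_ge0.
Qed.

(** Young's inequality for [f / a] and [g / b], integrated. [A] and [B] are arbitrary positive
    bounds instead of the integrals themselves, so that the normalization never divides by 0. *)
Lemma Int_hoelder D f g (s t A B : R) : measurable D -> nnm D f -> nnm D g ->
  0 < s -> 0 < t -> s^-1 + t^-1 = 1 -> 0 < A -> 0 < B ->
  Ile D (fun x => f x `^ s) A -> Ile D (fun x => g x `^ t) B ->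
  Ile D (fun x => f x * g x) (A `^ s^-1 * B `^ t^-1).
Proof.
move=> mD nf ng s0 t0 st A0 B0 fA gB.
pose a := A `^ s^-1; pose b := B `^ t^-1.
have a0 : 0 < a by exact: powR_gt0.
have b0 : 0 < b by exact: powR_gt0.
have as_ : a `^ s = A by rewrite /a -powRrM mulVf ?gt_eqF// powRr1// ltW.
have bt_ : b `^ t = B by rewrite /b -powRrM mulVf ?gt_eqF// powRr1// ltW.
have nfs := nnm_pow s nf.1; have ngt := nnm_pow t ng.1.
have c1 : 0 <= a * b / (A * s) by rewrite !(mulr_ge0, invr_ge0) ?ltW.
have c2 : 0 <= a * b / (B * t) by rewrite !(mulr_ge0, invr_ge0) ?ltW.
have nM k h : 0 <= k -> nnm D h -> nnm D (fun x => k * h x).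
  by move=> k0 nh; apply: nnmM => //; exact: nnm_cst.
apply: (@le_trans _ _ (Int D (fun x => a * b / (A * s) * f x `^ s + a * b / (B * t) * g x `^ t))).
  apply: Int_le => //; [exact: nnmM|by apply: nnmD; exact: nM|].
  apply: aeW => x Dx; have f0 := nf.2 x Dx; have g0 := ng.2 x Dx.
  have fa0 : 0 <= f x / a by rewrite divr_ge0// ltW.
  have gb0 : 0 <= g x / b by rewrite divr_ge0// ltW.
  have := conjugate_powR fa0 gb0 s0 t0 st.
  rewrite !powR_div// as_ bt_ => H.
  have -> : f x * g x = a * b * (f x / a * (g x / b)) by field; rewrite !gt_eqF.
  apply: le_trans (ler_wpM2l (ltW (mulr_gt0 a0 b0)) H) _.
  by rewrite le_eqVlt; apply/orP; left; apply/eqP; field; rewrite !gt_eqF.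
rewrite IntD//; [|exact: nM|exact: nM].
rewrite !IntZ//.
have -> : (a * b)%:E = ((a * b / (A * s))%:E * A%:E + (a * b / (B * t))%:E * B%:E)%E.
  rewrite -!EFinM -EFinD; congr EFin; rewrite -[LHS]mulr1 -st; field.
  by rewrite !gt_eqF.
by apply: leeD; apply: lee_pmul => //; rewrite ?lee_fin//; exact: Int_ge0.
Qed.

End integral_bounds.

(** * Automation for signs, measurability and finiteness of integrals *)

Lemma invr_ge0W (R : numFieldType) (x : R) : 0 <= x -> 0 <= x^-1. Proof. by rewrite invr_ge0. Qed.

Lemma pow_le (R : realType) (a x y : R) : 0 <= a -> 0 <= x -> x <= y -> x `^ a <= y `^ a.
Proof. by move=> a0 x0 xy; apply: ge0_ler_powR => //; rewrite nnegrE//; exact: le_trans xy. Qed.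

Lemma invr_gt0W (R : numFieldType) (x : R) : 0 < x -> 0 < x^-1. Proof. by rewrite invr_gt0. Qed.

Create HintDb opq discriminated.
#[global] Hint Constants Transparent : opq.
#[global] Hint Variables Transparent : opq.
#[global] Hint Opaque Int integral powR Qnorm enorm sqrtmx expR ln leb lebesgue_outer
  grad derive fine dotr poweR avg fint avg_norm Wnorm bigop lim measurable_fun nnm
  Lip_loc Lip_0 W1pQ W1pQ_0 opnorm Ile scalemx addmx oppmx mulmx map_mx map2_mx const_mx
  matrix_of_fun fun_of_matrix supp closure : opq.
#[global] Hint Resolve lexx ler01 ltr01 normr_ge0 ler0n ltr0Sn ltW addr_ge0 mulr_ge0
  powR_ge0 Qnorm_ge0 enorm_ge0 subset_refl
  invr_ge0W invr_gt0W mulr_gt0 powR_gt0 exprn_ge0 exprn_gt0 : opq.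

Ltac ssrdone0 :=
  trivial; hnf; intros; solve
   [ do ![solve [trivial | simple refine (@sym_equal _ _ _ _); trivial]
         | discriminate | contradiction | split]
   | match goal with H : ~ _ |- _ => solve [case H; trivial] end ].

Ltac nnt := first
  [ match goal with
    | H : is_true (0 <= ?x) |- is_true (0 <= ?y) => constr_eq x y; exact H
    | H : is_true (0 < ?x) |- is_true (0 <= ?y) => constr_eq x y; exact (ltW H)
    | H : is_true (0 < ?x) |- is_true (0 < ?y) => constr_eq x y; exact H
    end
  | lazymatch goal with
    | |- is_true (0 <= Qnorm _ _ _) => simple apply Qnorm_ge0
    | |- is_true (0 <= _ `^ _) => simple apply powR_ge0
    | |- is_true (0 <= `|_|) => simple apply normr_ge0
    | |- is_true (0 <= _ + _) => simple apply addr_ge0; nnt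
    | |- is_true (0 <= _ * _) => simple apply mulr_ge0; nnt
    | |- is_true (0 <= _^-1) => simple apply invr_ge0W; nnt
    | |- is_true (0 <= _ ^+ _) => simple apply exprn_ge0; nnt
    | |- is_true (0 <= _%:R) => simple apply ler0n
    | |- is_true (0 <= 1) => simple apply ler01
    | |- is_true (0 < _ `^ _) => simple apply powR_gt0; nnt
    | |- is_true (0 < _ * _) => simple apply mulr_gt0; nnt
    | |- is_true (0 < _^-1) => simple apply invr_gt0W; nnt
    | |- is_true (0 < _ ^+ _) => simple apply exprn_gt0; nnt
    | |- is_true (0 < 1) => simple apply ltr01
    | |- is_true (0 < _.+1%:R) => simple apply ltr0Sn
    end ].

Ltac opqdone := solve [ nnt
    | typeclasses eauto 7 with opq |
      match goal with H : is_true false |- _ => discriminate H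
      | H : false = true |- _ => discriminate H
      | H : False |- _ => case H end].

(* The default [done] unifies up to unfolding of integrals and powers, which
   makes its failures very slow here. *)
Ltac done := lazymatch goal with
  | |- forall _, _ => first [opqdone | intro; done]
  | |- _ /\ _ => split; done
  | |- measurable _ => opqdone
  | |- measurable_fun _ _ => opqdone
  | |- nnm _ _ => opqdone
  | |- Ile _ _ _ _ => opqdone
  | |- is_true (Order.le _ _) => opqdone
  | |- is_true (Order.lt _ _) => opqdone
  | |- is_true _ => solve [trivial | reflexivity |
      match goal with H : is_true false |- _ => discriminate H
      | H : false = true |- _ => discriminate H
      | H : False |- _ => case H end]
  | |- prop_near1 _ _ => opqdone
  | |- W1pQ _ _ _ _ _ => opqdone
  | |- W1pQ_0 _ _ _ _ _ => opqdone
  | |- Lip_loc _ _ => opqdone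
  | |- Lip_0 _ _ => opqdone
  | _ => ssrdone0
  end.

Lemma IntE d (T : measurableType d) (R : realType) (mu : {measure set T -> \bar R}) (D : set T) (f : T -> R) :
  Int mu D f = (\int[mu]_(x in D) (f x)%:E)%E.
Proof. by []. Qed.

Ltac subside := first [opqdone | move=> ? ?; opqdone].

Ltac mst := first [opqdone | lazymatch goal with
  | |- measurable_fun _ (fun x => @?f x - @?g x) => apply: (measurable_funB (f := f) (g := g)); mst
  | |- measurable_fun _ (fun x => @?f x + @?g x) => apply: (measurable_funD (f := f) (g := g)); mst
  | |- measurable_fun _ (fun x => @?f x * @?g x) => apply: (measurable_funM (f := f) (g := g)); mst
  | |- measurable_fun _ (fun x => `|@?f x|) => apply: (measurable_abs (f := f)); mst
  | |- measurable_fun _ (fun x => @?f x `^ ?a) => apply: (measurable_pow (f := f)); mst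
  | |- measurable_fun _ (fun=> ?a) => exact: measurable_cst
  | _ => match goal with
    | H : measurable_fun ?E ?f |- measurable_fun _ ?f => apply: (measurable_funS _ _ H); subside
    | H : nnm ?E ?f |- measurable_fun ?E ?f => exact H.1
    | H : nnm ?E ?f |- measurable_fun _ ?f => apply: (measurable_funS _ _ H.1); subside
    end
  end].

Ltac nnmt := first [opqdone | lazymatch goal with
  | |- nnm _ (fun x => @?f x + @?g x) => apply: (nnmD (f := f) (g := g)); nnmt
  | |- nnm _ (fun x => @?f x * @?g x) => apply: (nnmM (f := f) (g := g)); nnmt
  | |- nnm _ (fun x => `|@?f x|) => apply: (nnm_abs (f := f)); mst
  | |- nnm _ (fun x => @?f x `^ ?a) => apply: (nnm_pow (f := f)); mst
  | |- nnm _ (fun=> ?a) => apply: nnm_cst; opqdone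
  | _ => match goal with
    | H : nnm ?E ?f |- nnm _ ?f => apply: (nnm_sub _ _ H); subside
    end
  end].

Section finite_integrals.
Context {d : measure_display} {T : measurableType d} {R : realType}.
Variable mu : {measure set T -> \bar R}.
Implicit Types (U : set T) (f h : T -> R).
Local Notation IntFin U f := (Int mu U f%R < +oo)%E.

Lemma Int_dom_fin U f h : measurable U -> nnm U f -> nnm U h -> IntFin U h ->
  (\forall x \ae mu, U x -> f x <= h x) -> IntFin U f.
Proof. by move=> mU nf nh hi fh; apply: le_lt_trans (Int_le mU nf nh fh) hi. Qed.

Lemma IntFinD U f h : measurable U -> nnm U f -> nnm U h -> IntFin U f -> IntFin U h ->
  IntFin U (fun x => f x + h x).
Proof. by move=> mU nf nh fi hi; rewrite IntD// lte_add_pinfty. Qed.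

Lemma IntFinZ U f k : measurable U -> nnm U f -> 0 <= k -> IntFin U f ->
  IntFin U (fun x => k * f x).
Proof. by move=> mU nf k0 fi; rewrite IntZ// lte_mul_pinfty// lee_fin. Qed.

Lemma IntFin_sub U V f : measurable U -> measurable V -> nnm V f -> U `<=` V -> IntFin V f ->
  IntFin U f.
Proof. by move=> mU mV nf UV fi; apply: le_lt_trans fi; exact: Int_sub. Qed.

End finite_integrals.

Ltac ift := first [opqdone | lazymatch goal with
  | |- is_true (Int _ _ (fun x => @?f x + @?g x)%R < +oo)%E => apply: (IntFinD (f := f) (h := g)); [opqdone|nnmt|nnmt|ift|ift]
  | |- is_true (Int _ _ (fun x => ?k * @?f x)%R < +oo)%E => apply: (IntFinZ (f := f)); [opqdone|nnmt|opqdone|ift]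
  | |- is_true (Int _ _ ?f < +oo)%E => match goal with
    | H : is_true (Int _ _ f < +oo)%E |- _ => apply: (IntFin_sub _ _ _ _ H); first [subside|nnmt]
    end
  end].

(** * Functions of class C1 and inequalities for powers *)

Section c1.
Context {R : realType}.
Implicit Types (F dF : R -> R).

Definition C1fun F dF := (forall t : R, is_derive t (1 : R) F (dF t)) /\ continuous dF.

Lemma C1_continuous F dF : C1fun F dF -> continuous F.
Proof.
by move=> [HF _] t; apply: differentiable_continuous; apply/derivable1_diffP; have [] := HF t.
Qed.

Lemma C1_lip F dF L : C1fun F dF -> (forall t, `|dF t| <= L) ->
  forall a b, `|F a - F b| <= L * `|a - b|.
Proof.
move=> HF HL a b.
wlog ab : a b / a <= b => [W|].
  by have [/W//|/ltW/W] := leP a b; rewrite (distrC (F a)) (distrC a).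
have [||c _ E] := MVT_segment (f := F) (df := dF) ab.
- by move=> x _; exact: HF.1.
- by apply: continuous_subspaceT => x; exact: (C1_continuous HF).
by rewrite distrC E normrM (distrC a) ler_wpM2r.
Qed.

Lemma pow_add (p x y : R) : 0 <= p -> 0 <= x -> 0 <= y ->
  (x + y) `^ p <= 2 `^ p * (x `^ p + y `^ p).
Proof.
move=> p0 x0 y0; wlog xy : x y x0 y0 / x <= y => [W|].
  have [/W|/ltW/W] := leP x y; first exact.
  by rewrite (addrC y) (addrC (y `^ p)); apply.
apply: (@le_trans _ _ ((2 * y) `^ p)).
  by apply: ge0_ler_powR; rewrite ?nnegrE ?addr_ge0 ?mulr_ge0//; lra.
by rewrite powRM// ler_wpM2l ?powR_ge0// lerDr powR_ge0.
Qed.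

Lemma pow_cvg0 (y : nat -> R) (p : R) : 0 < p -> (forall k, 0 <= y k) ->
  y k `^ p @[k --> \oo] --> 0 -> y k @[k --> \oo] --> 0.
Proof.
move=> p0 y0 H; apply/cvgrPdist_lt => e e0.
have ep : 0 < e `^ p by exact: powR_gt0.
have [N _ HN] := (cvgrPdist_lt _ _).1 H _ ep.
exists N => // k Nk; have := HN k Nk; rewrite !sub0r !normrN.
rewrite (ger0_norm (y0 k)) ger0_norm ?powR_ge0// => h.
rewrite ltNge; apply/negP => ey; move: h; rewrite ltNge => /negP; apply.
by apply: ge0_ler_powR => //; rewrite ?nnegrE//; exact: ltW.
Qed.

Lemma cvg0_pow (y : nat -> R) (p : R) : 0 < p -> (forall k, 0 <= y k) -> y k @[k --> \oo] --> 0 ->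
  y k `^ p @[k --> \oo] --> 0.
Proof.
move=> p0 y0 H; apply/cvgrPdist_lt => e e0.
have ep : 0 < e `^ p^-1 by exact: powR_gt0.
have [N _ HN] := (cvgrPdist_lt _ _).1 H _ ep.
exists N => // k Nk; have := HN k Nk; rewrite !sub0r !normrN.
rewrite (ger0_norm (y0 k)) ger0_norm ?powR_ge0// => h.
have := gt0_ltr_powR p0 _ _ h; rewrite -powRrM mulVf ?gt_eqF// powRr1 ?(ltW e0)//; apply; rewrite nnegrE //.
Qed.

End c1.

(** * The degenerate Sobolev space *)

Section sobolev_space.
Context {R : realType} {n : nat}.
Variables (Om : set 'rV[R]_n) (p : R) (Q : 'rV[R]_n -> 'M[R]_n).
Hypothesis Om_open : open Om.
Hypothesis Om_bounded : bounded_set Om.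
Hypothesis p_gt1 : 1 < p.
Hypothesis Q_measurable : forall i j, measurable_fun Om (fun x => Q x i j).
Hypothesis Q_psd : forall x, Om x -> psdmx (Q x).
Implicit Types (u v : 'rV[R]_n -> R) (g du : 'rV[R]_n -> 'rV[R]_n) (U B : set 'rV[R]_n).
Local Notation Qn := (Qnorm Q).
Local Notation IntL U f := (Int leb U f%R).
Local Notation IntFin U f := (Int leb U f%R < +oo)%E.

Let p0 : 0 < p. Proof. exact: lt_trans p_gt1. Qed.
Let p0' : 0 <= p. Proof. exact: ltW. Qed.

Lemma Om_measurable : measurable Om. Proof. exact: open_rV_measurable. Qed.

Lemma leb_Om : (leb Om < +oo)%E. Proof. exact: leb_bounded. Qed.

Lemma Qn_measurable U g : measurable U -> U `<=` Om ->
  (forall i, measurable_fun U (fun x => g x 0 i)) -> measurable_fun U (fun x => Qn x (g x)).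
Proof.
move=> mU UO mg; apply: Qnorm_measurable => // [x /UO|i j]; first exact: Q_psd.
by apply: measurable_funS (Q_measurable i j) => //; exact: Om_measurable.
Qed.

Lemma Wnorm_fin U u g : measurable_fun U u -> measurable_fun U (fun x => Qn x (g x)) ->
  (Wnorm p Q U u g < +oo)%E <->
  IntFin U (fun x => `|u x| `^ p) /\ IntFin U (fun x => Qn x (g x) `^ p).
Proof.
move=> mu mg.
have i1 : (0 <= IntL U (fun x => `|u x| `^ p))%E.
  by apply: Int_ge0; apply: nnm_pow; exact: measurable_abs.
have i2 : (0 <= IntL U (fun x => Qn x (g x) `^ p))%E by apply: Int_ge0; exact: nnm_pow.
have -> : Wnorm p Q U u g =
  ((IntL U (fun x => `|u x| `^ p) + IntL U (fun x => Qn x (g x) `^ p)) `^ p^-1)%E by rewrite /Wnorm !IntE.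
split=> [|[h1 h2]].
  move=> H; have : (IntL U (fun x => `|u x| `^ p) + IntL U (fun x => Qn x (g x) `^ p) < +oo)%E.
    rewrite ltey; apply/eqP => E; move: H; rewrite E poweRyr ?ltxx//.
    by rewrite invr_eq0 gt_eqF.
  move=> H2; split; apply: le_lt_trans H2; [exact: leeDl|exact: leeDr].
by apply: poweR_lty; rewrite lte_add_pinfty.
Qed.

(* A rapidly converging approximating sequence has a single integrable majorant, so that limits
   under nonlinear operations are obtained by dominated convergence. *)
Lemma W1pQ_fast u du : W1pQ p Q Om u du -> exists (v : nat -> 'rV[R]_n -> R) (S : 'rV[R]_n -> R),
  [/\ forall k, Lip_loc Om (v k), forall k, (Wnorm p Q Om (v k) (grad (v k)) < +oo)%E,
      nnm Om S, (IntL Om S < +oo)%E &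
      \forall x \ae leb, Om x -> [/\ forall k, `|v k x - u x| `^ p <= S x,
        forall k, Qn x (grad (v k) x - du x) `^ p <= S x,
        v k x @[k --> \oo] --> u x & Qn x (grad (v k) x - du x) @[k --> \oo] --> 0]].
Proof.
move=> [mu mdu [v [Hv c1 c2]]]; have mO := Om_measurable.
have mv k : measurable_fun Om (v k) by apply: lip_loc_measurable => //; exact: (Hv k).1.
have mgv k i : measurable_fun Om (fun x => grad (v k) x 0 i).
  by apply: grad_measurable => //; exact: (Hv k).1.
pose a1 k x := `|v k x - u x| `^ p; pose a2 k x := Qn x (grad (v k) x - du x) `^ p.
have n1 k : nnm Om (a1 k) by apply: nnm_pow; apply: measurable_abs; exact: measurable_funB.
have n2 k : nnm Om (a2 k).
  apply: nnm_pow; apply: Qn_measurable => // i.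
  by apply: (@eq_measurable_fun _ _ _ _ Om (fun x => grad (v k) x 0 i - du x 0 i));
    [move=> x _; rewrite !mxE|exact: measurable_funB].
have [||phi [S [nS iS HS]]] := @fast_subsequence _ _ _ leb Om (fun k x => a1 k x + a2 k x) mO.
- by move=> k; exact: nnmD.
- rewrite (_ : (fun k => _) = (fun k => IntL Om (a1 k) + IntL Om (a2 k))%E); last first.
    by apply/funext => k; rewrite IntD.
  suff : (IntL Om (a1 k) + IntL Om (a2 k))%E @[k --> \oo] --> (0 + 0)%E by rewrite adde0.
  by apply: cvgeD c1 c2; rewrite fin_num_adde_defr.
exists (v \o phi), S; split => // [k|k|]; [exact: (Hv _).1|exact: (Hv _).2|].
move: HS; apply: filterS => x H Ox; have [H1 H2] := H Ox.
have a1x k : 0 <= a1 k x by exact: powR_ge0.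
have a2x k : 0 <= a2 k x by exact: powR_ge0.
have sq (a : nat -> R) : (forall k, 0 <= a k <= a1 (phi k) x + a2 (phi k) x) -> a k @[k --> \oo] --> 0.
  by move=> Ha; apply: (squeeze_cvgr _ (cvg_cst 0) H2); apply: nearW => k; exact: Ha.
split.
- by move=> k; apply: le_trans (H1 k); rewrite lerDl.
- by move=> k; apply: le_trans (H1 k); rewrite lerDr.
- apply/subr_cvg0; apply/norm_cvg0P; apply: (@pow_cvg0 _ _ p) => //.
  by apply: sq => k; rewrite a1x lerDl a2x.
- apply: (@pow_cvg0 _ _ p) => //.
  by apply: sq => k; rewrite a2x lerDr a1x.
Qed.

(** The triangle inequality against the single approximant [v 0], whose norm is finite. *)
Lemma W1pQ_fin u du : W1pQ p Q Om u du ->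
  IntFin Om (fun x => `|u x| `^ p) /\ IntFin Om (fun x => Qn x (du x) `^ p).
Proof.
move=> W; have [mu mdu _] := W; have [v [S [Lv Wv nS iS HS]]] := W1pQ_fast W.
have mO := Om_measurable.
have mv : measurable_fun Om (v 0%N) by exact: lip_loc_measurable.
have mgv : measurable_fun Om (fun x => Qn x (grad (v 0%N) x)).
  by apply: Qn_measurable => // i; exact: grad_measurable.
have mg : measurable_fun Om (fun x => Qn x (du x)) by exact: Qn_measurable.
have [h1 h2] := (Wnorm_fin mv mgv).1 (Wv 0%N).
have n1 := nnm_pow p (measurable_abs mv); have n2 := nnm_pow p mgv.
have main (w : 'rV[R]_n -> R) (f : 'rV[R]_n -> R) : measurable_fun Om w -> nnm Om f ->
    (IntL Om f < +oo)%E -> (\forall x \ae leb, Om x -> `|w x| `^ p <= 2 `^ p * (f x + S x)) ->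
    IntFin Om (fun x => `|w x| `^ p).
  move=> mw nf fi H.
  have nfS : nnm Om (fun x => f x + S x) by exact: nnmD.
  apply: (@le_lt_trans _ _ (IntL Om (fun x => 2 `^ p * (f x + S x)))).
    apply: Int_le => //; first by apply: nnm_pow; exact: measurable_abs.
    by apply: nnmM => //; apply: nnm_cst; exact: powR_ge0.
  by rewrite IntZ ?powR_ge0// IntD// lte_mul_pinfty ?lee_fin ?powR_ge0// lte_add_pinfty.
split.
  apply: (main u _ mu n1 h1); move: HS; apply: filterS => x H Ox; have [H1 _ _ _] := H Ox.
  apply: (@le_trans _ _ ((`|v 0%N x| + `|v 0%N x - u x|) `^ p)).
    apply: ge0_ler_powR; rewrite ?nnegrE ?addr_ge0//.
    by rewrite -lerBlDl distrC; apply: le_trans (lerB_dist _ _) _; rewrite distrC.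
  by apply: le_trans (pow_add _ _ _) _ => //; rewrite ler_wpM2l ?powR_ge0// lerD2l.
have := main _ _ mg n2 h2.
rewrite (_ : (fun x => `|Qn x (du x)| `^ p) = (fun x => Qn x (du x) `^ p)); last first.
  by apply/funext => x; rewrite ger0_norm// Qnorm_ge0.
apply; move: HS; apply: filterS => x H Ox; have [_ H2 _ _] := H Ox.
rewrite ger0_norm ?Qnorm_ge0//.
apply: (@le_trans _ _ ((Qn x (grad (v 0%N) x) + Qn x (grad (v 0%N) x - du x)) `^ p)).
  apply: ge0_ler_powR; rewrite ?nnegrE ?addr_ge0 ?Qnorm_ge0//.
  rewrite -(QnormN _ _ (_ - _)); apply: le_trans (QnormD _ _ _ _).
  by rewrite opprB addrCA subrr addr0.
apply: le_trans (pow_add _ _ _) _; rewrite ?Qnorm_ge0//.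
by rewrite ler_wpM2l ?powR_ge0// lerD2l.
Qed.

Lemma Lip_loc_comp U f F dF L : open U -> Lip_loc U f -> C1fun F dF -> 0 <= L ->
  (forall t, `|dF t| <= L) -> Lip_loc U (F \o f).
Proof.
move=> oU Lf HF L0 dFL x Ux; have [e [M [e0 M0 eU fM]]] := lip_loc_ball oU Lf Ux.
exists (ball x e); first exact: nbhsx_ballx.
apply/lipschitz_inP; exists (L * M); first exact: mulr_ge0.
move=> y z [ye _] [ze _] /=; apply: le_trans (C1_lip HF dFL _ _) _.
by rewrite -mulrA ler_wpM2l// fM.
Qed.

Lemma IntFin_cst U k : measurable U -> U `<=` Om -> 0 <= k -> IntFin U (fun=> k).
Proof.
move=> mU UO k0; rewrite Int_cst// lte_mul_pinfty ?lee_fin//.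
by apply: le_lt_trans leb_Om; apply: le_lebesgue_outer.
Qed.

Lemma dominated_to_zero U (f : nat -> 'rV[R]_n -> R) (h : 'rV[R]_n -> R) : measurable U ->
  (forall k, nnm U (f k)) -> nnm U h -> IntFin U h ->
  (\forall x \ae leb, U x -> (forall k, f k x <= h x) /\ f k x @[k --> \oo] --> 0) ->
  IntL U (f k) @[k --> \oo] --> 0%E.
Proof.
move=> mU nf nh hi H.
have [|||||_ _] := @dominated_convergence _ _ _ leb U mU (fun k => EFin \o f k) (cst 0%E) (EFin \o h).
- by move=> k; apply/measurable_EFinP; exact: (nf k).1.
- exact: measurable_cst.
- move: H; apply: filterS => x H Ux; have [_ H2] := H Ux.
  by apply: cvg_EFin => //; exact: nearW.
- exact: Int_integrable.
- move: H; apply: filterS => x H k Ux; have [H1 _] := H Ux.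
  by rewrite /= lee_fin ger0_norm//; apply: (nf k).2.
by rewrite integral0.
Qed.

(** The error is [dF (v k) (grad (v k) - du) + (dF (v k) - dF u) du]. The first part is controlled
    by the convergence of the gradients. The second tends to 0 pointwise, by continuity of [dF], and
    has the majorant [2 L |sqrt(Q) du|]; a derivative with jumps would fail here. *)
Lemma Lip_loc_comp_grad u du F dF L (v : nat -> 'rV[R]_n -> R) (S : 'rV[R]_n -> R) :
  (forall k, Lip_loc Om (v k)) -> C1fun F dF -> (forall t, `|dF t| <= L) ->
  (\forall x \ae leb, Om x -> [/\ forall k, `|v k x - u x| `^ p <= S x,
        forall k, Qn x (grad (v k) x - du x) `^ p <= S x,
        v k x @[k --> \oo] --> u x & Qn x (grad (v k) x - du x) @[k --> \oo] --> 0]) ->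
  \forall x \ae leb, Om x -> [/\ forall k, `|F (v k x) - F (u x)| <= L * `|v k x - u x|,
    forall k, pd (F \o v k) x /\ grad (F \o v k) x = dF (v k x) *: grad (v k) x,
    forall k, Qn x (grad (F \o v k) x - dF (u x) *: du x) `^ p <=
      2 `^ p * L `^ p * S x + 2 `^ p * (2 * L) `^ p * Qn x (du x) `^ p,
    F (v k x) @[k --> \oo] --> F (u x) &
    Qn x (grad (F \o v k) x - dF (u x) *: du x) @[k --> \oo] --> 0].
Proof.
move=> Lv HF HL HS.
have L0 : 0 <= L by apply: le_trans (HL 0).
have chain : \forall x \ae leb, Om x -> forall k, pd (F \o v k) x /\ grad (F \o v k) x = dF (v k x) *: grad (v k) x.
  apply: (@filterS _ _ (ae_filter_ringOfSetsType _) (fun x => forall k, Om x -> pd (v k) x)).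
    by move=> x H Ox k; exact: grad_comp (H k Ox) (HF.1 _).
  apply: ae_foralln => k; apply/aeP; apply: leb_null_sub (lip_loc_pd Om_open (Lv k)) => x /=.
  by move=> /not_implyP[? ?]; split.
move: HS chain; apply: filterS2 => x H Hc Ox; have [_ H2 H3 H4] := H Ox.
set dl := fun k => `|dF (v k x) - dF (u x)|.
set er := fun k => Qn x (grad (v k) x - du x).
have er0 k : 0 <= er k by exact: Qnorm_ge0.
have dl0 k : 0 <= dl k by exact: normr_ge0.
have E k : Qn x (grad (F \o v k) x - dF (u x) *: du x) <= L * er k + dl k * Qn x (du x).
  rewrite (Hc Ox k).2 (_ : _ - _ = dF (v k x) *: (grad (v k) x - du x) + (dF (v k x) - dF (u x)) *: du x).
    by apply: le_trans (QnormD _ _ _ _) _; rewrite !QnormZ lerD2r ler_wpM2r ?Qnorm_ge0 ?HL.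
  by rewrite scalerBr scalerBl addrA subrK.
have L20 : 0 <= 2 * L by rewrite mulr_ge0.
have cvF : F (v k x) @[k --> \oo] --> F (u x).
  by apply: continuous_cvg => //; exact: C1_continuous HF _.
split=> [k|k|k||]; [exact: C1_lip HF HL _ _|exact: (Hc Ox k)| |exact: cvF|].
  apply: (@le_trans _ _ ((L * er k + dl k * Qn x (du x)) `^ p)).
    by apply: ge0_ler_powR; rewrite ?nnegrE ?Qnorm_ge0// addr_ge0 ?mulr_ge0 ?Qnorm_ge0.
  apply: le_trans (pow_add _ _ _) _; rewrite ?mulr_ge0 ?Qnorm_ge0//.
  rewrite mulrDr !powRM ?Qnorm_ge0//; apply: lerD.
    by rewrite -!mulrA 2?ler_wpM2l ?powR_ge0 ?H2.
  rewrite -!mulrA; apply: ler_wpM2l; first exact: powR_ge0.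
  rewrite mulrA -[2 `^ p * L `^ p]powRM//; apply: ler_wpM2r; first exact: powR_ge0.
  apply: ge0_ler_powR; rewrite ?nnegrE//.
  by apply: le_trans (ler_normB _ _) _; rewrite mulr_natl mulr2n lerD.
apply: (squeeze_cvgr (f := fun=> 0) (h := fun k => L * er k + dl k * Qn x (du x))).
- by apply: nearW => k; rewrite Qnorm_ge0 E.
- exact: cvg_cst.
- rewrite (_ : 0 = L * 0 + 0 * Qn x (du x)); last by rewrite mulr0 mul0r addr0.
  apply: cvgD; first exact: cvgMr.
  apply: cvgMl; apply/norm_cvg0P; apply/subr_cvg0.
  by apply: continuous_cvg => //; exact: HF.2.
Qed.

(** The compositions [F \o v k] are admissible since [|F (v k)|] is at most [|F 0| + L |v k|] and
    constants are integrable on the bounded set [Om]. They converge by dominated convergence with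
    the majorants of [Lip_loc_comp_grad]. *)
Lemma W1pQ_comp u du F dF L : W1pQ p Q Om u du -> C1fun F dF -> (forall t, `|dF t| <= L) ->
  W1pQ p Q Om (F \o u) (fun x => dF (u x) *: du x).
Proof.
move=> W HF HL; have [mu mdu _] := W; have mO := Om_measurable.
have [v [S [Lv Wv nS iS HS]]] := W1pQ_fast W.
have L0 : 0 <= L by apply: le_trans (HL 0).
have cF := C1_continuous HF.
have mF : measurable_fun [set: R] F by exact: continuous_measurable_fun.
have mdF : measurable_fun [set: R] dF by apply: continuous_measurable_fun; exact: HF.2.
have Lip k : Lip_loc Om (F \o v k) by exact: Lip_loc_comp HF L0 HL.
have mv k : measurable_fun Om (v k) by exact: lip_loc_measurable.
have mgv k i : measurable_fun Om (fun x => grad (v k) x 0 i) by exact: grad_measurable.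
have mFv k : measurable_fun Om (F \o v k) by exact: (measurableT_comp mF).
have mFu : measurable_fun Om (F \o u) by exact: (measurableT_comp mF).
have mdFu : measurable_fun Om (dF \o u) by exact: (measurableT_comp mdF).
have mgFv k i : measurable_fun Om (fun x => grad (F \o v k) x 0 i) by exact: grad_measurable.
have mdg i : measurable_fun Om (fun x => (dF (u x) *: du x) 0 i).
  by apply: (@eq_measurable_fun _ _ _ _ Om (fun x => dF (u x) * du x 0 i));
    [move=> x _; rewrite !mxE|exact: measurable_funM].
have [ui gi] := W1pQ_fin W.
have mG : measurable_fun Om (fun x => Qn x (du x)) by exact: Qn_measurable.
have nG := nnm_pow p mG.
have HC := Lip_loc_comp_grad Lv HF HL HS.
split => //; exists (fun k => F \o v k); split.
- move=> k; split => //; apply/Wnorm_fin => //; first exact: Qn_measurable.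
  have [vi vgi] := (Wnorm_fin (mv k) (Qn_measurable mO (@subset_refl _ _) (mgv k))).1 (Wv k).
  split.
    have nFv := nnm_pow p (measurable_abs (mFv k)).
    have nv := nnm_pow p (measurable_abs (mv k)).
    pose c1 := 2 `^ p * `|F 0| `^ p; pose c2 := 2 `^ p * L `^ p.
    have c10 : 0 <= c1 by rewrite mulr_ge0 ?powR_ge0.
    have c20 : 0 <= c2 by rewrite mulr_ge0 ?powR_ge0.
    have nc2 : nnm Om (fun x => c2 * `|v k x| `^ p) by apply: nnmM => //; exact: nnm_cst.
    have nc1 : nnm Om (fun=> c1) by exact: nnm_cst.
    apply: (Int_dom_fin mO nFv (nnmD nc1 nc2)).
      by apply: IntFinD => //; [exact: IntFin_cst|exact: IntFinZ].
    apply: aeW => x Ox /=.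
    apply: (@le_trans _ _ ((`|F 0| + L * `|v k x|) `^ p)).
      apply: ge0_ler_powR; rewrite ?nnegrE ?addr_ge0 ?mulr_ge0//.
      rewrite -lerBlDl; apply: le_trans (lerB_dist _ _) _.
      by apply: le_trans (C1_lip HF HL _ _) _; rewrite subr0.
    apply: le_trans (pow_add _ _ _) _ => //.
    by rewrite /c1 /c2 mulrDr powRM// mulrA.
  have nGv := nnm_pow p (Qn_measurable mO (@subset_refl _ _) (mgv k)).
  have LG : IntFin Om (fun x => L `^ p * Qn x (grad (v k) x) `^ p).
    by apply: IntFinZ => //; exact: powR_ge0.
  apply: (Int_dom_fin mO _ _ LG).
  + by apply: nnm_pow; exact: Qn_measurable.
  + by apply: nnmM => //; apply: nnm_cst; exact: powR_ge0.
  move: HC; apply: filterS => x H Ox; have [_ HE _ _ _] := H Ox; rewrite (HE k).2 QnormZ powRM ?Qnorm_ge0//.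
  by rewrite ler_wpM2r ?powR_ge0// ge0_ler_powR ?nnegrE.
- apply: (@dominated_to_zero Om _ (fun x => L `^ p * S x)) => //.
  + by move=> k; apply: nnm_pow; apply: measurable_abs; exact: measurable_funB.
  + by apply: nnmM => //; apply: nnm_cst; exact: powR_ge0.
  + by apply: IntFinZ => //; exact: powR_ge0.
  move: HS HC; apply: filterS2 => x H H' Ox; have [H1 _ H3 _] := H Ox; have [E0 _ _ _ _] := H' Ox.
  have E k : `|(F \o v k) x - (F \o u) x| `^ p <= L `^ p * `|v k x - u x| `^ p.
    by rewrite -powRM// ge0_ler_powR ?nnegrE ?mulr_ge0//; exact: E0.
  split=> [k|]; first by apply: le_trans (E k) _; rewrite ler_wpM2l ?powR_ge0 ?H1.
  apply: (squeeze_cvgr (f := fun=> 0) (h := fun k => L `^ p * `|v k x - u x| `^ p)).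
  + by apply: nearW => k; rewrite powR_ge0 E.
  + exact: cvg_cst.
  + rewrite -[X in _ --> X](mulr0 (L `^ p)); apply: cvgMr; apply: cvg0_pow => //.
    by apply/norm_cvg0P; apply/subr_cvg0.
- pose C1 := 2 `^ p * L `^ p; pose C2 := 2 `^ p * (2 * L) `^ p.
  have C10 : 0 <= C1 by rewrite mulr_ge0 ?powR_ge0.
  have C20 : 0 <= C2 by rewrite mulr_ge0 ?powR_ge0.
  have n1 : nnm Om (fun x => C1 * S x) by apply: nnmM => //; exact: nnm_cst.
  have n2 : nnm Om (fun x => C2 * Qn x (du x) `^ p) by apply: nnmM => //; exact: nnm_cst.
  have mdiff k i : measurable_fun Om (fun x => (grad (F \o v k) x - dF (u x) *: du x) 0 i).
    apply: (@eq_measurable_fun _ _ _ _ Om (fun x => grad (F \o v k) x 0 i - (dF (u x) *: du x) 0 i)).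
      by move=> x _; rewrite !mxE.
    exact: measurable_funB.
  apply: (@dominated_to_zero Om _ (fun x => C1 * S x + C2 * Qn x (du x) `^ p)) => //.
  + by move=> k; apply: nnm_pow; exact: Qn_measurable.
  + exact: nnmD.
  + by apply: IntFinD => //; exact: IntFinZ.
  move: HC; apply: filterS => x H Ox; have [_ _ H1 _ H2] := H Ox.
  split=> [k|]; first exact: H1.
  by apply: cvg0_pow => // k; exact: Qnorm_ge0.
Qed.

End sobolev_space.

(** * Fatou's lemma, uniform Lipschitz bounds, Young's inequality *)

Section fatou_bound.
Context {d : measure_display} {T : measurableType d} {R : realType}.
Variable mu : {measure set T -> \bar R}.
Implicit Types (D : set T) (f g : T -> R).

Lemma Int_fatou D (f : nat -> T -> R) g (c : \bar R) : measurable D ->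
  (forall k, nnm D (f k)) -> nnm D g ->
  (\forall x \ae mu, D x -> f k x @[k --> \oo] --> g x) ->
  (forall k, (Int mu D (f k) <= c)%E) -> (Int mu D g <= c)%E.
Proof.
move=> mD nf ng fg H.
have mf k : measurable_fun D (EFin \o f k) by apply/measurable_EFinP; exact: (nf k).1.
apply: (@le_trans _ _ (\int[mu]_(x in D) limn_einf (fun k => (f k x)%:E))%E).
  rewrite IntE; apply: ae_ge0_le_integral => //.
  - by move=> x Dx; rewrite lee_fin; exact: ng.2.
  - by apply/measurable_EFinP; exact: ng.1.
  - move=> x Dx; rewrite limn_einf_lim; apply: lime_ge; first exact: is_cvg_einfs.
    apply: nearW => k; apply: le_ereal_inf_tmp => _ [j _ <-].
    by rewrite lee_fin; exact: (nf j).2.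
  - rewrite (_ : (fun x => _) = (fun x => - limn_esup (fun k => - (f k x)%:E))%E).
      apply: (measurableT_comp (@oppe_measurable _ _)).
      apply: measurable_fun_limn_esup => k.
      exact: (measurableT_comp (@oppe_measurable _ _)).
    by apply/funext => x; rewrite limn_esupN oppeK.
  move: fg; apply: filterS => x H1 Dx.
  suff -> : limn_einf (fun k => (f k x)%:E) = (g x)%:E by [].
  by apply: (cvg_limn_einf_sup _).1; apply: cvg_EFin; [exact: nearW|exact: H1].
apply: le_trans (fatou mu mD mf _) _.
  by move=> k x Dx; rewrite lee_fin; exact: (nf k).2.
rewrite limn_einf_lim; apply: lime_le; first exact: is_cvg_einfs.
apply: nearW => k; apply: le_trans (H k); apply: ereal_inf_lbound.
by exists k => //=.
Qed.

Lemma Int_restrict D E f : E `<=` D -> (forall x, D x -> ~ E x -> f x = 0) ->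
  Int mu D f = Int mu E f.
Proof.
move=> ED H; rewrite !IntE integral_mkcond [RHS]integral_mkcond.
apply: eq_integral => x _; rewrite !patchE.
have [Ex|Ex] := pselect (E x); first by rewrite !mem_set//; exact: ED.
rewrite [in RHS]memNset//; case: ifPn => //; rewrite inE => Dx.
by rewrite H.
Qed.

End fatou_bound.

(** One number [e] serves as radius and, through [e^-1], as Lipschitz constant. The property then
    holds near each point for all small [e], the form in which compactness applies along the filter
    of positive numbers tending to 0. *)
Lemma compact_unif_lip (R : realType) (V : normedModType R) (K : set V) (w : V -> R) : compact K ->
  (forall x, K x -> exists e M, [/\ 0 < e, 0 <= M &
    forall y z, ball x e y -> ball x e z -> `|w y - w z| <= M * `|y - z|]) ->
  exists2 e, 0 < e & forall x z, K x -> `|x - z| < e -> `|w x - w z| <= e^-1 * `|x - z|.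
Proof.
move=> /compact_near_coveringP cK H.
pose P (e : R) (x : V) := forall z, `|x - z| < e -> `|w x - w z| <= e^-1 * `|x - z|.
have Hx x : K x -> \forall x' \near x & e \near 0^'+, P e x'.
  move=> Kx; have [e [M [e0 M0 HM]]] := H x Kx.
  have e20 : 0 < e / 2 by [].
  pose d := Num.min (e / 2) (M + 1)^-1.
  have d0 : 0 < d by rewrite lt_min e20 invr_gt0 ltr_wpDl.
  exists (ball x (e / 2), [set y | 0 < y < d]) => /=.
    split; first exact: nbhsx_ballx.
    by exists d => //= y /=; rewrite sub0r normrN => /ltr_normlP[_ h1] h2; rewrite h2.
  move=> [x' e'] /= [xx' /andP[e'0]]; rewrite lt_min => /andP[e'1 e'2] z x'z.
  have xz : ball x e z by apply: (@ball_split _ _ x' x) => //; rewrite -ball_normE /=; exact: lt_trans e'1.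
  have xx'' : ball x e x' by apply: le_ball xx'; rewrite ler_pdivrMr// ler_pMr// ler1n.
  apply: le_trans (HM _ _ xx'' xz) _; rewrite ler_wpM2r//.
  have h : (M + 1) < e'^-1 by rewrite -[ltLHS]invrK ltf_pV2 ?posrE ?invr_gt0// ltr_wpDl.
  by apply: ltW; apply: lt_trans h; rewrite ltrDl.
have [e [e0 HP]] : exists e, 0 < e /\ K `<=` P e.
  have HK := cK _ _ P _ Hx.
  have : \forall e \near 0^'+, 0 < e /\ K `<=` P e.
    by apply: filterI; [exact: nbhs_right_gt|exact: HK].
  by move=> /filter_ex; exact.
by exists e => // x z Kx; exact: HP.
Qed.

Lemma young (R : realType) (a b s t : R) : 0 <= a -> 0 <= b -> 0 < s -> 0 < t -> s^-1 + t^-1 = 1 ->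
  a * b <= a `^ s + b `^ t.
Proof.
move=> a0 b0 s0 t0 st; apply: le_trans (conjugate_powR a0 b0 s0 t0 st) _.
have si : s^-1 <= 1 by rewrite -st lerDl.
have ti : t^-1 <= 1 by rewrite -st lerDr.
by apply: lerD; rewrite -[leRHS]mulr1 ler_wpM2l.
Qed.

Lemma pow_cvg (R : realType) (y : nat -> R) (l q : R) : y k @[k --> \oo] --> l ->
  (forall k, 0 <= y k) -> 0 <= q -> y k `^ q @[k --> \oo] --> l `^ q.
Proof.
move=> yl y0; rewrite le_eqVlt => /predU1P[<-|q0].
  rewrite powRr0 (_ : (fun k => _) = fun=> 1); first exact: cvg_cst.
  by apply/funext => k; rewrite powRr0.
have : 0 <= l by rewrite -(cvg_lim _ yl)//; apply: limr_ge; [apply/cvg_ex; exists l|exact: nearW].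
rewrite le_eqVlt => /predU1P[l0|l0].
  by move: yl; rewrite -l0 powR0 ?gt_eqF// => yl; apply: cvg0_pow.
apply: (@continuous_cvg _ _ _ _ _ _ (fun t => t `^ q)) yl; apply: differentiable_continuous; apply/derivable1_diffP.
by have [] := is_derive1_powR q l0.
Qed.

(** * Weak solutions *)

Section weak_solutions.
Context {R : realType} {n : nat}.
Variables (Om : set 'rV[R]_n) (p : R) (Q : 'rV[R]_n -> 'M[R]_n).
Hypothesis Om_open : open Om.
Hypothesis Om_bounded : bounded_set Om.
Hypothesis p_gt1 : 1 < p.
Hypothesis Q_measurable : forall i j, measurable_fun Om (fun x => Q x i j).
Hypothesis Q_psd : forall x, Om x -> psdmx (Q x).
Implicit Types (u v : 'rV[R]_n -> R) (g du : 'rV[R]_n -> 'rV[R]_n) (U B : set 'rV[R]_n).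
Local Notation Qn := (Qnorm Q).
Local Notation IntL U f := (Int leb U f%R).
Local Notation IntFin U f := (Int leb U f%R < +oo)%E.

(** Within distance [e] of a point of the support [w] is uniformly Lipschitz, and the product is
    estimated factor by factor. For points at distance at least [e] the bound [2 * L] is at most
    [2 * L / e * |x - z|]. If neither point lies in the support, both values vanish. *)
Lemma Lip_0_mul B zeta w L : B `<=` Om -> Lip_0 B zeta -> (forall x, `|zeta x| <= 1) ->
  Lip_loc Om w -> (forall x, `|w x| <= L) -> Lip_0 B (zeta * w).
Proof.
move=> BO [/lipschitz_inP[M M0 zM] cz sz] z1 Lw wL.
have L0 : 0 <= L by apply: le_trans (wL 0).
have sup_sub : [set x | (zeta * w) x != 0] `<=` [set x | zeta x != 0].
  by move=> x /=; apply: contraNN => /eqP zx; rewrite fctE zx mul0r.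
have sub : supp (zeta * w) `<=` supp zeta by exact: closure_subset.
split; last exact: subset_trans sz.
  have [x Kx|e e0 He] := @compact_unif_lip R _ (supp zeta) w cz.
    by have [e [N [e0 N0 _ HN]]] := lip_loc_ball Om_open Lw (BO _ (sz _ Kx)); exists e, N.
  apply/lipschitz_inP; exists (M * L + e^-1 + 2 * L / e).
    by [].
  have main x z : supp zeta x -> `|(zeta * w) x - (zeta * w) z| <= (M * L + e^-1 + 2 * L / e) * `|x - z|.
    move=> Kx; have [xz|xz] := ltP `|x - z| e.
      have -> : (zeta * w) x - (zeta * w) z = (zeta x - zeta z) * w x + zeta z * (w x - w z).
        by rewrite !fctE; ring.
      apply: le_trans (ler_normD _ _) _; rewrite !normrM.
      have h1 : `|zeta x - zeta z| * `|w x| <= M * `|x - z| * L.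
        by apply: ler_pM => //; exact: zM.
      have h2 : `|zeta z| * `|w x - w z| <= 1 * (e^-1 * `|x - z|).
        by apply: ler_pM => //; exact: He.
      apply: le_trans (lerD h1 h2) _.
      rewrite mul1r mulrAC -mulrDl ler_wpM2r// lerDl//.
    have nb y : `|(zeta * w) y| <= L.
      by rewrite fctE normrM -[leRHS]mul1r ler_pM.
    apply: le_trans (ler_normB _ _) _.
    apply: (@le_trans _ _ (2 * L / e * `|x - z|)).
      rewrite -mulrA; apply: (@le_trans _ _ (2 * L * 1)).
        by rewrite mulr1 mulr_natl mulr2n lerD.
      by rewrite ler_wpM2l ?mulr_ge0// ler_pdivlMl// mulr1.
    by rewrite ler_wpM2r// lerDr addr_ge0 ?mulr_ge0.
  move=> x z _ _; have [Kx|Kx] := pselect (supp zeta x); first exact: main.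
  have [Kz|Kz] := pselect (supp zeta z); first by rewrite distrC (distrC x); exact: main.
  have Z y : ~ supp zeta y -> (zeta * w) y = 0.
    move=> Ky; have -> : (zeta * w) y = zeta y * w y by [].
    have [->|zy] := eqVneq (zeta y) 0; first by rewrite mul0r.
    by case: Ky; exact: subset_closure.
  by rewrite !Z// subrr normr0 mulr_ge0 ?addr_ge0 ?mulr_ge0.
apply: subclosed_compact cz sub; exact: closed_closure.
Qed.

(* [al] and [be] stand for A(x, u, grad u) and B(x, u, grad u).  The structure functions A and B
   are not assumed to be measurable, so that they are only used through the bounds below. *)
Definition weak_identity (al : 'rV[R]_n -> 'rV[R]_n) (be : 'rV[R]_n -> R) : Prop :=
  forall phi, Lip_0 Om phi -> (forall x, 0 <= phi x) ->
  leb.-integrable Om (fun x => (dotr (grad phi x) (al x) + phi x * be x)%:E) /\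
  (\int[leb]_(x in Om) (dotr (grad phi x) (al x) + phi x * be x)%:E = 0)%E.

Definition growth_bounds (du al : 'rV[R]_n -> 'rV[R]_n) (be Ah Bh Hh : 'rV[R]_n -> R) (ai : R) : Prop :=
  \forall x \ae leb, Om x -> [/\ forall xi, `|dotr xi (al x)| <= Qn x xi * Ah x,
    ai * Qn x (du x) `^ p - Hh x <= dotr (du x) (al x) & `|be x| <= Bh x].

Section cutoff_product.
Variables (B : set 'rV[R]_n) (zeta : 'rV[R]_n -> R).
Hypothesis B_open : open B.
Hypothesis BO : B `<=` Om.
Hypothesis zetaL : Lip_0 B zeta.
Hypothesis zeta01 : forall x, 0 <= zeta x <= 1.
Hypothesis zeta_int : IntFin B (fun x => Qn x (grad zeta x) `^ p).

Let p0 : 0 < p. Proof. exact: lt_trans p_gt1. Qed.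
Let mO : measurable Om. Proof. exact: open_rV_measurable. Qed.
Let mB : measurable B. Proof. exact: open_rV_measurable. Qed.
Let z0 x : 0 <= zeta x. Proof. by have /andP[] := zeta01 x. Qed.
Let z1 x : zeta x <= 1. Proof. by have /andP[] := zeta01 x. Qed.
Let z1' x : `|zeta x| <= 1. Proof. by rewrite ger0_norm. Qed.

Lemma Lip_0_loc U : Lip_loc U zeta.
Proof.
have [/lipschitz_inP[M M0 zM] _ _] := zetaL.
move=> x Ux; exists setT; first exact: filterT.
by apply/lipschitz_inP; exists M => //; exact: lip_withS zM.
Qed.

Lemma zeta_measurable : measurable_fun Om zeta.
Proof. by apply: lip_loc_measurable => //; exact: Lip_0_loc. Qed.

Lemma Qgrad_zeta_measurable : measurable_fun Om (fun x => Qn x (grad zeta x)).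
Proof. by apply: (Qn_measurable Om_open) => // i; apply: grad_measurable => //; exact: Lip_0_loc. Qed.

(** Inserting the approximants of [u] into the bounded function [F] and cutting off yields Lipschitz
    functions with compact support in [B], admissible in the weak identity as well as in Sobolev's
    inequality. [H] majorizes all errors at once, so that both uses pass to the limit by dominated
    convergence. *)
Lemma cutoff_product_approx u du F dF L : W1pQ p Q Om u du -> C1fun F dF ->
  (forall t, `|F t| <= L) -> (forall t, `|dF t| <= L) ->
  exists (v : nat -> 'rV[R]_n -> R) (H : 'rV[R]_n -> R),
  [/\ forall k, Lip_0 B (zeta * (F \o v k)), nnm B H, IntFin B H &
    \forall x \ae leb, B x -> [/\ forall k, `|zeta x * F (v k x) - zeta x * F (u x)| `^ p <= H x,
      forall k, Qn x (grad (zeta * (F \o v k)) x -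
         ((zeta x * dF (u x)) *: du x + F (u x) *: grad zeta x)) `^ p <= H x,
      F (v k x) @[k --> \oo] --> F (u x) &
      Qn x (grad (zeta * (F \o v k)) x -
         ((zeta x * dF (u x)) *: du x + F (u x) *: grad zeta x)) @[k --> \oo] --> 0]].
Proof.
move=> W HF FL dFL; have L0 : 0 <= L by apply: le_trans (FL 0).
have [v [S [Lv Wv nS iS HS]]] := W1pQ_fast Om_open p_gt1 Q_measurable Q_psd W.
have [_ gi] := W1pQ_fin Om_open p_gt1 Q_measurable Q_psd W.
have [mu mdu _] := W.
have HC := Lip_loc_comp_grad Om_open p_gt1 Lv HF dFL HS.
pose c := 2 `^ p * L `^ p; pose c2 := 2 `^ p * (2 * L) `^ p.
pose H x := 2 `^ p * (c * S x + c2 * Qn x (du x) `^ p + (2 * L) `^ p * Qn x (grad zeta x) `^ p) + L `^ p * S x.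
have c0 : 0 <= c by [].
have c20 : 0 <= c2 by [].
have k0 : 0 <= 2 `^ p by [].
have k1 : 0 <= (2 * L) `^ p by [].
have k2 : 0 <= L `^ p by [].
have mdu' : measurable_fun Om (fun x => Qn x (du x)) by exact: (Qn_measurable Om_open Q_measurable Q_psd).
have nSB : nnm B S by exact: nnm_sub nS.
have iSB : IntFin B S by apply: le_lt_trans iS; exact: Int_sub.
have nG : nnm B (fun x => Qn x (du x) `^ p) by apply: nnm_pow; exact: measurable_funS mdu'.
have iG : IntFin B (fun x => Qn x (du x) `^ p).
  by apply: le_lt_trans gi; apply: Int_sub => //; exact: nnm_pow.
have nZ : nnm B (fun x => Qn x (grad zeta x) `^ p).
  by apply: nnm_pow; apply: measurable_funS Qgrad_zeta_measurable.
have nC k : 0 <= k -> nnm B (fun=> k) by move=> h; exact: nnm_cst.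
have Lip k : Lip_loc Om (F \o v k) by exact: Lip_loc_comp HF L0 dFL.
exists v, H; split.
- by move=> k; apply: Lip_0_mul => // x; exact: FL.
- by rewrite /H; nnmt.
- by rewrite /H; ift.
have Hz : \forall x \ae leb, B x -> pd zeta x.
  apply/aeP; apply: leb_null_sub (lip_loc_pd B_open (@Lip_0_loc B)) => x /=.
  by move=> /not_implyP[? ?]; split.
move: HS HC Hz; apply: filterS3 => x HS' HC' Hz Bx.
have Ox := BO Bx; have [H1 _ H3 _] := HS' Ox; have [C1 C2 C3 C4 C5] := HC' Ox.
set gz := Qn x (grad zeta x).
set er := fun k => Qn x (grad (F \o v k) x - dF (u x) *: du x).
set dl := fun k => `|F (v k x) - F (u x)|.
have er0 k : 0 <= er k by exact: Qnorm_ge0.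
have dl0 k : 0 <= dl k by exact: normr_ge0.
have gz0 : 0 <= gz by exact: Qnorm_ge0.
have dl2 k : dl k <= 2 * L.
  by apply: le_trans (ler_normB _ _) _; rewrite mulr_natl mulr2n lerD.
have Sx0 : 0 <= S x by exact: nS.2.
have E k : Qn x (grad (zeta * (F \o v k)) x - ((zeta x * dF (u x)) *: du x + F (u x) *: grad zeta x))
    <= er k + dl k * gz.
  rewrite (grad_mul (Hz Bx) (C2 k).1).2.
  have -> : zeta x *: grad (F \o v k) x + (F \o v k) x *: grad zeta x -
      ((zeta x * dF (u x)) *: du x + F (u x) *: grad zeta x) =
      zeta x *: (grad (F \o v k) x - dF (u x) *: du x) + (F (v k x) - F (u x)) *: grad zeta x.
    by rewrite scalerBr scalerA scalerBl opprD addrACA.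
  apply: le_trans (QnormD _ _ _ _) _; rewrite !QnormZ lerD2r.
  by rewrite -[leRHS]mul1r ler_wpM2r.
split=> [k|k||]; [| |exact: C4|].
- rewrite -mulrBr normrM; apply: (@le_trans _ _ (L `^ p * S x)).
    apply: (@le_trans _ _ ((L * `|v k x - u x|) `^ p)).
      apply: pow_le => //.
      by apply: le_trans (C1 k); rewrite -[leRHS]mul1r ler_wpM2r.
    by rewrite powRM// ler_wpM2l.
  by rewrite lerDr mulr_ge0// !addr_ge0//.
- apply: (@le_trans _ _ ((er k + dl k * gz) `^ p)).
    by apply: pow_le => //; exact: E.
  apply: le_trans (pow_add _ _ _) _; rewrite ?(ltW p0)//.
  rewrite /H; apply: ler_wpDr; first exact: mulr_ge0.
  rewrite ler_wpM2l//; apply: lerD; first exact: C3.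
  rewrite powRM// ler_wpM2r//.
  by apply: pow_le => //; exact: E.
apply: (squeeze_cvgr (f := fun=> 0) (h := fun k => er k + dl k * gz)).
- by apply: nearW => k; rewrite Qnorm_ge0 E.
- exact: cvg_cst.
- rewrite (_ : 0 = 0 + 0 * gz); last by rewrite mul0r addr0.
  apply: cvgD; first exact: C5.
  by apply: cvgMl; apply/norm_cvg0P; apply/subr_cvg0; exact: C4.
Qed.


Section bounded_nonlinearity.
Variables (u : 'rV[R]_n -> R) (du : 'rV[R]_n -> 'rV[R]_n) (F dF : R -> R) (L : R).
Hypothesis W : W1pQ p Q Om u du.
Hypothesis HF : C1fun F dF.
Hypothesis FL : forall t, `|F t| <= L.
Hypothesis dFL : forall t, `|dF t| <= L.

Let L0 : 0 <= L. Proof. by apply: le_trans (FL 0). Qed.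
Let mu_ : measurable_fun Om u. Proof. by case: W. Qed.
Let mdu i : measurable_fun Om (fun x => du x 0 i). Proof. by case: W. Qed.

Let mFu : measurable_fun Om (fun x => F (u x)).
Proof. by apply: (measurableT_comp (f := F)) => //; apply: continuous_measurable_fun; exact: (C1_continuous HF). Qed.

Let mdFu : measurable_fun Om (fun x => dF (u x)).
Proof. by apply: (measurableT_comp (f := dF)) => //; apply: continuous_measurable_fun; exact: HF.2. Qed.

Let mG : measurable_fun Om (fun x => Qn x (du x)).
Proof. exact: (Qn_measurable Om_open Q_measurable Q_psd). Qed.

Let mz := zeta_measurable.
Let mgz := Qgrad_zeta_measurable.

Let xi x := (zeta x * dF (u x)) *: du x + F (u x) *: grad zeta x.

Let mgzi i : measurable_fun Om (fun x => grad zeta x 0 i).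
Proof. by apply: grad_measurable => //; exact: Lip_0_loc. Qed.

Let mxi i : measurable_fun Om (fun x => xi x 0 i).
Proof.
apply: (@eq_measurable_fun _ _ _ _ Om (fun x => zeta x * dF (u x) * du x 0 i + F (u x) * grad zeta x 0 i)).
  by move=> x _; rewrite !mxE.
by mst.
Qed.

Let mQxi : measurable_fun Om (fun x => Qn x (xi x)).
Proof. exact: (Qn_measurable Om_open Q_measurable Q_psd). Qed.

Let Qxi_fin : IntFin B (fun x => Qn x (xi x) `^ p).
Proof.
have [_ gi] := W1pQ_fin Om_open p_gt1 Q_measurable Q_psd W.
have nG : nnm Om (fun x => Qn x (du x) `^ p) by nnmt.
have nZ : nnm Om (fun x => Qn x (grad zeta x) `^ p) by nnmt.
have nZB : nnm B (fun x => Qn x (grad zeta x) `^ p) by nnmt.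
have cL : 0 <= 2 `^ p * L `^ p by [].
have iB : IntFin B (fun x => 2 `^ p * L `^ p * Qn x (du x) `^ p + 2 `^ p * L `^ p * Qn x (grad zeta x) `^ p).
  by ift.
apply: (Int_dom_fin mB _ _ iB); [by nnmt|by nnmt|apply: aeW => x Bx].
rewrite -mulrA -[X in _ + X]mulrA -mulrDr.
apply: (@le_trans _ _ ((L * Qn x (du x) + L * Qn x (grad zeta x)) `^ p)); last first.
  apply: le_trans (pow_add _ _ _) _; rewrite ?(ltW p0)//.
  by rewrite !powRM.
apply: pow_le => //.
apply: le_trans (QnormD _ _ _ _) _; rewrite !QnormZ.
apply: lerD; rewrite ler_wpM2r// normrM -[leRHS]mul1r ler_pM//.
Qed.

Lemma cutoff_product_W0 : W1pQ_0 p Q B (fun x => zeta x * F (u x)) xi.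
Proof.
have [v [H [Lv nH iH HH]]] := cutoff_product_approx W HF FL dFL.
pose phi k : 'rV[R]_n -> R := zeta * (F \o v k).
have Lphi k U : Lip_loc U (phi k).
  move=> x Ux; have [/lipschitz_inP[M M0 zM] _ _] := Lv k.
  exists setT; first exact: filterT.
  by apply/lipschitz_inP; exists M => //; exact: lip_withS zM.
have mphi k : measurable_fun B (phi k) by exact: lip_loc_measurable.
have mgphi k i : measurable_fun B (fun x => grad (phi k) x 0 i) by exact: grad_measurable.
have mQ (g : 'rV[R]_n -> 'rV[R]_n) : (forall i, measurable_fun B (fun x => g x 0 i)) -> measurable_fun B (fun x => Qn x (g x)).
  by move=> mg; exact: (Qn_measurable Om_open Q_measurable Q_psd).
have mzF : measurable_fun B (fun x => zeta x * F (u x)) by mst.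
have mxiB i : measurable_fun B (fun x => xi x 0 i) by apply: measurable_funS (mxi i).
have mdiff k i : measurable_fun B (fun x => (grad (phi k) x - xi x) 0 i).
  by apply: (@eq_measurable_fun _ _ _ _ B (fun x => grad (phi k) x 0 i - xi x 0 i)); 
    [move=> x _; rewrite !mxE|exact: measurable_funB].
have mQphi k := mQ _ (mgphi k); have mQdiff k := mQ _ (mdiff k).
have nxi : nnm B (fun x => Qn x (xi x) `^ p) by nnmt.
split => //; exists phi; split.
- move=> k; split; first exact: Lv.
  apply/Wnorm_fin => //; split.
    have iL : IntFin B (fun=> L `^ p) by exact: (IntFin_cst (Om := Om)).
    apply: (Int_dom_fin mB _ _ iL); [by nnmt|by nnmt|apply: aeW => x Bx].
    apply: pow_le => //.
    by rewrite /phi fctE normrM -[leRHS]mul1r ler_pM.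
  have k0 : 0 <= 2 `^ p by [].
  have iX : IntFin B (fun x => 2 `^ p * (H x + Qn x (xi x) `^ p)) by ift.
  apply: (Int_dom_fin mB _ _ iX); [by nnmt|by nnmt|].
  move: HH; apply: filterS => x HH Bx; have [_ H2 _ _] := HH Bx.
  apply: (@le_trans _ _ ((Qn x (grad (phi k) x - xi x) + Qn x (xi x)) `^ p)).
    apply: pow_le => //.
    by apply: le_trans (QnormD _ _ _ _); rewrite subrK.
  apply: le_trans (pow_add _ _ _) _; rewrite ?(ltW p0)//.
  by rewrite ler_wpM2l// lerD2r; exact: H2.
- apply: (@dominated_to_zero _ _ B _ H) => // [k|]; first by nnmt.
  move: HH; apply: filterS => x HH Bx; have [H1 _ H3 _] := HH Bx.
  split=> [k|]; first exact: H1.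
  apply: cvg0_pow => //; apply/norm_cvg0P; apply/subr_cvg0.
  by rewrite /phi; apply: cvgMr; exact: H3.
- apply: (@dominated_to_zero _ _ B _ H) => // [k|]; first by nnmt.
  move: HH; apply: filterS => x HH Bx; have [_ H2 _ H4] := HH Bx.
  split=> [k|]; first exact: H2.
  by apply: cvg0_pow => //; exact: H4.
Qed.


Variables (al : 'rV[R]_n -> 'rV[R]_n) (be Ah Bh Hh : 'rV[R]_n -> R) (ai : R).
Hypothesis sol : weak_identity al be.
Hypothesis growth : growth_bounds du al be Ah Bh Hh ai.
Hypothesis ai0 : 0 <= ai.
Hypothesis nAh : nnm B Ah.
Hypothesis nBh : nnm B Bh.
Hypothesis nHh : nnm B Hh.
Hypothesis Ah_fin : IntFin B (fun x => Ah x `^ dual_exp p).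
Hypothesis Bh_fin : IntFin B Bh.
Hypothesis F0 : forall t, 0 <= F t.

Lemma test_identity :
  let T x := (dotr (xi x) (al x) + zeta x * F (u x) * be x)%:E in
  leb.-integrable B T /\ (\int[leb]_(x in B) T x = 0)%E.
Proof.
move=> T; have [v [H [Lv nH iH HH]]] := cutoff_product_approx W HF FL dFL.
pose phi k : 'rV[R]_n -> R := zeta * (F \o v k).
pose Tk k x := (dotr (grad (phi k) x) (al x) + phi k x * be x)%:E.
have phi0 k x : 0 <= phi k x by rewrite /phi fctE mulr_ge0 ?F0.
have Lphi k : Lip_0 Om (phi k).
  by have [h1 h2 h3] := Lv k; split => //; apply: subset_trans BO.
have intTk k : leb.-integrable B (Tk k).
  by apply: integrableS (sol (Lphi k) (phi0 k)).1.
(* Outside the support of [phi k], hence outside [B], the function and its gradient vanish, and both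
   integrals agree. *)
have TkB k : (\int[leb]_(x in B) Tk k x = 0)%E.
  rewrite -(sol (Lphi k) (phi0 k)).2 -!IntE.
  apply/esym; apply: Int_restrict => // x Ox Bx.
  have nx : ~ supp (phi k) x by have [_ _ sB] := Lv k; move=> /sB.
  rewrite grad_supp// (_ : phi k x = 0); last first.
    by apply: contrapT => /eqP px; apply: nx; exact: subset_closure.
  by rewrite mul0r addr0 /dotr big1// => i _; rewrite mxE mul0r.
have cv : \forall x \ae leb, B x -> Tk k x @[k --> \oo] --> T x.
  move: HH growth; apply: filterS2 => x HH' gr Bx.
  have [H1 H2 H3 H4] := HH' Bx; have [G1 _ _] := gr (BO Bx).
  apply: cvg_EFin; first exact: nearW.
  apply: cvgD; last by apply: cvgMl; rewrite /phi; apply: cvgMr; exact: H3.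
  apply/subr_cvg0; apply/norm_cvg0P.
  apply: (squeeze_cvgr (f := fun=> 0) (h := fun k => Qn x (grad (phi k) x - xi x) * Ah x)).
  - apply: nearW => k; rewrite normr_ge0/=; apply: le_trans (G1 _).
    by rewrite dotrDl -[- xi x]scaleN1r dotrZl mulN1r.
  - exact: cvg_cst.
  - by rewrite -[X in _ --> X](mul0r (Ah x)); apply: cvgMl; exact: H4.
have p'0 : 0 < dual_exp p by rewrite /dual_exp divr_gt0// subr_gt0.
have pp' : p^-1 + (dual_exp p)^-1 = 1.
  by rewrite /dual_exp invf_div -[X in X + _]mul1r -mulrDl addrC subrK mulfV// gt_eqF.
(* Young's inequality with the exponents p and p' splits the product of |sqrt(Q) grad phi| and [Ah];
   the gradient differs from its limit [xi] by an error bounded through [H]. *)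
pose D x := 2 `^ p * (H x + Qn x (xi x) `^ p) + Ah x `^ dual_exp p + L * Bh x.
have k0 : 0 <= 2 `^ p by [].
have nD : nnm B D by rewrite /D; nnmt.
have iD : IntFin B D by rewrite /D; ift.
have dom : \forall x \ae leb, forall k, B x -> (`|Tk k x| <= (D x)%:E)%E.
  move: HH growth; apply: filterS2 => x HH' gr k Bx.
  have [_ H2 _ _] := HH' Bx; have [G1 _ G3] := gr (BO Bx).
  have Ah0 : 0 <= Ah x by exact: nAh.2.
  rewrite /Tk /D lee_fin; apply: le_trans (ler_normD _ _) _.
  apply: lerD; last first.
    rewrite normrM; apply: ler_pM => //; rewrite /phi fctE normrM -[leRHS]mul1r.
    by apply: ler_pM => //; exact: FL.
  apply: le_trans (G1 _) _.
  apply: le_trans (young _ _ p0 p'0 pp') _ => //.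
  rewrite lerD2r.
  apply: (@le_trans _ _ ((Qn x (grad (phi k) x - xi x) + Qn x (xi x)) `^ p)).
    apply: pow_le => //.
    by apply: le_trans (QnormD _ _ _ _); rewrite subrK.
  apply: le_trans (pow_add _ _ _) _; rewrite ?(ltW p0)//.
  by rewrite ler_wpM2l// lerD2r; exact: H2.
(* [al] and [be] need not be measurable. The integrands [Tk k] are, as part of the weak identity,
   and therefore so is their limit almost everywhere. *)
have mT : measurable_fun B T.
  have [N [mN N0 HN]] := cv.
  have cvN x : B x -> ~ N x -> Tk k x @[k --> \oo] --> T x.
    by move=> Bx Nx; apply: contrapT => h; apply: Nx; apply: HN => /= /(_ Bx).
  apply: (measurable_null_patch mB N0).
  apply: (@emeasurable_fun_cvg _ _ _ _ (fun k => Tk k)).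
    by move=> k; apply: (measurable_funS mB); [exact: subDsetl|exact: (measurable_int _ (intTk k))].
  by move=> x [Bx Nx]; exact: cvN.
have [|iT _ cI] := dominated_convergence mB (fun k => measurable_int _ (intTk k)) mT cv (Int_integrable nD iD).
  exact: dom.
split => //.
have : (\int[leb]_(x in B) Tk k x)%E @[k --> \oo] --> (\int[leb]_(x in B) T x)%E by exact: cI.
rewrite (_ : (fun k => _) = (fun=> 0%E)); last by apply/funext => k; exact: TkB.
move=> h; exact: (cvg_unique (@ereal_hausdorff R) h (cvg_cst _)).
Qed.

Lemma test_inequality_bounded : (forall t, 0 <= dF t) ->
  (Int leb B (fun x => zeta x * dF (u x) * (ai * Qn x (du x) `^ p))%R <=
   Int leb B (fun x => zeta x * dF (u x) * Hh x + F (u x) * Qn x (grad zeta x) * Ah x +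
     zeta x * F (u x) * Bh x)%R)%E.
Proof.
move=> dF0; set X := fun x => _; set Y := fun x => _ + _.
have [iT T0] := test_identity.
set t := fun x => (dotr (xi x) (al x) + zeta x * F (u x) * be x) in iT T0.
have nz : nnm B zeta by split=> //; mst.
have ndF : nnm B (fun x => dF (u x)) by split=> //; mst.
have nF : nnm B (fun x => F (u x)) by split=> //; mst.
have nG : nnm B (fun x => Qn x (du x) `^ p) by nnmt.
have nQz : nnm B (fun x => Qn x (grad zeta x)) by split=> //; mst.
have nX : nnm B X by rewrite /X; nnmt.
have nY : nnm B Y by rewrite /Y; nnmt.
have mt : measurable_fun B t by apply/measurable_EFinP; exact: (measurable_int _ iT).
have XtY : \forall x \ae leb, B x -> X x <= t x + Y x.
  move: growth; apply: filterS => x /(_ _) gr Bx; have [G1 G2 G3] := gr (BO Bx).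
  rewrite /X /t /Y /xi dotrDl !dotrZl.
  have h1 : zeta x * dF (u x) * (ai * Qn x (du x) `^ p) <=
      zeta x * dF (u x) * dotr (du x) (al x) + zeta x * dF (u x) * Hh x.
    by rewrite -mulrDr ler_wpM2l ?mulr_ge0// -lerBlDr.
  have h2 : - (F (u x) * Qn x (grad zeta x) * Ah x) <= F (u x) * dotr (grad zeta x) (al x).
    rewrite -mulrA -mulrN ler_wpM2l//.
    by have := G1 (grad zeta x); rewrite ler_norml => /andP[].
  have h3 : - (zeta x * F (u x) * Bh x) <= zeta x * F (u x) * be x.
    by rewrite -mulrN ler_wpM2l ?mulr_ge0//; move: G3; rewrite ler_norml => /andP[].
  by move: h1 h2 h3; set e1 := _ * (ai * _); set e2 := _ * dotr (du x) _;
    set e3 := _ * Hh x; set e4 := F _ * _ * _; set e5 := F _ * dotr _ _; set e6 := _ * Bh x;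
    set e7 := _ * be x; lra.
(* An infinite right-hand side leaves nothing to prove; otherwise [Y] is integrable and can be added
   to [t], whose integral is 0. *)
have [->|/eqP Yfin] := eqVneq (Int leb B Y) +oo%E; first exact: leey.
have iY : leb.-integrable B (EFin \o Y) by apply: Int_integrable => //; rewrite ltey; apply/eqP.
(* [t + Y] is nonnegative only almost everywhere, as it dominates [X] there; its positive part takes
   its place in the comparison. *)
have mm : measurable_fun B (fun x => Num.max (t x + Y x) 0).
  by apply: measurable_maxr; [mst|exact: measurable_cst].
have nm : nnm B (fun x => Num.max (t x + Y x) 0).
  by split => // x _; rewrite le_max lexx orbT.
apply: le_trans (Int_le mB nX nm _) _.
  by move: XtY; apply: filterS => x h Bx; rewrite le_max h.
rewrite IntE (ae_eq_integral (fun x => (t x)%:E + (Y x)%:E)%E)//.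
- rewrite integralD//; first by rewrite T0 add0e -IntE.
- by apply/measurable_EFinP.
- by apply: emeasurable_funD; apply/measurable_EFinP => //; exact: nY.1.
move: XtY; apply: filterS => x h Bx; rewrite -EFinD max_l//.
by apply: le_trans (h Bx); exact: nX.2.
Qed.

End bounded_nonlinearity.

Let mz := zeta_measurable.
Let mgz := Qgrad_zeta_measurable.

(** * Test functions of linear growth *)

Section unbounded_nonlinearity.
Variables (u : 'rV[R]_n -> R) (du : 'rV[R]_n -> 'rV[R]_n) (F dF : R -> R) (L : R).
Hypothesis W : W1pQ p Q Om u du.
Hypothesis HF : C1fun F dF.
Hypothesis F0 : forall t, 0 <= F t.
Hypothesis dF0 : forall t, 0 <= dF t.
Hypothesis dFL : forall t, dF t <= L.

Let mu_ : measurable_fun Om u. Proof. by case: W. Qed.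
Let mdu i : measurable_fun Om (fun x => du x 0 i). Proof. by case: W. Qed.

Let mFu : measurable_fun Om (fun x => F (u x)).
Proof. by apply: (measurableT_comp (f := F)) => //; apply: continuous_measurable_fun; exact: (C1_continuous HF). Qed.

Let mdFu : measurable_fun Om (fun x => dF (u x)).
Proof. by apply: (measurableT_comp (f := dF)) => //; apply: continuous_measurable_fun; exact: HF.2. Qed.

Let mG : measurable_fun Om (fun x => Qn x (du x)).
Proof. exact: (Qn_measurable Om_open Q_measurable Q_psd). Qed.

(** A truncation of class C1: with [m = k + 1], the function [m F / (m + F)] lies between 0 and both
    [m] and [F], and its derivative [dF (m / (m + F))^2] lies between 0 and [dF]. Both tend to [F]
    and [dF]. *)
Let trF (k : nat) t := k.+1%:R * F t / (k.+1%:R + F t).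
Let trdF (k : nat) t := dF t * (k.+1%:R / (k.+1%:R + F t)) ^+ 2.

Let den (k : nat) t : 0 < k.+1%:R + F t. Proof. by rewrite ltr_wpDr. Qed.

Let trF0 k t : 0 <= trF k t.
Proof. by rewrite /trF divr_ge0 ?mulr_ge0 ?F0// ltW. Qed.

Let tr1 k t : k.+1%:R / (k.+1%:R + F t) <= 1.
Proof. by rewrite ler_pdivrMr// mul1r lerDl. Qed.

Let trFle k t : trF k t <= F t.
Proof. by rewrite /trF mulrAC -[leRHS]mul1r ler_wpM2r. Qed.

Let trFk k t : trF k t <= k.+1%:R.
Proof. by rewrite /trF -mulrA -[leRHS]mulr1 ler_wpM2l// ler_pdivrMr// mul1r lerDr. Qed.

Let trdF0 k t : 0 <= trdF k t.
Proof. by rewrite /trdF mulr_ge0// sqr_ge0. Qed.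

Let trdFle k t : trdF k t <= dF t.
Proof.
by rewrite /trdF -[leRHS]mulr1 ler_wpM2l// exprn_ile1// divr_ge0// ltW.
Qed.

Let trC1 k : C1fun (trF k) (trdF k).
Proof.
have cF := C1_continuous HF; split=> [t|t].
  have dt := HF.1 t.
  have nz : k.+1%:R + F t != 0 by rewrite gt_eqF.
  rewrite /trF.
  have dV : is_derive t (1 : R) (fun t => (k.+1%:R + F t)^-1) (- (k.+1%:R + F t) ^- 2 *: dF t).
    have -> : - (k.+1%:R + F t) ^- 2 *: dF t = - (k.+1%:R + F t) ^- 2 *: (0 + dF t) by rewrite add0r.
    exact: is_deriveV.
  apply: is_derive_eq.
  by rewrite /trdF /GRing.scale /=; field; rewrite nat1r.
have c1 : k.+1%:R / (k.+1%:R + F x) @[x --> t] --> k.+1%:R / (k.+1%:R + F t).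
  apply: cvgM; first exact: cvg_cst.
  apply: cvgV; first by rewrite gt_eqF.
  by apply: cvgD; [exact: cvg_cst|exact: cF].
rewrite (_ : trdF k = (fun x => dF x * ((k.+1%:R / (k.+1%:R + F x)) * (k.+1%:R / (k.+1%:R + F x))))).
  exact: (cvgM (HF.2 t) (cvgM c1 c1)).
by apply/funext => x; rewrite /trdF expr2.
Qed.

Let r_cvg t : k.+1%:R / (k.+1%:R + F t) @[k --> \oo] --> (1 : R).
Proof.
rewrite (_ : (fun k : nat => _) = (fun k : nat => 1 - F t / (k.+1%:R + F t))); last first.
  apply/funext => k; have := den k t; move=> /lt0r_neq0 h.
  by apply: (mulIf h); rewrite mulrBl !divfK// mul1r addrK.
rewrite -[X in _ --> X]subr0; apply: cvgB; first exact: cvg_cst.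
rewrite -(mulr0 (F t)); apply: cvgMr.
apply: (squeeze_cvgr (f := fun=> 0) (h := fun k : nat => k.+1%:R^-1)).
- by apply: nearW => k; rewrite invr_ge0 (ltW (den k t)) lef_pV2 ?posrE// lerDl F0.
- exact: cvg_cst.
- exact: cvg_harmonic.
Qed.

Let trF_cvg t : trF k t @[k --> \oo] --> F t.
Proof.
rewrite -[X in _ --> X]mul1r /trF.
rewrite (_ : (fun k => _) = (fun k : nat => k.+1%:R / (k.+1%:R + F t) * F t)).
  by apply: cvgM; [exact: r_cvg|exact: cvg_cst].
by apply/funext => k; rewrite mulrAC.
Qed.

Let trdF_cvg t : trdF k t @[k --> \oo] --> dF t.
Proof.
rewrite -[X in _ --> X]mulr1 -[X in _ * X](mulr1 1).
by apply: cvgM; [exact: cvg_cst|exact: (cvgM (r_cvg t) (r_cvg t))].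
Qed.

Let bF k t : `|trF k t| <= Num.max k.+1%:R L.
Proof. by rewrite ger0_norm// le_max trFk. Qed.

Let bdF k t : `|trdF k t| <= Num.max k.+1%:R L.
Proof. by rewrite ger0_norm// le_max (le_trans (trdFle _ _) (dFL t)) orbT. Qed.


(** The truncations tend to [F] from below: Fatou's lemma handles the left-hand side, while the
    right-hand side only grows when [trF k] and [trdF k] are replaced by [F] and [dF]. *)
Lemma test_inequality (al : 'rV[R]_n -> 'rV[R]_n) (be Ah Bh Hh : 'rV[R]_n -> R) (ai : R) :
  weak_identity al be -> growth_bounds du al be Ah Bh Hh ai -> 0 <= ai ->
  nnm B Ah -> nnm B Bh -> nnm B Hh ->
  IntFin B (fun x => Ah x `^ dual_exp p) -> IntFin B Bh ->
  (Int leb B (fun x => zeta x * dF (u x) * (ai * Qn x (du x) `^ p))%R <=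
   Int leb B (fun x => zeta x * dF (u x) * Hh x + F (u x) * Qn x (grad zeta x) * Ah x +
     zeta x * F (u x) * Bh x)%R)%E.
Proof.
move=> sol gr ai0 nAh nBh nHh iAh iBh.
have nz : nnm B zeta by split=> //; mst.
have ndF : nnm B (fun x => dF (u x)) by split=> //; mst.
have nF : nnm B (fun x => F (u x)) by split=> //; mst.
have nG : nnm B (fun x => Qn x (du x) `^ p) by nnmt.
have nQz : nnm B (fun x => Qn x (grad zeta x)) by split=> //; mst.
have mtr k : measurable_fun B (fun x => trF k (u x)).
  apply: (measurableT_comp (f := trF k)); last by mst.
  by apply: continuous_measurable_fun; exact: (C1_continuous (trC1 k)).
have mdtr k : measurable_fun B (fun x => trdF k (u x)).
  apply: (measurableT_comp (f := trdF k)); last by mst.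
  by apply: continuous_measurable_fun; exact: (trC1 k).2.
have ntr k : nnm B (fun x => trF k (u x)) by split.
have ndtr k : nnm B (fun x => trdF k (u x)) by split.
apply: (@Int_fatou _ _ _ _ _ (fun k x => zeta x * trdF k (u x) * (ai * Qn x (du x) `^ p))) => //.
- by move=> k; nnmt.
- by nnmt.
- apply: aeW => x Bx; apply: cvgMl; apply: cvgMr; exact: trdF_cvg.
move=> k.
apply: le_trans (test_inequality_bounded W (trC1 k) (bF k) (bdF k) sol gr ai0 nAh nBh nHh iAh iBh _ _) _ => //.
apply: Int_le => //; [by nnmt|by nnmt|apply: aeW => x Bx].
have Ah0 : 0 <= Ah x by exact: nAh.2.
have Bh0 : 0 <= Bh x by exact: nBh.2.
have Hh0 : 0 <= Hh x by exact: nHh.2.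
apply: lerD; first apply: lerD.
- by rewrite ler_wpM2r// ler_wpM2l.
- by rewrite ler_wpM2r// ler_wpM2r.
- by rewrite ler_wpM2r// ler_wpM2l.
Qed.

(** Membership of the cut-off composition in the Sobolev space is available for bounded
    nonlinearities. The truncations inherit the two bounds from [F], and Fatou's lemma transfers the
    conclusion to [F]. *)
Lemma sobolev_cutoff (sigma r C a c : R) : 0 <= sigma -> 0 <= r ->
  (forall w gw (a c : R), 0 <= a -> 0 <= c -> W1pQ_0 p Q B w gw ->
     Ile leb B (fun x => Qn x (gw x) `^ p) (fine (leb B) * a) ->
     Ile leb B (fun x => `|w x| `^ p) (fine (leb B) * c) ->
     Ile leb B (fun x => `|w x| `^ (p * sigma)) (fine (leb B) * (C * (r `^ p * a + c) `^ sigma))) ->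
  0 <= a -> 0 <= c ->
  Ile leb B (fun x => (zeta x * dF (u x) * Qn x (du x) + F (u x) * Qn x (grad zeta x)) `^ p) (fine (leb B) * a) ->
  Ile leb B (fun x => (zeta x * F (u x)) `^ p) (fine (leb B) * c) ->
  Ile leb B (fun x => (zeta x * F (u x)) `^ (p * sigma)) (fine (leb B) * (C * (r `^ p * a + c) `^ sigma)).
Proof.
move=> s0 r0 sob a0 c0 ia ic.
have mQdu : measurable_fun B (fun x => Qn x (du x)) by mst.
have mzB : measurable_fun B zeta by mst.
have mgB : measurable_fun B (fun x => Qn x (grad zeta x)) by mst.
have mFB : measurable_fun B (fun x => F (u x)) by mst.
have mdFB : measurable_fun B (fun x => dF (u x)) by mst.
have mtr k : measurable_fun B (fun x => trF k (u x)).
  apply: (measurableT_comp (f := trF k)); last by mst.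
  by apply: continuous_measurable_fun; exact: (C1_continuous (trC1 k)).
have pow_cvg (y : nat -> R) (l q : R) : y k @[k --> \oo] --> l -> (forall k, 0 <= y k) -> 0 <= q -> y k `^ q @[k --> \oo] --> l `^ q.
  exact: pow_cvg.
rewrite /Ile; apply: (@Int_fatou _ _ _ _ _ (fun k x => (zeta x * trF k (u x)) `^ (p * sigma))) => //.
- by move=> k; nnmt.
- by nnmt.
- apply: aeW => x Bx; apply: pow_cvg; last exact: mulr_ge0 (ltW p0) s0.
    by apply: cvgMr; exact: trF_cvg.
  by move=> k; rewrite mulr_ge0.
move=> k.
have W0 := cutoff_product_W0 W (trC1 k) (bF k) (bdF k).
have E q : (fun x => (zeta x * trF k (u x)) `^ q) = (fun x => `|zeta x * trF k (u x)| `^ q).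
  by apply/funext => x; rewrite ger0_norm// mulr_ge0.
rewrite E; have [_ mxi _] := W0.
have mQxi : measurable_fun B (fun x => Qn x ((zeta x * trdF k (u x)) *: du x + trF k (u x) *: grad zeta x)).
  exact: (Qn_measurable Om_open Q_measurable Q_psd).
apply: (sob _ _ a c a0 c0 W0).
  apply: (Ile_le mB _ _ _ _ ia); [by nnmt|by nnmt| |by []].
  apply: aeW => x Bx; apply: pow_le => //.
  apply: le_trans (QnormD _ _ _ _) _; rewrite !QnormZ !ger0_norm ?mulr_ge0//.
  by apply: lerD; rewrite ler_wpM2r// ler_wpM2l.
apply: (Ile_le mB _ _ _ _ ic); [by nnmt|by nnmt| |by []].
apply: aeW => x Bx; apply: pow_le => //.
by rewrite ger0_norm ?mulr_ge0// ler_wpM2l.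
Qed.

End unbounded_nonlinearity.

End cutoff_product.

End weak_solutions.

(** * From norms and averages to real bounds of integrals *)

Section norm_bounds.
Context {R : realType} {n : nat}.
Implicit Types (E B : set 'rV[R]_n) (f g : 'rV[R]_n -> R).

Lemma poweR_inv_le (x : \bar R) (q c : R) : (0 <= x)%E -> 0 < q -> (x `^ q^-1 <= c%:E)%E ->
  (x <= (c `^ q)%:E)%E.
Proof.
case: x => [r| |] r0 q0; last first.
- by have : false := r0.
- by rewrite poweRyr ?leye_eq// invr_eq0 gt_eqF.
rewrite poweR_EFin !lee_fin in r0 * => h.
rewrite -[leLHS]powRr1// -(mulVf (lt0r_neq0 q0)) powRrM.
by apply: pow_le.
Qed.

Lemma Lnorm_on_real E (q : R) f : 0 < q -> measurable_fun E f ->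
  Lnorm_on E q%:E f = (Int leb E (fun x => `|f x| `^ q)%R `^ q^-1)%E.
Proof.
move=> q0 mf; rewrite /Lnorm_on unlock; apply: (congr1 (fun z => z `^ q^-1)%E).
rewrite IntE [RHS]integral_mkcond; apply: eq_integral => x _.
rewrite patchE indicE; case: ifPn => xE.
  by rewrite mulr1 abse_EFin poweR_EFin.
by rewrite mulr0 abse_EFin normr0 poweR_EFin powR0// gt_eqF.
Qed.

Lemma Lnorm_on_Ile E (q c : R) f : 0 < q -> measurable_fun E f ->
  (Lnorm_on E q%:E f <= c%:E)%E -> Ile leb E (fun x => `|f x| `^ q) (c `^ q).
Proof.
move=> q0 mf; rewrite Lnorm_on_real// => h; apply: poweR_inv_le h => //.
by apply: Int_ge0; nnmt.
Qed.

Lemma Lnorm_on_ae E (c : R) f : (Lnorm_on E +oo f <= c%:E)%E -> \forall x \ae leb, E x -> `|f x| <= c.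
Proof.
rewrite /Lnorm_on unlock; case: ifPn => [_ /ess_supP|T0 _].
  apply: filterS => x h Ex; move: h; rewrite /= indicE mem_set// mulr1 lee_fin.
  exact.
apply/aeP; apply/eqP; rewrite eq_le lebesgue_outer_ge0 andbT.
apply: (@le_trans _ _ (leb [set: 'rV[R]_n])); first exact: le_lebesgue_outer.
by rewrite leNgt.
Qed.

(** Hoelder's inequality with the exponents t and t', where t = 1 and infinite t need separate
    arguments. The constant depends on [w] only through [c], which makes it uniform along
    approximating sequences. *)
Lemma hoelder_weight E (p : R) (t : \bar R) D : 0 < p -> (1 <= t)%E -> measurable E -> measurable_fun E D ->
  (Lnorm_on E (p%:E * t) D < +oo)%E ->
  forall c, 0 < c -> exists C, forall w, measurable_fun E w ->
    (Lnorm_on E (p%:E * hoelder_conjugate t) w <= c%:E)%E ->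
    Ile leb E (fun x => `|D x| `^ p * `|w x| `^ p) C.
Proof.
move=> p0 t1 mE mD Dfin c c0.
have nD : nnm E (fun x => `|D x| `^ p) by nnmt.
case: t t1 Dfin => [t| |//]; last first.
  move=> _; rewrite gt0_muley ?lte_fin// hoelder_conjugatey mule1 => Dfin.
  have D0 : (0 <= Lnorm_on E +oo D)%E by exact: Lnorm_ge0.
  have [e Ee] : exists e, Lnorm_on E +oo D = e%:E.
    by exists (fine (Lnorm_on E +oo D)); rewrite fineK// ge0_fin_numE.
  have De : (Lnorm_on E +oo D <= e%:E)%E by rewrite Ee.
  exists (e `^ p * c `^ p) => w mw /(Lnorm_on_Ile p0 mw) hw.
  have nw : nnm E (fun x => `|w x| `^ p) by nnmt.
  have := IleZ mE nw (powR_ge0 e p) hw.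
  apply: Ile_le => //; [by nnmt|by nnmt|].
  move: (Lnorm_on_ae De); apply: filterS => x h Ex.
  by rewrite ler_wpM2r//; apply: pow_le => //; exact: h.
rewrite lee_fin le_eqVlt => /predU1P[<-|t1].
  rewrite mule1 => Dfin; rewrite hoelder_conjugate1 gt0_muley ?lte_fin//.
  move: Dfin; rewrite Lnorm_on_real// => Dfin.
  have [A HA] : exists A, Ile leb E (fun x => `|D x| `^ p) A.
    apply/Ile_fin => //; rewrite ltey; apply/eqP => H; move: Dfin; rewrite H.
    by rewrite poweRyr ?ltxx// invr_eq0 gt_eqF.
  exists (c `^ p * A) => w mw hw.
  have := IleZ mE nD (powR_ge0 c p) HA.
  apply: Ile_le => //; [by nnmt|by nnmt|].
  move: (Lnorm_on_ae hw); apply: filterS => x h Ex.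
  by rewrite mulrC ler_wpM2r//; apply: pow_le => //; exact: h.
have t0 : 0 < t by exact: lt_trans t1.
have t'E : hoelder_conjugate t%:E = (t / (t - 1))%:E.
  by rewrite /hoelder_conjugate/= eqe gt_eqF// inver subr_eq0 gt_eqF.
have t'0 : 0 < t / (t - 1) by rewrite divr_gt0// subr_gt0.
rewrite t'E -!EFinM => Dfin.
have pt0 : 0 < p * t by [].
have pt'0 : 0 < p * (t / (t - 1)) by [].
move: Dfin; rewrite Lnorm_on_real// => Dfin.
have nDt : nnm E (fun x => `|D x| `^ (p * t)) by nnmt.
have [A HA] : exists A, Ile leb E (fun x => `|D x| `^ (p * t)) A.
  apply/Ile_fin => //; rewrite ltey; apply/eqP => H; move: Dfin; rewrite H.
  by rewrite poweRyr ?ltxx// invr_eq0 gt_eqF.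
pose A1 := Num.max A 1.
have A10 : 0 < A1 by rewrite lt_max ltr01 orbT.
have ct0 : 0 < c `^ (p * (t / (t - 1))) by exact: powR_gt0.
exists (A1 `^ t^-1 * (c `^ (p * (t / (t - 1)))) `^ (t / (t - 1))^-1) => w mw hw.
apply: Int_hoelder => //.
- by nnmt.
- by rewrite invf_div -[X in X + _]mul1r -mulrDl addrC subrK mulfV// gt_eqF.
- rewrite (_ : (fun x => _) = (fun x => `|D x| `^ (p * t))); last first.
    by apply/funext => x; rewrite powRrM.
  by apply: le_trans HA _; rewrite lee_fin le_max lexx.
- rewrite (_ : (fun x => _) = (fun x => `|w x| `^ (p * (t / (t - 1))))); last first.
    by apply/funext => x; rewrite -powRrM.
  exact: Lnorm_on_Ile.
Qed.

Lemma avg_norm_Ile E (q c : R) f : 0 < q -> measurable_fun E f -> 0 < fine (leb E) ->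
  (avg_norm E q%:E f <= c%:E)%E -> Ile leb E (fun x => `|f x| `^ q) (fine (leb E) * c `^ q).
Proof.
move=> q0 mf mE; rewrite /avg_norm /fint -IntE.
have I0 : (0 <= Int leb E (fun x => `|f x| `^ q)%R)%E by apply: Int_ge0; nnmt.
move=> /poweR_inv_le -/(_ _ q0) h.
have {}h : ((fine (leb E))^-1%:E * Int leb E (fun x => `|f x| `^ q)%R <= (c `^ q)%:E)%E.
  by apply: h; apply: mule_ge0 => //; rewrite lee_fin invr_ge0 ltW.
by rewrite /Ile EFinM -lee_pdivrMl//.
Qed.

Lemma Ile_avg_norm E (q a : R) f : 0 < q -> measurable_fun E f -> 0 < fine (leb E) -> 0 <= a ->
  Ile leb E (fun x => `|f x| `^ q) (fine (leb E) * a) -> (avg_norm E q%:E f <= (a `^ q^-1)%:E)%E.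
Proof.
move=> q0 mf mE a0 h; rewrite /avg_norm /fint -IntE -poweR_EFin.
have I0 : (0 <= Int leb E (fun x => `|f x| `^ q)%R)%E by apply: Int_ge0; nnmt.
set y := (_ * _)%E.
have y0 : (0 <= y)%E by apply: mule_ge0 => //; rewrite lee_fin invr_ge0 ltW.
have ya : (y <= a%:E)%E by rewrite lee_pdivrMl// -EFinM; exact: h.
have yf : y \is a fin_num by rewrite ge0_fin_numE//; apply: le_lt_trans ya _; exact: ltry.
rewrite -(fineK yf) poweR_EFin lee_fin; apply: pow_le => //.
- by rewrite fine_ge0.
- by rewrite -lee_fin fineK.
Qed.

End norm_bounds.

Section ball_data.
Context {R : realType} {n : nat}.
Variables (Om : set 'rV[R]_n) (p : R) (Q : 'rV[R]_n -> 'M[R]_n).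
Hypothesis Om_open : open Om.
Hypothesis Om_bounded : bounded_set Om.
Hypothesis p_gt1 : 1 < p.
Hypothesis Q_measurable : forall i j, measurable_fun Om (fun x => Q x i j).
Hypothesis Q_psd : forall x, Om x -> psdmx (Q x).
Variables (rho : 'rV[R]_n -> 'rV[R]_n -> R) (R2 : 'rV[R]_n -> R).
Hypothesis rho_open : balls_open Om rho.
Variable sigma : R.
Hypothesis sigma_gt1 : 1 < sigma.
Implicit Types (u v : 'rV[R]_n -> R) (g du : 'rV[R]_n -> 'rV[R]_n) (U B : set 'rV[R]_n).
Local Notation Qn := (Qnorm Q).
Local Notation ball_ := (qball Om rho).
Local Notation IntFin U f := (Int leb U f%R < +oo)%E.

Let p0 : 0 < p. Proof. exact: lt_trans p_gt1. Qed.
Let mO : measurable Om. Proof. exact: open_rV_measurable. Qed.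

Lemma qball_sub y r : ball_ y r `<=` Om. Proof. by move=> x []. Qed.

(** * Balls and cutoffs *)

(** This is Sobolev's inequality raised to the power [p * sigma]; [a] and [c] bound the averages of
    p-th powers, so that neither roots nor extended reals remain. *)
Definition sobolev_power (B : set 'rV[R]_n) (r C : R) : Prop :=
  forall w gw (a c : R), 0 <= a -> 0 <= c -> W1pQ_0 p Q B w gw ->
     Ile leb B (fun x => Qn x (gw x) `^ p) (fine (leb B) * a) ->
     Ile leb B (fun x => `|w x| `^ p) (fine (leb B) * c) ->
     Ile leb B (fun x => `|w x| `^ (p * sigma)) (fine (leb B) * (C * (r `^ p * a + c) `^ sigma)).

Lemma sobolev_power_exists : sobolev_inequality Om rho p Q R2 sigma ->
  exists2 C, 0 < C & forall y r, Om y -> 0 < r -> r < R2 y -> 0 < fine (leb (ball_ y r)) ->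
    sobolev_power (ball_ y r) r C.
Proof.
move=> [C1 C10 H]; exists (C1 `^ (p * sigma) * 2 `^ (p * sigma)); first exact: mulr_gt0.
move=> y r Oy r0 ry mB w gw a c a0 c0 W ia ic.
have s0 : 0 < sigma by exact: lt_trans sigma_gt1.
have ps0 : 0 < p * sigma by [].
have mBm : measurable (ball_ y r) by apply: open_rV_measurable; exact: rho_open.
have [mw mgw _] := W.
have BO := @qball_sub y r.
have mQ : measurable_fun (ball_ y r) (fun x => Qn x (gw x)).
  exact: (Qn_measurable Om_open Q_measurable Q_psd).
have h1 : (avg_norm (ball_ y r) p%:E (fun x => Qn x (gw x)) <= (a `^ p^-1)%:E)%E.
  apply: Ile_avg_norm => //; apply: le_trans ia.
  rewrite (_ : (fun x => _) = (fun x => Qn x (gw x) `^ p)) ?lexx//.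
  by apply/funext => x; rewrite ger0_norm.
have h2 : (avg_norm (ball_ y r) p%:E w <= (c `^ p^-1)%:E)%E by exact: Ile_avg_norm.
have := H y r Oy r0 ry w gw W.
move=> /le_trans -/(_ (C1%:E * (r%:E * (a `^ p^-1)%:E + (c `^ p^-1)%:E))%E) h.
have {}h : (avg_norm (ball_ y r) (p * sigma)%:E w <= (C1 * (r * a `^ p^-1 + c `^ p^-1))%:E)%E.
  have -> : ((C1 * (r * a `^ p^-1 + c `^ p^-1))%:E =
      C1%:E * (r%:E * (a `^ p^-1)%:E + (c `^ p^-1)%:E))%E by rewrite -!EFinM.
  apply: h; apply: lee_wpmul2l; first by rewrite lee_fin ltW.
  by apply: leeD => //; apply: lee_wpmul2l => //; rewrite lee_fin ltW.
apply: le_trans (avg_norm_Ile ps0 mw mB h) _.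
rewrite lee_fin ler_wpM2l ?(ltW mB)//.
have a1 : 0 <= r * a `^ p^-1 by rewrite mulr_ge0// ltW.
have rp : 0 <= r `^ p * a by [].
rewrite powRM ?(ltW C10) ?addr_ge0// -mulrA ler_wpM2l//.
rewrite powRrM [X in _ <= X * _]powRrM -powRM ?addr_ge0//; apply: pow_le; rewrite ?(ltW s0)//.
apply: le_trans (pow_add _ _ _) _; rewrite ?(ltW p0)//.
by rewrite powRM ?(ltW r0)// -!powRrM mulVf ?gt_eqF// !powRr1.
Qed.

(* [zeta j] is a large power of the cutoff eta_(j+1) of the paper, so that its gradient is
   controlled by a power of [zeta j] itself times D_j. *)
Definition cutoffs (B B' : set 'rV[R]_n) (r s1 Cc N : R) (zeta D : nat -> 'rV[R]_n -> R) : Prop :=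
  [/\ forall j, Lip_0 B (zeta j) /\ (forall x, 0 <= zeta j x <= 1),
      forall j x, B' x -> zeta j x = 1,
      forall j, nnm B (D j) /\ (\forall x \ae leb, B x ->
        Qn x (grad (zeta j) x) <= zeta j x `^ (1 - p^-1) * D j x),
      forall j x, (zeta j.+1 x != 0) || (D j.+1 x != 0) -> zeta j x = 1 &
      forall j, Ile leb B (fun x => (r * D j x) `^ s1) (fine (leb B) * (Cc * N ^+ j))].

(** A finite [s] is kept. For infinite [s] any finite exponent above the threshold will do; adding 1
    is an arbitrary choice. *)
Lemma avg_norm_exponent (s : \bar R) : ((p * dual_exp sigma)%:E < s)%E ->
  exists2 s1, p * dual_exp sigma < s1 & forall B f c, measurable B -> B `<=` Om -> measurable_fun B f ->
    0 < fine (leb B) -> (avg_norm B s f <= c%:E)%E ->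
    Ile leb B (fun x => `|f x| `^ s1) (fine (leb B) * c `^ s1).
Proof.
have q0 : 0 < p * dual_exp sigma.
  by rewrite mulr_gt0// /dual_exp divr_gt0 ?subr_gt0//; exact: lt_trans sigma_gt1.
case: s => [s| |].
- rewrite lte_fin => sq; exists s => // B f c mB BO mf B0; apply: avg_norm_Ile => //.
  exact: lt_trans sq.
- move=> _; exists (p * dual_exp sigma + 1); first by rewrite ltrDl.
  set s1 := _ + 1 => B f c mB BO mf B0 /Lnorm_on_ae h.
  have s10 : 0 <= s1 by rewrite addr_ge0// ltW.
  rewrite /Ile; have nc : nnm B (fun=> c `^ s1) by nnmt.
  apply: le_trans (Int_le mB _ nc _) _; first by nnmt.
    by move: h; apply: filterS => x h Bx; apply: pow_le => //; exact: h.
  rewrite Int_cst// muleC EFinM fineK ?lexx// ge0_fin_numE ?lebesgue_outer_ge0//.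
  exact: le_lt_trans (le_lebesgue_outer BO) (leb_Om Om_bounded).
- by move=> h; have : false := h.
Qed.


Lemma Wnorm_real U u g (M : R) : measurable_fun U u -> measurable_fun U (fun x => Qn x (g x)) -> 0 <= M ->
  Ile leb U (fun x => `|u x| `^ p) M -> Ile leb U (fun x => Qn x (g x) `^ p) M ->
  (Wnorm p Q U u g <= ((M + M) `^ p^-1)%:E)%E.
Proof.
move=> mu mg M0 h1 h2; rewrite /Wnorm -!IntE.
set y := (_ + _)%E.
have y0 : (0 <= y)%E by apply: adde_ge0; apply: Int_ge0; nnmt.
have ya : (y <= (M + M)%:E)%E by rewrite EFinD; apply: leeD; [exact: h1|exact: h2].
have yf : y \is a fin_num by rewrite ge0_fin_numE//; apply: le_lt_trans ya _; exact: ltry.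
rewrite -(fineK yf) poweR_EFin lee_fin; apply: pow_le => //.
- by rewrite fine_ge0.
- by rewrite -lee_fin fineK.
Qed.

(** The Sobolev norms of the approximants are bounded, so Hoelder's inequality and the bound with
    [C3] estimate their weighted integrals uniformly; Fatou's lemma passes to [u]. This admits a
    cutoff times [u] to Sobolev's inequality before any higher integrability of [u] is known. *)
Lemma weight_integrable B Dq (t : \bar R) C3 u du : measurable B -> B `<=` Om -> measurable_fun B Dq ->
  (1 <= t)%E -> (Lnorm_on B (p%:E * t) Dq < +oo)%E -> 0 < C3 ->
  (forall f, Lip_loc Om f -> (Lnorm_on B (p%:E * hoelder_conjugate t) f <= C3%:E * Wnorm p Q Om f (grad f))%E) ->
  W1pQ p Q Om u du -> IntFin B (fun x => `|Dq x| `^ p * `|u x| `^ p).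
Proof.
move=> mB BO mD t1 Dfin C30 HC W.
have [mu mdu _] := W.
have [v [S [Lv Wv nS iS HS]]] := W1pQ_fast Om_open p_gt1 Q_measurable Q_psd W.
have [ui gi] := W1pQ_fin Om_open p_gt1 Q_measurable Q_psd W.
have mQdu : measurable_fun Om (fun x => Qn x (du x)) by exact: (Qn_measurable Om_open Q_measurable Q_psd).
have k0 : 0 <= 2 `^ p by [].
have nu : nnm Om (fun x => `|u x| `^ p) by nnmt.
have ng : nnm Om (fun x => Qn x (du x) `^ p) by nnmt.
have [M1 HM1] : exists M, Ile leb Om (fun x => 2 `^ p * (S x + `|u x| `^ p)) M.
  by apply/Ile_fin; [nnmt|ift].
have [M2 HM2] : exists M, Ile leb Om (fun x => 2 `^ p * (S x + Qn x (du x) `^ p)) M.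
  by apply/Ile_fin; [nnmt|ift].
pose M := Num.max (Num.max M1 M2) 0.
have M0 : 0 <= M by rewrite le_max lexx orbT.
have mv k : measurable_fun Om (v k) by exact: lip_loc_measurable.
have mgv k : measurable_fun Om (fun x => Qn x (grad (v k) x)).
  by apply: (Qn_measurable Om_open Q_measurable Q_psd) => // i; exact: grad_measurable.
have Wk k : (Wnorm p Q Om (v k) (grad (v k)) <= ((M + M) `^ p^-1)%:E)%E.
  have mvk := mv k; have mgvk := mgv k; apply: Wnorm_real => //.
    apply: (Ile_le mO _ _ _ _ HM1); [by nnmt|by nnmt| |by rewrite !le_max lexx].
    move: HS; apply: filterS => x HS Ox; have [H1 _ _ _] := HS Ox.
    apply: (@le_trans _ _ ((`|v k x - u x| + `|u x|) `^ p)).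
      by apply: pow_le => //; apply: le_trans (ler_normD _ _); rewrite subrK.
    by apply: le_trans (pow_add _ _ _) _ => //; rewrite ler_wpM2l// lerD2r H1.
  apply: (Ile_le mO _ _ _ _ HM2); [by nnmt|by nnmt| |by rewrite !le_max lexx !orbT].
  move: HS; apply: filterS => x HS Ox; have [_ H1 _ _] := HS Ox.
  apply: (@le_trans _ _ ((Qn x (grad (v k) x - du x) + Qn x (du x)) `^ p)).
    by apply: pow_le => //; apply: le_trans (QnormD _ _ _ _); rewrite subrK.
  by apply: le_trans (pow_add _ _ _) _ => //; rewrite ler_wpM2l// lerD2r H1.
have c0 : 0 < C3 * (M + M) `^ p^-1 + 1 by rewrite ltr_wpDl// mulr_ge0// ltW.
have [C HCC] := hoelder_weight p0 t1 mB mD Dfin c0.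
have h k : Ile leb B (fun x => `|Dq x| `^ p * `|v k x| `^ p) C.
  apply: HCC; first by apply: measurable_funS (mv k).
  apply: le_trans (HC _ (Lv k)) _; apply: (@le_trans _ _ (C3 * (M + M) `^ p^-1)%:E).
    by rewrite EFinM; apply: lee_wpmul2l; [rewrite lee_fin ltW|exact: Wk].
  by rewrite lee_fin lerDl.
apply: (@le_lt_trans _ _ C%:E); last exact: ltry.
have nB k : nnm B (fun x => `|Dq x| `^ p * `|v k x| `^ p) by have := mv k => ?; nnmt.
apply: (Int_fatou mB nB); [by nnmt| |exact: h].
move: HS; apply: filterS => x HS Bx; have [_ _ H3 _] := HS (BO _ Bx).
by apply: cvgMr; apply: pow_cvg => //; exact: cvg_norm H3.
Qed.

(** The gradient of [eta^m] is [m eta^(m-1)] times that of [eta], and [m - 1 >= m (1 - 1/p)] because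
    [m >= p]. As [eta] is between 0 and 1, the larger exponent gives the smaller power. *)
Lemma grad_pow_cutoff B (eta : 'rV[R]_n -> R) (m : nat) : open B -> B `<=` Om -> p <= m%:R -> lipschitz eta ->
  (forall x, 0 <= eta x <= 1) ->
  \forall x \ae leb, B x -> Qn x (grad (fun x => eta x ^+ m) x) <=
    (eta x ^+ m) `^ (1 - p^-1) * (m%:R * Qn x (grad eta x)).
Proof.
move=> oB BO pm eL e01.
have Le : Lip_loc B eta.
  move=> x Bx; exists setT; first exact: filterT.
  by have [M M0 zM] := (lipschitz_inP _ _).1 eL; apply/lipschitz_inP; exists M => //; exact: lip_withS zM.
have : \forall x \ae leb, B x -> pd eta x.
  apply/aeP; apply: leb_null_sub (lip_loc_pd oB Le) => x /=.
  by move=> /not_implyP[? ?]; split.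
apply: filterS => x px Bx.
have /andP[e0 e1] := e01 x.
have HD : is_derive (eta x) (1 : R) (fun t => t ^+ m) (m%:R * eta x ^+ m.-1).
  have dX : is_derive (eta x) (1 : R) (@id R) 1 by exact: is_derive_id.
  have := @is_deriveX R _ _ m _ _ _ dX; rewrite /GRing.scale/= mulr1.
  rewrite (_ : (id ^+ m : R -> R) = (fun t => t ^+ m))//.
  by apply/funext => t; elim: (m) => [|k IH]; rewrite ?expr0// !exprS fctE IH.
rewrite (grad_comp (px Bx) HD).2 QnormZ ger0_norm ?mulr_ge0 ?exprn_ge0//.
suff h : eta x ^+ m.-1 <= (eta x ^+ m) `^ (1 - p^-1).
  by rewrite mulrAC mulrC ler_wpM2r// mulr_ge0.
have m1 : 1 < m%:R :> R by apply: lt_le_trans pm.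
have {}m1 : (1 < m)%N by move: m1; rewrite ltr1n.
move: e0; rewrite le_eqVlt => /predU1P[<-|e0].
  by rewrite (_ : m.-1 = m.-2.+1); [rewrite exprS mul0r|rewrite prednK// -ltnS prednK// ltnW].
rewrite -!powR_mulrn ?(ltW e0)// -powRrM.
apply: ger_powR; first by rewrite e0.
have h : 1 <= m%:R * p^-1 by rewrite ler_pdivlMr// mul1r.
have E : m.-1%:R = m%:R - 1 :> R by rewrite -[in RHS](prednK (ltnW m1)) -natr1 addrK.
by rewrite mulrBr mulr1 E lerD2l lerN2.
Qed.

Lemma cutoffs_exist : cutoff_conditions Om rho p Q R2 sigma ->
  exists s1 Cc N tau, [/\ p * dual_exp sigma < s1, 0 < Cc, 1 <= N, 0 < tau < 1 &
  forall y r, Om y -> 0 < r -> r < R2 y -> 0 < fine (leb (ball_ y r)) ->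
  exists zeta D, cutoffs (ball_ y r) (ball_ y (tau * r)) r s1 Cc N zeta D /\
  forall u du, W1pQ p Q Om u du -> IntFin (ball_ y r) (fun x => D 0%N x `^ p * `|u x| `^ p)].
Proof.
move=> [s [Cs [tau [N [t [ss [Cs0 tau0 tau1 N0] t1 H]]]]]].
have [s1 s1q Hs1] := avg_norm_exponent ss.
have s10 : 0 < s1.
  apply: lt_trans s1q; rewrite mulr_gt0// /dual_exp divr_gt0 ?subr_gt0//; exact: lt_trans sigma_gt1.
pose m := (Num.truncn p).+1; have pm : p <= m%:R by apply: ltW; rewrite /m; exact: truncnS_gt.
have m0 : 0 < m%:R :> R by exact: lt_le_trans pm.
(* With a base of at least 1 the powers are nondecreasing in [j], as the iteration requires. *)
pose N1 := Num.max N 1.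
have N10 : 0 < N1 by rewrite lt_max ltr01 orbT.
have N11 : 1 <= N1 by rewrite le_max lexx orbT.
exists s1, ((m%:R * Cs * N1) `^ s1), (N1 `^ s1), tau; split => //.
- by rewrite -(powRr0 N1); apply: ler_powR => //; exact: ltW.
- by rewrite tau0.
move=> y r Oy r0 ry mB0.
have [eta [[sup1 He] Hd [C3 C30 HC3]]] := H y r Oy r0 ry.
have oB : open (ball_ y r) by exact: rho_open.
have mB : measurable (ball_ y r) by exact: open_rV_measurable.
have BO := @qball_sub y r.
have eL j : lipschitz (eta j.+1) by have [] := He j.+1 isT.
have e01 j x : 0 <= eta j.+1 x <= 1 by have [_ h _ _ _] := He j.+1 isT; exact: h.
have supj j : supp (eta j.+1) `<=` ball_ y r.
  by case: j => // j; have [_ _ _ h _] := He j.+1 isT; move=> x /h[].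
have LL j : Lip_loc Om (eta j.+1).
  move=> x Bx; exists setT; first exact: filterT.
  by have [M M0 zM] := (lipschitz_inP _ _).1 (eL j); apply/lipschitz_inP; exists M => //; exact: lip_withS zM.
have mgr j : measurable_fun (ball_ y r) (fun x => Qn x (grad (eta j.+1) x)).
  have mg : measurable_fun Om (fun x => Qn x (grad (eta j.+1) x)).
    by apply: (Qn_measurable Om_open Q_measurable Q_psd) => // i; exact: grad_measurable.
  by mst.
(* Index [j] uses [eta j.+1], because the given cutoffs start at index 1. *)
pose D j x := m%:R * Qn x (grad (eta j.+1) x).
exists (fun j x => eta j.+1 x ^+ m), D; split; last first.
  move=> u du W; have [mu _ _] := W.
  have h := weight_integrable mB BO (mgr 0%N) t1 (Hd 1%N isT) C30 HC3 W.
  have muB : measurable_fun (ball_ y r) u by mst.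
  have mg0 := mgr 0%N.
  rewrite (_ : (fun x => _) = (fun x => m%:R `^ p * (`|Qn x (grad (eta 1%N) x)| `^ p * `|u x| `^ p))); last first.
    by apply/funext => x; rewrite /D powRM ?(ltW m0)// mulrA (ger0_norm (Qnorm_ge0 _ _ _)).
  by have mp : 0 <= m%:R `^ p :> R by []; ift.
split.
- move=> j; split; last first.
    by move=> x; have /andP[h1 h2] := e01 j x; rewrite exprn_ge0//= exprn_ile1.
  have [M M0 zM] := (lipschitz_inP _ _).1 (eL j).
  have sub : [set x | eta j.+1 x ^+ m != 0] `<=` [set x | eta j.+1 x != 0].
    by move=> x /=; apply: contraNN => /eqP ->; rewrite exprS mul0r.
  have cs : compact (supp (eta j.+1)).
    apply: bounded_closed_compact; last exact: closed_closure.
    by have [M' [M'r HM']] := Om_bounded; exists M'; split=> // N' MN' x /supj/BO; exact: HM'.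
  split.
  + apply/lipschitz_inP; exists (m%:R * M); first exact: mulr_ge0 (ltW m0) M0.
    move=> x z _ _; rewrite subrXX normrM.
    have h := zM x z Logic.I Logic.I.
    apply: le_trans (ler_wpM2r _ h) _ => //.
    rewrite [leRHS](_ : _ = M * `|x - z| * m%:R); last by ring.
    apply: ler_wpM2l; first by [].
    apply: le_trans (ler_norm_sum _ _ _) _.
    rewrite -[X in _ <= _ *+ X](card_ord m) -sumr_const.
    apply: ler_sum => i _; rewrite normrM !normrX.
    have nrm w : `|eta j.+1 w| <= 1.
      by have /andP[h1 h2] := e01 j w; rewrite ger0_norm.
    by rewrite -[leRHS]mul1r ler_pM// ?exprn_ge0// exprn_ile1.
  + apply: (subclosed_compact _ cs _); first exact: closed_closure.
    exact: closure_subset.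
  + by apply: subset_trans (supj j); exact: closure_subset.
- move=> j x Bx; have [_ _ h _ _] := He j.+1 isT.
  by rewrite h// expr1n.
- move=> j; split; first by split=> [|x _]; rewrite /D; [mst|].
  exact: grad_pow_cutoff.
- move=> j x hx.
  (* Outside this support the cutoff and its gradient vanish, and on it [eta j.+1] is 1. *)
  have sx : supp (eta j.+2) x.
    apply: contrapT => nx; move: hx; rewrite /D (grad_supp nx) Qnorm0 mulr0 eqxx orbF.
    have -> : eta j.+2 x = 0 by apply: contrapT => /eqP ex; apply: nx; exact: subset_closure.
    by rewrite exprS mul0r eqxx.
  by have [_ _ _ h _] := He j.+1 isT; have [_ ->] := h _ sx; rewrite expr1n.
- move=> j; have [_ _ _ _ h] := He j.+1 isT.
  have := Hs1 _ _ _ mB BO (mgr j) mB0 h.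
  rewrite (_ : (fun x => _) = (fun x => Qn x (grad (eta j.+1) x) `^ s1)); last first.
    by apply/funext => x; rewrite ger0_norm.
  have mg := mgr j; have n1 : nnm (ball_ y r) (fun x => Qn x (grad (eta j.+1) x) `^ s1) by nnmt.
  have rm0 : 0 <= (r * m%:R) `^ s1 by [].
  move=> /(IleZ mB n1 rm0) {}h.
  rewrite (_ : (fun x => _) = (fun x => (r * m%:R) `^ s1 * Qn x (grad (eta j.+1) x) `^ s1)); last first.
    by apply/funext => x; rewrite /D mulrA powRM// ltW// mulr_gt0.
  apply: le_trans h _; rewrite lee_fin mulrCA ler_wpM2l ?(ltW mB0)//.
  have NN : 0 <= N1 ^+ j by rewrite exprn_ge0// ltW.
  rewrite -(powR_mulrn j (powR_ge0 N1 s1)) powRAC powR_mulrn ?(ltW N10)//.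
  have N0' : 0 <= N by exact: ltW.
  have Cs0' : 0 <= Cs by exact: ltW.
  have N10' : 0 <= N1 by exact: ltW.
  have r0' : 0 <= r by exact: ltW.
  rewrite -!powRM ?mulr_ge0 ?invr_ge0 ?exprn_ge0//; apply: pow_le; rewrite ?mulr_ge0 ?invr_ge0 ?exprn_ge0 ?(ltW s10)//.
  rewrite (_ : r * m%:R * (Cs * N ^+ j.+1 / r) = m%:R * Cs * N ^+ j.+1); last first.
    by field; rewrite gt_eqF.
  rewrite -mulrA -[leRHS]mulrA -exprS -!mulrA ler_wpM2l// ler_wpM2l//.
  by apply: lerXn2r; rewrite ?nnegrE// le_max lexx.
Qed.

End ball_data.

(** * Caccioppoli's inequality *)

Section real_inequalities.
Context {R : realType}.
Implicit Types (x y : R).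

(** Young's inequality for [k * x] and [k^-1 * y], where [k^s = dl]. *)
Lemma young_eps (s t dl : R) : 0 < s -> 0 < t -> s^-1 + t^-1 = 1 -> 0 < dl ->
  exists2 C, 0 < C & forall x y, 0 <= x -> 0 <= y -> x * y <= dl * x `^ s + C * y `^ t.
Proof.
move=> s0 t0 st dl0; pose k := dl `^ s^-1.
have k0 : 0 < k by exact: powR_gt0.
exists ((k^-1) `^ t) => [|x y x0 y0]; first by rewrite powR_gt0// invr_gt0.
have -> : x * y = (k * x) * (k^-1 * y) by field; rewrite gt_eqF.
apply: le_trans (young _ _ s0 t0 st) _; rewrite ?mulr_ge0 ?invr_ge0 ?(ltW k0)//.
by rewrite !powRM ?invr_ge0 ?(ltW k0)// /k -powRrM mulVf ?gt_eqF// powRr1 ?(ltW dl0).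
Qed.

(** With [M = 1 + x^C + y^D] the factors are at most [M^(al / C)] and [M^(be / D)]. Since [M >= 1]
    and these exponents add up to at most 1, the product is at most [M]. This serves wherever the
    exponents are not conjugate. *)
Lemma pow_mul_le (al be C D x y : R) : 0 <= x -> 0 <= y -> 0 < C -> 0 < D -> 0 <= al -> 0 <= be ->
  al / C + be / D <= 1 -> x `^ al * y `^ be <= 1 + x `^ C + y `^ D.
Proof.
move=> x0 y0 C0 D0 a0 b0 h; set M := 1 + x `^ C + y `^ D.
have M1 : 1 <= M by rewrite /M -addrA lerDl.
have xM : x `^ C <= M by rewrite /M addrAC lerDr.
have yM : y `^ D <= M by rewrite /M lerDr.
have M0 : 0 <= M by exact: le_trans M1.
have e1 : x `^ al <= M `^ (al / C).
  rewrite (_ : al = C * (al / C)); last by field; rewrite gt_eqF.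
  by rewrite powRrM [C * _ / _](_ : _ = al / C); [apply: pow_le => //; rewrite divr_ge0// ltW|field; rewrite gt_eqF].
have e2 : y `^ be <= M `^ (be / D).
  rewrite (_ : be = D * (be / D)); last by field; rewrite gt_eqF.
  by rewrite powRrM [D * _ / _](_ : _ = be / D); [apply: pow_le => //; rewrite divr_ge0// ltW|field; rewrite gt_eqF].
apply: le_trans (ler_pM _ _ e1 e2) _ => //.
rewrite -powRD; last by apply/implyP => _; rewrite gt_eqF// (lt_le_trans _ M1).
by rewrite -[leRHS]powRr1//; apply: ler_powR.
Qed.

(** Here [G] stands for |sqrt(Q) grad u|, [w] for |u|, [z] for the cutoff and [Qz] for the length of
    its gradient. Young's inequality lets each of the two terms with a power of [G] cost
    [(4 a)^-1 G^p], together half of the coercivity. The term with [c] leaves [c^P v^P],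
    [P = p / (p + 1 - psi)]; its surplus [v^(P - p)] is charged to [1 + w] through the bound on
    [v]. *)
Lemma caccioppoli_pointwise (p a psi Cv : R) : 1 < p -> 0 < a -> p <= psi -> psi < p + 1 -> 0 <= Cv ->
  exists2 C0, 0 < C0 & forall G D z v w b c d e f g h F dF Qz : R,
  0 <= G -> 0 <= D -> 0 <= z <= 1 -> 0 <= v -> 0 <= w -> 0 <= b -> 0 <= c -> 0 <= d -> 0 <= e -> 0 <= f ->
  0 <= g -> 0 <= h -> 0 <= F -> 0 <= dF -> 0 <= Qz ->
  F <= dF * v -> v <= Cv * (1 + w) -> Qz <= z `^ (1 - p^-1) * D ->
  z * dF * (h * w `^ p + g) + F * Qz * (a * G `^ (p - 1) + b * w `^ (p - 1) + e) +
    z * F * (c * G `^ (psi - 1) + d * w `^ (p - 1) + f) <=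
  (2 * a)^-1 * (z * dF * G `^ p) + C0 * (dF * (D `^ p * v `^ p +
    z * (h + g + (b + e) `^ dual_exp p + d + f + c `^ (p / (p + 1 - psi)) * (1 + w) `^ (p / (p + 1 - psi) * (psi - p)))
      * (1 + w + v) `^ p)).
Proof.
move=> p1 a0 ppsi psip Cv0.
have p0 : 0 < p by exact: lt_trans p1.
have pm1 : 0 < p - 1 by rewrite subr_gt0.
have p'0 : 0 < dual_exp p by rewrite /dual_exp divr_gt0.
have pp' : (dual_exp p)^-1 + p^-1 = 1.
  by rewrite /dual_exp invf_div -[X in _ + X]mul1r -mulrDl subrK mulfV// gt_eqF.
have pp'1 : (p - 1) * dual_exp p = p by rewrite /dual_exp; field; rewrite gt_eqF.
pose P := p / (p + 1 - psi); pose s := p / (psi - 1).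
have e1 : 0 < p + 1 - psi by rewrite subr_gt0.
have e2 : 0 < psi - 1 by rewrite subr_gt0; exact: lt_le_trans ppsi.
have P0 : 0 < P by exact: divr_gt0.
have s0 : 0 < s by exact: divr_gt0.
have sP : s^-1 + P^-1 = 1.
  by rewrite /s /P !invf_div -mulrDl (_ : psi - 1 + _ = p) ?mulfV ?gt_eqF//; ring.
have dl0 : 0 < (4 * a)^-1 by rewrite invr_gt0 mulr_gt0.
have [C2 C20 Y2] := young_eps p'0 p0 pp' dl0.
have [C4 C40 Y4] := young_eps s0 P0 sP dl0.
have PP : P = (P - p) + p by rewrite subrK.
(* This identity turns the surplus power of [v] into the exponent of [1 + w] that appears in
   [Zf]. *)
have Ppsi : P - p = P * (psi - p) by rewrite /P; field; rewrite gt_eqF.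
have Pp0 : 0 <= P - p by rewrite Ppsi mulr_ge0 ?(ltW P0)// subr_ge0.
pose K := C2 * a `^ p; pose K4 := C4 * Cv `^ (P - p).
have K0 : 0 <= K by rewrite mulr_ge0// ltW.
have K40 : 0 <= K4 by rewrite mulr_ge0// ltW.
exists (K + K4 + 1); first by rewrite ltr_wpDl// addr_ge0.
move=> G D z v w b c d e f g h F dF Qz G0 D0 /andP[z0 z1] v0 w0 b0 c0 d0 e0 f0 g0 h0 F0 dF0 Qz0 Fv vw Qzle.
set U := 1 + w + v.
have U1 : 1 <= U by rewrite /U -addrA lerDl addr_ge0.
have U0 : 0 <= U by exact: le_trans U1.
have wU : w <= U by rewrite /U addrAC lerDr addr_ge0.
have vU : v <= U by rewrite /U lerDr addr_ge0.
have Up1 q : 0 <= q -> 1 <= U `^ q by move=> q0; apply: (@le_trans _ _ (1 `^ q)); [rewrite powR1|apply: pow_le].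
have UUp : U * U `^ (p - 1) = U `^ p by exact: mulr_powRB1.
set z1p := z `^ (1 - p^-1).
(* As a power with exponent p - 1 of [z^(1/p)], this factor becomes [z] when raised to the dual
   exponent of p. *)
have z1pE : z1p = (z `^ p^-1) `^ (p - 1).
  by rewrite /z1p -powRrM; congr (_ `^ _); field; rewrite gt_eqF.
have z1p0 : 0 <= z1p by [].
have zpK : (z `^ p^-1) `^ p = z by rewrite -powRrM mulVf ?gt_eqF// powRr1.
have h2 : z1p * G `^ (p - 1) * (a * D * v) <= (4 * a)^-1 * (z * G `^ p) + K * (D `^ p * v `^ p).
  have := Y2 (z1p * G `^ (p - 1)) (a * D * v).
  have -> : (z1p * G `^ (p - 1)) `^ dual_exp p = z * G `^ p.
    by rewrite z1pE -(powRM _ (powR_ge0 _ _) G0) -powRrM pp'1 (powRM _ (powR_ge0 _ _) G0) zpK.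
  have -> : (a * D * v) `^ p = a `^ p * (D `^ p * v `^ p).
    by rewrite !powRM ?mulr_ge0 ?(ltW a0)// mulrA.
  by move=> hh; apply: le_trans (hh _ _) _ => //; rewrite /K lerD2l -[leRHS]mulrA.
have h3 : z1p * ((b + e) * U `^ (p - 1)) * (D * v) <=
    z * ((b + e) `^ dual_exp p * U `^ p) + D `^ p * v `^ p.
  apply: le_trans (young _ _ p'0 p0 pp') _; rewrite ?mulr_ge0 ?addr_ge0//.
  have -> : (z1p * ((b + e) * U `^ (p - 1))) `^ dual_exp p = z * ((b + e) `^ dual_exp p * U `^ p).
    rewrite z1pE !powRM ?mulr_ge0 ?addr_ge0// -!powRrM pp'1.
    by rewrite mulVf ?gt_eqF// powRr1.
  by rewrite powRM.
have h4 : c * G `^ (psi - 1) * v <= (4 * a)^-1 * G `^ p +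
    K4 * (c `^ P * (1 + w) `^ (P * (psi - p)) * U `^ p).
  have := Y4 (G `^ (psi - 1)) (c * v) (powR_ge0 _ _) (mulr_ge0 c0 v0).
  rewrite -powRrM (_ : (psi - 1) * s = p); last by rewrite /s; field; rewrite gt_eqF.
  move=> hh; rewrite [leLHS](_ : _ = G `^ (psi - 1) * (c * v)); last by ring.
  apply: le_trans hh _; rewrite lerD2l /K4 -mulrA ler_wpM2l ?(ltW C40)//.
  rewrite powRM// [v `^ P](_ : _ = v `^ (P - p) * v `^ p); last first.
    by rewrite -powRD -?PP//; apply/implyP; rewrite gt_eqF.
  have v1 : v `^ (P - p) <= Cv `^ (P - p) * (1 + w) `^ (P * (psi - p)).
    by rewrite -Ppsi -powRM ?addr_ge0//; apply: pow_le.
  have v2 : v `^ p <= U `^ p by apply: pow_le => //; exact: ltW.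
  rewrite [leRHS](_ : _ = c `^ P * ((Cv `^ (P - p) * (1 + w) `^ (P * (psi - p))) * U `^ p)); last by ring.
  by rewrite ler_wpM2l// ler_pM.
have h5 : (d * w `^ (p - 1) + f) * v <= (d + f) * U `^ p.
  have : w `^ (p - 1) * v <= U `^ p.
    by rewrite -UUp mulrC; apply: ler_pM => //; apply: pow_le => //; exact: ltW.
  have : v <= U `^ p.
    apply: le_trans vU _; rewrite -[leLHS]mulr1 -UUp ler_wpM2l// Up1// ltW//.
  move=> k1 k2; rewrite mulrDl [leRHS]mulrDl -mulrA.
  by apply: lerD; rewrite ler_wpM2l.
have h1 : h * w `^ p + g <= (h + g) * U `^ p.
  rewrite mulrDl; apply: lerD.
    by rewrite ler_wpM2l//; apply: pow_le => //; exact: ltW.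
  by rewrite -[leLHS]mulr1 ler_wpM2l// Up1// ltW.
have h3' : b * w `^ (p - 1) + e <= (b + e) * U `^ (p - 1).
  rewrite mulrDl; apply: lerD.
    by rewrite ler_wpM2l//; apply: pow_le => //; exact: ltW.
  by rewrite -[leLHS]mulr1 ler_wpM2l// Up1// ltW.
set Gp := G `^ p in h2 h4 *; set Dv := D `^ p * v `^ p in h2 h3 *; set Up := U `^ p in h1 h3 h4 h5 *.
set E1 := a * G `^ (p - 1) + b * w `^ (p - 1) + e.
set E2 := c * G `^ (psi - 1) + d * w `^ (p - 1) + f.
set Zb := (b + e) `^ _ in h3 *; set Zc := c `^ P * _ in h4 *.
have E10 : 0 <= E1 by rewrite /E1 !addr_ge0 ?mulr_ge0// ltW.
have E20 : 0 <= E2 by rewrite /E2 !addr_ge0 ?mulr_ge0.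
have k1 : F * Qz * E1 <= dF * (v * (z1p * D) * E1).
  rewrite [leRHS](_ : _ = (dF * v) * (z1p * D) * E1); last by ring.
  by rewrite ler_wpM2r// ler_pM.
have k2 : z * F * E2 <= dF * (z * (v * E2)).
  rewrite [leRHS](_ : _ = z * (dF * v) * E2); last by ring.
  by rewrite ler_wpM2r// ler_wpM2l.
have k3 : v * (z1p * D) * E1 <= (4 * a)^-1 * (z * Gp) + K * Dv + (z * (Zb * Up) + Dv).
  rewrite (_ : v * (z1p * D) * E1 = z1p * G `^ (p - 1) * (a * D * v) + z1p * (b * w `^ (p - 1) + e) * (D * v)); last first.
    by rewrite /E1; ring.
  apply: lerD => //; apply: le_trans h3.
  by rewrite ler_wpM2r ?mulr_ge0// ler_wpM2l.
have k4 : v * E2 <= (4 * a)^-1 * Gp + K4 * (Zc * Up) + (d + f) * Up.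
  rewrite (_ : v * E2 = c * G `^ (psi - 1) * v + (d * w `^ (p - 1) + f) * v); last by rewrite /E2; ring.
  exact: lerD.
have k5 : z * (v * E2) <= z * ((4 * a)^-1 * Gp + K4 * (Zc * Up) + (d + f) * Up) by rewrite ler_wpM2l.
have k6 : z * (h * w `^ p + g) <= z * ((h + g) * Up) by rewrite ler_wpM2l.
have Up0 : 0 <= Up by exact: powR_ge0.
have Dv0 : 0 <= Dv by rewrite mulr_ge0.
have Zc0 : 0 <= Zc by rewrite mulr_ge0.
have Zb0 : 0 <= Zb by exact: powR_ge0.
have final : z * (h * w `^ p + g) + v * (z1p * D) * E1 + z * (v * E2) <=
   (2 * a)^-1 * (z * Gp) + (K + K4 + 1) * (Dv + z * (h + g + Zb + d + f + Zc) * Up).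
  apply: le_trans (lerD (lerD k6 k3) k5) _.
  have -> : (2 * a)^-1 = (4 * a)^-1 + (4 * a)^-1 by field; rewrite gt_eqF.
  have t1 : 0 <= K4 * Dv by rewrite mulr_ge0.
  have t2 : 0 <= (K + K4) * (z * ((h + g + Zb + d + f) * Up)) by rewrite !mulr_ge0// !addr_ge0.
  have t3 : 0 <= (K + 1) * (z * (Zc * Up)) by rewrite !mulr_ge0// addr_ge0.
  by move: t1 t2 t3; set q := (4 * a)^-1; clear; lra.
rewrite (_ : _ + z * F * E2 = z * dF * (h * w `^ p + g) + (F * Qz * E1 + z * F * E2)); last by rewrite addrA.
apply: (@le_trans _ _ (dF * (z * (h * w `^ p + g) + v * (z1p * D) * E1 + z * (v * E2)))).
  by move: k1 k2; clear; lra.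
apply: le_trans (ler_wpM2l dF0 final) _.
by set q := (2 * a)^-1; rewrite le_eqVlt; apply/orP; left; apply/eqP; ring.
Qed.

End real_inequalities.

Section solutions.
Context {R : realType} {n : nat}.
Variables (Om : set 'rV[R]_n) (p : R) (Q : 'rV[R]_n -> 'M[R]_n).
Hypothesis Om_open : open Om.
Hypothesis Om_bounded : bounded_set Om.
Hypothesis p_gt1 : 1 < p.
Hypothesis Q_measurable : forall i j, measurable_fun Om (fun x => Q x i j).
Hypothesis Q_psd : forall x, Om x -> psdmx (Q x).
Variables (a psi : R) (b c d e f g h : 'rV[R]_n -> R).
Hypothesis a0 : 0 < a.
Hypothesis ppsi : p <= psi.
Hypothesis psip : psi < p + 1.
Hypothesis nb : nnm Om b.
Hypothesis nc : nnm Om c.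
Hypothesis nd : nnm Om d.
Hypothesis ne : nnm Om e.
Hypothesis nf : nnm Om f.
Hypothesis ng : nnm Om g.
Hypothesis nh : nnm Om h.
Implicit Types (u v w : 'rV[R]_n -> R) (du : 'rV[R]_n -> 'rV[R]_n) (U B : set 'rV[R]_n).
Local Notation Qn := (Qnorm Q).
Local Notation IntFin U f := (Int leb U f%R < +oo)%E.

Let p0 : 0 < p. Proof. exact: lt_trans p_gt1. Qed.
Let mO : measurable Om. Proof. exact: open_rV_measurable. Qed.

Definition solution u du : Prop := exists al be,
  [/\ W1pQ p Q Om u du, weak_identity Om al be &
    growth_bounds Om p Q du al be
      (fun x => a * Qn x (du x) `^ (p - 1) + b x * `|u x| `^ (p - 1) + e x)
      (fun x => c x * Qn x (du x) `^ (psi - 1) + d x * `|u x| `^ (p - 1) + f x)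
      (fun x => h x * `|u x| `^ p + g x) a^-1].

(** All growth bounds are even in [u] and [du]. Upper bounds valid for every solution thus yield
    lower bounds. *)
Lemma solution_opp u du : solution u du -> solution (fun x => - u x) (fun x => - du x).
Proof.
move=> [al [be [W wi gr]]]; exists (fun x => - al x), (fun x => - be x); split.
- have HN : C1fun (fun t : R => - t) (fun=> -1).
    split=> [t|]; last exact: cst_continuous.
    by have dX : is_derive t (1 : R) (@id R) 1 by [exact: is_derive_id]; exact: is_deriveN.
  have N1 (t : R) : `|-1 : R| <= 1 by rewrite normrN1.
  have := W1pQ_comp Om_open Om_bounded p_gt1 Q_measurable Q_psd W HN N1.
  rewrite (_ : (fun x => -1 *: du x) = (fun x => - du x))//.
  by apply/funext => x; rewrite scaleN1r.
- move=> phi Lphi phi0; have [i1 i2] := wi phi Lphi phi0.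
  have E x : (dotr (grad phi x) (- al x) + phi x * - be x)%:E =
      (- (dotr (grad phi x) (al x) + phi x * be x)%:E)%E.
    by rewrite -scaleN1r dotrZr mulN1r mulrN -opprD.
  rewrite (_ : (fun x => _) = (fun x => - (dotr (grad phi x) (al x) + phi x * be x)%:E)%E); last first.
    by apply/funext => x; exact: E.
  split; first exact: integrableN.
  by rewrite integralN ?i2 ?oppe0//; apply: integrable_add_def.
- move: gr; apply: filterS => x gr Ox; have [g1 g2 g3] := gr Ox.
  rewrite !normrN !QnormN; split=> //.
    move=> xi; rewrite -scaleN1r dotrZr mulN1r normrN; exact: g1.
  have -> : dotr (- du x) (- al x) = dotr (du x) (al x); last by exact: g2.
  by rewrite -(scaleN1r (du x)) -(scaleN1r (al x)) dotrZr dotrZl !mulN1r opprK.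
Qed.

(* All coefficients, raised to the powers in which Young's inequality produces them. *)
Definition Zf u x := h x + g x + (b x + e x) `^ dual_exp p + d x + f x +
  c x `^ (p / (p + 1 - psi)) * (1 + `|u x|) `^ (p / (p + 1 - psi) * (psi - p)).

Lemma Zf_nnm u : measurable_fun Om u -> nnm Om (Zf u).
Proof. by move=> mu; rewrite /Zf; nnmt. Qed.

(** Both integrands are dominated by multiples of |sqrt(Q) du|^p and [Zf u * (1 + |u|)^p]. In this
    way the integrability demanded by [test_inequality] is supplied. *)
Lemma coef_integrable B u du : measurable B -> B `<=` Om -> W1pQ p Q Om u du ->
  IntFin B (fun x => Zf u x * (1 + `|u x|) `^ p) ->
  IntFin B (fun x => (a * Qn x (du x) `^ (p - 1) + b x * `|u x| `^ (p - 1) + e x) `^ dual_exp p) /\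
  IntFin B (fun x => c x * Qn x (du x) `^ (psi - 1) + d x * `|u x| `^ (p - 1) + f x).
Proof.
move=> mB BO W iZ; have [mu mdu _] := W.
have [_ gi] := W1pQ_fin Om_open p_gt1 Q_measurable Q_psd W.
have mQdu : measurable_fun Om (fun x => Qn x (du x)) by exact: (Qn_measurable Om_open Q_measurable Q_psd).
have nZ := Zf_nnm mu.
have nG : nnm Om (fun x => Qn x (du x) `^ p) by nnmt.
have nZu : nnm B (fun x => Zf u x * (1 + `|u x|) `^ p) by nnmt.
have pm1 : 0 < p - 1 by rewrite subr_gt0.
have p'0 : 0 < dual_exp p by rewrite /dual_exp divr_gt0.
have pp'1 : (p - 1) * dual_exp p = p by rewrite /dual_exp; field; rewrite gt_eqF.
have up1 q x : 0 <= q -> 1 <= (1 + `|u x|) `^ q.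
  by move=> q0; apply: (@le_trans _ _ (1 `^ q)); [rewrite powR1|apply: pow_le => //; rewrite lerDl].
have dom x : Om x -> [/\ 0 <= b x, 0 <= c x, 0 <= d x & 0 <= e x] /\ [/\ 0 <= f x, 0 <= g x & 0 <= h x].
  by move=> Ox; split; split; [exact: nb.2|exact: nc.2|exact: nd.2|exact: ne.2|exact: nf.2|exact: ng.2|exact: nh.2].
have bigZ x : Om x -> [/\ (b x + e x) `^ dual_exp p <= Zf u x, d x + f x <= Zf u x & c x `^ (p / (p + 1 - psi)) <= Zf u x].
  move=> Ox; have [[b0 c0 d0 e0] [f0 g0 h0]] := dom x Ox.
  have k0 : 0 <= (b x + e x) `^ dual_exp p by [].
  have k1 : c x `^ (p / (p + 1 - psi)) <= c x `^ (p / (p + 1 - psi)) * (1 + `|u x|) `^ (p / (p + 1 - psi) * (psi - p)).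
    rewrite -[leLHS]mulr1 ler_wpM2l// up1// mulr_ge0 ?subr_ge0// divr_ge0 ?(ltW p0)// subr_ge0 ltW//.
  have k2 : 0 <= c x `^ (p / (p + 1 - psi)) by [].
  by rewrite /Zf; move: k0 k1 k2; set A1 := _ `^ dual_exp p; set A2 := c x `^ _; set A3 := A2 * _; split; lra.
split.
  have k1 : 0 <= 2 `^ dual_exp p * a `^ dual_exp p by [].
  have k2 : 0 <= 2 `^ dual_exp p by [].
  have iD : IntFin B (fun x => 2 `^ dual_exp p * a `^ dual_exp p * Qn x (du x) `^ p +
    2 `^ dual_exp p * (Zf u x * (1 + `|u x|) `^ p)) by ift.
  apply: (Int_dom_fin mB _ _ iD); [by nnmt|by nnmt|apply: aeW => x Bx].
  have Ox := BO _ Bx; have [[b0 c0 d0 e0] [f0 g0 h0]] := dom x Ox; have [z1 z2 z3] := bigZ x Ox.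
  have h1 : b x * `|u x| `^ (p - 1) + e x <= (b x + e x) * (1 + `|u x|) `^ (p - 1).
    rewrite mulrDl; apply: lerD.
      by rewrite ler_wpM2l//; apply: pow_le => //; rewrite lerDr.
    by rewrite -[leLHS]mulr1 ler_wpM2l// up1// ltW.
  rewrite -addrA; apply: (@le_trans _ _ ((a * Qn x (du x) `^ (p - 1) + (b x + e x) * (1 + `|u x|) `^ (p - 1)) `^ dual_exp p)).
    by apply: pow_le => //; rewrite lerD2l.
  apply: le_trans (pow_add _ _ _) _ => //.
  rewrite !powRM// -!powRrM pp'1 -mulrA -mulrDr ler_wpM2l// lerD2l ler_wpM2r//.
pose P := p / (p + 1 - psi); pose s := p / (psi - 1).
have e1 : 0 < p + 1 - psi by rewrite subr_gt0.
have e2 : 0 < psi - 1 by rewrite subr_gt0; exact: lt_le_trans ppsi.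
have P0 : 0 < P by exact: divr_gt0.
have s0 : 0 < s by exact: divr_gt0.
have sP : P^-1 + s^-1 = 1.
  by rewrite /s /P !invf_div -mulrDl (_ : _ + (psi - 1) = p) ?mulfV ?gt_eqF//; ring.
have iD : IntFin B (fun x => Qn x (du x) `^ p + 2 * (Zf u x * (1 + `|u x|) `^ p)) by ift.
apply: (Int_dom_fin mB _ _ iD); [by nnmt|by nnmt|apply: aeW => x Bx].
have Ox := BO _ Bx; have [[b0 c0 d0 e0] [f0 g0 h0]] := dom x Ox; have [z1 z2 z3] := bigZ x Ox.
have Z0 : 0 <= Zf u x by exact: nZ.2.
have h1 : c x * Qn x (du x) `^ (psi - 1) <= c x `^ P + Qn x (du x) `^ p.
  apply: le_trans (young _ _ P0 s0 sP) _ => //.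
  by rewrite -powRrM (_ : (psi - 1) * s = p)//; rewrite /s; field; rewrite gt_eqF.
have h2 : c x `^ P <= Zf u x * (1 + `|u x|) `^ p.
  by apply: le_trans z3 _; rewrite -[leLHS]mulr1 ler_wpM2l// up1// ltW.
have h3 : d x * `|u x| `^ (p - 1) + f x <= Zf u x * (1 + `|u x|) `^ p.
  apply: (@le_trans _ _ ((d x + f x) * (1 + `|u x|) `^ p)); last by rewrite ler_wpM2r.
  rewrite mulrDl; apply: lerD; last by rewrite -[leLHS]mulr1 ler_wpM2l// up1// ltW.
  rewrite ler_wpM2l//; apply: (@le_trans _ _ ((1 + `|u x|) `^ (p - 1))).
    by apply: pow_le => //; rewrite lerDr.
  by apply: ler_powR; [rewrite lerDl|rewrite gerBl].
by move: h1 h2 h3; set A1 := c x `^ P; set A2 := Zf u x * _; set A3 := _ `^ p; lra.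
Qed.

(** The pointwise inequality is integrated and half of the coercive term absorbed. The function [v]
    with [F <= dF * v] keeps the inequality flexible: for a ramp it is the height above the level,
    for the logarithmic estimate a multiple of the distance to the singularity. *)
Lemma caccioppoli (Cv : R) : 0 <= Cv -> exists2 C0, 0 < C0 &
  forall u du, solution u du -> forall B zeta D, open B -> B `<=` Om -> Lip_0 B zeta ->
  (forall x, 0 <= zeta x <= 1) -> IntFin B (fun x => Qn x (grad zeta x) `^ p) ->
  nnm B D -> (\forall x \ae leb, B x -> Qn x (grad zeta x) <= zeta x `^ (1 - p^-1) * D x) ->
  IntFin B (fun x => Zf u x * (1 + `|u x|) `^ p) ->
  forall F dF L v, C1fun F dF -> (forall t, 0 <= F t) -> (forall t, 0 <= dF t <= L) -> nnm B v ->
  (\forall x \ae leb, B x -> F (u x) <= dF (u x) * v x /\ v x <= Cv * (1 + `|u x|)) ->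
  forall M, Ile leb B (fun x => dF (u x) * (D x `^ p * v x `^ p + zeta x * Zf u x * (1 + `|u x| + v x) `^ p)) M ->
  Ile leb B (fun x => zeta x * dF (u x) * Qn x (du x) `^ p) (C0 * M).
Proof.
move=> Cv0; have [C0 C00 HC] := caccioppoli_pointwise p_gt1 a0 ppsi psip Cv0.
exists (2 * a * C0); first by rewrite !mulr_gt0.
move=> u du [al [be [W wi gr]]] B zeta D oB BO Lz z01 iz nD zD iZ F dF L v HF F0 dF01 nv hv M HM.
have [mu mdu _] := W.
have mB : measurable B by exact: open_rV_measurable.
have mQdu : measurable_fun Om (fun x => Qn x (du x)) by exact: (Qn_measurable Om_open Q_measurable Q_psd).
have [iA iB] := coef_integrable mB BO W iZ.
have [_ gi] := W1pQ_fin Om_open p_gt1 Q_measurable Q_psd W.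
have dF0 t : 0 <= dF t by have /andP[] := dF01 t.
have dFL t : dF t <= L by have /andP[] := dF01 t.
have L0 : 0 <= L by exact: le_trans (dFL 0).
have mFu : measurable_fun Om (fun x => F (u x)).
  by apply: (measurableT_comp (f := F)) => //; apply: continuous_measurable_fun; exact: (C1_continuous HF).
have mdFu : measurable_fun Om (fun x => dF (u x)).
  by apply: (measurableT_comp (f := dF)) => //; apply: continuous_measurable_fun; exact: HF.2.
have ndF : nnm Om (fun x => dF (u x)) by split.
have nF : nnm Om (fun x => F (u x)) by split.
have nQdu : nnm Om (fun x => Qn x (du x)) by split.
have nz : nnm B zeta.
  split=> [|x _]; last by have /andP[] := z01 x.
  by have := zeta_measurable Om_open Lz => mz; mst.
have nQz : nnm B (fun x => Qn x (grad zeta x)).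
  by split=> //; have := Qgrad_zeta_measurable Om_open Q_measurable Q_psd Lz => mz; mst.
have nA : nnm B (fun x => a * Qn x (du x) `^ (p - 1) + b x * `|u x| `^ (p - 1) + e x) by nnmt.
have nB : nnm B (fun x => c x * Qn x (du x) `^ (psi - 1) + d x * `|u x| `^ (p - 1) + f x) by nnmt.
have nH : nnm B (fun x => h x * `|u x| `^ p + g x) by nnmt.
have ai0 : 0 <= a^-1 by rewrite invr_ge0 ltW.
have T := test_inequality Om_open p_gt1 Q_measurable Q_psd oB BO Lz z01 iz W HF F0 dF0 dFL
  wi gr ai0 nA nB nH iA iB.
have nZ := Zf_nnm mu.
pose X x := zeta x * dF (u x) * Qn x (du x) `^ p.
pose Y x := dF (u x) * (D x `^ p * v x `^ p + zeta x * Zf u x * (1 + `|u x| + v x) `^ p).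
have nX : nnm B X by rewrite /X; nnmt.
have nY : nnm B Y by rewrite /Y; nnmt.
(* Absorption is legitimate only for a finite integral; the bound [L] for [dF] provides this. *)
have iX : IntFin B X.
  have nG : nnm Om (fun x => Qn x (du x) `^ p) by nnmt.
  have iD : IntFin B (fun x => L * Qn x (du x) `^ p) by ift.
  apply: (Int_dom_fin mB _ _ iD); [by []|by nnmt|apply: aeW => x Bx].
  have /andP[z0 z1] := z01 x; rewrite /X ler_wpM2r// -[leRHS]mul1r ler_pM//.
have [i Xi] : exists i, Int leb B X = i%:E.
  by exists (fine (Int leb B X)); rewrite fineK// ge0_fin_numE//; exact: Int_ge0.
have k1 : 0 <= (2 * a)^-1 by rewrite invr_ge0 ltW// mulr_gt0.
have k2 : 0 <= C0 by exact: ltW.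
have h1 : (Int leb B (fun x => (2 * a)^-1 * X x + C0 * Y x)%R <= ((2 * a)^-1 * i + C0 * M)%:E)%E.
  rewrite IntD//; [|by nnmt|by nnmt].
  by rewrite !IntZ// Xi EFinD EFinM; apply: leeD => //; rewrite EFinM; apply: lee_wpmul2l; [rewrite lee_fin|exact: HM].
have h2 : (a^-1 * i)%:E = Int leb B (fun x => zeta x * dF (u x) * (a^-1 * Qn x (du x) `^ p))%R.
  rewrite EFinM -Xi -IntZ//; congr (Int _ _ _); apply/funext => x.
  by rewrite /X; ring.
have h3 : (a^-1 * i <= (2 * a)^-1 * i + C0 * M)%R.
  rewrite -lee_fin; apply: le_trans h1; rewrite h2; apply: le_trans T _.
  apply: Int_le => //; [by nnmt|by nnmt|].
  move: zD hv; apply: filterS2 => x zD hv Bx; have Ox := BO _ Bx.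
  have [v1 v2] := hv Bx.
  apply: HC => //; first [exact: nD.2|exact: nv.2|exact: nb.2|exact: nc.2|exact: nd.2|exact: ne.2|exact: nf.2|exact: ng.2|exact: nh.2|exact: zD].
rewrite /Ile -/X Xi lee_fin.
have -> : i = 2 * a * (a^-1 * i - (2 * a)^-1 * i) by field; rewrite gt_eqF.
by rewrite -[leRHS]mulrA; apply: ler_wpM2l; [rewrite mulr_ge0// ltW|rewrite lerBlDl].
Qed.


End solutions.

(** * De Giorgi iteration *)

Section glue.
Context {R : realType}.

Lemma is_deriveP (f : R -> R) (t d : R) :
  is_derive t (1 : R) f d <-> h^-1 *: (f (h *: 1 + t) - f t) @[h --> 0^'] --> d.
Proof.
split=> [[dv <-]|H]; first exact: dv.
split; first by apply/cvg_ex; exists d; exact: H.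
by apply/cvg_lim; [exact: norm_hausdorff|exact: H].
Qed.

Lemma near_is_derive (f g : R -> R) (t d : R) : {near t, f =1 g} -> is_derive t (1 : R) f d ->
  is_derive t (1 : R) g d.
Proof.
move=> fg [dv <-]; split; first exact: near_eq_derivable dv.
by apply/esym; apply: near_eq_derive.
Qed.

Lemma C1_glue (f df g dg : R -> R) (c : R) :
  (forall t, t <= c -> is_derive t (1 : R) f (df t)) -> (forall t, c <= t -> is_derive t (1 : R) g (dg t)) ->
  (forall t, t <= c -> {for t, continuous df}) -> (forall t, c <= t -> {for t, continuous dg}) ->
  f c = g c -> df c = dg c ->
  C1fun (fun t => if t <= c then f t else g t) (fun t => if t <= c then df t else dg t).
Proof.
move=> Hf Hg cf cg fgc dfgc; split=> t; have [tc|tc|->] := ltgtP t c.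
- apply: near_is_derive (Hf t (ltW tc)); near=> s.
  have -> // : s <= c; apply: ltW; near: s; exact: lt_nbhsl.
- apply: near_is_derive (Hg t (ltW tc)); near=> s.
  have cs : c < s by near: s; exact: lt_nbhsr.
  by rewrite leNgt cs.
- apply/is_deriveP; rewrite lexx.
  have /is_deriveP Hf' := Hf c (lexx c); have /is_deriveP Hg' := Hg c (lexx c).
  apply/cvgrPdist_lt => e e0.
  move/cvgrPdist_lt : Hf' => /(_ e e0) Hf'; move/cvgrPdist_lt : Hg' => /(_ e e0) Hg'.
  near=> h; case: ifPn => _; first by near: h; exact: Hf'.
  rewrite fgc dfgc; near: h; exact: Hg'.
- have : df s @[s --> t] --> df t by exact: cf (ltW tc).
  rewrite /continuous_at (ltW tc); apply: cvg_trans; apply: near_eq_cvg; near=> s.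
  have -> // : s <= c; apply: ltW; near: s; exact: lt_nbhsl.
- have : dg s @[s --> t] --> dg t by exact: cg (ltW tc).
  rewrite /continuous_at leNgt tc /=; apply: cvg_trans; apply: near_eq_cvg; near=> s.
  have cs : c < s by near: s; exact: lt_nbhsr.
  by rewrite leNgt cs.
- rewrite /continuous_at lexx.
  have /cvgrPdist_lt Hf' : df s @[s --> c] --> df c by exact: cf.
  have /cvgrPdist_lt Hg' : dg s @[s --> c] --> dg c by exact: cg.
  apply/cvgrPdist_lt => e e0; have := Hf' e e0; have := Hg' e e0.
  apply: filterS2 => s h1 h2; case: ifPn => _; first exact: h2.
  by rewrite dfgc.
Unshelve. all: by end_near.
Qed.

(* A convex function of class C1 lying between t - k - e and the positive part of t - k. *)
Definition ramp (k e t : R) : R := if t <= k then 0 else (t - k) ^+ 2 / (t - k + e).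
Definition dramp (k e t : R) : R := if t <= k then 0 else 1 - (e / (t - k + e)) ^+ 2.

Lemma ramp_C1 k e : 0 < e -> C1fun (ramp k e) (dramp k e).
Proof.
move=> e0; apply: (@C1_glue (fun=> 0) (fun=> 0)).
- move=> t kt.
  have nz : t - k + e != 0 by rewrite gt_eqF// ltr_wpDl// subr_ge0.
  have dV : is_derive t (1 : R) (fun t => (t - k + e)^-1) (- (t - k + e) ^- 2 *: (1 - 0 + 0)).
    by apply: is_deriveV.
  apply: is_derive_eq; rewrite /GRing.scale /=; field; exact: nz.
- by move=> t _; exact: cst_continuous.
- move=> t kt; have nz : t - k + e != 0 by rewrite gt_eqF// ltr_wpDl// subr_ge0.
  have c0 : s - k + e @[s --> t] --> t - k + e.
    by apply: cvgD; [apply: cvgB; [exact: cvg_id|exact: cvg_cst]|exact: cvg_cst].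
  have c1 : e / (s - k + e) @[s --> t] --> e / (t - k + e).
    by apply: cvgM; [exact: cvg_cst|exact: cvgV].
  rewrite (_ : (fun t => _) = (fun s => 1 - e / (s - k + e) * (e / (s - k + e)))); last first.
    by apply/funext => s; rewrite expr2.
  have c2 := cvgM c1 c1.
  have c3 : 1 - e / (s - k + e) * (e / (s - k + e)) @[s --> t] --> 1 - e / (t - k + e) * (e / (t - k + e)).
    by apply: cvgB; [exact: cvg_cst|exact: c2].
  exact: c3.
- by rewrite subrr expr0n/= mul0r.
- by rewrite subrr add0r divff ?gt_eqF// expr1n subrr.
Qed.

Lemma ramp_ge0 k e t : 0 < e -> 0 <= ramp k e t.
Proof.
move=> e0; rewrite /ramp; case: (leP t k) => // kt.
by rewrite divr_ge0 ?sqr_ge0// addr_ge0 ?subr_ge0// ltW.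
Qed.

Lemma dramp_bounds k e t : 0 < e -> 0 <= dramp k e t <= 1.
Proof.
move=> e0; rewrite /dramp; case: (leP t k) => [_|kt]; first by rewrite lexx ler01.
have d0 : 0 < t - k + e by rewrite addr_gt0// subr_gt0.
rewrite subr_ge0 gerBl sqr_ge0 andbT exprn_ile1//.
by rewrite ler_pdivrMr// mul1r lerDr subr_ge0 ltW.
Qed.

Lemma ramp_le k e t : 0 < e -> ramp k e t <= Num.max (t - k) 0.
Proof.
move=> e0; rewrite /ramp; case: (leP t k) => [_|kt]; first by rewrite le_max lexx orbT.
have d0 : 0 < t - k + e by rewrite addr_gt0// subr_gt0.
rewrite le_max ler_pdivrMr// expr2 ler_wpM2l ?subr_ge0 ?(ltW kt)//.
by rewrite lerDl ltW.
Qed.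

Lemma ramp_convex k e t : 0 < e -> ramp k e t <= dramp k e t * Num.max (t - k) 0.
Proof.
move=> e0; rewrite /ramp /dramp; case: (leP t k) => [_|kt]; first by rewrite mul0r.
have s0 : 0 < t - k by rewrite subr_gt0.
have d0 : 0 < t - k + e by rewrite addr_gt0.
rewrite max_l ?(ltW s0)//; move: s0 d0; set s := t - k => s0 d0.
rewrite -subr_ge0.
rewrite (_ : _ - _ = s * (s * e) / (s + e) ^+ 2); last by field; rewrite gt_eqF.
by rewrite divr_ge0 ?sqr_ge0// !mulr_ge0// ltW.
Qed.

Lemma ramp_half k e t : 0 < e -> e <= t - k -> (t - k) / 2 <= ramp k e t.
Proof.
move=> e0 et; have s0 : 0 < t - k by exact: lt_le_trans et.
have kt : k < t by rewrite -subr_gt0.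
rewrite /ramp (lt_geF kt).
have d0 : 0 < t - k + e by rewrite addr_gt0.
rewrite ler_pdivlMr// mulrAC expr2 -mulrA ler_wpM2l ?(ltW s0)//.
rewrite ler_pdivrMr//; move: et s0; lra.
Qed.

Lemma ramp_ge k e t : 0 < e -> t - k - e <= ramp k e t.
Proof.
move=> e0; rewrite /ramp; case: (leP t k) => [kt|kt]; first by move: kt e0; lra.
have s0 : 0 < t - k by rewrite subr_gt0.
have d0 : 0 < t - k + e by rewrite addr_gt0.
by rewrite ler_pdivlMr// -subr_sqr lerBlDr lerDl sqr_ge0.
Qed.

(** This solves the recursion [Y' <= K0 Mg^j Y^be]. The ratio satisfies [r^(be-1) = 1 / (Mg + 1)],
    which beats [Mg^j], and [nu^(be-1) = r / K0] supplies the additional factor [r]; the added 1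
    ensures [r < 1]. *)
Lemma geometric_decay (K0 Mg be : R) : 0 < K0 -> 0 < Mg -> 1 < be ->
  exists nu r : R, [/\ 0 < nu, 0 < r < 1 & forall j, K0 * Mg ^+ j * (nu * r ^+ j) `^ be <= nu * r ^+ j.+1].
Proof.
move=> K00 Mg0 be1; pose b1 := be - 1; have b10 : 0 < b1 by rewrite subr_gt0.
have M10 : 0 < Mg + 1 by rewrite addr_gt0.
pose r := (Mg + 1) `^ (- b1^-1).
have r0 : 0 < r by exact: powR_gt0.
have rb : r `^ b1 = (Mg + 1)^-1.
  by rewrite -powRrM mulNr mulVf ?gt_eqF// powR_inv1// ltW.
have r1 : r < 1.
  rewrite ltNge; apply/negP => r1.
  have : 1 <= r `^ b1 by apply: (@le_trans _ _ (1 `^ b1)); [rewrite powR1|apply: pow_le => //; exact: ltW].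
  by rewrite rb leNgt invf_lt1// ltrDr Mg0.
pose nu := (r / K0) `^ b1^-1.
have nu0 : 0 < nu by rewrite powR_gt0// divr_gt0.
have nub : nu `^ b1 = r / K0 by rewrite -powRrM mulVf ?gt_eqF// powRr1// divr_ge0// ltW.
exists nu, r; split => //; first by rewrite r0.
move=> j.
have bE : be = 1 + b1 by rewrite /b1; ring.
have P x : 0 < x -> x `^ be = x * x `^ b1.
  by move=> x0; rewrite bE powRD ?powRr1 ?(ltW x0)//; apply/implyP => _; rewrite gt_eqF.
have rj0 : 0 < r ^+ j by exact: exprn_gt0.
rewrite P ?mulr_gt0// powRM ?(ltW nu0) ?(ltW rj0)// nub.
have -> : (r ^+ j) `^ b1 = (Mg + 1) ^- j.
  by rewrite -(powR_mulrn j (ltW r0)) powRAC rb powR_mulrn ?invr_ge0 ?(ltW M10)// exprVn.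
rewrite (_ : _ * _ = nu * r ^+ j.+1 * (Mg / (Mg + 1)) ^+ j); last first.
  rewrite exprS [(Mg / _) ^+ j]exprMn exprVn.
  have X0 : 0 < (Mg + 1) ^+ j by exact: exprn_gt0.
  by move: X0; set X := (Mg + 1) ^+ j; set Y := r ^+ j; set Z := Mg ^+ j => X0; field; rewrite !gt_eqF.
rewrite -[leRHS]mulr1 ler_wpM2l ?mulr_ge0 ?exprn_ge0 ?(ltW nu0) ?(ltW r0)//.
by rewrite exprn_ile1 ?divr_ge0 ?(ltW Mg0) ?(ltW M10)// ler_pdivrMr// mul1r lerDl.
Qed.

End glue.

Section de_giorgi.
Context {R : realType} {n : nat}.
Variables (Om : set 'rV[R]_n) (p : R) (Q : 'rV[R]_n -> 'M[R]_n).
Hypothesis Om_open : open Om.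
Hypothesis Om_bounded : bounded_set Om.
Hypothesis p_gt1 : 1 < p.
Hypothesis Q_measurable : forall i j, measurable_fun Om (fun x => Q x i j).
Hypothesis Q_psd : forall x, Om x -> psdmx (Q x).
Variable sigma : R.
Hypothesis sigma_gt1 : 1 < sigma.
Implicit Types (u v w : 'rV[R]_n -> R) (du : 'rV[R]_n -> 'rV[R]_n) (U : set 'rV[R]_n).
Local Notation Qn := (Qnorm Q).
Local Notation IntFin U f := (Int leb U f%R < +oo)%E.

Let p0 : 0 < p. Proof. exact: lt_trans p_gt1. Qed.
Let sigma0 : 0 < sigma. Proof. exact: lt_trans sigma_gt1. Qed.

Variables (B B' : set 'rV[R]_n) (r s1 Cc N CS : R) (zeta D : nat -> 'rV[R]_n -> R).
Hypothesis B_open : open B.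
Hypothesis BO : B `<=` Om.
Hypothesis r0 : 0 < r.
Hypothesis mB0 : 0 < fine (leb B).
Hypothesis s1_gt : p < s1.
Hypothesis Cc0 : 0 < Cc.
Hypothesis N1 : 1 <= N.
Hypothesis CS0 : 0 < CS.
Hypothesis cut : cutoffs p Q B B' r s1 Cc N zeta D.
Hypothesis sob : sobolev_power p Q sigma B r CS.

Let mB : measurable B. Proof. exact: open_rV_measurable. Qed.
Let mO : measurable Om. Proof. exact: open_rV_measurable. Qed.

Let lebBfin : (leb B < +oo)%E.
Proof. exact: le_lt_trans (le_lebesgue_outer BO) (leb_Om Om_bounded). Qed.

Let lebB : leb B = (fine (leb B))%:E.
Proof. by rewrite fineK// ge0_fin_numE// lebesgue_outer_ge0. Qed.

Lemma Ile_cst k : 0 <= k -> Ile leb B (fun=> k) (fine (leb B) * k).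
Proof. by move=> k0; rewrite /Ile Int_cst// [X in (_ * X)%E]lebB -EFinM mulrC. Qed.

(** The exponent [s1] exceeds [p], and [B] has finite measure. *)
Lemma cutoff_grad_int j : IntFin B (fun x => Qn x (grad (zeta j) x) `^ p).
Proof.
have [c1 c2 c3 c4 c5] := cut; have [Lz z01] := c1 j; have [nD gD] := c3 j.
have mz : measurable_fun B (fun x => Qn x (grad (zeta j) x)).
  by have := Qgrad_zeta_measurable Om_open Q_measurable Q_psd Lz => h; mst.
have iD : IntFin B (fun x => (r * D j x) `^ s1) by apply: le_lt_trans (c5 j) _; exact: ltry.
have k1 : 0 <= (r `^ p)^-1 by [].
have i1 : IntFin B (fun=> 1) by exact: (IntFin_cst Om_bounded).
have n1 : nnm B (fun=> 1 : R) by nnmt.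
have nD1 : nnm B (fun x => (r * D j x) `^ s1) by nnmt.
have iH : IntFin B (fun x => (r `^ p)^-1 * (1 + (r * D j x) `^ s1)) by ift.
apply: (Int_dom_fin mB _ _ iH); [by nnmt|by nnmt|].
move: gD; apply: filterS => x gD Bx; have D0 : 0 <= D j x by exact: nD.2.
have /andP[z0 z1] := z01 x.
have h1 : Qn x (grad (zeta j) x) <= D j x.
  apply: le_trans (gD Bx) _; rewrite -[leRHS]mul1r ler_wpM2r//.
  apply: (@le_trans _ _ (1 `^ (1 - p^-1))); last by rewrite powR1.
  by apply: pow_le => //; rewrite subr_ge0 invf_le1// ltW.
apply: (@le_trans _ _ ((r `^ p)^-1 * (r * D j x) `^ p)).
  rewrite powRM ?(ltW r0)// mulKf ?gt_eqF// ?powR_gt0//.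
  by apply: pow_le => //; exact: ltW.
rewrite ler_wpM2l//.
have := @pow_mul_le R p 0 s1 1 (r * D j x) 0.
rewrite powRr0 mulr1 powR0 ?oner_eq0// addr0; apply => //; rewrite ?mulr_ge0 ?(ltW r0) ?(ltW p0)//.
- exact: lt_trans s1_gt.
- by rewrite mul0r addr0 ler_pdivrMr ?mul1r ?(ltW s1_gt)//; exact: lt_trans s1_gt.
Qed.

Section iteration.
Variables (q s Lam Lc : R).
Hypothesis q1 : 1 < q.
Hypothesis qs1 : p * q <= s1.
Hypothesis qs : q <= s.
Hypothesis be1 : 1 < sigma * (1 - q^-1).
Hypothesis Lam0 : 0 < Lam.
Hypothesis Lc0 : 0 < Lc.

(** The exponent of the recursion: Hoelder's inequality with a weight in L^q leaves [1 - 1/q], and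
    Sobolev's inequality multiplies by [sigma]. The constants after it are those of [weight_bound]
    and [dg_step]; none depends on [r], [l], [u] or the measure of [B]. *)
Definition dg_be := sigma * (1 - q^-1).
Definition dg_CW := 4 `^ q * (3 + Cc + Lam).
Definition dg_K := CS * (2 `^ p * (Lc + 1) + 1) `^ sigma * 8 `^ (p * dg_be * sigma) * (dg_CW * N) `^ (sigma / q).
Definition dg_M := 2 `^ (p * dg_be * sigma) * N `^ (sigma / q).

Variables (u Zs : 'rV[R]_n -> R) (du : 'rV[R]_n -> 'rV[R]_n) (k l : R).
Hypothesis W : W1pQ p Q Om u du.
Hypothesis l0 : 0 < l.
Hypothesis nZs : nnm B Zs.
Hypothesis Zs_int : Ile leb B (fun x => (r `^ p * Zs x) `^ s) (fine (leb B) * Lam).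
Hypothesis energy : forall k' e j M, k <= k' <= k + l -> 0 < e ->
  Ile leb B (fun x => dramp k' e (u x) * (D j x `^ p * Num.max (u x - k') 0 `^ p +
     zeta j x * Zs x * (Num.max (u x - k') 0 + l) `^ p)) M ->
  Ile leb B (fun x => zeta j x * dramp k' e (u x) * Qn x (du x) `^ p) (Lc * M).

Let q0 : 0 < q. Proof. exact: lt_trans q1. Qed.
Let s0 : 0 < s. Proof. exact: lt_le_trans qs. Qed.
Let N0 : 0 < N. Proof. exact: lt_le_trans N1. Qed.

(** The weights of one step together, scaled by [r^p]; the summand 1 covers the term of order zero
    in Sobolev's inequality. *)
Let Wt j x := r `^ p * D j x `^ p + r `^ p * Zs x + 1.

Let nWt j : nnm B (Wt j).
Proof. by have [_ _ c3 _ _] := cut; have [nD _] := c3 j; rewrite /Wt; nnmt. Qed.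

Lemma dg_CW0 : 0 < dg_CW.
Proof. by rewrite mulr_gt0// ?powR_gt0// !addr_gt0. Qed.

(** Since [p * q <= s1] and [q <= s], the q-th powers of both weights are controlled by the given
    integrals. The 3 in [dg_CW] collects the constants from lowering two exponents and the summand 1
    of [Wt]. *)
Lemma weight_bound j : Ile leb B (fun x => Wt j x `^ q) (fine (leb B) * (dg_CW * N ^+ j)).
Proof.
have [_ _ c3 _ c5] := cut; have [nD _] := c3 j.
have nX : nnm B (fun x => (r * D j x) `^ s1) by nnmt.
have nY : nnm B (fun x => (r `^ p * Zs x) `^ s) by nnmt.
have n3 : nnm B (fun=> 3 : R) by nnmt.
have nXY : nnm B (fun x => (r * D j x) `^ s1 + (r `^ p * Zs x) `^ s) by nnmt.
have h := IleZ mB (nnmD (nnmD nX nY) n3) (powR_ge0 4 q) (IleD mB (nnmD nX nY) n3 (IleD mB nX nY (c5 j) Zs_int) (Ile_cst (ler0n R 3))).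
have nW := nWt j.
have n1 : nnm B (fun x => Wt j x `^ q) by nnmt.
apply: Ile_le h => //; first by nnmt.
  apply: aeW => x Bx; rewrite /Wt.
  have D0 : 0 <= D j x by exact: nD.2.
  have Z0 : 0 <= Zs x by exact: nZs.2.
  have q0' : 0 <= q by exact: ltW.
  rewrite -addrA -powRM ?(ltW r0)//.
  apply: le_trans (pow_add _ _ _) _ => //.
  have e1 : ((r * D j x) `^ p) `^ q <= 1 + (r * D j x) `^ s1.
    rewrite -powRrM; have := @pow_mul_le R (p * q) 0 s1 1 (r * D j x) 0.
    rewrite powRr0 mulr1 powR0 ?oner_eq0// addr0; apply => //; rewrite ?mulr_ge0 ?(ltW r0) ?(ltW p0)//.
    - exact: lt_trans s1_gt.
    - by rewrite mul0r addr0 ler_pdivrMr ?mul1r//; exact: lt_trans s1_gt.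
  have e2 : (r `^ p * Zs x) `^ q <= 1 + (r `^ p * Zs x) `^ s.
    have := @pow_mul_le R q 0 s 1 (r `^ p * Zs x) 0.
    rewrite powRr0 mulr1 powR0 ?oner_eq0// addr0; apply => //; rewrite ?mulr_ge0 ?powR_ge0//.
    by rewrite mul0r addr0 ler_pdivrMr ?mul1r.
  have e3 : (r `^ p * Zs x + 1) `^ q <= 2 `^ q * ((r `^ p * Zs x) `^ q + 1).
    by apply: le_trans (pow_add _ _ _) _; rewrite ?mulr_ge0 ?powR_ge0// powR1.
  have t2 : 1 <= 2 `^ q :> R by apply: (@le_trans _ _ (1 `^ q)); [rewrite powR1|apply: pow_le => //; rewrite ler1n].
  have t4 : 4 `^ q = 2 `^ q * 2 `^ q :> R by rewrite -powRM// -natrM.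
  rewrite t4 -mulrA ler_wpM2l ?powR_ge0//.
  apply: le_trans (lerD e1 e3) _.
  apply: (@le_trans _ _ (2 `^ q * (1 + (r * D j x) `^ s1) + 2 `^ q * ((r `^ p * Zs x) `^ q + 1))).
    by rewrite lerD2r -[leLHS]mul1r ler_wpM2r// addr_ge0.
  rewrite -mulrDr ler_wpM2l ?powR_ge0//.
  by move: e2; set A1 := _ `^ q; set A2 := _ `^ s1; set A3 := _ `^ s; lra.
rewrite /dg_CW -mulrDr -mulrDr mulrCA ler_wpM2l ?(ltW mB0)// -mulrA ler_wpM2l ?powR_ge0//.
have Nj : 1 <= N ^+ j by exact: exprn_ege1.
have : Lam <= Lam * N ^+ j by rewrite -[leLHS]mulr1 ler_wpM2l// ltW.
have : 3 <= 3 * N ^+ j by rewrite -[leLHS]mulr1 ler_wpM2l.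
by move: Cc0; set y := N ^+ j; lra.
Qed.


(** Levels increasing to [k + l]. The smoothing parameter [ej j] of the ramp is the gap to the next
    level, so that above that level the ramp is at least half of [u - kj j]. *)
Let kj j := k + l * (1 - 2^-1 ^+ j).
Let ej j := l * 2^-1 ^+ j.+1.
Let fj j x := zeta j x * ramp (kj j) (ej j) (u x).

Let hp j : 0 < (2^-1 : R) ^+ j. Proof. by []. Qed.
Let ej0 j : 0 < ej j. Proof. by rewrite mulr_gt0. Qed.
Let kj_range j : k <= kj j <= k + l.
Proof.
have h1 : (2^-1 : R) ^+ j <= 1 by rewrite exprn_ile1// invf_le1// ler1n.
rewrite /kj lerDl mulr_ge0 ?subr_ge0 ?(ltW l0)//= lerD2l -[leRHS]mulr1 ler_wpM2l ?(ltW l0)//.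
by rewrite gerBl ltW.
Qed.
Let kjS j : kj j.+1 - kj j = ej j.
Proof. by rewrite /kj /ej exprS; field. Qed.

Let mu_ : measurable_fun Om u. Proof. by case: W. Qed.

Let mramp k' e : 0 < e -> measurable_fun B (fun x => ramp k' e (u x)).
Proof.
move=> e0; apply: (measurableT_comp (f := ramp k' e)); last by mst.
by apply: continuous_measurable_fun; exact: (C1_continuous (ramp_C1 k' e0)).
Qed.

Let mdramp k' e : 0 < e -> measurable_fun B (fun x => dramp k' e (u x)).
Proof.
move=> e0; apply: (measurableT_comp (f := dramp k' e)); last by mst.
by apply: continuous_measurable_fun; exact: (ramp_C1 k' e0).2.
Qed.

Let mzeta j : measurable_fun B (zeta j).
Proof.
have [c1 _ _ _ _] := cut; have [Lz _] := c1 j.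
by have := zeta_measurable Om_open Lz => h; mst.
Qed.

Let z0 j x : 0 <= zeta j x. Proof. by have [c1 _ _ _ _] := cut; have /andP[] := (c1 j).2 x. Qed.
Let z1 j x : zeta j x <= 1. Proof. by have [c1 _ _ _ _] := cut; have /andP[] := (c1 j).2 x. Qed.

Let fj0 j x : 0 <= fj j x. Proof. by rewrite /fj mulr_ge0// ramp_ge0. Qed.

Let fjn j : nnm B (fj j).
Proof.
split=> //; rewrite /fj.
by have h1 := mzeta j; have h2 := mramp (kj j) (ej0 j); mst.
Qed.

Let be0 : 0 < dg_be. Proof. exact: lt_trans be1. Qed.

(* On the support of the next cutoff and above the next level, [fj j] is at least a fixed
   multiple of [l], which turns the lower-order terms into powers of [fj j]. *)
Let level_gap j x (w : R) : B x -> kj j.+1 < u x -> zeta j x = 1 -> w = u x - kj j.+1 ->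
  (w + l) `^ p <= l `^ p * ((2 ^+ j.+3 / l) `^ (p * dg_be) * fj j x `^ (p * dg_be)).
Proof.
move=> Bx ku zx wE.
have es : ej j <= u x - kj j by rewrite -kjS lerB// ltW.
have f1 : (u x - kj j) / 2 <= fj j x by rewrite /fj zx mul1r; apply: ramp_half.
have wle : w + l <= l * (2 ^+ j.+3 / l * fj j x).
  rewrite mulrA [l * _]mulrC divfK ?gt_eqF//.
  have w2 : w <= 2 * fj j x by rewrite wE; move: f1 es; have := ej0 j; have := kjS j; lra.
  have l2 : l <= 2 ^+ j.+2 * fj j x.
    have : l = 2 ^+ j.+2 * (ej j / 2).
      by rewrite /ej -[l * _ / 2]mulrA -exprSr mulrCA -exprMn divff// expr1n mulr1.
    move=> {1}->; rewrite ler_wpM2l ?exprn_ge0//; apply: le_trans f1.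
    by rewrite ler_wpM2r.
  rewrite [2 ^+ j.+3]exprS -mulrA.
  have p2 : 1 <= 2 ^+ j.+2 :> R by rewrite exprn_ege1// ler1n.
  have : 2 * fj j x <= 2 ^+ j.+2 * fj j x.
    by rewrite ler_wpM2r// exprS ler_peMr// exprn_ege1// ler1n.
  by move: w2 l2; set A1 := _ ^+ _ * _; lra.
set t := 2 ^+ j.+3 / l * fj j x in wle.
have t1 : 1 <= t.
  have w0 : 0 < w by rewrite wE subr_gt0.
  have : l * 1 <= l * t by rewrite mulr1; apply: le_trans wle; rewrite lerDr ltW.
  by rewrite ler_pM2l.
apply: (@le_trans _ _ ((l * t) `^ p)).
  by apply: pow_le => //; rewrite wE addr_ge0 ?subr_ge0 ?(ltW ku)// ltW.
have t0 : 0 <= t by exact: le_trans t1.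
rewrite powRM ?(ltW l0)// ler_wpM2l//.
rewrite -powRM ?divr_ge0 ?exprn_ge0 ?(ltW l0)//.
by apply: ler_powR => //; rewrite ler_peMr ?(ltW p0)// ltW.
Qed.

Let q'0 : 0 < 1 - q^-1. Proof. by rewrite subr_gt0 invf_lt1. Qed.

Let M1 j Y := l `^ p * (2 ^+ j.+3) `^ (p * dg_be) * (dg_CW * N ^+ j.+1) `^ q^-1 * Y `^ (1 - q^-1).

Let kap j := l `^ p * (2 ^+ j.+3 / l) `^ (p * dg_be).

(** Homogeneity: the powers of [l] other than [l^p] cancel and the measure of [B] comes out to the
    power 1. Hence the constants of the step do not depend on either. *)
Let M1E j Y : 0 < Y -> kap j * ((fine (leb B) * (dg_CW * N ^+ j.+1)) `^ q^-1 *
  (fine (leb B) * (l `^ (p * sigma) * Y)) `^ (1 - q^-1)) = fine (leb B) * M1 j Y.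
Proof.
move=> Y0; have m0' : 0 <= fine (leb B) by exact: ltW.
have CWN : 0 <= dg_CW * N ^+ j.+1 by rewrite mulr_ge0 ?exprn_ge0 ?(ltW dg_CW0) ?(ltW N0).
have lY : 0 <= l `^ (p * sigma) * Y by rewrite mulr_ge0 ?powR_ge0 ?(ltW Y0).
rewrite (powRM q^-1 m0' CWN) (powRM (1 - q^-1) m0' lY) (powRM (1 - q^-1) (powR_ge0 l _) (ltW Y0)) -powRrM.
have -> : p * sigma * (1 - q^-1) = p * dg_be by rewrite /dg_be mulrA.
have l'0 : 0 <= l^-1 by rewrite invr_ge0 ltW.
have t0 : 0 <= (2 : R) ^+ j.+3 by [].
rewrite /kap (powRM (p * dg_be) t0 l'0).
have e1 : l^-1 `^ (p * dg_be) * l `^ (p * dg_be) = 1.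
  by rewrite -powRM ?invr_ge0 ?(ltW l0)// mulVf ?gt_eqF// powR1.
have e2 : fine (leb B) `^ q^-1 * fine (leb B) `^ (1 - q^-1) = fine (leb B).
  rewrite -powRD; last by apply/implyP => _; rewrite gt_eqF.
  by rewrite addrC subrK powRr1.
rewrite /M1; move: e1 e2.
set A1 := l^-1 `^ _; set A2 := l `^ (p * dg_be); set A3 := fine _ `^ q^-1; set A4 := fine _ `^ (1 - q^-1).
set A5 := l `^ p; set A6 := (2 ^+ _) `^ _; set A7 := (dg_CW * _) `^ _; set A8 := Y `^ _ => e1 e2.
transitivity (A3 * A4 * (A5 * A6 * A7 * A8) * (A1 * A2)); first by ring.
by rewrite e1 e2 mulr1.
Qed.

(** Above the level [kj j.+1] and where the next cutoff is active, all terms are bounded by [H], the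
    weight times a power of [fj j], because [level_gap] trades [(w + l)^p] for that power. Hoelder's
    inequality bounds the integral of [H], [energy] the gradient, and Sobolev's inequality for the
    next cutoff times the next ramp closes the recursion. *)
Lemma dg_step j Y : 0 < Y ->
  Ile leb B (fun x => fj j x `^ (p * sigma)) (fine (leb B) * (l `^ (p * sigma) * Y)) ->
  Ile leb B (fun x => fj j.+1 x `^ (p * sigma))
    (fine (leb B) * (l `^ (p * sigma) * (dg_K * dg_M ^+ j * Y `^ dg_be))).
Proof.
move=> Y0 hY; have [c1 _ c3 c4 _] := cut.
have [Lz z01] := c1 j.+1; have [nD gD] := c3 j.+1.
pose H x := Wt j.+1 x * fj j x `^ (p * dg_be).
have nW := nWt j.+1; have nfj := fjn j; have nfj1 := fjn j.+1.
have nH : nnm B H by rewrite /H; nnmt.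
have kap0 : 0 <= kap j by [].
have mB0' : 0 <= fine (leb B) by exact: ltW.
have M10 : 0 <= M1 j Y by [].
have rp0 : 0 < r `^ p by exact: powR_gt0.
have HH : Ile leb B (fun x => kap j * H x) (fine (leb B) * M1 j Y).
  rewrite -(M1E j Y0); apply: IleZ => //.
  have -> : 1 - q^-1 = (q / (q - 1))^-1 by field; rewrite subr_eq0 !gt_eqF.
  have nfp : nnm B (fun x => fj j x `^ (p * dg_be)) by nnmt.
  apply: Int_hoelder => //.
  - by rewrite divr_gt0// subr_gt0.
  - by field; rewrite subr_eq0 !gt_eqF.
  - by rewrite mulr_gt0// mulr_gt0 ?dg_CW0// exprn_gt0.
  - exact: weight_bound.
  - rewrite (_ : (fun x => _) = (fun x => fj j x `^ (p * sigma)))//.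
    apply/funext => x; rewrite -powRrM; congr (_ `^ _).
    by rewrite /dg_be; field; rewrite subr_eq0 !gt_eqF.
have key x : B x -> kj j.+1 < u x -> (zeta j.+1 x != 0) || (D j.+1 x != 0) ->
    Wt j.+1 x * (u x - kj j.+1 + l) `^ p <= kap j * H x.
  move=> Bx ku zD; have zx := c4 _ _ zD.
  have := level_gap Bx ku zx erefl; rewrite mulrA -/(kap j) => h.
  rewrite /H mulrCA; apply: ler_wpM2l => //; exact: nW.2.
pose k' := kj j.+1; pose e := ej j.+1; pose wp x := Num.max (u x - k') 0.
have e0 : 0 < e by exact: ej0.
have nwp : nnm B wp.
  split=> [|x _]; last by rewrite le_max lexx orbT.
  by apply: measurable_maxr; [mst|exact: measurable_cst].
have nz : nnm B (zeta j.+1) by split=> //; exact: mzeta.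
have nra : nnm B (fun x => ramp k' e (u x)) by split=> [|x _]; [exact: mramp|exact: ramp_ge0].
have ndr : nnm B (fun x => dramp k' e (u x)).
  by split=> [|x _]; [exact: mdramp|have /andP[] := dramp_bounds k' (u x) e0].
have mQdu : measurable_fun B (fun x => Qn x (du x)).
  have [_ mdu _] := W.
  have h : measurable_fun Om (fun x => Qn x (du x)) by exact: (Qn_measurable Om_open Q_measurable Q_psd).
  by mst.
have nQz : nnm B (fun x => Qn x (grad (zeta j.+1) x)).
  by split=> //; have := Qgrad_zeta_measurable Om_open Q_measurable Q_psd Lz => h; mst.
have nkH : nnm B (fun x => kap j * H x) by nnmt.
have rpV : 0 <= (r `^ p)^-1 by [].
have [wp0 wp1] : (forall x, u x <= k' -> wp x = 0) /\ (forall x, k' < u x -> wp x = u x - k').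
  by split=> x h; [apply: max_r; rewrite subr_le0|apply: max_l; rewrite subr_ge0 ltW].
have dr1 x : dramp k' e (u x) <= 1 by have /andP[] := dramp_bounds k' (u x) e0.
have dr0 x : u x <= k' -> dramp k' e (u x) = 0 by rewrite /dramp => ->.
have ra0 x : u x <= k' -> ramp k' e (u x) = 0 by rewrite /ramp => ->.
have pn0 : p != 0 by rewrite gt_eqF.
have bound x : B x -> k' < u x -> (zeta j.+1 x != 0) || (D j.+1 x != 0) ->
    r `^ p * (D j.+1 x `^ p * wp x `^ p + zeta j.+1 x * Zs x * (wp x + l) `^ p) <= kap j * H x /\
    wp x `^ p <= kap j * H x.
  move=> Bx ku zD; have := key x Bx ku zD; rewrite -/k' -(wp1 x ku) => h.
  have D0 : 0 <= D j.+1 x by exact: nD.2.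
  have Z0 : 0 <= Zs x by exact: nZs.2.
  have w0 : 0 <= wp x by exact: nwp.2.
  have wl : wp x `^ p <= (wp x + l) `^ p by apply: pow_le => //; rewrite ?(ltW p0)// lerDl ltW.
  have X0 : 0 <= (wp x + l) `^ p by [].
  split; apply: le_trans h; rewrite /Wt.
    rewrite mulrDl mulrDl mulrDr -addrA; apply: lerD.
      by rewrite mulrA ler_wpM2l// mulr_ge0.
    apply: ler_wpDr; first by rewrite mul1r.
    rewrite -!mulrA; apply: ler_wpM2l => //.
    by rewrite -[leRHS]mul1r ler_wpM2r ?mulr_ge0.
  apply: le_trans wl _; rewrite -[leLHS]mul1r ler_wpM2r// lerDr.
  by rewrite addr_ge0// mulr_ge0.
have E1 : Ile leb B (fun x => zeta j.+1 x * dramp k' e (u x) * Qn x (du x) `^ p)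
    (Lc * ((r `^ p)^-1 * (fine (leb B) * M1 j Y))).
  apply: energy => //; first exact: kj_range.
  apply: (Ile_le mB _ _ _ _ (IleZ mB nkH rpV HH)) => //; [by nnmt|by nnmt|].
  apply: aeW => x Bx; rewrite ler_pdivlMl//.
  have nkHx : 0 <= kap j * H x by exact: nkH.2.
  have [uk|ku] := leP (u x) k'; first by rewrite dr0// mul0r mulr0.
  have [zD|] := boolP ((zeta j.+1 x != 0) || (D j.+1 x != 0)); last first.
    by rewrite negb_or !negbK => /andP[/eqP -> /eqP ->]; rewrite powR0// !mul0r addr0 !mulr0.
  have [h _] := bound x Bx ku zD; apply: le_trans h.
  rewrite ler_wpM2l ?(ltW rp0)// -[leRHS]mul1r ler_wpM2r//.
  have D0 : 0 <= D j.+1 x by exact: nD.2.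
  have Z0 : 0 <= Zs x by exact: nZs.2.
  by rewrite addr_ge0 ?mulr_ge0 ?powR_ge0.
have E2 : \forall x \ae leb, B x -> (ramp k' e (u x) * Qn x (grad (zeta j.+1) x)) `^ p <= (r `^ p)^-1 * (kap j * H x).
  move: gD; apply: filterS => x gD Bx.
  have nkHx : 0 <= kap j * H x by exact: nkH.2.
  have D0 : 0 <= D j.+1 x by exact: nD.2.
  have Z0 : 0 <= Zs x by exact: nZs.2.
  have [uk|ku] := leP (u x) k'; first by rewrite ra0// mul0r powR0// mulr_ge0.
  have h1 : Qn x (grad (zeta j.+1) x) <= D j.+1 x.
    apply: le_trans (gD Bx) _; rewrite -[leRHS]mul1r ler_wpM2r//.
    apply: (@le_trans _ _ (1 `^ (1 - p^-1))); last by rewrite powR1.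
    by apply: pow_le => //; rewrite subr_ge0 invf_le1// ltW.
  have [zD|] := boolP ((zeta j.+1 x != 0) || (D j.+1 x != 0)); last first.
    rewrite negb_or !negbK => /andP[_ /eqP DE].
    have -> : Qn x (grad (zeta j.+1) x) = 0 by apply/eqP; rewrite eq_le Qnorm_ge0 andbT -DE.
    by rewrite mulr0 powR0// mulr_ge0.
  have [h _] := bound x Bx ku zD; rewrite ler_pdivlMl//; apply: le_trans h.
  rewrite ler_wpM2l ?(ltW rp0)//.
  apply: (@le_trans _ _ ((wp x * D j.+1 x) `^ p)).
    apply: pow_le => //; first by rewrite mulr_ge0 ?ramp_ge0.
    by apply: ler_pM => //; [exact: ramp_ge0|exact: ramp_le].
  rewrite powRM//; last exact: nwp.2.
  by rewrite mulrC lerDl !mulr_ge0// powR_ge0.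
have E3 : \forall x \ae leb, B x -> (zeta j.+1 x * ramp k' e (u x)) `^ p <= kap j * H x.
  apply: aeW => x Bx.
  have nkHx : 0 <= kap j * H x by exact: nkH.2.
  have [uk|ku] := leP (u x) k'; first by rewrite ra0// mulr0 powR0.
  have [->|zz] := eqVneq (zeta j.+1 x) 0; first by rewrite mul0r powR0.
  have [|_ h] := bound x Bx ku; first by rewrite zz.
  apply: le_trans h.
  apply: pow_le => //.
  by rewrite -[leRHS]mul1r ler_pM ?ramp_ge0 ?ramp_le.
pose a1 := 2 `^ p * (Lc + 1) * ((r `^ p)^-1 * M1 j Y).
have S := sobolev_cutoff Om_open Om_bounded p_gt1 Q_measurable Q_psd B_open BO Lz z01 (cutoff_grad_int j.+1)
  W (ramp_C1 k' e0) (fun t => ramp_ge0 k' t e0) (fun t => (andP (dramp_bounds k' t e0)).1)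
  (fun t => (andP (dramp_bounds k' t e0)).2) (ltW sigma0) (ltW r0) sob (a := a1) (c := M1 j Y).
have Lc0' : 0 <= Lc by exact: ltW.
have a10 : 0 <= a1 by rewrite /a1 !mulr_ge0 ?addr_ge0.
have k20 : 0 <= 2 `^ p by [].
have nX : nnm B (fun x => zeta j.+1 x * dramp k' e (u x) * Qn x (du x) `^ p) by nnmt.
have nH2 : nnm B (fun x => (r `^ p)^-1 * (kap j * H x)) by nnmt.
have {}S : Ile leb B (fun x => fj j.+1 x `^ (p * sigma)) (fine (leb B) * (CS * (r `^ p * a1 + M1 j Y) `^ sigma)).
  apply: S => //.
    have -> : fine (leb B) * a1 = 2 `^ p * (Lc * ((r `^ p)^-1 * (fine (leb B) * M1 j Y)) + (r `^ p)^-1 * (fine (leb B) * M1 j Y)).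
      by rewrite /a1; move: (r `^ p)^-1 => i; ring.
    have h := IleZ mB (nnmD nX nH2) k20 (IleD mB nX nH2 E1 (IleZ mB nkH rpV HH)).
    apply: (Ile_le mB _ _ _ _ h) => //; [by nnmt|by nnmt|].
    move: E2; apply: filterS => x E2 Bx.
    have dx0 : 0 <= dramp k' e (u x) by exact: ndr.2.
    have rx0 : 0 <= ramp k' e (u x) by exact: nra.2.
    apply: le_trans (pow_add _ _ _) _; rewrite ?mulr_ge0 ?(ltW p0)//.
    rewrite ler_wpM2l//; apply: lerD; last exact: E2.
    rewrite powRM ?mulr_ge0// ler_wpM2r//.
    have t0 : 0 <= zeta j.+1 x * dramp k' e (u x) by rewrite mulr_ge0.
    have t1 : zeta j.+1 x * dramp k' e (u x) <= 1 by rewrite -[leRHS]mul1r ler_pM.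
    move: t0; rewrite le_eqVlt => /predU1P[<-|t0]; first by rewrite powR0.
    by apply: ge1r_powR; rewrite ?t0 ?t1 ?ltW.
  apply: (Ile_le mB _ _ _ _ HH) => //; by nnmt.
have CWN0 : 0 < dg_CW * N by rewrite mulr_gt0 ?dg_CW0.
suff <- : CS * (r `^ p * a1 + M1 j Y) `^ sigma = l `^ (p * sigma) * (dg_K * dg_M ^+ j * Y `^ dg_be) by [].
have -> : r `^ p * a1 + M1 j Y = (2 `^ p * (Lc + 1) + 1) * M1 j Y.
  by rewrite /a1 mulrCA mulVKf ?gt_eqF// mulrDl mul1r.
have L1 : 0 <= 2 `^ p * (Lc + 1) + 1 by rewrite addr_ge0 ?mulr_ge0 ?addr_ge0.
have expX (x y : R) (i : nat) : 0 <= x -> (x ^+ i) `^ y = (x `^ y) ^+ i.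
  by move=> x0; rewrite -(powR_mulrn i x0) powRAC powR_mulrn.
have CWN : 0 <= dg_CW * N ^+ j.+1 by rewrite mulr_ge0 ?exprn_ge0 ?(ltW dg_CW0) ?(ltW N0).
have eA : (l `^ p) `^ sigma = l `^ (p * sigma) by rewrite powRrM.
have eB : ((2 ^+ j.+3) `^ (p * dg_be)) `^ sigma = 8 `^ (p * dg_be * sigma) * (2 `^ (p * dg_be * sigma)) ^+ j :> R.
  rewrite -powRrM -expX// -powRM//; congr (_ `^ _).
  by rewrite !exprS; ring.
have eC : ((dg_CW * N ^+ j.+1) `^ q^-1) `^ sigma = (dg_CW * N) `^ (sigma / q) * (N `^ (sigma / q)) ^+ j.
  rewrite -powRrM [q^-1 * _]mulrC exprS mulrA.
  by rewrite powRM ?exprn_ge0 ?(ltW CWN0) ?(ltW N0)// expX// ltW.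
have eD : (Y `^ (1 - q^-1)) `^ sigma = Y `^ dg_be by rewrite -powRrM mulrC.
have M1s : M1 j Y `^ sigma = l `^ (p * sigma) * (8 `^ (p * dg_be * sigma) * (2 `^ (p * dg_be * sigma)) ^+ j) *
    ((dg_CW * N) `^ (sigma / q) * (N `^ (sigma / q)) ^+ j) * Y `^ dg_be.
  rewrite -eA -eB -eC -eD /M1 [LHS]powRM ?mulr_ge0 ?powR_ge0//; congr (_ * _).
  rewrite [LHS]powRM ?mulr_ge0 ?powR_ge0//; congr (_ * _).
  by rewrite [LHS]powRM ?powR_ge0.
rewrite [(_ * M1 j Y) `^ _]powRM// M1s /dg_K /dg_M [(_ * _) ^+ j]exprMn.
by set t1 := _ ^+ j; set t2 := _ ^+ j; ring.
Qed.


Lemma dg_start Y : Ile leb B (fun x => Num.max (u x - k) 0 `^ (p * sigma)) (fine (leb B) * (l `^ (p * sigma) * Y)) ->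
  Ile leb B (fun x => fj 0 x `^ (p * sigma)) (fine (leb B) * (l `^ (p * sigma) * Y)).
Proof.
have nwp : nnm B (fun x => Num.max (u x - k) 0).
  split=> [|x _]; last by rewrite le_max lexx orbT.
  by apply: measurable_maxr; [mst|exact: measurable_cst].
have nfj := fjn 0%N.
apply: Ile_le => //; [by nnmt|by nnmt|].
apply: aeW => x Bx; apply: pow_le => //.
rewrite /fj; apply: (@le_trans _ _ (1 * Num.max (u x - kj 0) 0)).
  by apply: ler_pM => //; [exact: ramp_ge0|exact: ramp_le].
by rewrite mul1r /kj expr0 subrr mulr0 addr0.
Qed.

(** As [kj j + ej j <= k + l], each ramp is at least [u - (k + l)]. The integral of a power of the
    excess over [B'] is thus below every member of a geometric sequence, and vanishes. *)
Lemma dg_conclusion nu rr : 0 < nu -> 0 < rr < 1 -> B' `<=` B -> measurable B' ->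
  (forall j, dg_K * dg_M ^+ j * (nu * rr ^+ j) `^ dg_be <= nu * rr ^+ j.+1) ->
  Ile leb B (fun x => Num.max (u x - k) 0 `^ (p * sigma)) (fine (leb B) * (l `^ (p * sigma) * nu)) ->
  \forall x \ae leb, B' x -> u x <= k + l.
Proof.
move=> nu0 /andP[rr0 rr1] BB mB' Hnu start.
have lp0 : 0 < l `^ (p * sigma) by exact: powR_gt0.
have all j : Ile leb B (fun x => fj j x `^ (p * sigma)) (fine (leb B) * (l `^ (p * sigma) * (nu * rr ^+ j))).
  elim: j => [|j IH]; first by rewrite expr0 mulr1; exact: dg_start.
  have Y0 : 0 < nu * rr ^+ j by rewrite mulr_gt0 ?exprn_gt0.
  apply: le_trans (dg_step Y0 IH) _; rewrite lee_fin ler_wpM2l ?(ltW mB0)// ler_wpM2l ?(ltW lp0)//.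
have B'O : B' `<=` Om by move=> x /BB/BO.
have mB'B : measurable_fun B' u by mst.
pose w x := Num.max (u x - (k + l)) 0.
have nw : nnm B' w.
  split=> [|x _]; last by rewrite le_max lexx orbT.
  by apply: measurable_maxr; [mst|exact: measurable_cst].
have nwp : nnm B' (fun x => w x `^ (p * sigma)) by nnmt.
have ps0 : 0 <= p * sigma by rewrite mulr_ge0 ?(ltW p0) ?(ltW sigma0).
have bound j : (Int leb B' (fun x => w x `^ (p * sigma))%R <= (fine (leb B) * (l `^ (p * sigma) * (nu * rr ^+ j)))%:E)%E.
  have nfj := fjn j; have nfp : nnm B (fun x => fj j x `^ (p * sigma)) by nnmt.
  apply: le_trans (all j).
  have h : (Int leb B' (fun x => fj j x `^ (p * sigma))%R <= Int leb B (fun x => fj j x `^ (p * sigma))%R)%E.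
    exact: Int_sub.
  apply: le_trans h.
  have nfp' := nnm_sub mB BB nfp.
  apply: Int_le => //.
  apply: aeW => x B'x; apply: pow_le => //; first by rewrite le_max lexx orbT.
  have [_ c2 _ _ _] := cut.
  rewrite /w /fj c2// mul1r ge_max ramp_ge0// andbT.
  apply: le_trans (ramp_ge (kj j) (u x) (ej0 j)).
  rewrite -addrA -opprD lerD2l lerN2 /kj /ej exprS.
  have h := hp j; have h2 := mulr_gt0 l0 h.
  by move: h2; set y := 2^-1 ^+ j; lra.
have I0 : Int leb B' (fun x => w x `^ (p * sigma))%R = 0%E.
  apply/eqP; rewrite eq_le Int_ge0// andbT.
  have cv : (fine (leb B) * (l `^ (p * sigma) * (nu * rr ^+ j)))%:E @[j --> \oo] --> 0%E.
    apply: cvg_EFin; first exact: nearW.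
    rewrite -(mulr0 (fine (leb B))) -(mulr0 (l `^ (p * sigma))) -(mulr0 nu).
    by do 3! apply: cvgMr; apply: cvg_expr; rewrite ger0_norm// ltW.
  apply: (@le_trans _ _ (limn (fun j => (fine (leb B) * (l `^ (p * sigma) * (nu * rr ^+ j)))%:E))).
    by apply: lime_ge; [apply/cvg_ex; exists 0%E|exact: nearW].
  by move/cvg_lim : cv => ->//; exact: lexx.
have mwp : measurable_fun B' (fun x => (w x `^ (p * sigma))%:E) by apply/measurable_EFinP; exact: nwp.1.
have [+ _] := ae_eq_integral_abs leb mB' mwp.
move=> /(_ _); rewrite /ae_eq => H.
have {H} : \forall x \ae leb, B' x -> (w x `^ (p * sigma))%:E = 0%E.
  apply: H; rewrite -[RHS]I0 /Int; apply: eq_integral => x _.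
  by rewrite gee0_abs// lee_fin powR_ge0.
apply: filterS => x H B'x; have [] := H B'x => /powR_eq0_eq0 w0.
by move: (lexx (w x)); rewrite {2}w0 /w ge_max => /andP[]; rewrite subr_le0.
Qed.

End iteration.

End de_giorgi.

(** * The De Giorgi lemma for solutions *)

Section de_giorgi_lemma.
Context {R : realType} {n : nat}.
Variables (Om : set 'rV[R]_n) (p : R) (Q : 'rV[R]_n -> 'M[R]_n).
Hypothesis Om_open : open Om.
Hypothesis Om_bounded : bounded_set Om.
Hypothesis p_gt1 : 1 < p.
Hypothesis Q_measurable : forall i j, measurable_fun Om (fun x => Q x i j).
Hypothesis Q_psd : forall x, Om x -> psdmx (Q x).
Variable sigma : R.
Hypothesis sigma_gt1 : 1 < sigma.
Variables (a psi : R) (b c d e f g h : 'rV[R]_n -> R).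
Hypothesis a0 : 0 < a.
Hypothesis ppsi : p <= psi.
Hypothesis psip : psi < p + 1.
Hypothesis nb : nnm Om b.
Hypothesis nc : nnm Om c.
Hypothesis nd : nnm Om d.
Hypothesis ne : nnm Om e.
Hypothesis nf : nnm Om f.
Hypothesis ng : nnm Om g.
Hypothesis nh : nnm Om h.
Implicit Types (u v w : 'rV[R]_n -> R) (du : 'rV[R]_n -> 'rV[R]_n) (U : set 'rV[R]_n).
Local Notation Qn := (Qnorm Q).
Local Notation IntFin U f := (Int leb U f%R < +oo)%E.
Local Notation sol := (solution Om p Q a psi b c d e f g h).
Local Notation Z := (Zf p psi b c d e f g h).

Let p0 : 0 < p. Proof. exact: lt_trans p_gt1. Qed.
Let sigma0 : 0 < sigma. Proof. exact: lt_trans sigma_gt1. Qed.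
Let mO : measurable Om. Proof. exact: open_rV_measurable. Qed.

Lemma solution_measurable u du : sol u du -> measurable_fun Om u.
Proof. by move=> [al [be [[]]]]. Qed.

(** [Zs] absorbs the passage from [1 + |u| + (u - k')] in Caccioppoli's inequality to the scale [l];
    the two applications choose it differently. [nu] is fixed before the solution, the ball and the
    levels, all quantities being normalized by the radius and the measure of [B]. *)
Lemma de_giorgi (Cv s1 Cc N CS s Lam : R) : 0 <= Cv -> p * dual_exp sigma < s1 -> dual_exp sigma < s ->
  0 < Cc -> 1 <= N -> 0 < CS -> 0 < Lam ->
  exists2 nu, 0 < nu & forall u du B B' r zeta D, sol u du -> open B -> B `<=` Om -> 0 < r ->
  0 < fine (leb B) -> measurable B' -> B' `<=` B -> cutoffs p Q B B' r s1 Cc N zeta D ->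
  sobolev_power p Q sigma B r CS -> IntFin B (fun x => Z u x * (1 + `|u x|) `^ p) ->
  forall k l Zs, 0 < l -> nnm B Zs ->
  (\forall x \ae leb, B x -> forall k', k <= k' <= k + l -> k' < u x -> u x - k' <= Cv * (1 + `|u x|) /\
     Z u x * (1 + `|u x| + (u x - k')) `^ p <= Zs x * (u x - k' + l) `^ p) ->
  Ile leb B (fun x => (r `^ p * Zs x) `^ s) (fine (leb B) * Lam) ->
  Ile leb B (fun x => Num.max (u x - k) 0 `^ (p * sigma)) (fine (leb B) * (l `^ (p * sigma) * nu)) ->
  \forall x \ae leb, B' x -> u x <= k + l.
Proof.
move=> Cv0 s1s ss Cc0 N1 CS0 Lam0.
have ds1 : 1 < dual_exp sigma by rewrite /dual_exp ltr_pdivlMr ?subr_gt0// mul1r gtrBl.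
have ds0 : 0 < dual_exp sigma by exact: lt_trans ds1.
(* The integrability common to [D^p] and [Zs]. It exceeds the dual exponent of [sigma], which is
   equivalent to [sigma * (1 - 1/q) > 1]. *)
pose q := Num.min (s1 / p) s.
have dq : dual_exp sigma < q by rewrite lt_min ss andbT ltr_pdivlMr// mulrC.
have q1 : 1 < q by exact: lt_trans dq.
have q0 : 0 < q by exact: lt_trans q1.
have qs1 : p * q <= s1 by rewrite mulrC -ler_pdivlMr// ge_min lexx.
have qs : q <= s by rewrite ge_min lexx orbT.
have be1 : 1 < sigma * (1 - q^-1).
  have : q^-1 < (dual_exp sigma)^-1 by rewrite ltf_pV2.
  rewrite /dual_exp invf_div => h1; rewrite mulrBr mulr1 ltrBrDr -ltrBrDl.
  have := ltr_pM2l sigma0 q^-1 ((sigma - 1) / sigma); rewrite h1 => /idP.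
  by rewrite mulrCA divff ?gt_eqF// mulr1.
have ps1 : p < s1 by apply: lt_trans s1s; rewrite ltr_pMr.
have [C0 C00 cac] := caccioppoli Om_open p_gt1 Q_measurable Q_psd a0 ppsi psip nb nc nd ne nf ng nh Cv0.
have K0 : 0 < dg_K p sigma Cc N CS q Lam C0.
  by rewrite /dg_K !mulr_gt0 ?powR_gt0 ?addr_gt0 ?mulr_gt0 ?powR_gt0 ?addr_gt0//; exact: lt_le_trans N1.
have M0 : 0 < dg_M p sigma N q.
  by rewrite /dg_M !mulr_gt0 ?powR_gt0//; exact: lt_le_trans N1.
have [nu [rr [nu0 rr01 H]]] := geometric_decay K0 M0 be1.
exists nu => // u du B B' r zeta D Su B_open BO r0 mB0 mB' BB cut sob IZ k l Zs l0 nZs HZ iZs start.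
have mu := solution_measurable Su.
have [al [be [W _ _]]] := Su.
have mB : measurable B by exact: open_rV_measurable.
apply: (@dg_conclusion R n Om p Q Om_open Om_bounded p_gt1 Q_measurable Q_psd sigma sigma_gt1 B B' r s1 Cc N CS
  zeta D B_open BO r0 mB0 ps1 Cc0 N1 cut sob q s Lam C0 q1 qs1 qs be1 Lam0 C00 u Zs du k l W l0 nZs iZs _ nu rr) => //.
move=> k' e' j M kk e0 hM; have [c1 c2 c3 c4 c5] := cut.
have [Lz z01] := c1 j; have [nD gD] := c3 j.
have mramp' : measurable_fun B (fun x => dramp k' e' (u x)).
  apply: (measurableT_comp (f := dramp k' e')); last by mst.
  by apply: continuous_measurable_fun; exact: (ramp_C1 k' e0).2.
have nv : nnm B (fun x => Num.max (u x - k') 0).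
  split=> [|x _]; last by rewrite le_max lexx orbT.
  by apply: measurable_maxr; [mst|exact: measurable_cst].
have nZ : nnm B (Z u) by apply: (nnm_sub mO BO); apply: Zf_nnm.
have nz : nnm B (zeta j).
  by split=> [|x _]; [have := zeta_measurable Om_open Lz => h1; mst|have /andP[] := z01 x].
have ndr : nnm B (fun x => dramp k' e' (u x)).
  by split=> // x _; have /andP[] := dramp_bounds k' (u x) e0.
apply: (cac u du Su B (zeta j) (D j) B_open BO Lz z01 (cutoff_grad_int Om_open Om_bounded p_gt1 Q_measurable Q_psd B_open BO r0 ps1 cut j) nD gD IZ
  (ramp k' e') (dramp k' e') 1 (fun x => Num.max (u x - k') 0)) => //.
- exact: ramp_C1.
- by move=> t; exact: ramp_ge0.
- by move=> t; exact: dramp_bounds.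
- move: HZ; apply: filterS => x HZ Bx; split; first exact: ramp_convex.
  have [uk|ku] := leP (u x) k'; first by rewrite max_r ?subr_le0// mulr_ge0 ?addr_ge0.
  rewrite max_l ?subr_ge0 ?(ltW ku)//; exact: (HZ Bx k' kk ku).1.
apply: (Ile_le mB _ _ _ (lexx M) hM); [by nnmt|by nnmt|].
move: HZ; apply: filterS => x HZ Bx.
have [uk|ku] := leP (u x) k'; first by rewrite /dramp uk !mul0r.
have [_ h2] := HZ Bx k' kk ku.
rewrite max_l ?subr_ge0 ?(ltW ku)//.
rewrite ler_wpM2l ?ndr.2// lerD2l -!mulrA ler_wpM2l ?nz.2//.
Qed.

End de_giorgi_lemma.

(** * Integrability of the coefficients *)

Section local_to_compact.
Context {R : realType} {n : nat}.
Variables (Om : set 'rV[R]_n).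
Hypothesis Om_open : open Om.
Hypothesis Om_bounded : bounded_set Om.
Implicit Types (u f : 'rV[R]_n -> R) (U K : set 'rV[R]_n).
Local Notation IntFin U f := (Int leb U f%R < +oo)%E.

Let mO : measurable Om. Proof. exact: open_rV_measurable. Qed.

(** A finite subcover and induction on its length. The passages from local statements to compact
    sets below go through this principle. *)
Lemma compact_local (P : set 'rV[R]_n -> Prop) K : compact K -> P set0 ->
  (forall A B, P A -> P B -> P (A `|` B)) -> (forall A B, A `<=` B -> P B -> P A) ->
  (forall x, K x -> exists V, [/\ open V, V x & P V]) -> P K.
Proof.
move=> cK P0 PU PS H.
have /choice[V HV] : forall x, exists V, K x -> [/\ open V, V x & P V].
  by move=> x; have [/H[V HV]|nK] := pselect (K x); [exists V|exists set0 => /nK].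
move: cK; rewrite compact_cover => /(_ 'rV[R]_n K V)[x Kx|x Kx|D' DK KD'].
- by have [] := HV x Kx.
- by exists x => //; have [] := HV x Kx.
suff : P (\bigcup_(x in [set x | x \in finmap.enum_fset D']) V x).
  by apply: PS => x /KD'[y yD Vy]; exists y.
have : forall x, x \in finmap.enum_fset D' -> K x by move=> x xs; apply: set_mem; apply: DK.
elim: (finmap.enum_fset D') => [_|x s IH sK]; first by apply: PS P0 => y [z].
have Kx : K x by apply: sK; rewrite mem_head.
have {}IH := IH (fun y ys => sK y (mem_behead (s := x :: s) ys)).
have [_ _ PV] := HV x Kx.
apply: PS (PU _ _ PV IH) => y [z /=]; rewrite inE => /predU1P[-> Vy|zs Vy]; first by left.
by right; exists z.
Qed.

Lemma compact_measurable K : compact K -> measurable K.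
Proof. by move=> cK; apply: closed_rV_measurable; apply: compact_closed => //; exact: norm_hausdorff. Qed.


Lemma IntFin_local K f : compact K -> nnm Om f ->
  (forall x, K x -> exists V, [/\ open V, V x, V `<=` Om & IntFin V f]) -> IntFin K f.
Proof.
move=> cK nf H.
have mK := compact_measurable cK.
have [A [mA KA AO fA]] : exists A, [/\ measurable A, K `<=` A, A `<=` Om & IntFin A f].
  apply: (compact_local (P := fun X => exists A, [/\ measurable A, X `<=` A, A `<=` Om & IntFin A f]) cK).
  - by exists set0; split; [exact: measurable0| |exact: sub0set|rewrite /Int integral_set0 ltry].
  - move=> X Y [A [mA XA AO fA]] [B [mB YB BO fB]]; exists (A `|` B).
    have ABO : A `|` B `<=` Om by move=> x [/AO|/BO].
    split => //; [exact: measurableU|by move=> x [/XA|/YB]; [left|right]|].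
    have nA := nnm_sub mO AO nf; have nB := nnm_sub mO BO nf; have nAB := nnm_sub mO ABO nf.
    have mBA : measurable (B `\` A) by exact: measurableD.
    have BAB : B `\` A `<=` B by move=> x [].
    have fBA : IntFin (B `\` A) f by apply: (IntFin_sub mBA mB nB BAB fB).
    rewrite (_ : A `|` B = A `|` (B `\` A)); last first.
      by apply/seteqP; split=> x [Ax|]; [left|have [Ax|nAx] := pselect (A x); [left|right]|left|case; right].
    rewrite /Int ge0_integral_setU//=.
    + rewrite lte_add_pinfty//; first exact: fA.
      exact: fBA.
    + apply/measurable_EFinP; apply: measurable_funS nAB.1; first exact: measurableU.
      by move=> x [Ax|[Bx _]]; [left|right].
    + by move=> x AB; rewrite lee_fin; apply: nf.2; case: AB => [/AO|[/BO]].
    + by apply/disj_setPS => x [Ax [_ /(_ Ax)]].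
  - by move=> X Y XY [A [mA YA AO fA]]; exists A; split => //; exact: subset_trans YA.
  - by move=> x Kx; have [V [oV Vx VO fV]] := H x Kx; exists V; split => //; exists V; split => //; exact: open_rV_measurable.
by apply: (IntFin_sub mK mA _ KA fA); apply: (nnm_sub mO AO nf).
Qed.

Lemma ae_bounded_local K u : compact K ->
  (forall x, K x -> exists V, [/\ open V, V x & exists M, \forall x \ae leb, V x -> `|u x| <= M]) ->
  exists2 M, 0 < M & \forall x \ae leb, K x -> `|u x| <= M.
Proof.
move=> cK H.
suff [M HM] : exists M, \forall x \ae leb, K x -> `|u x| <= M.
  exists (Num.max M 1); first by rewrite lt_max ltr01 orbT.
  by apply: filterS HM => x HM Kx; rewrite le_max HM.
apply: (compact_local (P := fun X => exists M, \forall x \ae leb, X x -> `|u x| <= M) cK) => //.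
- by exists 0; apply: aeW => x [].
- move=> X Y [M HM] [M' HM']; exists (Num.max M M').
  by apply: filterS2 HM HM' => x hM hM' [/hM|/hM'] H'; rewrite le_max H' ?orbT.
- by move=> X Y XY [M HM]; exists M; apply: filterS HM => x hM Xx; apply: hM; exact: XY.
Qed.

(** An infinite exponent is traded for the finite one [t + 1], so that later computations with
    exponents are real arithmetic. *)
Lemma Lloc_real (qe : \bar R) (t : R) f : 0 <= t -> (t%:E < qe)%E -> Lloc Om qe f -> nnm Om f ->
  exists2 C, t < C & forall K, compact K -> K `<=` Om -> IntFin K (fun x => f x `^ C).
Proof.
move=> t0 tq [mf fK] nf.
have fin C K : 0 < C -> compact K -> K `<=` Om -> forall M, Ile leb K (fun x => `|f x| `^ C) M ->
    IntFin K (fun x => f x `^ C).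
  move=> C0 cK KO M hM; have mK := compact_measurable cK; have nK := nnm_sub mO KO nf.
  have h : IntFin K (fun x => `|f x| `^ C) by apply: le_lt_trans hM _; exact: ltry.
  apply: (Int_dom_fin mK _ _ h); [by nnmt|by nnmt|].
  by apply: aeW => x Kx; apply: pow_le => //; solve [exact: nK.2|exact: ler_norm|exact: ltW].
case: qe tq fK => [r| |//] tq fK.
- rewrite lte_fin in tq; exists r => // K cK KO; have r0 : 0 < r by exact: le_lt_trans tq.
  have mK := compact_measurable cK.
  have mfK : measurable_fun K f by mst.
  have N0 : (0 <= Lnorm_on K r%:E f)%E by exact: Lnorm_ge0.
  apply: (fin r K r0 cK KO _ (Lnorm_on_Ile (c := fine (Lnorm_on K r%:E f)) r0 mfK _)).
  by rewrite fineK// ge0_fin_numE// fK.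
- exists (t + 1); first by rewrite ltrDl.
  move=> K cK KO; have C0 : 0 < t + 1 by rewrite ltr_wpDl.
  have mK := compact_measurable cK.
  have N0 : (0 <= Lnorm_on K +oo f)%E by exact: Lnorm_ge0.
  have : (Lnorm_on K +oo f <= (fine (Lnorm_on K +oo f))%:E)%E by rewrite fineK// ge0_fin_numE// fK.
  move: (fine _) => M /Lnorm_on_ae HM.
  have nK := nnm_sub mO KO nf.
  have h : IntFin K (fun=> Num.max M 0 `^ (t + 1)) by apply: (IntFin_cst Om_bounded mK KO).
  apply: (Int_dom_fin mK _ _ h); [by nnmt|by nnmt|].
  move: HM; apply: filterS => x HM Kx; apply: pow_le => //; first exact: nK.2.
  by rewrite le_max (le_trans (ler_norm _) (HM Kx)).
Qed.

Lemma pow_le1D (s t x : R) : 0 <= s -> s <= t -> 0 < t -> 0 <= x -> x `^ s <= 1 + x `^ t.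
Proof.
move=> s0 st t0 x0.
have := @pow_mul_le R s 0 t 1 x 0.
rewrite powRr0 mulr1 powR0 ?oner_eq0// addr0; apply => //.
by rewrite mul0r addr0 ler_pdivrMr ?mul1r.
Qed.

Lemma IntFin_pow_le U f (s t : R) : measurable U -> U `<=` Om -> nnm U f -> 0 <= s -> s <= t -> 0 < t ->
  IntFin U (fun x => f x `^ t) -> IntFin U (fun x => f x `^ s).
Proof.
move=> mU UO nf s0 st t0 ft.
have i1 : IntFin U (fun=> 1) by exact: (IntFin_cst Om_bounded).
have n1 : nnm U (fun=> 1 : R) by nnmt.
have nt : nnm U (fun x => f x `^ t) by nnmt.
have h : IntFin U (fun x => 1 + f x `^ t) by ift.
apply: (Int_dom_fin mU _ _ h); [by nnmt|by nnmt|].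
by apply: aeW => x Ux; apply: pow_le1D => //; exact: nf.2.
Qed.

Lemma IntFin_powD U f g (s : R) : measurable U -> U `<=` Om -> nnm U f -> nnm U g -> 0 <= s ->
  IntFin U (fun x => f x `^ s) -> IntFin U (fun x => g x `^ s) -> IntFin U (fun x => (f x + g x) `^ s).
Proof.
move=> mU UO nf ng s0 fs gs.
have k0 : 0 <= 2 `^ s :> R by [].
have h : IntFin U (fun x => 2 `^ s * (f x `^ s + g x `^ s)) by ift.
apply: (Int_dom_fin mU _ _ h); [by nnmt|by nnmt|].
by apply: aeW => x Ux; apply: pow_add => //; [exact: nf.2|exact: ng.2].
Qed.

End local_to_compact.

(** * Arithmetic of the exponents and integrability of [Zf] *)

Section coefficient_exponents.
Context {R : realType}.
Variables (p sigma psi d0 : R).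
Hypothesis p_gt1 : 1 < p.
Hypothesis sigma_gt1 : 1 < sigma.
Hypothesis psi_ge : p <= psi.
Hypothesis psi_lt : psi < p + 1 - sigma^-1.
Hypothesis d0_gt0 : 0 < d0.

Let p0 : 0 < p. Proof. exact: lt_trans p_gt1. Qed.
Let sigma0 : 0 < sigma. Proof. exact: lt_trans sigma_gt1. Qed.
Let w := p + 1 - psi.
Let wV : sigma^-1 < w. Proof. by move: psi_lt; rewrite /w; set y := sigma^-1; lra. Qed.
Let w0 : 0 < w. Proof. by apply: lt_trans wV; rewrite invr_gt0. Qed.
Let w1 : w <= 1. Proof. by move: psi_ge; rewrite /w; lra. Qed.
Let sw1 : 0 < sigma * w - 1.
Proof. by rewrite subr_gt0 mulrC -ltr_pdivrMr// div1r. Qed.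

Lemma dual_exp_gt0 : 0 < dual_exp sigma.
Proof. by rewrite /dual_exp divr_gt0// subr_gt0. Qed.

Lemma dual_exp_inv : (dual_exp sigma)^-1 = 1 - sigma^-1.
Proof. by rewrite /dual_exp invf_div mulrBl divff ?gt_eqF// div1r. Qed.

Section above_threshold.
Variable C : R.
Hypothesis C1 : p * sigma / (sigma * w - 1) < C.

Lemma c_exp_gt0 : 0 < C.
Proof. by apply: lt_trans C1; rewrite divr_gt0// mulr_gt0. Qed.
Let C0 := c_exp_gt0.

Let CV : C^-1 < (sigma * w - 1) / (p * sigma).
Proof. by rewrite -invf_div ltf_pV2// posrE ?divr_gt0 ?mulr_gt0. Qed.

(** For [c] in L^C and [u] in L^(p sigma), Hoelder's inequality puts the last summand of [Zf] into
    L^s, where 1/s is the left-hand side. At the threshold assumed for [C] the two sides would be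
    equal. *)
Lemma c_exp_unbounded : p / w / C + p / w * (psi - p) / (p * sigma) < (dual_exp sigma)^-1.
Proof.
rewrite dual_exp_inv.
have P0 : 0 < p / w by rewrite divr_gt0.
have : p / w / C < p / w * ((sigma * w - 1) / (p * sigma)) by rewrite ltr_pM2l.
rewrite (_ : p / w * ((sigma * w - 1) / (p * sigma)) = 1 - sigma^-1 - p / w * (psi - p) / (p * sigma)).
  by set X := p / w / C; set Y := _ / (p * sigma); lra.
by rewrite /w; field; rewrite -/w !gt_eqF.
Qed.

(** For bounded [u] only [c^(p/w)] matters, which lies in L^s with [s = C / (p/w)]. *)
Lemma c_exp_bounded : dual_exp sigma < C / (p / w).
Proof.
have P0 : 0 < p / w by rewrite divr_gt0.
rewrite ltr_pdivlMr//; apply: le_lt_trans C1.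
rewrite /dual_exp mulrACA -invfM [sigma * p]mulrC ler_wpM2l ?mulr_ge0 ?(ltW p0) ?(ltW sigma0)//.
have s1 : 0 < sigma - 1 by rewrite subr_gt0.
have e2 := mulr_gt0 s1 w0.
rewrite lef_pV2 ?posrE ?sw1 ?e2//.
by rewrite -subr_ge0 (_ : _ - _ = 1 - w) ?subr_ge0//; ring.
Qed.

(** Since [w <= 1], the positive denominator is at most [w * p * sigma], so the threshold is at
    least [d0 / w]. *)
Lemma c_exp_dimension : 0 < d0 * p * sigma / (w * (p * sigma + d0) - d0) ->
  d0 * p * sigma / (w * (p * sigma + d0) - d0) < C -> d0 / p < C / (p / w).
Proof.
move=> X0 XC.
have P0 : 0 < p / w by rewrite divr_gt0.
have n0 : 0 < d0 * p * sigma by rewrite !mulr_gt0.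
have den0 : 0 < w * (p * sigma + d0) - d0.
  rewrite ltNge; apply/negP => den; move: X0; apply/negP; rewrite -leNgt.
  by rewrite pmulr_rle0// invr_le0.
rewrite ltr_pdivlMr//; apply: le_lt_trans XC.
rewrite mulrA divfK ?gt_eqF//.
rewrite ler_pdivrMr// mulrAC ler_pdivlMr// -!mulrA ler_wpM2l ?(ltW d0_gt0)//.
have : d0 * w <= d0 by rewrite -[leRHS]mulr1 ler_wpM2l// ltW.
lra.
Qed.

End above_threshold.
End coefficient_exponents.

Section coefficient_integrability.
Context {R : realType} {n : nat}.
Variables (Om : set 'rV[R]_n) (p sigma psi d0 : R).
Hypothesis Om_open : open Om.
Hypothesis Om_bounded : bounded_set Om.
Hypothesis p_gt1 : 1 < p.
Hypothesis sigma_gt1 : 1 < sigma.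
Hypothesis psi_ge : p <= psi.
Hypothesis psi_lt : psi < p + 1 - sigma^-1.
Hypothesis d0_gt0 : 0 < d0.
Variables (b c d e f g h : 'rV[R]_n -> R).
Hypothesis nb : nnm Om b.
Hypothesis nc : nnm Om c.
Hypothesis nd : nnm Om d.
Hypothesis ne : nnm Om e.
Hypothesis nf : nnm Om f.
Hypothesis ng : nnm Om g.
Hypothesis nh : nnm Om h.
Implicit Types (u : 'rV[R]_n -> R) (U K : set 'rV[R]_n).
Local Notation IntFin U f := (Int leb U f%R < +oo)%E.
Local Notation Z := (Zf p psi b c d e f g h).
Variables (qB qH qD qC : \bar R).
Hypothesis qB_gt : ((Num.max (dual_exp p * dual_exp sigma) (d0 / (p - 1)))%:E < qB)%E.
Hypothesis b_Lloc : Lloc Om qB b.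
Hypothesis e_Lloc : Lloc Om qB e.
Hypothesis qH_gt : ((d0 / p)%:E < qH)%E.
Hypothesis qH_gt' : ((dual_exp sigma)%:E < qH)%E.
Hypothesis h_Lloc : Lloc Om qH h.
Hypothesis g_Lloc : Lloc Om qH g.
Hypothesis qD_gt : ((d0 / p)%:E < qD)%E.
Hypothesis qD_gt' : ((dual_exp sigma)%:E < qD)%E.
Hypothesis d_Lloc : Lloc Om qD d.
Hypothesis f_Lloc : Lloc Om qD f.
Hypothesis qC_gt0 : 0 < d0 * p * sigma / ((p + 1 - psi) * (p * sigma + d0) - d0).
Hypothesis qC_gt : ((d0 * p * sigma / ((p + 1 - psi) * (p * sigma + d0) - d0))%:E < qC)%E.
Hypothesis qC_gt' : ((p * sigma / (sigma * (p + 1 - psi) - 1))%:E < qC)%E.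
Hypothesis c_Lloc : Lloc Om qC c.

Let p0 : 0 < p. Proof. exact: lt_trans p_gt1. Qed.
Let sigma0 : 0 < sigma. Proof. exact: lt_trans sigma_gt1. Qed.
Let mO : measurable Om. Proof. exact: open_rV_measurable. Qed.
Let dp0 : 0 < dual_exp p. Proof. exact: dual_exp_gt0. Qed.
Let ds0 : 0 < dual_exp sigma. Proof. exact: dual_exp_gt0. Qed.
Let w0 : 0 < p + 1 - psi.
Proof.
have : 0 < sigma^-1 by rewrite invr_gt0.
by move: psi_lt; set y := sigma^-1; lra.
Qed.

Let Zf_pow_integrable U u s : measurable U -> U `<=` Om -> measurable_fun Om u -> 0 < s ->
  IntFin U (fun x => h x `^ s) -> IntFin U (fun x => g x `^ s) ->
  IntFin U (fun x => b x `^ (dual_exp p * s)) -> IntFin U (fun x => e x `^ (dual_exp p * s)) ->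
  IntFin U (fun x => d x `^ s) -> IntFin U (fun x => f x `^ s) ->
  IntFin U (fun x => (c x `^ (p / (p + 1 - psi)) * (1 + `|u x|) `^ (p / (p + 1 - psi) * (psi - p))) `^ s) ->
  IntFin U (fun x => Z u x `^ s).
Proof.
move=> mU UO mu s0 ih ig ib ie id_ if_ ic.
have nbU := nnm_sub mO UO nb; have ncU := nnm_sub mO UO nc; have ndU := nnm_sub mO UO nd.
have neU := nnm_sub mO UO ne; have nfU := nnm_sub mO UO nf; have ngU := nnm_sub mO UO ng.
have nhU := nnm_sub mO UO nh.
have muU : measurable_fun U u by mst.
have s0' : 0 <= s by exact: ltW.
have ps0 : 0 <= dual_exp p * s by rewrite mulr_ge0// ltW.
have ibe : IntFin U (fun x => ((b x + e x) `^ dual_exp p) `^ s).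
  rewrite (_ : (fun x => _) = (fun x => (b x + e x) `^ (dual_exp p * s))); last first.
    by apply/funext => x; rewrite powRrM.
  exact: (IntFin_powD mU UO).
rewrite /Zf.
apply: (IntFin_powD mU UO) => //; [by nnmt|by nnmt|].
apply: (IntFin_powD mU UO) => //; [by nnmt|].
apply: (IntFin_powD mU UO) => //; [by nnmt|].
apply: (IntFin_powD mU UO) => //; [by nnmt|by nnmt|].
exact: (IntFin_powD mU UO).
Qed.

(** Each pair of coefficients gets one finite exponent. [b] and [e] enter [Zf] to the dual power p'
    of p, and [d0 / (p - 1)] divided by p' is [d0 / p]. *)
Let exponents : exists tH tB tD, [/\ dual_exp sigma < tH /\ d0 / p < tH,
  dual_exp sigma < tB / dual_exp p /\ d0 / p < tB / dual_exp p, dual_exp sigma < tD /\ d0 / p < tD &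
  forall K, compact K -> K `<=` Om -> [/\ IntFin K (fun x => h x `^ tH) /\ IntFin K (fun x => g x `^ tH),
    IntFin K (fun x => b x `^ tB) /\ IntFin K (fun x => e x `^ tB) &
    IntFin K (fun x => d x `^ tD) /\ IntFin K (fun x => f x `^ tD)]].
Proof.
have dp : 0 <= d0 / p by rewrite divr_ge0 ?(ltW p0)// ltW.
have two (qe : \bar R) (t : R) (u v : 'rV[R]_n -> R) : 0 <= t -> (t%:E < qe)%E -> Lloc Om qe u -> Lloc Om qe v ->
    nnm Om u -> nnm Om v -> exists2 C, t < C & forall K, compact K -> K `<=` Om ->
      IntFin K (fun x => u x `^ C) /\ IntFin K (fun x => v x `^ C).
  move=> t0 tq uL vL nu nv.
  have [C tC HC] := Lloc_real Om_open Om_bounded t0 tq uL nu.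
  have [C' tC' HC'] := Lloc_real Om_open Om_bounded t0 tq vL nv.
  exists (Num.min C C'); first by rewrite lt_min tC tC'.
  move=> K cK KO; have mK := compact_measurable cK.
  have C00 : 0 <= Num.min C C' by rewrite le_min !(le_trans t0) ?(ltW tC) ?(ltW tC').
  split.
    apply: (IntFin_pow_le Om_bounded mK KO (nnm_sub mO KO nu) C00 _ _ (HC K cK KO)); first by rewrite ge_min lexx.
    exact: le_lt_trans tC.
  apply: (IntFin_pow_le Om_bounded mK KO (nnm_sub mO KO nv) C00 _ _ (HC' K cK KO)); first by rewrite ge_min lexx orbT.
  exact: le_lt_trans tC'.
have maxq (x y : R) (qe : \bar R) : (x%:E < qe)%E -> (y%:E < qe)%E -> ((Num.max x y)%:E < qe)%E.
  by move=> h1 h2; rewrite /Num.max; case: ifP.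
have [tH tH1 HH] := two qH (Num.max (dual_exp sigma) (d0 / p)) h g
  ltac:(by rewrite le_max dp orbT) (maxq _ _ _ qH_gt' qH_gt) h_Lloc g_Lloc nh ng.
have [tD tD1 HD] := two qD (Num.max (dual_exp sigma) (d0 / p)) d f
  ltac:(by rewrite le_max dp orbT) (maxq _ _ _ qD_gt' qD_gt) d_Lloc f_Lloc nd nf.
have B0 : 0 <= Num.max (dual_exp p * dual_exp sigma) (d0 / (p - 1)).
  by rewrite le_max (mulr_ge0 (ltW dp0) (ltW ds0)).
have [tB tB1 HB] := two qB (Num.max (dual_exp p * dual_exp sigma) (d0 / (p - 1))) b e
  B0 qB_gt b_Lloc e_Lloc nb ne.
exists tH, tB, tD; split.
- by move: tH1; rewrite gt_max => /andP.
- move: tB1; rewrite gt_max => /andP[h1 h2]; split; rewrite ltr_pdivlMr//; first by rewrite mulrC.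
  apply: le_lt_trans h2; rewrite /dual_exp mulrA divfK ?gt_eqF//.
- by move: tD1; rewrite gt_max => /andP.
- by move=> K cK KO; split; [exact: HH|exact: HB|exact: HD].
Qed.

Let Zf_pow_of_exponents U u s tH tB tD : measurable U -> U `<=` Om -> measurable_fun Om u -> 0 < s ->
  s <= tH -> s <= tB / dual_exp p -> s <= tD ->
  [/\ IntFin U (fun x => h x `^ tH) /\ IntFin U (fun x => g x `^ tH),
    IntFin U (fun x => b x `^ tB) /\ IntFin U (fun x => e x `^ tB) &
    IntFin U (fun x => d x `^ tD) /\ IntFin U (fun x => f x `^ tD)] ->
  IntFin U (fun x => (c x `^ (p / (p + 1 - psi)) * (1 + `|u x|) `^ (p / (p + 1 - psi) * (psi - p))) `^ s) ->
  IntFin U (fun x => Z u x `^ s).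
Proof.
move=> mU UO mu s0 sH sB sD [[ih ig] [ib ie] [id_ if_]] ic.
have R0 (v : 'rV[R]_n -> R) (s' t : R) : nnm Om v -> 0 < s' -> s' <= t -> IntFin U (fun x => v x `^ t) ->
    IntFin U (fun x => v x `^ s').
  move=> nv s'0 st iv.
  by apply: (IntFin_pow_le Om_bounded mU UO (nnm_sub mO UO nv) (ltW s'0) st (lt_le_trans s'0 st) iv).
have sB' : dual_exp p * s <= tB by rewrite mulrC -ler_pdivlMr.
have ps0 : 0 < dual_exp p * s by rewrite mulr_gt0.
have := R0 h _ _ nh s0 sH ih; have := R0 g _ _ ng s0 sH ig.
have := R0 b _ _ nb ps0 sB' ib; have := R0 e _ _ ne ps0 sB' ie.
have := R0 d _ _ nd s0 sD id_; have := R0 f _ _ nf s0 sD if_.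
by move=> *; apply: Zf_pow_integrable.
Qed.

Lemma Zf_integrable_unbounded : exists2 s, dual_exp sigma < s & forall K u, compact K -> K `<=` Om ->
  measurable_fun Om u -> IntFin K (fun x => `|u x| `^ (p * sigma)) -> IntFin K (fun x => Z u x `^ s).
Proof.
have [tH [tB [tD [[H1 _] [B1 _] [D1 _] HK]]]] := exponents.
have X0 : 0 < sigma * (p + 1 - psi) - 1.
  rewrite subr_gt0 mulrC -ltr_pdivrMr// div1r.
  by move: psi_lt; set y := sigma^-1; lra.
have [C C1 HC] := Lloc_real Om_open Om_bounded (ltW (divr_gt0 (mulr_gt0 p0 sigma0) X0)) qC_gt' c_Lloc nc.
have C0 := c_exp_gt0 p_gt1 sigma_gt1 psi_lt C1.
have E := c_exp_unbounded p_gt1 sigma_gt1 psi_lt C1.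
set P := p / (p + 1 - psi) in E.
have P0 : 0 < P by rewrite divr_gt0.
have ps0 : 0 < p * sigma by rewrite mulr_gt0.
have E0 : 0 < P / C + P * (psi - p) / (p * sigma).
  by rewrite ltr_wpDr ?divr_gt0// divr_ge0 ?mulr_ge0 ?subr_ge0 ?(ltW P0) ?(ltW p0) ?(ltW sigma0).
(* The last entry is the Hoelder exponent of the term with [c], computed in [c_exp_unbounded]. *)
pose s := Num.min (Num.min tH (tB / dual_exp p)) (Num.min tD (P / C + P * (psi - p) / (p * sigma))^-1).
have ss : dual_exp sigma < s.
  rewrite !lt_min H1 B1 D1/= -[dual_exp sigma]invrK ltf_pV2 ?posrE ?invr_gt0//.
exists s => // K u cK KO mu iu; have mK := compact_measurable cK.
have s0 : 0 < s by exact: lt_trans ss.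
have [s1 s2 s3 s4] : [/\ s <= tH, s <= tB / dual_exp p, s <= tD & s <= (P / C + P * (psi - p) / (p * sigma))^-1].
  by split; rewrite /s !ge_min lexx ?orbT.
apply: (Zf_pow_of_exponents mK KO mu s0 s1 s2 s3 (HK K cK KO)).
have ncK := nnm_sub mO KO nc.
have muK : measurable_fun K u by mst.
have i1 : IntFin K (fun=> 1) by exact: (IntFin_cst Om_bounded).
have n1 : nnm K (fun=> 1 : R) by nnmt.
have nu : nnm K (fun x => `|u x|) by nnmt.
have iU : IntFin K (fun x => (1 + `|u x|) `^ (p * sigma)).
  apply: (IntFin_powD mK KO) => //.
  by rewrite (_ : (fun x => _) = (fun=> 1))//; apply/funext => x; rewrite powR1.
have iC := HC K cK KO.
have nC : nnm K (fun x => c x `^ C) by nnmt.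
have nU : nnm K (fun x => (1 + `|u x|) `^ (p * sigma)) by nnmt.
have hh : IntFin K (fun x => 1 + c x `^ C + (1 + `|u x|) `^ (p * sigma)) by ift.
apply: (Int_dom_fin mK _ _ hh); [by nnmt|by nnmt|].
apply: aeW => x Kx; have c0 : 0 <= c x by exact: ncK.2.
rewrite powRM ?powR_ge0// -!powRrM.
apply: pow_mul_le => //; rewrite ?addr_ge0 ?mulr_ge0 ?subr_ge0 ?(ltW P0) ?(ltW s0)//.
have : s * (P / C + P * (psi - p) / (p * sigma)) <= 1 by rewrite -ler_pdivlMr// div1r.
rewrite (_ : s * _ = P * s / C + P * (psi - p) * s / (p * sigma))//.
by field; rewrite !gt_eqF.
Qed.

(** Boundedness turns the power of [1 + |u|] into a constant, so that the term with [c] is as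
    integrable as [c^P]. This makes room for the second requirement [d0 / p < s]. *)
Lemma Zf_integrable_bounded : exists s, [/\ dual_exp sigma < s, d0 / p < s & forall K u M, compact K -> K `<=` Om ->
  measurable_fun Om u -> (\forall x \ae leb, K x -> `|u x| <= M) -> IntFin K (fun x => Z u x `^ s)].
Proof.
have [tH [tB [tD [[H1 H2] [B1 B2] [D1 D2] HK]]]] := exponents.
have X0 : 0 < sigma * (p + 1 - psi) - 1.
  rewrite subr_gt0 mulrC -ltr_pdivrMr// div1r.
  by move: psi_lt; set y := sigma^-1; lra.
pose t := Num.max (p * sigma / (sigma * (p + 1 - psi) - 1))
  (d0 * p * sigma / ((p + 1 - psi) * (p * sigma + d0) - d0)).
have t0 : 0 <= t by rewrite le_max (ltW qC_gt0) orbT.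
have tq : (t%:E < qC)%E by rewrite /t /Num.max; case: ifP.
have [C + HC] := Lloc_real Om_open Om_bounded t0 tq c_Lloc nc.
rewrite gt_max => /andP[C1 C2].
have C0 := c_exp_gt0 p_gt1 sigma_gt1 psi_lt C1.
have E1 := c_exp_bounded p_gt1 sigma_gt1 psi_ge psi_lt C1.
have E2 := c_exp_dimension p_gt1 sigma_gt1 psi_ge psi_lt d0_gt0 qC_gt0 C2.
set P := p / (p + 1 - psi) in E1 E2.
have P0 : 0 < P by rewrite divr_gt0.
pose s := Num.min (Num.min tH (tB / dual_exp p)) (Num.min tD (C / P)).
have ss : dual_exp sigma < s by rewrite !lt_min H1 B1 D1.
exists s; split => //; first by rewrite !lt_min H2 B2 D2.
move=> K u M cK KO mu iu; have mK := compact_measurable cK.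
have s0 : 0 < s by exact: lt_trans ss.
have [s1 s2 s3 s4] : [/\ s <= tH, s <= tB / dual_exp p, s <= tD & s <= C / P].
  by split; rewrite /s !ge_min lexx ?orbT.
apply: (Zf_pow_of_exponents mK KO mu s0 s1 s2 s3 (HK K cK KO)).
have ncK := nnm_sub mO KO nc.
have muK : measurable_fun K u by mst.
have Ps0 : 0 < P * s by rewrite mulr_gt0.
have PsC : P * s <= C by rewrite mulrC -ler_pdivlMr.
have iC := IntFin_pow_le Om_bounded mK KO ncK (ltW Ps0) PsC C0 (HC K cK KO).
pose k := (1 + Num.max M 0) `^ (P * (psi - p) * s).
have k0 : 0 <= k by [].
have nC : nnm K (fun x => c x `^ (P * s)) by nnmt.
have hh : IntFin K (fun x => k * c x `^ (P * s)) by ift.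
apply: (Int_dom_fin mK _ _ hh); [by nnmt|by nnmt|].
move: iu; apply: filterS => x iu Kx; have c0 : 0 <= c x by exact: ncK.2.
rewrite powRM ?powR_ge0// -!powRrM mulrC ler_wpM2r//.
apply: pow_le => //.
  by rewrite !mulr_ge0 ?subr_ge0// ltW.
by rewrite lerD2l le_max iu.
Qed.

End coefficient_integrability.

(** * Logarithmic estimate and oscillation decay *)

Section barriers.
Context {R : realType}.
Variables (p M lam : R).
Hypothesis p_gt1 : 1 < p.
Hypothesis lam0 : 0 < lam.

(* [pow_barrier] is the test function (M + lam - t)^(1 - p), whose energy controls the p-energy of
   [log_barrier], the logarithm of 1 / (M + lam - t); both are extended linearly beyond t = M. *)
Definition pow_barrier (t : R) : R :=
  if t <= M then (M + lam - t) `^ (1 - p) else lam `^ (1 - p) + (p - 1) * lam `^ (- p) * (t - M).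
Definition dpow_barrier (t : R) : R :=
  if t <= M then (p - 1) * (M + lam - t) `^ (- p) else (p - 1) * lam `^ (- p).
Definition log_barrier (A t : R) : R :=
  if t <= M then ln A - ln (M + lam - t) else ln A - ln lam + lam^-1 * (t - M).
Definition dlog_barrier (t : R) : R := if t <= M then (M + lam - t)^-1 else lam^-1.

Let gap0 t : t <= M -> 0 < M + lam - t. Proof. by move=> tM; rewrite addrAC ltr_wpDl ?subr_ge0. Qed.
Let gaplam t : t <= M -> lam <= M + lam - t. Proof. by move=> tM; rewrite addrAC lerDr subr_ge0. Qed.
Let p10 : 0 < p - 1. Proof. by rewrite subr_gt0. Qed.

Let dgap t : is_derive t (1 : R) (fun s => M + lam - s) (-1).
Proof.
have d1 : is_derive t (1 : R) (cst (M + lam) - id) (0 - 1) by apply: is_deriveB.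
by rewrite sub0r in d1.
Qed.

Let cgap t : M + lam - s @[s --> t] --> M + lam - t.
Proof. by apply: cvgB; [exact: cvg_cst|exact: cvg_id]. Qed.

Let daff (k m t : R) : is_derive t (1 : R) (fun s => k + m * (s - M)) m.
Proof. by apply: is_derive_eq; rewrite /GRing.scale /=; ring. Qed.

Lemma pow_barrier_C1 : C1fun pow_barrier dpow_barrier.
Proof.
apply: (@C1_glue R (fun t => (M + lam - t) `^ (1 - p)) (fun t => (p - 1) * (M + lam - t) `^ (- p))
  (fun t => lam `^ (1 - p) + (p - 1) * lam `^ (- p) * (t - M)) (fun=> (p - 1) * lam `^ (- p))).
- move=> t tM; have := gap0 tM => g0.
  have d1 := is_derive1_powR (1 - p) g0.
  have d2 := @is_derive1_comp R (@powR R ^~ (1 - p)) (fun s => M + lam - s) t _ _ d1 (dgap t).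
  apply: is_derive_eq.
  rewrite (_ : 1 - p - 1 = - p); last by ring.
  by ring.
- by move=> t _; exact: daff.
- move=> t tM; have := gap0 tM => g0.
  have d1 := is_derive1_powR (- p) g0.
  have d2 := @is_derive1_comp R (@powR R ^~ (- p)) (fun s => M + lam - s) t _ _ d1 (dgap t).
  have c : {for t, continuous (@powR R ^~ (- p) \o (fun s => M + lam - s))}.
    by apply: differentiable_continuous; apply/derivable1_diffP; case: d2.
  by apply: cvgM; [exact: cvg_cst|exact: c].
- by move=> t _; exact: cst_continuous.
- by rewrite subrr mulr0 addr0 addrAC subrr add0r.
- by rewrite addrAC subrr add0r.
Qed.

Lemma log_barrier_C1 A : C1fun (log_barrier A) dlog_barrier.
Proof.
apply: (@C1_glue R (fun t => ln A - ln (M + lam - t)) (fun t => (M + lam - t)^-1)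
  (fun t => ln A - ln lam + lam^-1 * (t - M)) (fun=> lam^-1)).
- move=> t tM; have := gap0 tM => g0.
  have d1 := is_derive1_ln g0.
  have d2 := @is_derive1_comp R (@ln R) (fun s => M + lam - s) t _ _ d1 (dgap t).
  have d3 : is_derive t (1 : R) (fun s => ln A - (@ln R \o (fun s => M + lam - s)) s) (0 - (M + lam - t)^-1 * (-1)).
    by apply: is_deriveB.
  apply: is_derive_eq.
  by ring.
- by move=> t _; exact: daff.
- move=> t tM; have := gap0 tM => g0.
  by apply: cvgV; [rewrite gt_eqF|exact: cgap].
- by move=> t _; exact: cst_continuous.
- by rewrite subrr mulr0 addr0 addrAC subrr add0r.
- by rewrite addrAC subrr add0r.
Qed.

Lemma pow_barrier_ge0 t : 0 <= pow_barrier t.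
Proof.
rewrite /pow_barrier; case: (leP t M) => [//|Mt].
by rewrite addr_ge0// !mulr_ge0// ?subr_ge0 ?(ltW Mt)// ltW.
Qed.

Lemma dpow_barrier_bounds t : 0 <= dpow_barrier t <= (p - 1) * lam `^ (- p).
Proof.
rewrite /dpow_barrier; case: (leP t M) => [tM|Mt]; last by rewrite lexx andbT mulr_ge0// ltW.
rewrite mulr_ge0 ?(ltW p10)//= ler_wpM2l ?(ltW p10)// !powRN lef_pV2 ?posrE ?powR_gt0 ?gap0//.
by apply: pow_le; [exact: (ltW (lt_trans ltr01 p_gt1))|exact: ltW|exact: gaplam].
Qed.


Lemma dlog_barrier_bounds t : 0 <= dlog_barrier t <= lam^-1.
Proof.
rewrite /dlog_barrier; case: (leP t M) => [tM|Mt]; last by rewrite lexx invr_ge0 ltW.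
by rewrite invr_ge0 (ltW (gap0 tM))/= lef_pV2 ?posrE ?gap0// gaplam.
Qed.

Lemma dlog_barrier_pow t : dlog_barrier t `^ p = (p - 1)^-1 * dpow_barrier t.
Proof.
rewrite /dlog_barrier /dpow_barrier; case: (leP t M) => [tM|Mt].
  by rewrite mulKf ?gt_eqF// -powR_inv1 ?(ltW (gap0 tM))// -powRrM mulN1r.
by rewrite mulKf ?gt_eqF// -powR_inv1 ?(ltW lam0)// -powRrM mulN1r.
Qed.

Lemma pow_barrier_eq t : t <= M -> pow_barrier t = dpow_barrier t * ((M + lam - t) / (p - 1)).
Proof.
move=> tM; rewrite /pow_barrier /dpow_barrier tM; have g0 := gap0 tM.
rewrite powRD; last by apply/implyP => _; rewrite gt_eqF.
rewrite powRr1 ?(ltW g0)//; set X := _ `^ _; field; rewrite gt_eqF//.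
Qed.

(** With [v = (M + lam - t) / (p - 1)] one has [F = dF * v] by [pow_barrier_eq], and the main term
    [dF * v^p] of Caccioppoli's inequality becomes a constant. This dictates the exponent [1 - p] of
    the barrier. *)
Lemma dpow_barrier_gap t : t <= M -> dpow_barrier t * ((M + lam - t) / (p - 1)) `^ p = (p - 1) `^ (1 - p).
Proof.
move=> tM; rewrite /dpow_barrier tM; have g0 := gap0 tM.
rewrite powRM ?invr_ge0 ?(ltW g0) ?(ltW p10)// -[(p - 1)^-1]powR_inv1 ?(ltW p10)// -powRrM mulN1r.
rewrite [(M + lam - t) `^ (- p)]powRN.
have : (M + lam - t) `^ p != 0 by rewrite gt_eqF ?powR_gt0.
rewrite [(p - 1) `^ (1 - p)]powRD; last by apply/implyP => _; rewrite gt_eqF.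
rewrite powRr1 ?(ltW p10)//; set X := _ `^ _; set Y := _ `^ (- p) => X0; field.
exact: X0.
Qed.

End barriers.

(** * Estimates for solutions on a single ball *)

Section regularity.
Context {R : realType} {n : nat}.
Variables (Om : set 'rV[R]_n) (p : R) (Q : 'rV[R]_n -> 'M[R]_n).
Hypothesis Om_open : open Om.
Hypothesis Om_bounded : bounded_set Om.
Hypothesis p_gt1 : 1 < p.
Hypothesis Q_measurable : forall i j, measurable_fun Om (fun x => Q x i j).
Hypothesis Q_psd : forall x, Om x -> psdmx (Q x).
Variables (rho : 'rV[R]_n -> 'rV[R]_n -> R) (R2 : 'rV[R]_n -> R).
Hypothesis rho_open : balls_open Om rho.
Variable sigma : R.
Hypothesis sigma_gt1 : 1 < sigma.
Variables (a psi : R) (b c d e f g h : 'rV[R]_n -> R).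
Hypothesis a0 : 0 < a.
Hypothesis ppsi : p <= psi.
Hypothesis psip : psi < p + 1.
Hypothesis nb : nnm Om b.
Hypothesis nc : nnm Om c.
Hypothesis nd : nnm Om d.
Hypothesis ne : nnm Om e.
Hypothesis nf : nnm Om f.
Hypothesis ng : nnm Om g.
Hypothesis nh : nnm Om h.
Implicit Types (u v w : 'rV[R]_n -> R) (du : 'rV[R]_n -> 'rV[R]_n) (U : set 'rV[R]_n).
Local Notation Qn := (Qnorm Q).
Local Notation IntFin U f := (Int leb U f%R < +oo)%E.
Local Notation sol := (solution Om p Q a psi b c d e f g h).
Local Notation Z := (Zf p psi b c d e f g h).
Local Notation ball_ := (qball Om rho).
Variables (s1 Cc N CS tau : R).
Hypothesis s1_gt : p * dual_exp sigma < s1.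
Hypothesis Cc0 : 0 < Cc.
Hypothesis N1 : 1 <= N.
Hypothesis CS0 : 0 < CS.
Hypothesis tau01 : 0 < tau < 1.
Hypothesis ball_pos : forall y r, Om y -> 0 < r -> 0 < fine (leb (ball_ y r)).
Hypothesis cutoffs_ball : forall y r, Om y -> 0 < r -> r < R2 y -> exists zeta D,
  cutoffs p Q (ball_ y r) (ball_ y (tau * r)) r s1 Cc N zeta D /\
  forall u du, W1pQ p Q Om u du -> IntFin (ball_ y r) (fun x => D 0%N x `^ p * `|u x| `^ p).
Hypothesis sobolev_ball : forall y r, Om y -> 0 < r -> r < R2 y -> sobolev_power p Q sigma (ball_ y r) r CS.

Let p0 : 0 < p. Proof. exact: lt_trans p_gt1. Qed.
Let sigma0 : 0 < sigma. Proof. exact: lt_trans sigma_gt1. Qed.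
Let mO : measurable Om. Proof. exact: open_rV_measurable. Qed.
Let ds1 : 1 < dual_exp sigma.
Proof. by rewrite /dual_exp ltr_pdivlMr ?subr_gt0// mul1r gtrBl. Qed.
Let ps1 : p < s1. Proof. by apply: lt_trans s1_gt; rewrite ltr_pMr. Qed.
Let tau0 : 0 < tau. Proof. by case/andP: tau01. Qed.

Let ballO y r : ball_ y r `<=` Om. Proof. by move=> x []. Qed.
Let open_ball y r : Om y -> 0 < r -> open (ball_ y r). Proof. by move=> Oy r0; exact: rho_open. Qed.
Let mball y r : Om y -> 0 < r -> measurable (ball_ y r).
Proof. by move=> Oy r0; apply: open_rV_measurable; exact: rho_open. Qed.
Let ball_le y r t : r <= t -> ball_ y r `<=` ball_ y t.
Proof. by move=> rt x [Ox xr]; split=> //; exact: lt_le_trans rt. Qed.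
Let ball_tau y r : 0 < r -> ball_ y (tau * r) `<=` ball_ y r.
Proof. by move=> r0; apply: ball_le; rewrite -[leRHS]mul1r ler_wpM2r ?ltW//; case/andP: tau01. Qed.

Lemma cutoff_grad_le B B' r zeta D j : cutoffs p Q B B' r s1 Cc N zeta D ->
  \forall x \ae leb, B x -> Qn x (grad (zeta j) x) <= D j x.
Proof.
move=> [c1 _ c3 _ _]; have [_ z01] := c1 j; have [nD gD] := c3 j.
apply: filterS gD => x gD Bx; have /andP[z0 z1] := z01 x; have D0 : 0 <= D j x by exact: nD.2.
apply: le_trans (gD Bx) _; rewrite -[leRHS]mul1r ler_wpM2r//.
apply: (@le_trans _ _ (1 `^ (1 - p^-1))); last by rewrite powR1.
by apply: pow_le => //; rewrite subr_ge0 invf_le1// ltW.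
Qed.

(** The first gain of integrability, from Sobolev's inequality for [zeta 0] times the ramp of [u].
    The energy is finite because the gradient bound [D 0] times [u] is p-integrable by the choice of
    the cutoffs. *)
Let ramp_power_integrable u du y r : W1pQ p Q Om u du -> Om y -> 0 < r -> r < R2 y ->
  IntFin (ball_ y (tau * r)) (fun x => ramp 0 1 (u x) `^ (p * sigma)).
Proof.
move=> W Oy r0 rR; have [zeta [D [cut uD]]] := cutoffs_ball Oy r0 rR.
have sob := sobolev_ball Oy r0 rR.
set B := ball_ y r in cut uD sob *; set B' := ball_ y (tau * r) in cut *.
have mB : measurable B by exact: mball.
have mB' : measurable B' by apply: mball => //; rewrite mulr_gt0.
have BB : B' `<=` B by exact: ball_tau.
have BO : B `<=` Om by exact: ballO.
have B_open : open B by exact: open_ball.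
have mB0 : 0 < fine (leb B) by exact: ball_pos.
have [c1 c2 c3 _ _] := cut; have [Lz z01] := c1 0%N; have [nD _] := c3 0%N.
have gD := cutoff_grad_le 0 cut.
have [mu mdu _] := W.
have e0 : 0 < 1 :> R by [].
have ra0 t : 0 <= ramp 0 1 t :> R by exact: ramp_ge0.
have rau t : ramp 0 1 t <= `|t| :> R.
  by apply: le_trans (ramp_le 0 t e0) _; rewrite subr0 ge_max normr_ge0 ler_norm.
have mra : measurable_fun B (fun x => ramp 0 1 (u x)).
  apply: (measurableT_comp (f := ramp 0 1)); last by mst.
  by apply: continuous_measurable_fun; exact: (C1_continuous (ramp_C1 0 e0)).
have mdra : measurable_fun B (fun x => dramp 0 1 (u x)).
  apply: (measurableT_comp (f := dramp 0 1)); last by mst.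
  by apply: continuous_measurable_fun; exact: (ramp_C1 0 e0).2.
have nra : nnm B (fun x => ramp 0 1 (u x)) by split.
have ndra : nnm B (fun x => dramp 0 1 (u x)).
  by split=> // x _; have /andP[] := dramp_bounds 0 (u x) e0.
have nz : nnm B (zeta 0%N).
  by split=> [|x _]; [have := zeta_measurable Om_open Lz => h1; mst|have /andP[] := z01 x].
have mQdu : measurable_fun B (fun x => Qn x (du x)).
  have h1 : measurable_fun Om (fun x => Qn x (du x)) by exact: (Qn_measurable Om_open Q_measurable Q_psd).
  by mst.
have nQdu : nnm B (fun x => Qn x (du x)) by split.
have nQz : nnm B (fun x => Qn x (grad (zeta 0%N) x)).
  by split=> //; have := Qgrad_zeta_measurable Om_open Q_measurable Q_psd Lz => h1; mst.
have muB : measurable_fun B u by mst.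
have nu : nnm B (fun x => `|u x| `^ p) by nnmt.
have nQ : nnm B (fun x => Qn x (du x) `^ p) by nnmt.
have nuO : nnm Om (fun x => `|u x| `^ p) by nnmt.
have nQO : nnm Om (fun x => Qn x (du x) `^ p).
  have h1 : measurable_fun Om (fun x => Qn x (du x)) by exact: (Qn_measurable Om_open Q_measurable Q_psd).
  by nnmt.
have nDu : nnm B (fun x => D 0%N x `^ p * `|u x| `^ p) by nnmt.
have [ui gi] := W1pQ_fin Om_open p_gt1 Q_measurable Q_psd W.
have ui' : IntFin B (fun x => `|u x| `^ p) by exact: (IntFin_sub mB mO nuO BO ui).
have gi' : IntFin B (fun x => Qn x (du x) `^ p) by exact: (IntFin_sub mB mO nQO BO gi).
have uDi := uD u du W.
have toIle F : IntFin B F -> nnm B F -> exists2 k, 0 <= k & Ile leb B F (fine (leb B) * k).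
  move=> iF nF; exists (fine (Int leb B F) / fine (leb B)).
    by rewrite divr_ge0 ?(ltW mB0)// fine_ge0//; exact: Int_ge0.
  by rewrite mulrC divfK ?gt_eqF// /Ile fineK// ge0_fin_numE//; exact: Int_ge0.
have k2 : 0 <= 2 `^ p :> R by [].
have i1 : IntFin B (fun x => (zeta 0%N x * dramp 0 1 (u x) * Qn x (du x) + ramp 0 1 (u x) * Qn x (grad (zeta 0%N) x)) `^ p).
  have hh : IntFin B (fun x => 2 `^ p * (Qn x (du x) `^ p + D 0%N x `^ p * `|u x| `^ p)) by ift.
  apply: (Int_dom_fin mB _ _ hh); [by nnmt|by nnmt|].
  move: gD; apply: filterS => x gD Bx.
  have D0 : 0 <= D 0%N x by exact: nD.2.
  have z0 := nz.2 x Bx; have dr0 := ndra.2 x Bx.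
  have z1 : zeta 0%N x <= 1 by have /andP[] := z01 x.
  have dr1 : dramp 0 1 (u x) <= 1 by have /andP[] := dramp_bounds 0 (u x) e0.
  apply: le_trans (pow_add _ _ _) _; rewrite ?mulr_ge0//.
  rewrite ler_wpM2l// lerD//.
    apply: pow_le; [exact: ltW|by rewrite !mulr_ge0|].
    by rewrite -[leRHS]mul1r ler_wpM2r// -[leRHS]mul1r ler_pM.
  rewrite -powRM//; apply: pow_le; [exact: ltW|by rewrite mulr_ge0|].
  by rewrite mulrC ler_pM// gD.
have i2 : IntFin B (fun x => (zeta 0%N x * ramp 0 1 (u x)) `^ p).
  apply: (Int_dom_fin mB _ _ ui'); [by nnmt|by nnmt|].
  apply: aeW => x Bx; apply: pow_le; [exact: ltW|by rewrite mulr_ge0 ?nz.2|].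
  by rewrite -[leRHS]mul1r ler_pM ?nz.2//; have /andP[] := z01 x.
have [al al0 Ia] := toIle _ i1 ltac:(by nnmt).
have [be be0 Ib] := toIle _ i2 ltac:(by nnmt).
have S := sobolev_cutoff Om_open Om_bounded p_gt1 Q_measurable Q_psd B_open BO Lz z01
  (cutoff_grad_int Om_open Om_bounded p_gt1 Q_measurable Q_psd B_open BO r0 ps1 cut 0%N)
  W (ramp_C1 0 e0) ra0 (fun t => (andP (dramp_bounds 0 t e0)).1)
  (fun t => (andP (dramp_bounds 0 t e0)).2) (ltW sigma0) (ltW r0) sob al0 be0 Ia Ib.
have nzr : nnm B (fun x => (zeta 0%N x * ramp 0 1 (u x)) `^ (p * sigma)) by nnmt.
have SF : IntFin B (fun x => (zeta 0%N x * ramp 0 1 (u x)) `^ (p * sigma)) by apply: le_lt_trans S _; exact: ltry.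
have SF' := IntFin_sub mB' mB nzr BB SF.
have n' : nnm B' (fun x => ramp 0 1 (u x)) := nnm_sub mB BB nra.
have nzr' := nnm_sub mB BB nzr.
apply: (Int_dom_fin mB' _ _ SF'); [by nnmt|by nnmt|].
by apply: aeW => x B'x; rewrite c2// mul1r.
Qed.

(** [|t|] is at most [ramp 0 1 t + ramp 0 1 (- t) + 1], so that the ramps of [u] and [- u]
    suffice. *)
Lemma power_integrable_ball u du y r : W1pQ p Q Om u du -> Om y -> 0 < r -> r < R2 y ->
  IntFin (ball_ y (tau * r)) (fun x => `|u x| `^ (p * sigma)).
Proof.
have key (x z t : R) : t - 0 - 1 <= x -> - t - 0 - 1 <= z -> 0 <= x -> 0 <= z -> `|t| <= x + z + 1.
  by move=> h1 h2 h3 h4; rewrite ler_norml; apply/andP; split; lra.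
move=> W Oy r0 rR.
have HN : C1fun (fun t : R => - t) (fun=> -1).
  split=> [t|]; last exact: cst_continuous.
  by have dX : is_derive t (1 : R) (@id R) 1 by [exact: is_derive_id]; exact: is_deriveN.
have N1' (t : R) : `|-1 : R| <= 1 by rewrite normrN1.
have W' := W1pQ_comp Om_open Om_bounded p_gt1 Q_measurable Q_psd W HN N1'.
have I1 := ramp_power_integrable W Oy r0 rR.
have I2 := ramp_power_integrable W' Oy r0 rR.
have mB' : measurable (ball_ y (tau * r)) by apply: mball => //; rewrite mulr_gt0.
set B' := ball_ y (tau * r) in I1 I2 mB' *.
have BO : B' `<=` Om by exact: ballO.
have [mu _ _] := W; have muB : measurable_fun B' u by mst.
have e0 : 0 < 1 :> R by [].
have mra v : measurable_fun B' v -> nnm B' (fun x => ramp 0 1 (v x)).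
  move=> mv; split; last by move=> x _; exact: ramp_ge0.
  apply: (measurableT_comp (f := ramp 0 1)) => //.
  by apply: continuous_measurable_fun; exact: (C1_continuous (ramp_C1 0 e0)).
have [mN' _ _] := W'; have mN := measurable_funS mO BO mN'.
have n1 := mra u muB; have n2 := mra _ mN.
have ps0 : 0 <= p * sigma by rewrite mulr_ge0 ?(ltW p0) ?(ltW sigma0).
have i3 := IntFin_powD mB' BO n1 n2 ps0 I1 I2.
have n3 : nnm B' (fun x => ramp 0 1 (u x) + ramp 0 1 (- u x)) by nnmt.
have n4 : nnm B' (fun=> 1 : R) by nnmt.
have i4 : IntFin B' (fun x => 1 `^ (p * sigma)) by exact: (IntFin_cst Om_bounded).
have i5 := IntFin_powD mB' BO n3 n4 ps0 i3 i4.
apply: (Int_dom_fin mB' _ _ i5); [by nnmt|by nnmt|].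
apply: aeW => x Bx; apply: pow_le => //.
have h1 := ramp_ge 0 (u x) e0; have h2 := ramp_ge 0 (- u x) e0.
have h3 := ramp_ge0 0 (u x) e0; have h4 := ramp_ge0 0 (- u x) e0.
exact: key.
Qed.

(** As [s] exceeds the dual exponent of [sigma], [1/s + 1/sigma <= 1], and [pow_mul_le] applies. *)
Lemma Zf_weight_integrable U u s : measurable U -> U `<=` Om -> measurable_fun Om u -> dual_exp sigma < s ->
  IntFin U (fun x => `|u x| `^ (p * sigma)) -> IntFin U (fun x => Z u x `^ s) ->
  IntFin U (fun x => Z u x * (1 + `|u x|) `^ p).
Proof.
move=> mU UO mu ss iu iZ.
have s0 : 0 < s by apply: lt_trans ss; exact: lt_trans ds1.
have muU : measurable_fun U u by mst.
have nZ : nnm U (Z u) by apply: (nnm_sub mO UO); apply: Zf_nnm.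
have ps0 : 0 < p * sigma by rewrite mulr_gt0.
have i1 : IntFin U (fun=> 1) by exact: (IntFin_cst Om_bounded).
have n1 : nnm U (fun=> 1 : R) by nnmt.
have nu : nnm U (fun x => `|u x|) by nnmt.
have iU : IntFin U (fun x => (1 + `|u x|) `^ (p * sigma)).
  apply: (IntFin_powD mU UO) => //.
  by rewrite (_ : (fun x => _) = (fun=> 1))//; apply/funext => x; rewrite powR1.
have nU : nnm U (fun x => (1 + `|u x|) `^ (p * sigma)) by nnmt.
have nZs : nnm U (fun x => Z u x `^ s) by nnmt.
have hh : IntFin U (fun x => 1 + Z u x `^ s + (1 + `|u x|) `^ (p * sigma)) by ift.
apply: (Int_dom_fin mU _ _ hh); [by nnmt|by nnmt|].
apply: aeW => x Ux; have Z0 := nZ.2 x Ux.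
have := @pow_mul_le R 1 p s (p * sigma) (Z u x) (1 + `|u x|).
rewrite powRr1//; apply => //.
have -> : p / (p * sigma) = sigma^-1 by field; rewrite !gt_eqF.
have : s^-1 < (dual_exp sigma)^-1 by rewrite ltf_pV2// posrE; exact: lt_trans ds1.
rewrite dual_exp_inv// div1r; move: (sigma^-1) (s^-1) => x1 x2; lra.
Qed.

Lemma local_upper_bound u du y r s : sol u du -> Om y -> 0 < r -> r < R2 y -> dual_exp sigma < s ->
  IntFin (ball_ y r) (fun x => `|u x| `^ (p * sigma)) -> IntFin (ball_ y r) (fun x => Z u x `^ s) ->
  exists M, \forall x \ae leb, ball_ y (tau * r) x -> u x <= M.
Proof.
have ar1 (l k' t : R) : 1 <= l -> l <= k' -> k' < t -> 0 <= 1 + t + (t - k') by lra.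
have ar2 (l k' t : R) : 1 <= l -> k' <= l + l -> k' < t -> 1 + t + (t - k') <= 3 * (t - k' + l) by lra.
have ar3 (l k' t : R) : 1 <= l -> l <= k' -> t - k' <= 1 + t by lra.
move=> Su Oy r0 rR ss iu iZ; have [zeta [D [cut _]]] := cutoffs_ball Oy r0 rR.
have sob := sobolev_ball Oy r0 rR.
set B := ball_ y r in cut sob iu iZ *; set B' := ball_ y (tau * r) in cut *.
have mB : measurable B by exact: mball.
have mB' : measurable B' by apply: mball => //; rewrite mulr_gt0.
have BB : B' `<=` B by exact: ball_tau.
have BO : B `<=` Om by exact: ballO.
have B_open : open B by exact: open_ball.
have mB0 : 0 < fine (leb B) by exact: ball_pos.
have mu := solution_measurable Su.
have muB : measurable_fun B u by mst.
have s0 : 0 < s by apply: lt_trans ss; exact: lt_trans ds1.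
have ps0 : 0 < p * sigma by rewrite mulr_gt0.
have IZ := Zf_weight_integrable mB BO mu ss iu iZ.
have nZ : nnm B (Z u) by apply: (nnm_sub mO BO); apply: Zf_nnm.
(* For a level [k'] between [l] and [2 * l], [l >= 1], and [u > k'], the sum [1 + u + (u - k')] is
   at most [3 * (u - k' + l)]. *)
pose Zs x := 3 `^ p * Z u x.
have nZs : nnm B Zs by rewrite /Zs; nnmt.
have iZs : IntFin B (fun x => (r `^ p * Zs x) `^ s).
  have k0 : 0 <= (r `^ p * 3 `^ p) `^ s by [].
  have nn : nnm B (fun x => Z u x `^ s) by nnmt.
  have hh : IntFin B (fun x => (r `^ p * 3 `^ p) `^ s * Z u x `^ s) by ift.
  apply: (Int_dom_fin mB _ _ hh); [by nnmt|by nnmt|].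
  by apply: aeW => x Bx; rewrite /Zs mulrA powRM ?mulr_ge0// nZ.2.
have nZss : nnm B (fun x => (r `^ p * Zs x) `^ s) by nnmt.
pose Lam := fine (Int leb B (fun x => (r `^ p * Zs x) `^ s)) / fine (leb B) + 1.
have Lam0 : 0 < Lam.
  by apply: ltr_wpDl => //; apply: divr_ge0; [apply: fine_ge0; exact: Int_ge0|exact: ltW].
have ILam : Ile leb B (fun x => (r `^ p * Zs x) `^ s) (fine (leb B) * Lam).
  rewrite /Lam mulrDr mulrCA divff ?gt_eqF// !mulr1.
  apply: (@le_trans _ _ (fine (Int leb B (fun x => (r `^ p * Zs x) `^ s)))%:E).
    by rewrite fineK// ge0_fin_numE//; exact: Int_ge0.
  by rewrite lee_fin lerDl ltW.
have [nu nu0 H] := de_giorgi Om_open Om_bounded p_gt1 Q_measurable Q_psd sigma_gt1 a0 ppsi psip nb nc nd ne nf ng nh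
  ler01 s1_gt ss Cc0 N1 CS0 Lam0.
have nu_ : nnm B (fun x => `|u x| `^ (p * sigma)) by nnmt.
pose I := fine (Int leb B (fun x => `|u x| `^ (p * sigma))).
have I0 : 0 <= I by apply: fine_ge0; apply: Int_ge0; exact: nu_.
have II : Ile leb B (fun x => `|u x| `^ (p * sigma)) I.
  by rewrite /Ile /I fineK// ge0_fin_numE//; exact: Int_ge0.
have q0 : 0 <= I / (fine (leb B) * nu) by rewrite divr_ge0 ?mulr_ge0// ltW.
(* So large that [l^(p sigma) * nu] times the measure of [B] is at least the integral of
   [|u|^(p sigma)], which starts the iteration; at least 1 as required for [Zs]. *)
pose l := 1 + (I / (fine (leb B) * nu)) `^ (p * sigma)^-1.
have l1 : 1 <= l by rewrite lerDl.
have l0 : 0 < l by exact: lt_le_trans l1.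
have lI : I <= fine (leb B) * (l `^ (p * sigma) * nu).
  have : I / (fine (leb B) * nu) <= l `^ (p * sigma).
    apply: (@le_trans _ _ (((I / (fine (leb B) * nu)) `^ (p * sigma)^-1) `^ (p * sigma))).
      by rewrite -powRrM mulVf ?gt_eqF// powRr1.
    by apply: pow_le; [exact: ltW|by []|rewrite lerDr].
  by rewrite ler_pdivrMr ?mulr_gt0// => h1; rewrite mulrCA.
exists (l + l).
apply: (H u du B B' r zeta D Su B_open BO r0 mB0 mB' BB cut sob IZ l l Zs l0 nZs _ ILam _).
- apply: aeW => x Bx k' /andP[lk kl] ku.
  have u0 : 0 < u x by apply: lt_trans ku; exact: lt_le_trans lk.
  rewrite (ger0_norm (ltW u0)) mul1r; split; first exact: ar3 l1 lk.
  rewrite /Zs mulrAC [leRHS]mulrC; apply: ler_wpM2l; first exact: nZ.2.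
  rewrite -powRM//; last by rewrite addr_ge0 ?(ltW l0)// subr_ge0 ltW.
  by apply: pow_le; [exact: ltW|exact: ar1 l1 lk ku|exact: ar2 l1 kl ku].
- have nw : nnm B (fun x => Num.max (u x - l) 0 `^ (p * sigma)).
    have nw : nnm B (fun x => Num.max (u x - l) 0).
      split=> [|x _]; last by rewrite le_max lexx orbT.
      by apply: measurable_maxr; [mst|exact: measurable_cst].
    by nnmt.
  apply: (Ile_le mB nw nu_ _ lI II).
  apply: aeW => x Bx; apply: pow_le; [exact: ltW|by rewrite le_max lexx orbT|].
  by rewrite ge_max normr_ge0 andbT; apply: le_trans (ler_norm _); rewrite gerBl ltW.
Qed.


Lemma Int_level (H : set 'rV[R]_n) (F : 'rV[R]_n -> R) (k m : R) : measurable H -> (leb H < +oo)%E -> nnm H F -> 0 <= k ->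
  (\forall x \ae leb, H x -> k <= F x) -> Ile leb H F m -> k * fine (leb H) <= m.
Proof.
move=> mH Hfin nF k0 kF hF.
have lH : leb H = (fine (leb H))%:E by rewrite fineK// ge0_fin_numE// lebesgue_outer_ge0.
have nk : nnm H (fun=> k) by nnmt.
have : Ile leb H (fun=> k) m by apply: (Ile_le mH nk nF kF _ hF).
by rewrite /Ile Int_cst// [X in (_ * X)%E]lH -EFinM lee_fin.
Qed.

Let Ile_sub U V F k : measurable U -> measurable V -> U `<=` V -> nnm V F -> Ile leb V F k -> Ile leb U F k.
Proof.
move=> mU mV UV nF; apply: le_trans.
have : (Int leb U F <= Int leb V F)%E by exact: Int_sub.
exact.
Qed.

Let leb_fin U : U `<=` Om -> (leb U < +oo)%E.
Proof. by move=> UO; apply: le_lt_trans (le_lebesgue_outer UO) (leb_Om Om_bounded). Qed.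

Let lebE U : U `<=` Om -> leb U = (fine (leb U))%:E.
Proof. by move=> UO; rewrite fineK// ge0_fin_numE ?leb_fin// lebesgue_outer_ge0. Qed.

Let fine_leb_le U V : U `<=` V -> V `<=` Om -> fine (leb U) <= fine (leb V).
Proof.
move=> UV VO; have UO := subset_trans UV VO.
by rewrite -lee_fin -(lebE UO) -(lebE VO); exact: le_lebesgue_outer.
Qed.

Let Zf_weight_bounded U u s M0 I : measurable U -> U `<=` Om -> measurable_fun Om u -> 1 < s ->
  (\forall x \ae leb, U x -> `|u x| <= M0) -> Ile leb U (fun x => Z u x `^ s) I ->
  IntFin U (fun x => Z u x * (1 + `|u x|) `^ p).
Proof.
move=> mU UO mu s1' uM iZ.
have nZ : nnm U (Z u) by apply: (nnm_sub mO UO); apply: Zf_nnm.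
have muU : measurable_fun U u by mst.
have iZs : IntFin U (fun x => Z u x `^ s) by apply: le_lt_trans iZ _; exact: ltry.
have i1 : IntFin U (fun=> 1) by exact: (IntFin_cst Om_bounded).
have n1 : nnm U (fun=> 1 : R) by nnmt.
have nZs : nnm U (fun x => Z u x `^ s) by nnmt.
have k0 : 0 <= (1 + M0) `^ p by [].
have hh : IntFin U (fun x => (1 + M0) `^ p * (1 + Z u x `^ s)) by ift.
apply: (Int_dom_fin mU _ _ hh); [by nnmt|by nnmt|].
move: uM; apply: filterS => x uM Ux; have Z0 := nZ.2 x Ux.
have h1 : (1 + `|u x|) `^ p <= (1 + M0) `^ p.
  by apply: pow_le; [exact: ltW|by rewrite addr_ge0|rewrite lerD2l; exact: uM].
have h2 := @pow_le1D R 1 s (Z u x) ler01 (ltW s1') (lt_trans ltr01 s1') Z0.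
rewrite powRr1// in h2.
by rewrite mulrC ler_pM.
Qed.

(** Caccioppoli's inequality for [pow_barrier]. The term with the cutoff does not see [u], by
    [dpow_barrier_gap]. The term with [Zf] carries at worst [lam^(-p)], and the condition on [I]
    says that [lam] is large enough for this term, too, to be of order [r^(-p)] in the mean. *)
Lemma log_energy (M0 s : R) : 0 < M0 -> 1 < s -> exists2 C4, 0 < C4 & forall u du y r M lam I,
  sol u du -> Om y -> 0 < r -> r < R2 y ->
  (\forall x \ae leb, ball_ y r x -> `|u x| <= M0 /\ u x <= M) -> `|M| <= M0 -> 0 < lam -> lam <= 2 * M0 ->
  Ile leb (ball_ y r) (fun x => Z u x `^ s) I -> r `^ (p * s) * I <= lam `^ (p * s) * fine (leb (ball_ y r)) ->
  Ile leb (ball_ y (tau * r)) (fun x => dpow_barrier p M lam (u x) * Qn x (du x) `^ p)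
    (C4 * ((r `^ p)^-1 * fine (leb (ball_ y r)))).
Proof.
have ar1 (M lam t : R) : t <= M -> 0 < lam -> 0 <= M + lam - t by lra.
have ar2 (M lam t : R) : `|t| <= M0 -> `|M| <= M0 -> lam <= 2 * M0 -> M + lam - t <= 4 * M0.
  by rewrite !ler_norml => /andP[h3 h4] /andP[h5 h6] h7; lra.
move=> M00 s_1; have p10 : 0 < p - 1 by rewrite subr_gt0.
have s0 : 0 < s by exact: lt_trans s_1.
(* A bound for [v], since [M + lam - u <= 4 * M0]. *)
pose Cv := 4 * M0 / (p - 1).
have Cv0 : 0 <= Cv by rewrite divr_ge0 ?mulr_ge0 ?(ltW M00) ?(ltW p10).
have [C0 C00 cac] := caccioppoli Om_open p_gt1 Q_measurable Q_psd a0 ppsi psip nb nc nd ne nf ng nh Cv0.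
pose K1 := 1 + M0 + Cv.
have K10 : 0 < K1 by rewrite ltr_wpDr// addr_gt0.
pose k1 := (p - 1) `^ (1 - p); pose k2 := (p - 1) * K1 `^ p.
have k10 : 0 < k1 by rewrite powR_gt0.
have k20 : 0 < k2 by rewrite mulr_gt0// powR_gt0.
exists (C0 * (k1 * (1 + Cc) + k2 * 2)).
  by rewrite mulr_gt0// addr_gt0// mulr_gt0// addr_gt0.
move=> u du y r M lam I Su Oy r0 rR uM MM0 lam0 lamM iZ hI.
have [zeta [D [cut _]]] := cutoffs_ball Oy r0 rR.
have mB' : measurable (ball_ y (tau * r)) by apply: mball => //; rewrite mulr_gt0.
set B := ball_ y r in cut uM iZ hI *; set B' := ball_ y (tau * r) in cut mB' *.
have mB : measurable B by exact: mball.
have BB : B' `<=` B by exact: ball_tau.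
have BO : B `<=` Om by exact: ballO.
have B_open : open B by exact: open_ball.
have mB0 : 0 < fine (leb B) by exact: ball_pos.
have mu := solution_measurable Su; have muB : measurable_fun B u by mst.
have [al [be [W _ _]]] := Su; have [_ mdu _] := W.
have [c1 c2 c3 _ c5] := cut; have [Lz z01] := c1 0%N; have [nD gD] := c3 0%N.
have nZ : nnm B (Z u) by apply: (nnm_sub mO BO); apply: Zf_nnm.
have uM0 : \forall x \ae leb, B x -> `|u x| <= M0 by apply: filterS uM => x h1 /h1[].
have IZ := Zf_weight_bounded mB BO mu s_1 uM0 iZ.
have FC1 : C1fun (pow_barrier p M lam) (dpow_barrier p M lam) by exact: pow_barrier_C1.
have F0 t : 0 <= pow_barrier p M lam t by exact: pow_barrier_ge0.
have dF0 t : 0 <= dpow_barrier p M lam t <= (p - 1) * lam `^ (- p) by exact: dpow_barrier_bounds.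
pose v x := Num.max (M + lam - u x) 0 / (p - 1).
have nmx : nnm B (fun x => Num.max (M + lam - u x) 0).
  split=> [|x _]; last by rewrite le_max lexx orbT.
  by apply: measurable_maxr; [mst|exact: measurable_cst].
have k00 : 0 <= (p - 1)^-1 by rewrite invr_ge0 ltW.
have nv : nnm B v by rewrite /v; nnmt.
have veq x : u x <= M -> v x = (M + lam - u x) / (p - 1).
  by move=> h1; rewrite /v max_l//; exact: ar1.
have vle x : `|u x| <= M0 -> u x <= M -> v x <= Cv.
  move=> h1 h2; rewrite veq// /Cv ler_wpM2r// ar2.
have ndF : nnm B (fun x => dpow_barrier p M lam (u x)).
  split=> [|x _]; last by have /andP[] := dF0 (u x).
  apply: (measurableT_comp (f := dpow_barrier p M lam)); last by mst.
  by apply: continuous_measurable_fun; exact: FC1.2.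
have nz : nnm B (zeta 0%N).
  by split=> [|x _]; [have := zeta_measurable Om_open Lz => h1; mst|have /andP[] := z01 x].
have nQdu : nnm B (fun x => Qn x (du x)).
  split=> //; have h1 : measurable_fun Om (fun x => Qn x (du x)) by exact: (Qn_measurable Om_open Q_measurable Q_psd).
  by mst.
(* Both have averages bounded by constants: [X1] by the cutoffs, [X2] by the condition relating
   [lam], [r] and [I]. *)
pose X1 x := (r * D 0%N x) `^ s1; pose X2 x := (r `^ p * lam `^ (- p) * Z u x) `^ s.
have rl0 : 0 <= r `^ p * lam `^ (- p) by [].
have r0' : 0 <= r by exact: ltW.
have nX1 : nnm B X1 by rewrite /X1; nnmt.
have nX2 : nnm B X2 by rewrite /X2; nnmt.
have n1 : nnm B (fun=> 1 : R) by nnmt.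
have i1 : Ile leb B (fun=> 1) (fine (leb B) * 1).
  by rewrite /Ile Int_cst// [X in (_ * X)%E](lebE BO) -EFinM mulrC.
have iX1 : Ile leb B X1 (fine (leb B) * Cc) by have := c5 0%N; rewrite expr0 mulr1.
have iX2 : Ile leb B X2 (fine (leb B) * 1).
  have nZs : nnm B (fun x => Z u x `^ s) by nnmt.
  have kk : 0 <= (r `^ p * lam `^ (- p)) `^ s by [].
  have h2 := IleZ mB nZs kk iZ.
  apply: (Ile_le mB nX2 _ _ _ h2); first by nnmt.
    by apply: aeW => x Bx; rewrite /X2 powRM ?nZ.2.
  have lp0 : 0 < lam `^ (p * s) by rewrite powR_gt0.
  rewrite powRM// -!powRrM mulNr powRN mulrAC ler_pdivrMr// mulr1 [leRHS]mulrC//.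
pose X x := k1 * (1 + X1 x) + k2 * (1 + X2 x).
have iX : Ile leb B X (fine (leb B) * (k1 * (1 + Cc) + k2 * 2)).
  have a1 := IleZ mB (nnmD n1 nX1) (ltW k10) (IleD mB n1 nX1 i1 iX1).
  have a2 := IleZ mB (nnmD n1 nX2) (ltW k20) (IleD mB n1 nX2 i1 iX2).
  have nk1 : nnm B (fun x => k1 * (1 + X1 x)) by nnmt.
  have nk2 : nnm B (fun x => k2 * (1 + X2 x)) by nnmt.
  have := IleD mB nk1 nk2 a1 a2; congr (Ile leb B _ _).
  by ring.
have nX : nnm B X by rewrite /X; nnmt.
have rp0 : 0 < r `^ p by rewrite powR_gt0.
have rV0 : 0 <= (r `^ p)^-1 by [].
have key : Ile leb B (fun x => zeta 0%N x * dpow_barrier p M lam (u x) * Qn x (du x) `^ p)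
    (C0 * ((r `^ p)^-1 * (fine (leb B) * (k1 * (1 + Cc) + k2 * 2)))).
  apply: (cac u du Su B (zeta 0%N) (D 0%N) B_open BO Lz z01
    (cutoff_grad_int Om_open Om_bounded p_gt1 Q_measurable Q_psd B_open BO r0 ps1 cut 0%N) nD gD IZ
    (pow_barrier p M lam) (dpow_barrier p M lam) ((p - 1) * lam `^ (- p)) v FC1 F0 dF0 nv).
    apply: filterS uM => x h1 Bx; have [h2 h3] := h1 Bx; split.
      by rewrite (pow_barrier_eq p_gt1 lam0 h3) veq.
    by apply: le_trans (vle x h2 h3) _; rewrite ler_peMr// lerDl.
  apply: (Ile_le mB _ _ _ (lexx _) (IleZ mB nX rV0 iX)); [by nnmt|by nnmt|].
  apply: filterS uM => x h1 Bx; have [h2 h3] := h1 Bx.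
  have D0 := nD.2 x Bx; have Z0 := nZ.2 x Bx; have v0 := nv.2 x Bx.
  have d0 := ndF.2 x Bx; have z0 := nz.2 x Bx.
  rewrite ler_pdivlMl// mulrCA [r `^ p * _]mulrDr mulrDr; apply: lerD.
    rewrite (_ : _ * (_ * (_ * _)) = (dpow_barrier p M lam (u x) * v x `^ p) * (r `^ p * D 0%N x `^ p)); last by ring.
    rewrite -powRM// veq// (dpow_barrier_gap p_gt1 lam0 h3).
    by rewrite ler_wpM2l ?(ltW k10)//; apply: pow_le1D; rewrite ?mulr_ge0 ?(ltW p0) ?(ltW ps1)//; exact: lt_trans ps1.
  have b1 : (1 + `|u x| + v x) `^ p <= K1 `^ p.
    by apply: pow_le; [exact: ltW|by rewrite !addr_ge0|rewrite /K1 lerD// ?lerD2l// vle].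
  have b2 : dpow_barrier p M lam (u x) <= (p - 1) * lam `^ (- p) by have /andP[] := dF0 (u x).
  have b3 := @pow_le1D R 1 s (r `^ p * lam `^ (- p) * Z u x) ler01 (ltW s_1) s0 (mulr_ge0 rl0 Z0).
  rewrite powRr1 ?mulr_ge0// in b3.
  apply: (@le_trans _ _ (k2 * (r `^ p * lam `^ (- p) * Z u x))); last by rewrite ler_wpM2l ?(ltW k20).
  have z1 : zeta 0%N x <= 1 by have /andP[] := z01 x.
  have b4 : zeta 0%N x * Z u x * (1 + `|u x| + v x) `^ p <= Z u x * K1 `^ p.
    by apply: ler_pM => //; rewrite ?mulr_ge0// -[leRHS]mul1r ler_wpM2r.
  apply: (@le_trans _ _ ((p - 1) * lam `^ (- p) * (r `^ p * (Z u x * K1 `^ p)))).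
    by apply: ler_pM => //; rewrite ?ler_wpM2l ?(ltW rp0) ?mulr_ge0.
  by rewrite le_eqVlt; apply/orP; left; apply/eqP; rewrite /k2; ring.
have nzd : nnm B (fun x => zeta 0%N x * dpow_barrier p M lam (u x) * Qn x (du x) `^ p) by nnmt.
have ndF' := nnm_sub mB BB ndF; have nQdu' := nnm_sub mB BB nQdu; have nzd' := nnm_sub mB BB nzd.
have h6 : Ile leb B' (fun x => zeta 0%N x * dpow_barrier p M lam (u x) * Qn x (du x) `^ p)
    (C0 * ((r `^ p)^-1 * (fine (leb B) * (k1 * (1 + Cc) + k2 * 2)))) by exact: (Ile_sub mB' mB BB nzd key).
apply: (Ile_le mB' _ nzd' _ _ h6); first by nnmt.
  by apply: aeW => x B'x; rewrite c2// mul1r.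
by rewrite le_eqVlt; apply/orP; left; apply/eqP; ring.
Qed.

Variables (C2 bb : R).
Hypothesis C20 : 0 < C2.
Hypothesis bb1 : 1 <= bb.
Hypothesis poincare_ball : forall y r, Om y -> 0 < r -> r < R2 y -> forall w gw, W1pQ p Q Om w gw ->
  (fint (ball_ y r) (fun x => `|w x - avg (ball_ y r) w|%:E) <=
   (C2 * r)%:E * avg_norm (ball_ y (bb * r)) p%:E (fun x => Qn x (gw x)))%E.

Let bb0 : 0 < bb. Proof. exact: lt_le_trans bb1. Qed.

Lemma poincare_Ile y r w gw k : Om y -> 0 < r -> r < R2 y -> W1pQ p Q Om w gw -> 0 <= k ->
  Ile leb (ball_ y (bb * r)) (fun x => Qn x (gw x) `^ p) (fine (leb (ball_ y (bb * r))) * k) ->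
  exists A, Ile leb (ball_ y r) (fun x => `|w x - A|) (fine (leb (ball_ y r)) * (C2 * r * k `^ p^-1)).
Proof.
move=> Oy r0 rR W k0 hk; have P := poincare_ball Oy r0 rR W.
have [mw mgw _] := W.
exists (avg (ball_ y r) w); set A := avg _ _ in P *.
have br0 : 0 < bb * r by rewrite mulr_gt0.
have mB := mball Oy r0; have mB1 := mball Oy br0.
have mBp := ball_pos Oy r0; have mBp1 := ball_pos Oy br0.
have BO1 : ball_ y (bb * r) `<=` Om by exact: ballO.
have mQ : measurable_fun (ball_ y (bb * r)) (fun x => Qn x (gw x)).
  have h1 : measurable_fun Om (fun x => Qn x (gw x)) by exact: (Qn_measurable Om_open Q_measurable Q_psd).
  by mst.
have hav : (avg_norm (ball_ y (bb * r)) p%:E (fun x => Qn x (gw x)) <= (k `^ p^-1)%:E)%E.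
  apply: (Ile_avg_norm p0 mQ mBp1 k0).
  have -> : (fun x => `|Qn x (gw x)| `^ p) = (fun x => Qn x (gw x) `^ p).
    by apply/funext => x; rewrite ger0_norm// Qnorm_ge0.
  exact: hk.
have Cr0 : 0 <= C2 * r by rewrite mulr_ge0 ?(ltW C20) ?(ltW r0).
have {}P : (fint (ball_ y r) (fun x => `|w x - A|%:E) <= (C2 * r * k `^ p^-1)%:E)%E.
  by apply: le_trans P _; rewrite [in leRHS]EFinM; apply: lee_wpmul2l; rewrite ?lee_fin.
by rewrite /Ile EFinM -lee_pdivrMl//; exact: P.
Qed.

(** With this radius the enlarged ball of Poincare's inequality has radius [tau * r], where the
    logarithmic energy is controlled. *)
Let rr r := tau * r / bb.

Let rr0 r : 0 < r -> 0 < rr r. Proof. by move=> r0; rewrite /rr !mulr_gt0// invr_gt0. Qed.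
Let bbrr r : bb * rr r = tau * r. Proof. by rewrite /rr; field; rewrite gt_eqF. Qed.
Let rr_tau r : 0 < r -> rr r <= tau * r.
Proof. by move=> r0; rewrite /rr ler_pdivrMr// ler_peMr// mulr_ge0 ?(ltW tau0) ?(ltW r0). Qed.
Let rr_le r : 0 < r -> rr r <= r.
Proof.
move=> r0; apply: le_trans (rr_tau r0) _; rewrite -[leRHS]mul1r ler_wpM2r ?(ltW r0)//.
by case/andP: tau01 => _ /ltW.
Qed.

(* The truncated logarithm vanishes where u <= M - om / 2, which is half of the ball, so that
   Poincare's inequality bounds its integral and Chebyshev's inequality the measure of the set
   where u is exponentially close to M + lam. *)
Lemma log_level (M0 s Cd : R) : 0 < M0 -> 1 < s -> 0 < Cd -> exists2 C5, 0 < C5 & forall u du y r M lam om I S,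
  sol u du -> Om y -> 0 < r -> r < R2 y ->
  (\forall x \ae leb, ball_ y r x -> `|u x| <= M0 /\ u x <= M) -> `|M| <= M0 -> 0 < lam -> lam <= 2 * M0 ->
  Ile leb (ball_ y r) (fun x => Z u x `^ s) I -> r `^ (p * s) * I <= lam `^ (p * s) * fine (leb (ball_ y r)) ->
  fine (leb (ball_ y r)) <= Cd * fine (leb (ball_ y (rr r))) -> 0 < om -> 0 < S ->
  fine (leb (ball_ y (rr r))) / 2 <= fine (leb (ball_ y (rr r) `&` [set x | u x <= M - om / 2])) ->
  (S - C5) * fine (leb (ball_ y (rr r) `&` [set x | M + lam - expR (- S) * (om / 2 + lam) < u x]))
    <= C5 * fine (leb (ball_ y (rr r))).
Proof.
move=> M00 s_1 Cd0; have [C4 C40 E] := log_energy M00 s_1.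
have ar1 (M lam t : R) : t <= M -> 0 < lam -> 0 < M + lam - t by lra.
have ar2 (om lam M t : R) : t <= M - om / 2 -> om / 2 + lam <= M + lam - t by lra.
have ar3 (M lam X t : R) : M + lam - X < t -> M + lam - t <= X by lra.
have ar4 (S' y z : R) : y <= - S' + z -> S' <= z - y by lra.
have ar5 (S' y z a' b' : R) : S' <= y -> y - 0 - 1 <= z -> a' <= b' -> S' - 1 - b' <= z - a' by lra.
have p10 : 0 < p - 1 by rewrite subr_gt0.
pose k := (p - 1)^-1 * C4 * Cd.
have k0 : 0 < k by rewrite !mulr_gt0// invr_gt0.
pose k3 := C2 * k `^ p^-1.
have k30 : 0 < k3 by rewrite mulr_gt0// powR_gt0.
have ar S' X Y a' m : 0 <= X -> 0 <= Y -> a' * (Y / 2) <= Y * k3 -> 0 < Y ->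
    m * X <= Y * k3 -> S' - 1 - a' <= m -> (S' - (1 + 2 * k3)) * X <= (1 + 2 * k3) * Y.
  move=> X0 Y0 h1 Yp h2 h3.
  have h4 : a' <= 2 * k3 by move: h1; rewrite mulrCA ler_pM2l//; lra.
  apply: (@le_trans _ _ (m * X)); first by apply: ler_wpM2r => //; lra.
  by apply: le_trans h2 _; rewrite mulrC; apply: ler_wpM2r => //; lra.
(* The 1 is the loss of the smoothed positive part [ramp 0 1], and [2 * k3] bounds the constant
   subtracted in Poincare's inequality. *)
exists (1 + 2 * k3); first by rewrite addr_gt0// mulr_gt0.
move=> u du y r M lam om I S Su Oy r0 rR uM MM0 lam0 lamM iZ hI dbl om0 S0 half.
have {}E := E u du y r M lam I Su Oy r0 rR uM MM0 lam0 lamM iZ hI.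
have mu := solution_measurable Su.
have [al [be [W _ _]]] := Su.
pose A := om / 2 + lam.
have A0 : 0 < A by rewrite addr_gt0// divr_gt0.
have e0 : 0 < 1 :> R by [].
have L1 : forall t, `|dlog_barrier M lam t| <= lam^-1.
  by move=> t; have /andP[h1 h2] := dlog_barrier_bounds M lam0 t; rewrite ger0_norm.
have R1' : forall t : R, `|dramp 0 1 t| <= 1.
  by move=> t; have /andP[h1 h2] := dramp_bounds 0 t e0; rewrite ger0_norm.
have W1 := W1pQ_comp Om_open Om_bounded p_gt1 Q_measurable Q_psd W (log_barrier_C1 M lam0 A) L1.
have W2 := W1pQ_comp Om_open Om_bounded p_gt1 Q_measurable Q_psd W1 (ramp_C1 0 e0) R1'.
set w := (ramp 0 1 \o _) in W2; set gw := (fun x => dramp 0 1 _ *: _) in W2.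
have r20 := rr0 r0; have r2R : rr r < R2 y by apply: le_lt_trans rR; exact: rr_le.
set B2 := ball_ y (rr r) in dbl half *.
have mB2 : measurable B2 by exact: mball.
have mB2p : 0 < fine (leb B2) by exact: ball_pos.
have B2O : B2 `<=` Om by exact: ballO.
have tr0 : 0 < tau * r by rewrite mulr_gt0.
have mB' := mball Oy tr0.
have [mw mgw _] := W2.
have mdu : measurable_fun Om (fun x => Qn x (du x)).
  by have [_ ? _] := W; exact: (Qn_measurable Om_open Q_measurable Q_psd).
have B'O : ball_ y (tau * r) `<=` Om by exact: ballO.
have iw : Ile leb (ball_ y (bb * rr r)) (fun x => Qn x (gw x) `^ p)
    (fine (leb (ball_ y (bb * rr r))) * (k * (r `^ p)^-1)).
  rewrite bbrr.
  have n1 : nnm (ball_ y (tau * r)) (fun x => Qn x (gw x) `^ p).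
    have h1 : measurable_fun Om (fun x => Qn x (gw x)) by exact: (Qn_measurable Om_open Q_measurable Q_psd).
    by nnmt.
  have n2 : nnm (ball_ y (tau * r)) (fun x => dpow_barrier p M lam (u x) * Qn x (du x) `^ p).
    have n3 : nnm (ball_ y (tau * r)) (fun x => dpow_barrier p M lam (u x)).
      split=> [|x _]; last by have /andP[] := dpow_barrier_bounds M p_gt1 lam0 (u x).
      apply: (measurableT_comp (f := dpow_barrier p M lam)); last by mst.
      apply: continuous_measurable_fun.
      have FC1 : C1fun (pow_barrier p M lam) (dpow_barrier p M lam) by exact: pow_barrier_C1.
      exact: FC1.2.
    have n4 : nnm (ball_ y (tau * r)) (fun x => Qn x (du x)) by split=> //; mst.
    by nnmt.
  have kk : 0 <= (p - 1)^-1 by rewrite invr_ge0 ltW.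
  have h1 := IleZ mB' n2 kk E.
  apply: (Ile_le mB' n1 _ _ _ h1); first by nnmt.
    apply: aeW => x Bx; rewrite /gw !QnormZ.
    have /andP[d1 d2] := dramp_bounds 0 (log_barrier M lam A (u x)) e0.
    have /andP[d3 d4] := dlog_barrier_bounds M lam0 (u x).
    rewrite [`|dramp _ _ _|]ger0_norm// [`|dlog_barrier _ _ _|]ger0_norm//.
    apply: (@le_trans _ _ ((dlog_barrier M lam (u x) * Qn x (du x)) `^ p)).
      apply: pow_le; [exact: ltW|by rewrite !mulr_ge0|].
      by rewrite -[leRHS]mul1r ler_wpM2r// mulr_ge0.
    by rewrite powRM// dlog_barrier_pow// -mulrA.
  have mle : fine (leb (ball_ y r)) <= Cd * fine (leb (ball_ y (tau * r))).
    apply: le_trans dbl _; rewrite ler_wpM2l ?(ltW Cd0)//; apply: fine_leb_le => //; exact: (ball_le (rr_tau r0)).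
  rewrite [leRHS]mulrC /k -!mulrA ler_wpM2l// ler_wpM2l ?(ltW C40)//.
  by rewrite mulrCA ler_wpM2l// invr_ge0 ltW// powR_gt0.
have krp0 : 0 <= k * (r `^ p)^-1 by rewrite mulr_ge0 ?(ltW k0)// invr_ge0 ltW// powR_gt0.
have [a' iA] := poincare_Ile Oy r20 r2R W2 krp0 iw.
have nwa : nnm B2 (fun x => `|w x - a'|).
  have mwB : measurable_fun B2 w by exact: (measurable_funS mO B2O).
  have mwa : measurable_fun B2 (fun x => w x - a') by apply: measurable_funB => //; exact: measurable_cst.
  by nnmt.
have {}iA : Ile leb B2 (fun x => `|w x - a'|) (fine (leb B2) * k3).
  apply: (Ile_le mB2 nwa nwa _ _ iA); first exact: aeW.
  rewrite ler_wpM2l ?(ltW mB2p)// powRM ?(ltW k0) ?invr_ge0 ?powR_ge0//.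
  have -> : (r `^ p)^-1 `^ p^-1 = r^-1.
    by rewrite -powRN -powRrM mulNr divff ?gt_eqF// powR_inv1// ltW.
  rewrite (_ : _ * _ = (rr r / r) * k3); last by rewrite /k3; ring.
  by rewrite -[leRHS]mul1r ler_wpM2r ?(ltW k30)// ler_pdivrMr// mul1r rr_le.
have muB := measurable_funS mO B2O mu.
have meas_le (c' : R) : measurable (B2 `&` [set x | u x <= c']).
  have := muB mB2 `]-oo, c']%classic (measurable_itv _).
  by congr (measurable (_ `&` _)); apply/seteqP; split=> x /=; rewrite in_itv.
have meas_gt (c' : R) : measurable (B2 `&` [set x | c' < u x]).
  have := muB mB2 `]c', +oo[%classic (measurable_itv _).
  by congr (measurable (_ `&` _)); apply/seteqP; split=> x /=; rewrite in_itv/= andbT.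
have small H m : measurable H -> H `<=` B2 -> 0 <= m -> (\forall x \ae leb, H x -> m <= `|w x - a'|) ->
    m * fine (leb H) <= fine (leb B2) * k3.
  move=> mH HB m0 hm; apply: (Int_level mH _ (nnm_sub mB2 HB nwa) m0 hm).
    by apply: leb_fin; exact: subset_trans B2O.
  exact: (Ile_sub mH mB2 HB nwa iA).
set H := B2 `&` [set x | _ < u x].
have H0 : 0 <= fine (leb H) by rewrite fine_ge0// lebesgue_outer_ge0.
have logM x : u x <= M -> log_barrier M lam A (u x) = ln A - ln (M + lam - u x).
  by rewrite /log_barrier => ->.
(* Where [u <= M - om / 2] the logarithm is not positive and [w] vanishes. This set has at least
   half of the measure of the ball, which bounds [a']. *)
have e1 : `|a'| * (fine (leb B2) / 2) <= fine (leb B2) * k3.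
  apply: le_trans (small _ `|a'| (meas_le (M - om / 2)) (@subIsetl _ _ _) (normr_ge0 _) _).
    by rewrite ler_wpM2l.
  apply: aeW => x [Bx /= ux].
  have uM' : u x <= M by apply: le_trans ux _; rewrite gerBl divr_ge0// ltW.
  have -> : w x = 0.
    rewrite /w /= (logM x uM') /ramp.
    have -> // : ln A - ln (M + lam - u x) <= 0.
    have g0 := ar1 M lam (u x) uM' lam0.
    by rewrite subr_le0 ler_ln ?posrE; [exact: ar2|exact: A0|exact: g0].
  by rewrite sub0r normrN.
have [S1|S1] := leP (S - 1 - `|a'|) 0.
  by apply: (ar S _ _ `|a'| 0) => //; rewrite mul0r mulr_ge0// ltW.
have e2 : (S - 1 - `|a'|) * fine (leb H) <= fine (leb B2) * k3.
  apply: small; [exact: meas_gt|exact: subIsetl|exact: ltW|].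
  apply: filterS uM => x hx [Bx /= ux].
  have [_ uM'] := hx (ball_le (rr_le r0) Bx).
  have gap := ar1 M lam (u x) uM' lam0.
  have hS : S <= ln A - ln (M + lam - u x).
    have : ln (M + lam - u x) <= ln (expR (- S) * A).
      by rewrite ler_ln ?posrE; [exact: ar3|exact: gap|apply: mulr_gt0 => //; exact: expR_gt0].
    by rewrite lnM ?posrE ?expRK; [exact: ar4|exact: expR_gt0|exact: A0].
  have h3 := ramp_ge 0 (ln A - ln (M + lam - u x)) e0.
  apply: le_trans (ler_norm _); rewrite /w /= (logM x uM').
  have h4 := ler_norm a'.
  have := ar5 S _ _ a' `|a'| hS h3 h4; exact: id.
by apply: (ar S _ _ `|a'| (S - 1 - `|a'|)) => //; exact: ltW.
Qed.

(* The parameters are chosen in the order nu (De Giorgi), S (logarithmic estimate), lam = th om. *)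
Lemma growth_lemma (M0 s Cd : R) : 0 < M0 -> dual_exp sigma < s -> 0 < Cd -> exists eta Kc,
  [/\ 0 < eta, eta < 1, 0 < Kc & forall u du y r M om I,
  sol u du -> Om y -> 0 < r -> r < R2 y ->
  (\forall x \ae leb, ball_ y r x -> `|u x| <= M0 /\ u x <= M) -> `|M| <= M0 -> 0 < om -> om <= 2 * M0 ->
  Ile leb (ball_ y r) (fun x => Z u x `^ s) I -> 0 <= I ->
  fine (leb (ball_ y r)) <= Cd * fine (leb (ball_ y (rr r))) ->
  Kc * (r `^ (p * s) * I) <= om `^ (p * s) * fine (leb (ball_ y (rr r))) ->
  fine (leb (ball_ y (rr r))) / 2 <= fine (leb (ball_ y (rr r) `&` [set x | u x <= M - om / 2])) ->
  \forall x \ae leb, ball_ y (tau * rr r) x -> u x <= M - eta * om].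
Proof.
move=> M00 ss Cd0.
have ar1 (es L om : R) : es * om / 2 <= L -> es / 8 * om <= L / 4 by rewrite -[es / 8 * om]mulrAC; lra.
have ar2 (x1 L M lam : R) : x1 / 2 <= L -> lam = x1 / 8 -> 0 < x1 -> M + lam - L + L / 4 <= M - x1 / 4 by lra.
have ar3 (t k' M lam L om : R) : L <= om / 2 + lam -> M + lam - L <= k' -> t <= M -> om <= 2 * M0 -> t - k' <= 3 * M0 by lra.
have ar4 (t M lam L : R) : t <= M -> 0 < lam -> t - (M + lam - L) <= L by lra.
have ar5 (es : R) : es < 1 -> es / 8 <= 1 / 8 by lra.
have ar6 (th om : R) : th <= 1 / 8 -> 0 < om -> th * om <= om / 8 by nra.
have ar7 (lam om : R) : lam <= om / 8 -> om <= 2 * M0 -> 0 < om -> lam <= 2 * M0 by lra.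
have s_1 : 1 < s by exact: lt_trans ss.
have s0 : 0 < s by exact: lt_trans s_1.
have [C5 C50 lev] := log_level M00 s_1 Cd0.
pose Cv := 3 * M0; have Cv0 : 0 <= Cv by rewrite mulr_ge0// ltW.
have [nu nu0 dg] := de_giorgi Om_open Om_bounded p_gt1 Q_measurable Q_psd sigma_gt1 a0 ppsi psip nb nc nd ne nf ng nh
  Cv0 s1_gt ss Cc0 N1 CS0 ltr01.
have ps0 : 0 < p * sigma by rewrite mulr_gt0.
have pss0 : 0 < p * s by rewrite mulr_gt0.
pose q4 : R := 4 `^ (p * sigma); have q40 : 0 < q4 by rewrite powR_gt0.
(* Now [S - C5 = C5 * q4 / nu], so that the logarithmic estimate bounds the measure of the level set
   by [nu / q4] times that of the ball. *)
pose S := C5 + C5 * q4 / nu.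
have S0 : 0 < S by rewrite addr_gt0// divr_gt0// mulr_gt0.
pose es := expR (- S); have es0 : 0 < es by exact: expR_gt0.
have es1 : es < 1 by rewrite /es expR_lt1 oppr_lt0.
pose th := es / 8; have th0 : 0 < th by rewrite divr_gt0.
pose K1 := 1 + M0 + Cv.
have K11 : 1 <= K1 by rewrite /K1 -addrA lerDl addr_ge0 ?(ltW M00).
have K10 : 0 < K1 by exact: lt_le_trans K11.
(* The constant [Kc] serves twice: for the condition of the logarithmic estimate at the scale
   [lam = th * om], and for the normalization of [Zs] at the scale [l >= th * om]. *)
exists (es / 4), ((K1 / th) `^ (p * s)); split; [by rewrite divr_gt0|by move: es1; lra|by rewrite powR_gt0 ?divr_gt0|].
move=> u du y r M om I Su Oy r0 rR uM MM0 om0 omM iZ I0 dbl hK half.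
pose lam := th * om; have lam0 : 0 < lam by rewrite mulr_gt0.
have th8 : th <= 1 / 8 by exact: ar5.
have lam8 : lam <= om / 8 by exact: ar6.
have lamM : lam <= 2 * M0 by exact: ar7 lam8 omM om0.
pose A := om / 2 + lam; pose L := es * A.
have L_lo : es * om / 2 <= L by rewrite /L /A mulrDr mulrA lerDl mulr_ge0 ?(ltW es0) ?(ltW lam0).
have L0 : 0 < L by apply: lt_le_trans L_lo; rewrite divr_gt0// mulr_gt0.
have LA : L <= A by rewrite /L -[leRHS]mul1r ler_wpM2r ?(ltW es1)// addr_ge0 ?divr_ge0 ?(ltW om0) ?(ltW lam0).
have lamE : lam = es * om / 8 by rewrite /lam /th mulrAC.
(* With [lam = es * om / 8] and [L >= es * om / 2], the final level [M + lam - 3 L / 4] lies at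
   least [es * om / 4] below [M]. *)
pose l := L / 4; have l0 : 0 < l by rewrite divr_gt0.
pose k := M + lam - L.
have r20 := rr0 r0; have r2R : rr r < R2 y by apply: le_lt_trans rR; exact: rr_le.
have tr20 : 0 < tau * rr r by rewrite mulr_gt0.
have B2B := ball_le (y := y) (rr_le r0).
have mB := mball Oy r0; have mB2 := mball Oy r20; have mB' := mball Oy tr20.
have mBp := ball_pos Oy r0; have mB2p := ball_pos Oy r20.
have BO : ball_ y r `<=` Om by exact: ballO.
have B2O : ball_ y (rr r) `<=` Om by exact: ballO.
have BB' := ball_tau (y := y) r20.
have oB2 := open_ball Oy r20.
have [zeta [D [cut _]]] := cutoffs_ball Oy r20 r2R.
have sob := sobolev_ball Oy r20 r2R.
have hI : r `^ (p * s) * I <= lam `^ (p * s) * fine (leb (ball_ y r)).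
  have h1 : 1 <= K1 `^ (p * s).
    by apply: (@le_trans _ _ (1 `^ (p * s))); [rewrite powR1|apply: pow_le => //; exact: ltW].
  rewrite /lam powRM ?(ltW th0) ?(ltW om0)// -mulrA -ler_pdivrMl ?powR_gt0//.
  apply: (@le_trans _ _ ((K1 / th) `^ (p * s) * (r `^ (p * s) * I))).
    apply: ler_wpM2r; first by rewrite mulr_ge0.
    rewrite powRM ?invr_ge0 ?(ltW K10) ?(ltW th0)// -[th^-1]powR_inv1 ?(ltW th0)// powRAC powR_inv1 ?powR_ge0//.
    by rewrite -[leLHS]mul1r ler_wpM2r// invr_ge0.
  by apply: le_trans hK _; rewrite ler_wpM2l//; exact: fine_leb_le.
have lv := lev u du y r M lam om I S Su Oy r0 rR uM MM0 lam0 lamM iZ hI dbl om0 S0 half.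
rewrite -/es -/A -/L -/k in lv.
set B2 := ball_ y (rr r) in B2B mB2 mB2p B2O BB' oB2 cut sob dbl hK half lv *.
set B' := ball_ y (tau * rr r) in mB' BB' cut *.
set H := B2 `&` _ in lv.
have mu := solution_measurable Su.
have muB := measurable_funS mO B2O mu.
have mH : measurable H.
  have := muB mB2 `]k, +oo[%classic (measurable_itv _).
  by congr (measurable (_ `&` _)); apply/seteqP; split=> x /=; rewrite in_itv/= andbT.
have HB2 : H `<=` B2 by exact: subIsetl.
have H0 : 0 <= fine (leb H) by rewrite fine_ge0// lebesgue_outer_ge0.
have Hsmall : q4 * fine (leb H) <= nu * fine (leb B2).
  move: lv; rewrite /S addrAC subrr add0r.
  rewrite (_ : C5 * q4 / nu * fine (leb H) = C5 * (q4 * fine (leb H) / nu)); last by ring.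
  by rewrite ler_pM2l// ler_pdivrMr// [_ * nu]mulrC.
have uM2 : \forall x \ae leb, B2 x -> `|u x| <= M0 /\ u x <= M.
  by apply: filterS uM => x h1 /B2B.
have uM0 : \forall x \ae leb, B2 x -> `|u x| <= M0 by apply: filterS uM2 => x h1 /h1[].
have nZO : nnm Om (Z u) by apply: Zf_nnm.
have nZB := nnm_sub mO BO nZO; have nZ := nnm_sub mO B2O nZO.
have nZsB : nnm (ball_ y r) (fun x => Z u x `^ s) by nnmt.
have iZ2 := Ile_sub mB2 mB B2B nZsB iZ.
have IZ := Zf_weight_bounded mB2 B2O mu s_1 uM0 iZ2.
(* Here [1 + |u| + (u - k')] is bounded by [K1], and [u - k' + l] is at least [l]. *)
pose Zs x := K1 `^ p * l `^ (- p) * Z u x.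
have Kl0 : 0 <= K1 `^ p * l `^ (- p) by rewrite mulr_ge0.
have nZs : nnm B2 Zs by rewrite /Zs; nnmt.
have r2 : 0 <= rr r by exact: ltW.
have thl : th * om <= l.
  exact: ar1.
have iZs : Ile leb B2 (fun x => (rr r `^ p * Zs x) `^ s) (fine (leb B2) * 1).
  pose kk := (rr r `^ p * (K1 `^ p * l `^ (- p))) `^ s.
  have kk0 : 0 <= kk by [].
  have nZsB2 : nnm B2 (fun x => Z u x `^ s) by nnmt.
  apply: (Ile_le mB2 _ _ _ _ (IleZ mB2 nZsB2 kk0 iZ2)); [by nnmt|by nnmt| |].
    by apply: aeW => x Bx; rewrite /Zs mulrA powRM ?mulr_ge0// nZ.2.
  have kkE : kk = (rr r * K1) `^ (p * s) / l `^ (p * s).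
    rewrite /kk mulrA -powRM ?(ltW K10)// powRM ?powR_ge0//.
    by rewrite -!powRrM mulNr powRN.
  rewrite mulr1 kkE mulrAC ler_pdivrMr ?powR_gt0// mulrC [leRHS]mulrC.
  apply: (@le_trans _ _ (I * (r * K1) `^ (p * s))).
    rewrite ler_wpM2l//; apply: pow_le; [exact: ltW|by rewrite mulr_ge0// ltW|].
    by rewrite ler_wpM2r ?(ltW K10)// rr_le.
  apply: (@le_trans _ _ ((th * om) `^ (p * s) * fine (leb B2))); last first.
    apply: ler_wpM2r; first exact: ltW.
    by apply: pow_le; [exact: ltW|by rewrite mulr_ge0 ?(ltW th0)// ltW|].
  rewrite [(th * om) `^ _]powRM ?(ltW th0) ?(ltW om0)// -mulrA -ler_pdivrMl ?powR_gt0//.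
  apply: le_trans hK; rewrite le_eqVlt; apply/orP; left; apply/eqP.
  rewrite [(K1 / th) `^ _]powRM ?invr_ge0 ?(ltW K10) ?(ltW th0)// [(r * K1) `^ _]powRM ?(ltW K10) ?(ltW r0)//.
  rewrite -[th^-1 in RHS]powR_inv1 ?(ltW th0)// [(th `^ _) `^ _]powRAC powR_inv1 ?powR_ge0//.
  by ring.
have kl : k + l <= M - es / 4 * om.
  by rewrite [es / 4 * om]mulrAC; apply: ar2 => //; exact: mulr_gt0.
have : \forall x \ae leb, B' x -> u x <= k + l.
  apply: (dg u du B2 B' (rr r) zeta D Su oB2 B2O r20 mB2p mB' BB' cut sob IZ k l Zs l0 nZs _ iZs _).
  - apply: filterS uM2 => x h1 Bx k' /andP[kk' _] ku; have [h2 h3] := h1 Bx.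
    have b1 : u x - k' <= Cv.
      exact: (ar3 _ _ _ _ _ _ LA kk' h3 omM).
    split; first by apply: le_trans b1 _; rewrite ler_peMr// lerDl.
    have b2 : 0 <= u x - k' by rewrite subr_ge0 ltW.
    have b3 : (1 + `|u x| + (u x - k')) `^ p <= K1 `^ p.
      by apply: pow_le; [exact: ltW|exact: (addr_ge0 (addr_ge0 ler01 (normr_ge0 _)) b2)|rewrite /K1 lerD// lerD2l].
    have b4 : l `^ p <= (u x - k' + l) `^ p by apply: pow_le; [exact: ltW|exact: ltW|rewrite lerDr].
    have Z0 := nZ.2 x Bx.
    apply: (@le_trans _ _ (Z u x * K1 `^ p)); first by rewrite ler_wpM2l.
    apply: (@le_trans _ _ (Zs x * l `^ p)); last by rewrite ler_wpM2l// nZs.2.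
    rewrite /Zs powRN mulrAC divfK ?gt_eqF ?powR_gt0//.
    by rewrite mulrC.
  - have nmx : nnm B2 (fun x => Num.max (u x - k) 0).
      split=> [|x _]; last by rewrite le_max lexx orbT.
      by apply: measurable_maxr; [apply: measurable_funB => //; exact: measurable_cst|exact: measurable_cst].
    have nmp : nnm B2 (fun x => Num.max (u x - k) 0 `^ (p * sigma)) by nnmt.
    have nmpH := nnm_sub mB2 HB2 nmp.
    rewrite /Ile (@Int_restrict _ _ _ leb B2 H)//; last first.
      move=> x Bx nHx; rewrite max_r ?powR0 ?gt_eqF//.
      by rewrite subr_le0 leNgt; apply/negP => ku; apply: nHx.
    have LP0 : 0 <= L `^ (p * sigma) by [].
    have hL : Ile leb H (fun=> L `^ (p * sigma)) (L `^ (p * sigma) * fine (leb H)).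
      by rewrite /Ile Int_cst// [X in (_ * X)%E](lebE (subset_trans HB2 B2O)) -EFinM.
    apply: (Ile_le mH nmpH _ _ _ hL); first by nnmt.
      apply: filterS uM2 => x h1 /HB2 Bx; have [_ h3] := h1 Bx.
      apply: pow_le; [exact: ltW|by rewrite le_max lexx orbT|].
      rewrite ge_max (ltW L0) andbT; exact: ar4.
    (* On [H] the excess [u - k] is at most [L]; the factor [4^(p sigma)] is the [q4] for which [S]
       has been prepared. *)
    have -> : L = 4 * l by rewrite /l; field.
    rewrite powRM ?(ltW l0)// -/q4 mulrAC [_ * l `^ _]mulrC [leRHS]mulrCA ler_wpM2l//.
    by rewrite [leRHS]mulrC.
by apply: filterS => x h1 /h1 h2; apply: le_trans kl.
Qed.

End regularity.

(** * Iteration over balls and Hoelder continuity *)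

Section oscillation.
Context {R : realType} {n : nat}.
Variables (Om : set 'rV[R]_n) (rho : 'rV[R]_n -> 'rV[R]_n -> R).
Hypothesis Om_open : open Om.
Hypothesis Om_bounded : bounded_set Om.
Hypothesis rho_open : balls_open Om rho.
Variable kappa : R.
Hypothesis kappa1 : 1 <= kappa.
Hypothesis rho_ge0 : forall x y, Om x -> Om y -> 0 <= rho x y.
Hypothesis rho_sym : forall x y, Om x -> Om y -> rho x y = rho y x.
Hypothesis rho_eq0 : forall x y, Om x -> Om y -> (rho x y = 0 <-> x = y).
Hypothesis rho_triangle : forall x y z, Om x -> Om y -> Om z -> rho x y <= kappa * (rho x z + rho y z).
Implicit Types (u : 'rV[R]_n -> R) (K U : set 'rV[R]_n).
Local Notation ball_ := (qball Om rho).

Let kappa0 : 0 < kappa. Proof. exact: lt_le_trans kappa1. Qed.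
Let mO : measurable Om. Proof. exact: open_rV_measurable. Qed.

Let rho_refl x : Om x -> rho x x = 0. Proof. by move=> Ox; apply/rho_eq0. Qed.

Let leb_fin U : U `<=` Om -> (leb U < +oo)%E.
Proof. by move=> UO; apply: le_lt_trans (le_lebesgue_outer UO) (leb_Om Om_bounded). Qed.

Let lebE U : U `<=` Om -> leb U = (fine (leb U))%:E.
Proof. by move=> UO; rewrite fineK// ge0_fin_numE ?leb_fin// lebesgue_outer_ge0. Qed.

(** The two sets cover [U]. The alternative decides whether the growth lemma is applied to [u] or to
    [- u]. *)
Lemma half_level U u (t : R) : U `<=` Om ->
  fine (leb U) / 2 <= fine (leb (U `&` [set x | u x <= t])) \/
  fine (leb U) / 2 <= fine (leb (U `&` [set x | - u x <= - t])).
Proof.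
move=> UO; set X := U `&` _; set Y := U `&` _.
have XU : X `<=` Om by move=> x [/UO].
have YU : Y `<=` Om by move=> x [/UO].
have UXY : U `<=` X `|` Y.
  move=> x Ux; have [h|h] := leP (u x) t; first by left.
  by right; split => //=; rewrite lerN2 ltW.
have h : fine (leb U) <= fine (leb X) + fine (leb Y).
  rewrite -lee_fin EFinD -(lebE UO) -(lebE XU) -(lebE YU).
  apply: (@le_trans _ _ (leb (X `|` Y))); first exact: le_lebesgue_outer.
  exact: outer_measureU2.
have [h1|h1] := leP (fine (leb U) / 2) (fine (leb X)); first by left.
by right; move: h h1; lra.
Qed.

(** Either the oscillation is already below the next bound and the interval is kept, or it exceeds
    the threshold [E0 * r^al] and is reduced by [step]. The entry [kap^al] of the maximum is the
    rate at which the threshold falls. *)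
Lemma oscillation_decay u K (M0 rb kap al E0 eta : R) : 0 < M0 -> 0 < rb -> 0 < kap < 1 -> 0 < al -> 0 <= E0 ->
  0 < eta < 1 -> K `<=` Om ->
  (forall y r, K y -> 0 < r -> r <= rb -> \forall x \ae leb, ball_ y r x -> `|u x| <= M0) ->
  (forall y r m M, K y -> 0 < r -> r <= rb -> - M0 <= m -> M <= M0 -> m < M ->
    (\forall x \ae leb, ball_ y r x -> m <= u x <= M) -> E0 * r `^ al <= M - m ->
    exists m' M', [/\ m <= m', M' <= M, M' - m' <= (1 - eta) * (M - m) &
      \forall x \ae leb, ball_ y (kap * r) x -> m' <= u x <= M']) ->
  exists D, 2 * M0 <= D /\ forall y i, K y -> exists m M,
    M - m <= D * Num.max (1 - eta) (kap `^ al) ^+ i /\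
    \forall x \ae leb, ball_ y (kap ^+ i * rb) x -> m <= u x <= M.
Proof.
move=> M00 rb0 /andP[kap0 kap1] al0 E00 /andP[eta0 eta1] KO bd step.
set q := Num.max _ _.
have q0 : 0 < q by rewrite lt_max subr_gt0 eta1.
(* The first entry starts the induction. By the second, an oscillation above [D * q^(i+1)] also
   exceeds [E0 * r^al] at the i-th radius. *)
pose D := Num.max (2 * M0) (E0 * rb `^ al / q).
have D1 : 2 * M0 <= D by rewrite le_max lexx.
have D2 : E0 * rb `^ al <= D * q by rewrite -ler_pdivrMr// le_max lexx orbT.
have D0 : 0 < D by apply: lt_le_trans D1; rewrite mulr_gt0.
exists D; split=> // y i Ky.
suff [m [M [h1 h2 h3 h4]]] : exists m M, [/\ - M0 <= m, M <= M0, M - m <= D * q ^+ i &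
    \forall x \ae leb, ball_ y (kap ^+ i * rb) x -> m <= u x <= M] by exists m, M.
elim: i => [|i [m [M [h1 h2 h3 h4]]]].
  exists (- M0), M0; split => //; first by rewrite expr0 mulr1 opprK -mulr2n -mulr_natl.
  by rewrite expr0 mul1r; apply: filterS (bd y rb Ky rb0 (lexx _)) => x H Bx; rewrite -ler_norml H.
have ki0 : 0 < kap ^+ i by rewrite exprn_gt0.
have ri0 : 0 < kap ^+ i * rb by rewrite mulr_gt0.
have ki1 : kap ^+ i <= 1 by rewrite exprn_ile1// ltW.
have rib : kap ^+ i * rb <= rb by rewrite -[leRHS]mul1r ler_wpM2r// ltW.
have keep : M - m <= D * q ^+ i.+1 -> exists m M, [/\ - M0 <= m, M <= M0, M - m <= D * q ^+ i.+1 &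
    \forall x \ae leb, ball_ y (kap ^+ i.+1 * rb) x -> m <= u x <= M].
  move=> h5; exists m, M; split => //; apply: filterS h4 => x H [Ox Bx]; apply: H; split => //.
  apply: lt_le_trans Bx _; rewrite exprS -mulrA -[leRHS]mul1r ler_wpM2r// ltW//.
have [h5|h5] := leP (M - m) (D * q ^+ i.+1); first exact: keep.
have mM : m < M by rewrite -subr_gt0; apply: lt_trans h5; rewrite mulr_gt0// exprn_gt0.
have [|m' [M' [a1 a2 a3 a4]]] := step y _ m M Ky ri0 rib h1 h2 mM h4.
  apply: le_trans (ltW h5); rewrite powRM ?(ltW ki0) ?(ltW rb0)//.
  have -> : (kap ^+ i) `^ al = (kap `^ al) ^+ i by rewrite -powR_mulrn ?(ltW kap0)// powRAC powR_mulrn.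
  rewrite (_ : E0 * _ = E0 * rb `^ al * (kap `^ al) ^+ i); last by ring.
  rewrite exprS mulrA; apply: ler_pM => //.
  by rewrite lerXn2r ?nnegrE ?(ltW q0)// le_max lexx orbT.
exists m', M'; split.
- exact: le_trans a1.
- exact: le_trans h2.
- apply: le_trans a3 _; rewrite exprS mulrCA; apply: ler_pM => //.
  + by rewrite subr_ge0 ltW.
  + by rewrite subr_ge0 ltW.
  + by rewrite le_max lexx.
- by rewrite exprS -mulrA.
Qed.

(* Finitely many balls of each radius cover K, so that countably many null sets suffice for all
   pairs of points. *)
Lemma holder_of_decay u K (M0 rb kap q D : R) : compact K -> K `<=` Om -> 0 < M0 -> 0 < rb -> 0 < kap < 1 ->
  0 < q < 1 -> 2 * M0 <= D -> (\forall x \ae leb, K x -> `|u x| <= M0) ->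
  (forall y i, K y -> exists m M, M - m <= D * q ^+ i /\
    \forall x \ae leb, ball_ y (kap ^+ i * rb) x -> m <= u x <= M) ->
  exists C mu, [/\ 0 < C, 0 < mu &
    (ess_sup (@leb R (n + n)) (fun w =>
      let z := lsubmx w in let x := rsubmx w in
      (`|u z - u x| / rho z x `^ mu * (\1_K z * \1_K x))%:E) <= C%:E)%E].
Proof.
move=> cK KO M00 rb0 /andP[kap0 kap1] /andP[q0 q1] DM bd osc.
have D0 : 0 < D by apply: lt_le_trans DM; rewrite mulr_gt0.
(* Since [kappa * (dl i + dl i) = kap^i * rb], the ball of radius [kap^i * rb] around a point within
   [dl i] of [z] contains every point within [dl i] of [z]. *)
pose dl i : R := kap ^+ i * rb / (2 * kappa).
have dl0 i : 0 < dl i by rewrite /dl !mulr_gt0 ?exprn_gt0// invr_gt0 mulr_gt0.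
have pair i : exists N, leb N = 0%E /\ forall z x, K z -> ~ N z -> K x -> ~ N x -> rho z x < dl i ->
    `|u z - u x| <= D * q ^+ i.
  apply: (compact_local (P := fun X => exists N, leb N = 0%E /\ forall z x, X z -> ~ N z -> K x -> ~ N x ->
    rho z x < dl i -> `|u z - u x| <= D * q ^+ i) cK).
  - by exists set0; split=> [|z x []//]; exact: lebesgue_outer0.
  - move=> X Y [N1 [N10 H1]] [N2 [N20 H2]]; exists (N1 `|` N2); split.
      apply/eqP; rewrite eq_le lebesgue_outer_ge0 andbT.
      apply: le_trans (outer_measureU2 _ _ _) _.
      by rewrite -[X in (X + _ <= _)%E]/(leb N1) -[X in (_ + X <= _)%E]/(leb N2) N10 N20 adde0.
    move=> z x [Xz|Yz] /not_orP[z1 z2] Kx /not_orP[x1 x2] h; first exact: H1.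
    exact: H2.
  - by move=> X Y XY [N [N0 H]]; exists N; split=> // z x Xz; apply: H; exact: XY.
  - move=> y Ky; have Oy := KO y Ky.
    exists (ball_ y (dl i)); split; [exact: rho_open|by split=> //; rewrite rho_refl|].
    have [m [M [Mm hM]]] := osc y i Ky.
    exists [set x | ~ (ball_ y (kap ^+ i * rb) x -> m <= u x <= M)]; split; first exact/aeP.
    move=> z x [Oz yz] /contrapT Nz Kx /contrapT Nx zx; have Ox := KO x Kx.
    have riE : kap ^+ i * rb = kappa * (dl i + dl i) by rewrite /dl; field; rewrite gt_eqF.
    have dri : dl i <= kap ^+ i * rb.
      rewrite riE -[leLHS]mul1r; apply: ler_pM => //.
      by rewrite lerDl ltW.
    have Bz : ball_ y (kap ^+ i * rb) z by split=> //; exact: lt_le_trans dri.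
    have Bx : ball_ y (kap ^+ i * rb) x.
      split=> //; apply: le_lt_trans (rho_triangle Oy Ox Oz) _.
      by rewrite riE ltr_pM2l// ltrD// (rho_sym Ox Oz).
    have /andP[z1 z2] := Nz Bz; have /andP[x1 x2] := Nx Bx.
    by apply: le_trans Mm; rewrite ler_norml; apply/andP; split; lra.
have [NN HN] := choice pair.
pose NI := \bigcup_i NN i `|` [set x | ~ (K x -> `|u x| <= M0)].
have NI0 : leb NI = 0%E.
  apply/eqP; rewrite eq_le lebesgue_outer_ge0 andbT.
  apply: le_trans (outer_measureU2 _ _ _) _.
  have e0 : leb [set x | ~ (K x -> `|u x| <= M0)] = 0%E by exact/aeP.
  rewrite [X in (_ + X <= _)%E]e0 adde0; apply: le_trans (lebesgue_outer_sigma_subadditive NN) _.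
  by rewrite eseries0// => i _ _; exact: (HN i).1.
(* This is the exponent with [kap^mu = q]: geometric decay along the radii becomes a power of the
   distance. *)
pose mu := ln q / ln kap.
have lk : ln kap < 0 by apply: ln_lt0; rewrite kap0.
have lq : ln q < 0 by apply: ln_lt0; rewrite q0.
have mu0 : 0 < mu by rewrite /mu -divrNN divr_gt0// oppr_gt0.
have kmu : kap `^ mu = q.
  by rewrite /powR gt_eqF// /mu divfK ?lt_eqF// lnK.
(* The factor [kap] pays for the gap between two consecutive radii. *)
pose C := D * (kap * dl 0) `^ (- mu).
have C0 : 0 < C by rewrite mulr_gt0// powR_gt0// mulr_gt0.
have kd0 : 0 < kap * dl 0 by rewrite mulr_gt0.
exists C, mu; split => //; apply/ess_supP.
have n1 := null_prodl NI0; have n2 := null_prodr NI0.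
have h1 : \forall w \ae (@leb R (n + n)), ~ NI (lsubmx w).
  by apply/aeP; apply: leb_null_sub n1 => w /= /contrapT.
have h2 : \forall w \ae (@leb R (n + n)), ~ NI (rsubmx w).
  by apply/aeP; apply: leb_null_sub n2 => w /= /contrapT.
apply: filterS2 h1 h2 => w; set z := lsubmx w; set x := rsubmx w.
move=> /not_orP[z1 z2] /not_orP[x1 x2]; rewrite lee_fin !indicE.
have [/set_mem Kz|] := boolP (z \in K); last by rewrite mul0r mulr0 ltW.
have [/set_mem Kx|] := boolP (x \in K); last by rewrite mulr0 mulr0 ltW.
rewrite /= !mulr1.
move/contrapT : z2 => /(_ Kz) uz; move/contrapT : x2 => /(_ Kx) ux.
have Oz := KO z Kz; have Ox := KO x Kx.
have [zx|zx] := eqVneq z x; first by rewrite zx subrr normr0 mul0r ltW.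
have r0 : 0 < rho z x.
  rewrite lt_neqAle rho_ge0// andbT; apply/eqP => /esym /rho_eq0 E.
  by move/eqP : zx; apply; exact: E.
rewrite ler_pdivrMr ?powR_gt0//.
have CE t : 0 < t -> C * t `^ mu = D * (t / (kap * dl 0)) `^ mu.
  move=> t0; rewrite /C -mulrA; congr (_ * _).
  have vE : (kap * dl 0)^-1 `^ mu = (kap * dl 0) `^ (- mu).
    by rewrite -powR_inv1 ?(ltW kd0)// -powRrM mulN1r.
  by rewrite [RHS]powRM ?invr_ge0 ?(ltW t0) ?(ltW kd0)// vE mulrC.
rewrite CE//.
have [far|near] := leP (dl 0) (rho z x).
  apply: (@le_trans _ _ (D * 1)).
    rewrite mulr1; apply: le_trans DM; apply: le_trans (ler_normB _ _) _.
    by rewrite mulrDl mul1r lerD.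
  rewrite ler_wpM2l ?(ltW D0)//; apply: (@le_trans _ _ (1 `^ mu)); first by rewrite powR1.
  apply: pow_le; [exact: ltW|by []|].
  rewrite ler_pdivlMr// mul1r; apply: le_trans far; rewrite -[leRHS]mul1r ler_wpM2r//; exact: ltW.
have ex : exists i, dl i.+1 <= rho z x.
  have cv : kap ^+ i @[i --> \oo] --> (0 : R) by apply: cvg_expr; rewrite ger0_norm// ltW.
  have t0 : 0 < rho z x / (rb / (2 * kappa)) by rewrite divr_gt0// divr_gt0// mulr_gt0.
  move/cvgrPdist_lt : cv => /(_ _ t0) [i _ Hi]; exists i.
  have := Hi i.+1 (leqnSn i); rewrite sub0r normrN ger0_norm ?exprn_ge0 ?(ltW kap0)//.
  by rewrite ltr_pdivlMr ?divr_gt0 ?mulr_gt0// /dl mulrA => /ltW.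
(* The least index places [rho z x] between [dl i.+1] and [dl i]; distances of at least [dl 0] have
   been settled by the bound for [u]. *)
case: (ex_minnP ex) => i Hi imin.
have ri : rho z x < dl i.
  case: i Hi imin => [//|i] _ imin; rewrite ltNge; apply/negP => h.
  by have := imin i h; rewrite ltnn.
have := (HN i).2 z x Kz (fun h => z1 (ex_intro2 _ _ i I h)) Kx (fun h => x1 (ex_intro2 _ _ i I h)) ri.
move=> /le_trans; apply; rewrite ler_wpM2l ?(ltW D0)//.
have -> : q ^+ i = (kap ^+ i) `^ mu by rewrite -kmu -powR_mulrn// powRAC -powR_mulrn ?(ltW kap0).
apply: pow_le; [exact: ltW|by rewrite exprn_ge0// ltW|].
rewrite ler_pdivlMr//; apply: le_trans Hi.
by rewrite /dl expr0 mul1r exprSr !mulrA.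
Qed.

Lemma closed_subset_compact U : closed U -> U `<=` Om -> compact U.
Proof.
move=> cU UO; apply: bounded_closed_compact => //.
by case: Om_bounded => M [Mr HM]; exists M; split=> // x Mx y Uy; apply: HM => //; exact: UO.
Qed.

(** Locally, one ball of radius [rx] contains all small balls with centres nearby, and its closure
    is compact in [Om]. The doubling inequality from this ball down to radius [r] is the volume
    bound, through which integrability above [d0 / p] becomes a power of [r]. *)
Lemma compact_ball_neighbourhood K (R0 R1 : 'rV[R]_n -> R) (C0 d0 s0 : R) : compact K -> K `<=` Om ->
  closed_balls_inside Om rho R0 -> 0 < C0 -> 0 < s0 ->
  (forall x y r t, Om x -> Om y -> 0 < t -> t <= r -> r < R1 x -> ball_ y t `&` ball_ x r !=set0 ->
    (leb (ball_ x r) <= (C0 * (r / t) `^ d0)%:E * leb (ball_ y t))%E) ->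
  (forall y r, Om y -> 0 < r -> 0 < fine (leb (ball_ y r))) ->
  (forall y, K y -> s0 <= R0 y /\ s0 <= R1 y) ->
  exists K' c, [/\ compact K', K' `<=` Om, 0 < c & forall y r, K y -> 0 < r -> r <= s0 / (4 * kappa) ->
    ball_ y r `<=` K' /\ c * r `^ d0 <= fine (leb (ball_ y r))].
Proof.
move=> cK KO cb C00 s00 dbl bpos Ks.
set t0 := s0 / (4 * kappa).
have t00 : 0 < t0 by rewrite divr_gt0// mulr_gt0.
suff [K' [c [h1 h2 h3 h4]]] : exists K' c, [/\ compact K', K' `<=` Om, 0 < c &
    forall y r, K y -> Om y -> 0 < r -> r <= t0 ->
    ball_ y r `<=` K' /\ c * r `^ d0 <= fine (leb (ball_ y r))].
  by exists K', c; split => // y r Ky; apply: h4 => //; exact: KO.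
apply: (compact_local (P := fun X => exists K' c, [/\ compact K', K' `<=` Om, 0 < c &
    forall y r, X y -> Om y -> 0 < r -> r <= t0 ->
    ball_ y r `<=` K' /\ c * r `^ d0 <= fine (leb (ball_ y r))]) cK).
- by exists set0, 1; split; [exact: compact0|exact: sub0set|exact: ltr01|move=> y r []].
- move=> X Y [K1 [c1 [h1 h2 h3 h4]]] [K2 [c2 [g1 g2 g3 g4]]].
  exists (K1 `|` K2), (Num.min c1 c2); split.
  + exact: compactU.
  + by move=> x [/h2|/g2].
  + by rewrite lt_min h3.
  + move=> y r [Xy|Yy] Oy r0 rt.
      have [a1 a2] := h4 y r Xy Oy r0 rt; split; first by move=> x /a1; left.
      by apply: le_trans a2; rewrite ler_wpM2r// ge_min lexx.
    have [a1 a2] := g4 y r Yy Oy r0 rt; split; first by move=> x /a1; right.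
    by apply: le_trans a2; rewrite ler_wpM2r// ge_min lexx orbT.
- by move=> X Y XY [K1 [c1 [h1 h2 h3 h4]]]; exists K1, c1; split => // y r Xy; apply: h4; exact: XY.
- move=> x Kx; have Ox := KO x Kx; have [sR0 sR1] := Ks x Kx.
  pose rx := s0 / 2; have rx0 : 0 < rx by rewrite divr_gt0.
  have rxs : rx < s0 by rewrite /rx ltr_pdivrMr// ltr_pMr// ltr1n.
  (* By this relation a ball of radius at most [t0] centred in [ball_ x t0] stays inside
     [ball_ x rx]. *)
  have rxE : rx = kappa * (t0 + t0) by rewrite /rx /t0; field; rewrite gt_eqF.
  have clO : closure (ball_ x rx) `<=` Om by apply: cb => //; exact: lt_le_trans sR0.
  exists (ball_ x t0); split; [exact: rho_open|by split=> //; rewrite rho_refl|].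
  have mx := bpos x rx Ox rx0.
  exists (closure (ball_ x rx)), (fine (leb (ball_ x rx)) / (C0 * rx `^ d0)); split => //.
  + by apply: closed_subset_compact => //; exact: closed_closure.
  + move=> y r [_ xy] Oy r0 rt; split.
      move=> z [Oz yz]; apply: subset_closure; split=> //.
      apply: le_lt_trans (rho_triangle Ox Oz Oy) _.
      rewrite rxE ltr_pM2l// ltrD// (rho_sym Oz Oy); exact: lt_le_trans rt.
    have t0rx : t0 <= rx.
      by rewrite rxE -[leLHS]mul1r; apply: ler_pM => //; rewrite lerDl ltW.
    have ne : ball_ y r `&` ball_ x rx !=set0.
      exists y; split; first by split=> //; rewrite rho_refl.
      by split=> //; exact: lt_le_trans t0rx.
    have h := dbl x y rx r Ox Oy r0 (le_trans rt t0rx) (lt_le_trans rxs sR1) ne.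
    have BO z s : ball_ z s `<=` Om by move=> z' [].
    rewrite (lebE (BO x rx)) (lebE (BO y r)) -EFinM lee_fin in h.
    have rd0 : 0 < rx `^ d0 by rewrite powR_gt0.
    have vE : (rx / r) `^ d0 = rx `^ d0 / r `^ d0.
      rewrite powRM ?(ltW rx0) ?invr_ge0 ?(ltW r0)//; congr (_ * _).
      by rewrite -[r^-1]powR_inv1 ?(ltW r0)// -powRrM mulN1r powRN.
    rewrite vE in h; rewrite mulrAC ler_pdivrMr ?mulr_gt0//.
    rewrite -ler_pdivlMr ?powR_gt0//; apply: le_trans h _.
    by rewrite le_eqVlt; apply/orP; left; apply/eqP; ring.
Qed.

End oscillation.

(** The structural conditions are evaluated along [(u, du)]. The bound of the flux against an
    arbitrary vector combines the factorization of [A] through the root of [Q], the symmetry of this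
    root and the Cauchy-Schwarz inequality. *)
Lemma weak_solution_solution (R : realType) (n : nat) (Om : set 'rV[R]_n) (p psi : R) (Q : 'rV[R]_n -> 'M[R]_n)
    (A : 'rV[R]_n -> R -> 'rV[R]_n -> 'rV[R]_n) (B : 'rV[R]_n -> R -> 'rV[R]_n -> R)
    (b c d e f g h u : 'rV[R]_n -> R) (du : 'rV[R]_n -> 'rV[R]_n) :
  (forall x, Om x -> psdmx (Q x)) ->
  structural_conditions Om p Q A B p psi p b c d e f g h -> weak_solution Om p Q A B u du ->
  exists2 a, 0 < a & solution Om p Q a psi b c d e f g h u du.
Proof.
move=> Q_psd [_ _ _ [[nb _ _] [ne _ _ _]] [a [At [a1 H]]]] [W wk].
have a0 : 0 < a by exact: lt_trans a1.
exists a => //; exists (fun x => A x (u x) (du x)), (fun x => B x (u x) (du x)); split => //.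
apply: filterS H => x H Ox; have [h1 h2 h3 h4] := H Ox (u x) (du x); split => //.
- move=> xi; rewrite h1; apply: le_trans (dotr_sqrtmx Q x _ _) _.
  by rewrite ler_wpM2l// Qnorm_ge0.
- by move: h2; lra.
Qed.

Theorem corollary3p9 (R : realType) (n : nat) (n_gt0 : (0 < n)%N)
  (Om : set 'rV[R]_n)
  (Om_neq0 : Om !=set0) (Om_open : open Om) (Om_connected : connected Om)
  (Om_bounded : bounded_set Om)
  (p : R) (p_gt1 : 1 < p)
  (Q : 'rV[R]_n -> 'M[R]_n)
  (Q_measurable : forall i j, measurable_fun Om (fun x => Q x i j))
  (Q_psd : forall x, Om x -> psdmx (Q x))
  (Q_Lloc : Lloc Om (p / 2)%:E (fun x => opnorm (Q x)))
  (rho : 'rV[R]_n -> 'rV[R]_n -> R)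
  (rho_quasimetric : quasimetric Om rho)
  (rho_open : balls_open Om rho)
  (rho_euclidean : rho_controls_euclidean Om rho)
  (R0 R1 R2 r1 : 'rV[R]_n -> R)
  (R_gt0 : forall x, Om x -> [/\ 0 < R0 x, 0 < R1 x, 0 < R2 x & 0 < r1 x])
  (R0_closure : closed_balls_inside Om rho R0)
  (d0 : R) (d0_gt0 : 0 < d0)
  (R1_doubling : local_homogeneous Om rho d0 R1)
  (sigma : R) (sigma_gt1 : 1 < sigma)
  (R2_sobolev : sobolev_inequality Om rho p Q R2 sigma)
  (R2_poincare : poincare_inequality Om rho p Q R2)
  (R2_cutoff : cutoff_conditions Om rho p Q R2 sigma)
  (A : 'rV[R]_n -> R -> 'rV[R]_n -> 'rV[R]_n)
  (B : 'rV[R]_n -> R -> 'rV[R]_n -> R)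
  (psi : R) (psi_ge : p <= psi) (psi_lt : psi < p + 1 - sigma^-1)
  (b c d e f g h : 'rV[R]_n -> R)
  (AB_structure : structural_conditions Om p Q A B p psi p b c d e f g h)
  (AB_integrability : minimal_integrability Om p sigma p psi p b c d e f)
  (qB qH qD qC : \bar R)
  (qB_gt : ((Num.max (dual_exp p * dual_exp sigma) (d0 / (p - 1)))%:E < qB)%E)
  (b_Lloc : Lloc Om qB b) (e_Lloc : Lloc Om qB e)
  (qH_gt : ((d0 / p)%:E < qH)%E) (qH_gt' : ((dual_exp sigma)%:E < qH)%E)
  (h_Lloc : Lloc Om qH h) (g_Lloc : Lloc Om qH g)
  (qD_gt : ((d0 / p)%:E < qD)%E) (qD_gt' : ((dual_exp sigma)%:E < qD)%E)
  (d_Lloc : Lloc Om qD d) (f_Lloc : Lloc Om qD f)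
  (qC_gt0 : 0 < d0 * p * sigma / ((p + 1 - psi) * (p * sigma + d0) - d0))
  (qC_gt : ((d0 * p * sigma / ((p + 1 - psi) * (p * sigma + d0) - d0))%:E
              < qC)%E)
  (qC_gt' : ((p * sigma / (sigma * (p + 1 - psi) - 1))%:E < qC)%E)
  (c_Lloc : Lloc Om qC c)
  (r1_le : forall x, Om x -> [/\ r1 x <= R0 x, r1 x <= R1 x, r1 x <= R2 x & r1 x <= 1])
  (r1_compact : forall K : set 'rV[R]_n, compact K -> K `<=` Om ->
     exists2 s0, 0 < s0 & forall y, K y -> s0 <= r1 y <= 1)
  (u : 'rV[R]_n -> R) (du : 'rV[R]_n -> 'rV[R]_n)
  (u_weak : weak_solution Om p Q A B u du) :
  ess_locally_holder Om rho u.
Proof.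
have [[U [oU [Une U0]]]|nonnull] := pselect (exists U : set 'rV[R]_n, open U /\ U !=set0 /\ leb U = 0%E).
  move=> K cK KO; exists 1, 1; split=> //; apply/ess_supP/aeP.
  have T0 : leb [set: 'rV[R]_n] = 0%E by exact: (open_null oU Une U0).
  by apply: leb_null_sub (null_prodl T0) => w.
have [rho_ge0 rho_sym rho_eq0 [kappa kappa1 rho_tri]] := rho_quasimetric.
have ball_pos y r : Om y -> 0 < r -> 0 < fine (leb (qball Om rho y r)).
  move=> Oy r0; rewrite fine_gt0// lt_neqAle eq_sym lebesgue_outer_ge0 andbT; apply/andP; split.
    apply/eqP => E; apply: nonnull; exists (qball Om rho y r); split; [exact: rho_open|split=> //].
    by exists y; split=> //; have -> : rho y y = 0 by apply/rho_eq0.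
  by apply: le_lt_trans (leb_Om Om_bounded); apply: le_lebesgue_outer => x [].
have [p0 s0] : 0 < p /\ 0 < sigma by split; [exact: lt_trans p_gt1|exact: lt_trans sigma_gt1].
have mO : measurable Om by exact: open_rV_measurable.
have sV : 0 < sigma^-1 by rewrite invr_gt0.
have psip : psi < p + 1 by move: psi_lt sV; clear; lra.
have [a a0 Su] := weak_solution_solution Q_psd AB_structure u_weak.
have [_ _ _ [[nb nc nd] [ne nf ng nh]] _] := AB_structure.
have {}nb : nnm Om b := nb; have {}nc : nnm Om c := nc; have {}nd : nnm Om d := nd; have {}ne : nnm Om e := ne.
have {}nf : nnm Om f := nf; have {}ng : nnm Om g := ng; have {}nh : nnm Om h := nh.
have W : W1pQ p Q Om u du by case: u_weak.
have mu : measurable_fun Om u by case: W.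
have Su' := solution_opp Om_open Om_bounded p_gt1 Q_measurable Q_psd Su.
have ZN : Zf p psi b c d e f g h (fun x => - u x) = Zf p psi b c d e f g h u.
  by apply/funext => x; rewrite /Zf normrN.
have [s1 [Cc [N [tau [s1_gt Cc0 N1 tau01 cuts]]]]] :=
  cutoffs_exist Om_open Om_bounded p_gt1 Q_measurable Q_psd rho_open sigma_gt1 R2_cutoff.
have cutoffs_ball y r : Om y -> 0 < r -> r < R2 y -> exists zeta D,
  cutoffs p Q (qball Om rho y r) (qball Om rho y (tau * r)) r s1 Cc N zeta D /\
  forall u du, W1pQ p Q Om u du -> (Int leb (qball Om rho y r) (fun x => D 0%N x `^ p * `|u x| `^ p)%R < +oo)%E.
  by move=> Oy r0 rR; apply: cuts => //; exact: ball_pos.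
have [CS CS0 sob] := sobolev_power_exists Om_open p_gt1 Q_measurable Q_psd rho_open sigma_gt1 R2_sobolev.
have sobolev_ball y r : Om y -> 0 < r -> r < R2 y -> sobolev_power p Q sigma (qball Om rho y r) r CS.
  by move=> Oy r0 rR; apply: sob => //; exact: ball_pos.
have [C2 [bb [C20 bb1 poin]]] := R2_poincare.
have bb0 : 0 < bb by exact: lt_le_trans bb1.
have /andP[tau0 tau1] := tau01.
(* The gain of integrability on balls is first spread over compact sets, because the integrability
   of the coefficients is available on compact sets such as closures of balls. *)
have upow K : compact K -> K `<=` Om -> (Int leb K (fun x => `|u x| `^ (p * sigma))%R < +oo)%E.
  move=> cK KO; have nup : nnm Om (fun x => `|u x| `^ (p * sigma)) by nnmt.
  apply: (IntFin_local Om_open cK nup) => y Ky; have Oy := KO y Ky.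
  have [_ _ R20 _] := R_gt0 y Oy; pose r := R2 y / 2.
  have r0 : 0 < r by rewrite divr_gt0.
  have rR : r < R2 y by rewrite ltr_pdivrMr// ltr_pMr// ltr1n.
  exists (qball Om rho y (tau * r)); split.
  - by apply: rho_open => //; rewrite mulr_gt0.
  - by split=> //; have -> : rho y y = 0 by apply/rho_eq0.
  - by move=> x [].
  - exact: (power_integrable_ball Om_open Om_bounded p_gt1 Q_measurable Q_psd rho_open sigma_gt1 s1_gt tau01 ball_pos
      cutoffs_ball sobolev_ball W Oy r0 rR).
have [s' ss' Zunb] := Zf_integrable_unbounded Om_open Om_bounded p_gt1 sigma_gt1 psi_ge psi_lt d0_gt0 nb nc nd ne nf ng nh
  qB_gt b_Lloc e_Lloc qH_gt qH_gt' h_Lloc g_Lloc qD_gt qD_gt' d_Lloc f_Lloc qC_gt' c_Lloc.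
have ubound K : compact K -> K `<=` Om -> exists2 M, 0 < M & \forall x \ae leb, K x -> `|u x| <= M.
  move=> cK KO; apply: (ae_bounded_local cK) => y Ky; have Oy := KO y Ky.
  have [R00 _ R20 _] := R_gt0 y Oy; pose r := Num.min (R0 y) (R2 y) / 2.
  have m0 : 0 < Num.min (R0 y) (R2 y) by rewrite lt_min R00.
  have r0 : 0 < r by rewrite divr_gt0.
  have rm : r < Num.min (R0 y) (R2 y) by rewrite ltr_pdivrMr// ltr_pMr// ltr1n.
  have [rR0 rR2] : r < R0 y /\ r < R2 y by move: rm; rewrite lt_min => /andP[].
  have clO := R0_closure y r Oy r0 rR0.
  have clc := closed_subset_compact Om_bounded (@closed_closure _ _) clO.
  have mcl := compact_measurable clc.
  have oB := rho_open y r Oy r0; have mB := open_rV_measurable oB.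
  have Bcl := @subset_closure _ (qball Om rho y r).
  have mucl := measurable_funS mO clO mu.
  have iu := upow _ clc clO.
  have iZ := Zunb _ u clc clO mu iu.
  have nZ : nnm (closure (qball Om rho y r)) (Zf p psi b c d e f g h u) by apply: (nnm_sub mO clO); apply: Zf_nnm.
  have nup : nnm (closure (qball Om rho y r)) (fun x => `|u x| `^ (p * sigma)) by nnmt.
  have nZs : nnm (closure (qball Om rho y r)) (fun x => Zf p psi b c d e f g h u x `^ s') by nnmt.
  have iuB := IntFin_sub mB mcl nup Bcl iu.
  have iZB := IntFin_sub mB mcl nZs Bcl iZ.
  have [M1 H1] := local_upper_bound Om_open Om_bounded p_gt1 Q_measurable Q_psd rho_open sigma_gt1 a0 psi_ge psip
    nb nc nd ne nf ng nh s1_gt Cc0 N1 CS0 tau01 ball_pos cutoffs_ball sobolev_ball Su Oy r0 rR2 ss' iuB iZB.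
  have iuB' : (Int leb (qball Om rho y r) (fun x => `|(- u x)%R| `^ (p * sigma))%R < +oo)%E.
    by rewrite (_ : (fun x => _) = (fun x => `|u x| `^ (p * sigma))%R)//; apply/funext => x; rewrite normrN.
  have iZB' : (Int leb (qball Om rho y r) (fun x => Zf p psi b c d e f g h (fun x => - u x) x `^ s')%R < +oo)%E.
    by rewrite ZN.
  have [M2 H2] := local_upper_bound Om_open Om_bounded p_gt1 Q_measurable Q_psd rho_open sigma_gt1 a0 psi_ge psip
    nb nc nd ne nf ng nh s1_gt Cc0 N1 CS0 tau01 ball_pos cutoffs_ball sobolev_ball Su' Oy r0 rR2 ss' iuB' iZB'.
  exists (qball Om rho y (tau * r)); split.
  - by apply: rho_open => //; rewrite mulr_gt0.
  - by split=> //; have -> : rho y y = 0 by apply/rho_eq0; rewrite // mulr_gt0.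
  - exists (Num.max M1 M2); apply: filterS2 H1 H2 => x h1 h2 Bx.
    rewrite ler_norml lerNl !le_max; apply/andP; split; first by rewrite (h2 Bx) orbT.
    by rewrite (h1 Bx).
have [s [ss sd0 Zbd]] := Zf_integrable_bounded Om_open Om_bounded p_gt1 sigma_gt1 psi_ge psi_lt d0_gt0 nb nc nd ne nf ng nh
  qB_gt b_Lloc e_Lloc qH_gt qH_gt' h_Lloc g_Lloc qD_gt qD_gt' d_Lloc f_Lloc qC_gt0 qC_gt qC_gt' c_Lloc.
move=> K cK KO.
have [s0' s0'0 Ks0] := r1_compact K cK KO.
have [C0 C00 dbl] := R1_doubling.
have KR y : K y -> [/\ s0' <= R0 y, s0' <= R1 y & s0' <= R2 y].
  move=> Ky; have /andP[h1 _] := Ks0 y Ky; have [h2 h3 h4 _] := r1_le y (KO y Ky).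
  by split; exact: le_trans h1 _.
(* All balls used from here on lie in [K'], where the bound for [u] and the integral of the s-th
   power of [Zf] are fixed once and for all. *)
have [K' [cv [cK' K'O cv0 Kball]]] := compact_ball_neighbourhood Om_bounded rho_open kappa1 rho_sym rho_eq0 rho_tri cK KO
  R0_closure C00 s0'0 dbl ball_pos (fun y Ky => let: And3 x1 x2 _ := KR y Ky in conj x1 x2).
have [M0 M00 uM0] := ubound K' cK' K'O.
have ps0 : 0 < p * s.
  by rewrite mulr_gt0//; apply: lt_trans ss; exact: dual_exp_gt0.
pose al := (p * s - d0) / (p * s).
have al0 : 0 < al.
  by rewrite divr_gt0// subr_gt0 mulrC -ltr_pdivrMr.
(* The doubling constant between the radii [r] and [tau * r / bb]. *)
pose Cd := C0 * (bb / tau) `^ d0.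
have Cd0 : 0 < Cd by rewrite mulr_gt0// powR_gt0// divr_gt0.
have [eta [Kc [eta0 eta1 Kc0 G]]] := growth_lemma Om_open Om_bounded p_gt1 Q_measurable Q_psd rho_open sigma_gt1 a0 psi_ge psip
  nb nc nd ne nf ng nh s1_gt Cc0 N1 CS0 tau01 ball_pos cutoffs_ball sobolev_ball C20 bb1 poin M00 ss Cd0.
have mK' := compact_measurable cK'.
have nZ : nnm Om (Zf p psi b c d e f g h u) by apply: Zf_nnm.
have nZK := nnm_sub mO K'O nZ.
have nZs : nnm K' (fun x => Zf p psi b c d e f g h u x `^ s) by nnmt.
have iZ := Zbd K' u M0 cK' K'O mu uM0.
pose I := fine (Int leb K' (fun x => Zf p psi b c d e f g h u x `^ s)).
have I0 : 0 <= I by apply: fine_ge0; apply: Int_ge0; exact: nZs.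
have II : (Int leb K' (fun x => Zf p psi b c d e f g h u x `^ s)%R <= I%:E)%E.
  by rewrite fineK// ge0_fin_numE//; exact: Int_ge0.
pose w := cv * (tau / bb) `^ d0.
have tb0 : 0 < tau / bb by rewrite divr_gt0.
have w0 : 0 < w by rewrite mulr_gt0// powR_gt0.
(* Thus [E0^(p s) = Kc * I / w]. Together with the volume bound [w * r^d0] and
   [al * (p * s) + d0 = p * s], the threshold [E0 * r^al <= M - m] implies the smallness condition
   of the growth lemma. *)
pose E0 := (Kc * I / w) `^ (p * s)^-1.
have E00 : 0 <= E0 by [].
have kappa0 : 0 < kappa by exact: lt_le_trans kappa1.
pose rb := Num.min (s0' / (4 * kappa)) (s0' / 2).
have rb0 : 0 < rb by rewrite lt_min !divr_gt0// mulr_gt0.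
have rb1 : rb <= s0' / (4 * kappa) by rewrite ge_min lexx.
have rbs : rb < s0'.
  by apply: (@le_lt_trans _ _ (s0' / 2)); [rewrite ge_min lexx orbT|rewrite ltr_pdivrMr// ltr_pMr// ltr1n].
(* The radius shrinks by [tau / bb] for Poincare's inequality and once more by [tau] for the De
   Giorgi lemma. *)
pose kap := tau * tau / bb.
have kap0 : 0 < kap by rewrite divr_gt0// mulr_gt0.
have kap1 : kap < 1.
  rewrite ltr_pdivrMr// mul1r; apply: lt_le_trans bb1.
  by rewrite -[ltRHS]mul1r; apply: ltr_pM => //; exact: ltW.
have kap01 : 0 < kap < 1 by rewrite kap0.
have eta01 : 0 < eta < 1 by rewrite eta0.
have bd y r : K y -> 0 < r -> r <= rb -> \forall x \ae leb, qball Om rho y r x -> `|u x| <= M0.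
  move=> Ky r0 rrb; have [h1 _] := Kball y r Ky r0 (le_trans rrb rb1).
  by apply: filterS uM0 => x H /h1.
have step y r m M : K y -> 0 < r -> r <= rb -> - M0 <= m -> M <= M0 -> m < M ->
    (\forall x \ae leb, qball Om rho y r x -> m <= u x <= M) -> E0 * r `^ al <= M - m ->
    exists m' M', [/\ m <= m', M' <= M, M' - m' <= (1 - eta) * (M - m) &
      \forall x \ae leb, qball Om rho y (kap * r) x -> m' <= u x <= M'].
  move=> Ky r0 rrb mM0 MM0 mM um hE; have Oy := KO y Ky; have [KR0 KR1 KR2] := KR y Ky.
  have rR2 : r < R2 y by apply: lt_le_trans KR2; exact: le_lt_trans rbs.
  have rR1 : r < R1 y by apply: lt_le_trans KR1; exact: le_lt_trans rbs.
  have om0 : 0 < M - m by rewrite subr_gt0.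
  have omM : M - m <= 2 * M0 by move: mM0 MM0; clear; lra.
  have r20 : 0 < tau * r / bb by rewrite !mulr_gt0// invr_gt0.
  have r2r : tau * r / bb <= r.
    rewrite ler_pdivrMr// mulrC; apply: ler_pM; [exact: ltW|exact: ltW|by []|].
    exact: le_trans (ltW tau1) bb1.
  have rs : r <= s0' / (4 * kappa) by exact: le_trans rb1.
  have [BK' _] := Kball y r Ky r0 rs.
  have [_ vol] := Kball y _ Ky r20 (le_trans r2r rs).
  set B1 := qball Om rho y r in um BK'; set B2 := qball Om rho y (tau * r / bb) in vol.
  have BO : B1 `<=` Om by move=> x [].
  have B2O : B2 `<=` Om by move=> x [].
  have mB : measurable B1 by apply: open_rV_measurable; exact: rho_open.
  have iZB : Ile leb B1 (fun x => Zf p psi b c d e f g h u x `^ s) I.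
    apply: le_trans II; have : (Int leb B1 (fun x => Zf p psi b c d e f g h u x `^ s)%R <=
      Int leb K' (fun x => Zf p psi b c d e f g h u x `^ s)%R)%E by exact: Int_sub.
    exact.
  have lebE U : U `<=` Om -> leb U = (fine (leb U))%:E.
    move=> UO; rewrite fineK// ge0_fin_numE ?lebesgue_outer_ge0//.
    by apply: le_lt_trans (leb_Om Om_bounded); apply: le_lebesgue_outer.
  have dbB : fine (leb B1) <= Cd * fine (leb B2).
    have ne0 : B2 `&` B1 !=set0.
      have yy : rho y y = 0 by apply/rho_eq0.
      by exists y; split; split => //; rewrite yy.
    have hd := dbl y y r (tau * r / bb) Oy Oy r20 r2r rR1 ne0.
    rewrite -/B1 -/B2 (lebE B1 BO) (lebE B2 B2O) -EFinM lee_fin in hd.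
    apply: le_trans hd _; rewrite /Cd (_ : r / (tau * r / bb) = bb / tau)//.
    by field; rewrite !gt_eqF.
  have hK : Kc * (r `^ (p * s) * I) <= (M - m) `^ (p * s) * fine (leb B2).
    have h1 : (E0 * r `^ al) `^ (p * s) <= (M - m) `^ (p * s).
      by apply: pow_le; [exact: ltW|by rewrite mulr_ge0|].
    apply: (@le_trans _ _ ((E0 * r `^ al) `^ (p * s) * (cv * (tau * r / bb) `^ d0))); last by apply: ler_pM; rewrite ?mulr_ge0// ltW.
    have EE : E0 `^ (p * s) = Kc * I / w.
      by rewrite /E0 -powRrM mulVf ?gt_eqF// powRr1// divr_ge0 ?(ltW w0)// mulr_ge0// ltW.
    have ra : (r `^ al) `^ (p * s) * r `^ d0 = r `^ (p * s).
      rewrite -powRrM -powRD; last by apply/implyP => _; rewrite gt_eqF.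
      by congr (_ `^ _); rewrite /al divfK ?gt_eqF// subrK.
    rewrite powRM ?powR_ge0// EE -ra (_ : tau * r / bb = tau / bb * r); last by rewrite mulrAC.
    rewrite [(tau / bb * r) `^ _]powRM ?(ltW tb0) ?(ltW r0)//.
    rewrite le_eqVlt; apply/orP; left; apply/eqP; rewrite /w; field.
    by rewrite !gt_eqF// powR_gt0.
  have um' : \forall x \ae leb, B1 x -> m <= u x /\ u x <= M by apply: filterS um => x H /H/andP.
  have u0 := bd y r Ky r0 rrb.
  have krE : kap * r = tau * (tau * r / bb) by rewrite /kap; ring.
  have kB : qball Om rho y (kap * r) `<=` B1.
    move=> x [Ox yx]; split => //; apply: lt_le_trans yx _.
    by rewrite -[leRHS]mul1r ler_wpM2r// ltW.
  (* The level is the midpoint of [m] and [M]. In the second case [- u] lies below its own midpoint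
     on half of the smaller ball, and the lower bound improves instead of the upper one. *)
  have [hf|hf] := half_level Om_bounded u (M - (M - m) / 2) B2O.
  - have absM : `|M| <= M0 by rewrite ler_norml MM0 andbT; apply: le_trans mM0 _; exact: ltW.
    have uM : \forall x \ae leb, B1 x -> `|u x| <= M0 /\ u x <= M.
      by apply: filterS2 um' u0 => x h1 h2 Bx; split; [exact: h2|exact: (h1 Bx).2].
    have res := G u du y r M (M - m) I Su Oy r0 rR2 uM absM om0 omM iZB I0 dbB hK hf.
    exists m, (M - eta * (M - m)); split => //.
    + by rewrite gerBl mulr_ge0// ltW.
    + by rewrite le_eqVlt; apply/orP; left; apply/eqP; ring.
    + apply: filterS2 res um' => x h1 h2 Bx; apply/andP; split; first exact: (h2 (kB x Bx)).1.
      by apply: h1; rewrite -krE.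
  - have absm : `|- m| <= M0 by rewrite normrN ler_norml mM0; apply: le_trans MM0; exact: ltW.
    have uM : \forall x \ae leb, B1 x -> `|- u x| <= M0 /\ - u x <= - m.
      by apply: filterS2 um' u0 => x h1 h2 Bx; rewrite normrN lerN2; split; [exact: h2|exact: (h1 Bx).1].
    have iZB' : Ile leb B1 (fun x => Zf p psi b c d e f g h (fun x => - u x) x `^ s) I.
      by rewrite ZN.
    have hf' : fine (leb B2) / 2 <= fine (leb (B2 `&` [set x | - u x <= - m - (M - m) / 2])).
      by rewrite (_ : - m - (M - m) / 2 = - (M - (M - m) / 2))//; field.
    have res := G (fun x => - u x) (fun x => - du x) y r (- m) (M - m) I Su' Oy r0 rR2 uM absm om0 omM iZB' I0 dbB hK hf'.
    exists (m + eta * (M - m)), M; split => //.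
    + by rewrite lerDl mulr_ge0// ltW.
    + by rewrite le_eqVlt; apply/orP; left; apply/eqP; ring.
    + apply: filterS2 res um' => x h1 h2 Bx; apply/andP; split; last exact: (h2 (kB x Bx)).2.
      by rewrite -lerN2 opprD; apply: h1; rewrite -krE.
have [D [DM osc]] := oscillation_decay M00 rb0 kap01 al0 E00 eta01 KO bd step.
have q01 : 0 < Num.max (1 - eta) (kap `^ al) < 1.
  rewrite lt_max gt_max subr_gt0 eta1 gtrBl eta0/=.
  have : kap `^ al < 1 `^ al by apply: gt0_ltr_powR; rewrite ?nnegrE ?(ltW kap0).
  by rewrite powR1.
have uMK : \forall x \ae leb, K x -> `|u x| <= M0.
  apply: filterS uM0 => x H Kx; apply: H; have [h1 _] := Kball x rb Kx rb0 rb1.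
  have Ox := KO x Kx; have xx : rho x x = 0 by apply/rho_eq0.
  by apply: h1; split => //; rewrite xx.
exact: (holder_of_decay rho_open kappa1 rho_ge0 rho_sym rho_eq0 rho_tri cK KO M00 rb0 kap01 q01 DM uMK osc).
Qed.
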